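(* Let $n,m\ge 1$, $\lambda_1,\lambda_2>2$, $0<\alpha\le n(\lambda_1-2)/2$ and $0<\beta\le m(\lambda_2-2)/2$. Suppose the kernel $K_{t_1,t_2}$ satisfies Assumptions 1, 2 and 3 (stated in the context). Then for every $f\in L^2(\mathbb{R}^{n+m})$, $$\|g^*_{\lambda_1,\lambda_2}(f)\|_{L^2(\mathbb{R}^{n+m})}\lesssim \|f\|_{L^2(\mathbb{R}^{n+m})},$$ where the implied constant depends only on $n,m,\alpha,\beta,\lambda_1,\lambda_2$ and the constants in the assumptions.
   Context: Norms on $\mathbb{R}^n$ and $\mathbb{R}^m$ are the $\ell^\infty$ norms. Points are written $x=(x_1,x_2)\in\mathbb{R}^{n}\times\mathbb{R}^m$, and $t_1,t_2>0$. For a kernel $K_{t_1,t_2}:\mathbb{R}^{n+m}\times\mathbb{R}^{n+m}\to\mathbb{C}$ set $\theta_{t_1,t_2}f(y_1,y_2)=\iint_{\mathbb{R}^{n+m}}K_{t_1,t_2}((y_1,y_2),(z_1,z_2))f(z_1,z_2)\,dz_1\,dz_2$, and $$g^*_{\lambda_1,\lambda_2}(f)(x)=\Big(\iint_{\mathbb{R}^{m+1}_+}\Big(\tfrac{t_2}{t_2+|x_2-y_2|}\Big)^{m\lambda_2}\iint_{\mathbb{R}^{n+1}_+}\Big(\tfrac{t_1}{t_1+|x_1-y_1|}\Big)^{n\lambda_1}|\theta_{t_1,t_2}f(y_1,y_2)|^2\frac{dy_1dt_1}{t_1^{n+1}}\frac{dy_2dt_2}{t_2^{m+1}}\Big)^{1/2}.$$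 We write $K_{t_1,t_2}(x-y,z_1,z_2)$ for $K_{t_1,t_2}((x_1-y_1,x_2-y_2),(z_1,z_2))$. For a cube $I\subset\mathbb{R}^n$ with side length $\ell(I)$, $\widehat I=I\times(0,\ell(I))$ and $W_I=I\times(\ell(I)/2,\ell(I))$. Assumption 1 (standard estimates), for all $x,y,y'\in\mathbb{R}^{n+m}$, $t_1,t_2>0$: (1) $|K_{t_1,t_2}(x,y)|\lesssim \frac{t_1^\alpha}{(t_1+|x_1-y_1|)^{n+\alpha}}\frac{t_2^\beta}{(t_2+|x_2-y_2|)^{m+\beta}}$; (2) $|K_{t_1,t_2}(x,y)-K_{t_1,t_2}(x,(y_1,y_2'))-K_{t_1,t_2}(x,(y_1',y_2))+K_{t_1,t_2}(x,y')|\lesssim \frac{|y_1-y_1'|^\alpha}{(t_1+|x_1-y_1|)^{n+\alpha}}\frac{|y_2-y_2'|^\beta}{(t_2+|x_2-y_2|)^{m+\beta}}$ whenever $|y_1-y_1'|<t_1/2$, $|y_2-y_2'|<t_2/2$; (3) $|K_{t_1,t_2}(x,y)-K_{t_1,t_2}(x,(y_1,y_2'))|\lesssim \frac{t_1^\alpha}{(t_1+|x_1-y_1|)^{n+\alpha}}\frac{|y_2-y_2'|^\beta}{(t_2+|x_2-y_2|)^{m+\beta}}$ whenever $|y_2-y_2'|<t_2/2$, and $|K_{t_1,t_2}(x,y)-K_{t_1,t_2}(x,(y_1',y_2))|\lesssim \frac{|y_1-y_1'|^\alpha}{(t_1+|x_1-y_1|)^{n+\alpha}}\frac{t_2^\beta}{(t_2+|x_2-y_2|)^{m+\beta}}$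 whenever $|y_1-y_1'|<t_1/2$. Assumption 2, for every cube $I\subset\mathbb{R}^n$, $J\subset\mathbb{R}^m$, all $x_2,y_2,z_2,z_2'\in\mathbb{R}^m$, $x_1,y_1,z_1,z_1'\in\mathbb{R}^n$, $t_1,t_2>0$: (1) $\Big(\iint_{\widehat I}\int_{\mathbb{R}^n}\big|\int_I K_{t_1,t_2}(x-y,z_1,z_2)dz_1\big|^2\big(\tfrac{t_1}{t_1+|y_1|}\big)^{n\lambda_1}\frac{dy_1dx_1dt_1}{t_1^{n+1}}\Big)^{1/2}\lesssim |I|^{1/2}\frac{t_2^\beta}{(t_2+|x_2-y_2-z_2|)^{m+\beta}}$, and symmetrically $\Big(\iint_{\widehat J}\int_{\mathbb{R}^m}\big|\int_J K_{t_1,t_2}(x-y,z_1,z_2)dz_2\big|^2\big(\tfrac{t_2}{t_2+|y_2|}\big)^{m\lambda_2}\frac{dy_2dx_2dt_2}{t_2^{m+1}}\Big)^{1/2}\lesssim |J|^{1/2}\frac{t_1^\alpha}{(t_1+|x_1-y_1-z_1|)^{n+\alpha}}$; (2) $\Big(\iint_{\widehat I}\int_{\mathbb{R}^n}\big|\int_I [K_{t_1,t_2}(x-y,z_1,z_2)-K_{t_1,t_2}(x-y,z_1,z_2')]dz_1\big|^2\big(\tfrac{t_1}{t_1+|y_1|}\big)^{n\lambda_1}\frac{dy_1dx_1dt_1}{t_1^{n+1}}\Big)^{1/2}\lesssim |I|^{1/2}\frac{|z_2-z_2'|^\beta}{(t_2+|x_2-y_2-z_2|)^{m+\beta}}$ whenever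 $|z_2-z_2'|<t_2/2$, and symmetrically $\Big(\iint_{\widehat J}\int_{\mathbb{R}^m}\big|\int_J [K_{t_1,t_2}(x-y,z_1,z_2)-K_{t_1,t_2}(x-y,z_1',z_2)]dz_2\big|^2\big(\tfrac{t_2}{t_2+|y_2|}\big)^{m\lambda_2}\frac{dy_2dx_2dt_2}{t_2^{m+1}}\Big)^{1/2}\lesssim |J|^{1/2}\frac{|z_1-z_1'|^\alpha}{(t_1+|x_1-y_1-z_1|)^{n+\alpha}}$ whenever $|z_1-z_1'|<t_1/2$. Assumption 3 (bi-parameter Carleson condition): For dyadic grids $\mathcal D_n$ in $\mathbb{R}^n$ and $\mathcal D_m$ in $\mathbb{R}^m$ (translates of the standard dyadic grids), $\mathcal D=\mathcal D_n\times\mathcal D_m$, and $I\in\mathcal D_n$, $J\in\mathcal D_m$, let $$C^{\mathcal D}_{IJ}=\iint_{W_J}\iint_{W_I}\iint_{\mathbb{R}^{n+m}}|\theta_{t_1,t_2}\mathbf 1(y_1,y_2)|^2\Big(\tfrac{t_1}{t_1+|x_1-y_1|}\Big)^{n\lambda_1}\Big(\tfrac{t_2}{t_2+|x_2-y_2|}\Big)^{m\lambda_2}\frac{dy_1dy_2}{t_1^nt_2^m}\frac{dx_1dt_1}{t_1}\frac{dx_2dt_2}{t_2}.$$ It is assumed that for every such $\mathcal D$, $\sum_{I\times J\in\mathcal D,\ I\times J\subset\Omega}C^{\mathcal D}_{IJ}\lesssim|\Omega|$ for all sets $\Omega\subset\mathbb{R}^{n+m}$ with $|\Omega|<\infty$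 such that every $x\in\Omega$ lies in some $I\times J\in\mathcal D$ with $I\times J\subset\Omega$. *)

(* Defs.v *)
From HB Require Import structures.
From mathcomp Require Import all_boot all_order all_algebra.
From mathcomp Require Import all_classical all_reals all_analysis.
From mathcomp.real_closed Require Import complex.
Set Implicit Arguments.
Unset Strict Implicit.
Unset Printing Implicit Defensive.
Import Order.TTheory GRing.Theory Num.Theory.
Local Open Scope classical_set_scope.
Local Open Scope ring_scope.

Definition vecR (R : realType) (n : nat) := 'rV[R]_n.
HB.instance Definition _ (R : realType) n := GRing.Zmodule.on (vecR R n).
HB.instance Definition _ (R : realType) n := isPointed.Build (vecR R n) 0.

Definition ninf (R : realType) (n : nat) (x : 'rV[R]_n) : R :=
  \big[Num.max/0]_(i < n) `|x ord0 i|.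

Definition box (R : realType) (n : nat) (a b : 'rV[R]_n) : set (vecR R n) :=
  [set x : 'rV[R]_n | forall i, a ord0 i <= x ord0 i < b ord0 i].

Definition vol (R : realType) (n : nat) (a b : 'rV[R]_n) : R :=
  \prod_(i < n) Num.max (b ord0 i - a ord0 i) 0.

Definition boxes (R : realType) (n : nat) : set (set (vecR R n)) :=
  [set B | exists a b : 'rV[R]_n, B = box a b].

Definition Rn (R : realType) (n : nat) := g_sigma_algebraType (@boxes R n).

Definition Rnm (R : realType) (n m : nat) := (Rn R n * Rn R m)%type.

(* mu is Lebesgue measure on (the Borel sets of) R^n: it gives every box its
   volume (this characterizes it uniquely). *)
Definition is_lebesgue (R : realType) (n : nat)
    (mu : {measure set (Rn R n) -> \bar R}) : Prop :=
  forall a b : 'rV[R]_n, mu (box a b) = (vol a b)%:E.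

Definition is_lebesgue2 (R : realType) (n m : nat)
    (mu : {measure set (Rnm R n m) -> \bar R}) : Prop :=
  forall (a b : 'rV[R]_n) (c d : 'rV[R]_m),
    mu (box a b `*` box c d) = (vol a b * vol c d)%:E.

Definition cube (R : realType) (n : nat) (c : 'rV[R]_n) (l : R) : set (vecR R n) :=
  [set x : 'rV[R]_n | forall i, c ord0 i <= x ord0 i < c ord0 i + l].

Definition dcube (R : realType) (n : nat) (w : 'rV[R]_n) (k : int)
    (j : 'rV[int]_n) : set (vecR R n) :=
  cube (\row_i (w ord0 i + (2 : R) ^ k * (j ord0 i)%:~R)) ((2 : R) ^ k).

Definition oitv (R : realType) (a b : R) : set R := `]a, b[%classic.
Definition oitvy (R : realType) (a : R) : set R := `]a, +oo[%classic.

Definition cabs (R : realType) (z : R[i]) : R :=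
  Num.sqrt (complex.Re z ^+ 2 + complex.Im z ^+ 2).

Definition cint (R : realType) d (T : measurableType d)
    (mu : {measure set T -> \bar R}) (D : set T) (h : T -> R[i]) : R[i] :=
  complex.Complex (Rintegral mu D (fun x => complex.Re (h x)))
                  (Rintegral mu D (fun x => complex.Im (h x))).

Definition gkernel (R : realType) (n m : nat) :=
  R -> R -> Rnm R n m -> Rnm R n m -> R[i].

Definition pdiff (R : realType) (n m : nat) (x y : Rnm R n m) : Rnm R n m :=
  ((x.1 : 'rV[R]_n) - y.1, (x.2 : 'rV[R]_m) - y.2).

Definition theta (R : realType) (n m : nat) (muP : {measure set (Rnm R n m) -> \bar R})
    (K : gkernel R n m) (t1 t2 : R) (f : Rnm R n m -> R[i]) (y : Rnm R n m) : R[i] :=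
  cint muP setT (fun z => K t1 t2 y z * f z).

Definition one_fun (R : realType) (n m : nat) : Rnm R n m -> R[i] := fun=> 1.

Definition wgt (R : realType) (k : nat) (n : nat) (lam t : R) (u : 'rV[R]_n) : R :=
  (t / (t + ninf u)) `^ (k%:R * lam).

Definition gstar2 (R : realType) (n m : nat)
    (mun : {measure set (Rn R n) -> \bar R}) (mum : {measure set (Rn R m) -> \bar R})
    (muP : {measure set (Rnm R n m) -> \bar R})
    (lam1 lam2 : R) (K : gkernel R n m) (f : Rnm R n m -> R[i]) (x : Rnm R n m) : \bar R :=
  (\int[@lebesgue_measure R]_(t2 in oitvy 0)
   \int[mum]_(y2 in setT)
   \int[@lebesgue_measure R]_(t1 in oitvy 0)
   \int[mun]_(y1 in setT)
     (wgt m lam2 t2 ((x.2 : 'rV[R]_m) - y2) * wgt n lam1 t1 ((x.1 : 'rV[R]_n) - y1)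
      * cabs (theta muP K t1 t2 f (y1, y2)) ^+ 2
      / (t1 ^+ n.+1 * t2 ^+ m.+1))%:E)%E.

Definition gstar (R : realType) (n m : nat)
    (mun : {measure set (Rn R n) -> \bar R}) (mum : {measure set (Rn R m) -> \bar R})
    (muP : {measure set (Rnm R n m) -> \bar R})
    (lam1 lam2 : R) (K : gkernel R n m) (f : Rnm R n m -> R[i]) (x : Rnm R n m) : \bar R :=
  sqrte (gstar2 mun mum muP lam1 lam2 K f x).

Definition L2norme (R : realType) d (T : measurableType d)
    (mu : {measure set T -> \bar R}) (g : T -> \bar R) : \bar R :=
  sqrte (\int[mu]_(x in setT) (`|g x| ^+ 2))%E.

Definition L2normc (R : realType) d (T : measurableType d)
    (mu : {measure set T -> \bar R}) (f : T -> R[i]) : \bar R :=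
  sqrte (\int[mu]_(x in setT) ((cabs (f x)) ^+ 2)%:E)%E.

Definition inL2 (R : realType) d (T : measurableType d)
    (mu : {measure set T -> \bar R}) (f : T -> R[i]) : Prop :=
  measurable_fun setT (fun x => complex.Re (f x)) /\
  measurable_fun setT (fun x => complex.Im (f x)) /\
  (\int[mu]_(x in setT) ((cabs (f x)) ^+ 2)%:E < +oo)%E.

(* standing (implicit) assumption: K is jointly measurable in (t1,t2,x,y)
   on t1,t2 > 0 *)
Definition kernel_measurable (R : realType) (n m : nat) (K : gkernel R n m) : Prop :=
  let D := [set q : (R * R) * (Rnm R n m * Rnm R n m) | 0 < q.1.1 /\ 0 < q.1.2] in
  measurable_fun D (fun q => complex.Re (K q.1.1 q.1.2 q.2.1 q.2.2)) /\
  measurable_fun D (fun q => complex.Im (K q.1.1 q.1.2 q.2.1 q.2.2)).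

Definition pdecay (R : realType) (k : nat) (n : nat) (a t : R) (u : 'rV[R]_n) : R :=
  t `^ a / (t + ninf u) `^ (k%:R + a).

Definition pholder (R : realType) (k : nat) (n : nat) (a t : R) (h u : 'rV[R]_n) : R :=
  ninf h `^ a / (t + ninf u) `^ (k%:R + a).

Definition assumption1 (R : realType) (n m : nat) (alpha beta A : R)
    (K : gkernel R n m) : Prop :=
  forall t1 t2 : R, 0 < t1 -> 0 < t2 ->
  forall x y y' : Rnm R n m,
  let x1 : 'rV[R]_n := x.1 in let x2 : 'rV[R]_m := x.2 in
  let y1 : 'rV[R]_n := y.1 in let y2 : 'rV[R]_m := y.2 in
  let y1' : 'rV[R]_n := y'.1 in let y2' : 'rV[R]_m := y'.2 in
  cabs (K t1 t2 x y) <= A * pdecay n alpha t1 (x1 - y1) * pdecay m beta t2 (x2 - y2)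
  /\
  (ninf (y1 - y1') < t1 / 2 -> ninf (y2 - y2') < t2 / 2 ->
   cabs (K t1 t2 x y - K t1 t2 x (y.1, y'.2) - K t1 t2 x (y'.1, y.2) + K t1 t2 x y')
     <= A * pholder n alpha t1 (y1 - y1') (x1 - y1)
          * pholder m beta t2 (y2 - y2') (x2 - y2))
  /\
  (ninf (y2 - y2') < t2 / 2 ->
   cabs (K t1 t2 x y - K t1 t2 x (y.1, y'.2))
     <= A * pdecay n alpha t1 (x1 - y1) * pholder m beta t2 (y2 - y2') (x2 - y2))
  /\
  (ninf (y1 - y1') < t1 / 2 ->
   cabs (K t1 t2 x y - K t1 t2 x (y'.1, y.2))
     <= A * pholder n alpha t1 (y1 - y1') (x1 - y1) * pdecay m beta t2 (x2 - y2)).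

Definition lhs2_1 (R : realType) (n : nat) (mun : {measure set (Rn R n) -> \bar R})
    (lam1 : R) (c : 'rV[R]_n) (l : R) (H : R -> 'rV[R]_n -> Rn R n -> R[i]) : \bar R :=
  sqrte (\int[@lebesgue_measure R]_(t1 in oitv 0 l)
         \int[mun]_(x1 in cube c l)
         \int[mun]_(y1 in setT)
           (cabs (cint mun (cube c l) (H t1 ((x1 : 'rV[R]_n) - y1))) ^+ 2
            * wgt n lam1 t1 (y1 : 'rV[R]_n) / t1 ^+ n.+1)%:E)%E.

Definition assumption2 (R : realType) (n m : nat)
    (mun : {measure set (Rn R n) -> \bar R}) (mum : {measure set (Rn R m) -> \bar R})
    (lam1 lam2 alpha beta A : R) (K : gkernel R n m) : Prop :=
  (forall (c : 'rV[R]_n) (l : R), 0 < l ->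
   forall (x2 y2 z2 z2' : 'rV[R]_m) (t2 : R), 0 < t2 ->
   (lhs2_1 mun lam1 c l
      (fun t1 u z1 => (K t1 t2 (u, x2 - y2) (z1, z2))%R)
    <= (A * Num.sqrt (l ^+ n) * pdecay m beta t2 (x2 - y2 - z2))%:E)%E
   /\
   (ninf (z2 - z2') < t2 / 2 ->
    (lhs2_1 mun lam1 c l
       (fun t1 u z1 => (K t1 t2 (u, x2 - y2) (z1, z2) - K t1 t2 (u, x2 - y2) (z1, z2'))%R)
     <= (A * Num.sqrt (l ^+ n) * pholder m beta t2 (z2 - z2') (x2 - y2 - z2))%:E)%E))
  /\
  (forall (c : 'rV[R]_m) (l : R), 0 < l ->
   forall (x1 y1 z1 z1' : 'rV[R]_n) (t1 : R), 0 < t1 ->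
   (lhs2_1 mum lam2 c l
      (fun t2 u z2 => (K t1 t2 (x1 - y1, u) (z1, z2))%R)
    <= (A * Num.sqrt (l ^+ m) * pdecay n alpha t1 (x1 - y1 - z1))%:E)%E
   /\
   (ninf (z1 - z1') < t1 / 2 ->
    (lhs2_1 mum lam2 c l
       (fun t2 u z2 => (K t1 t2 (x1 - y1, u) (z1, z2) - K t1 t2 (x1 - y1, u) (z1', z2))%R)
     <= (A * Num.sqrt (l ^+ m) * pholder n alpha t1 (z1 - z1') (x1 - y1 - z1))%:E)%E)).

Definition CIJ (R : realType) (n m : nat)
    (mun : {measure set (Rn R n) -> \bar R}) (mum : {measure set (Rn R m) -> \bar R})
    (muP : {measure set (Rnm R n m) -> \bar R})
    (lam1 lam2 : R) (K : gkernel R n m) (wn : 'rV[R]_n) (wm : 'rV[R]_m)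
    (k1 : int) (j1 : 'rV[int]_n) (k2 : int) (j2 : 'rV[int]_m) : \bar R :=
  let l1 : R := 2 ^ k1 in let l2 : R := 2 ^ k2 in
  (\int[@lebesgue_measure R]_(t2 in oitv (l2 / 2) l2)
   \int[mum]_(x2 in dcube wm k2 j2)
   \int[@lebesgue_measure R]_(t1 in oitv (l1 / 2) l1)
   \int[mun]_(x1 in dcube wn k1 j1)
   \int[muP]_(y in setT)
     (cabs (theta muP K t1 t2 (@one_fun R n m) y) ^+ 2
      * wgt n lam1 t1 ((x1 : 'rV[R]_n) - y.1) * wgt m lam2 t2 ((x2 : 'rV[R]_m) - y.2)
      / (t1 ^+ n * t2 ^+ m) / t1 / t2)%:E)%E.

Definition drect (R : realType) (n m : nat) (wn : 'rV[R]_n) (wm : 'rV[R]_m)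
    (q : int * 'rV[int]_n * int * 'rV[int]_m) : set (Rnm R n m) :=
  dcube wn q.1.1.1 q.1.1.2 `*` dcube wm q.1.2 q.2.

Definition assumption3 (R : realType) (n m : nat)
    (mun : {measure set (Rn R n) -> \bar R}) (mum : {measure set (Rn R m) -> \bar R})
    (muP : {measure set (Rnm R n m) -> \bar R})
    (lam1 lam2 A : R) (K : gkernel R n m) : Prop :=
  (* every dyadic grid D = D_n x D_m, D_n translated by wn, D_m by wm *)
  forall (wn : 'rV[R]_n) (wm : 'rV[R]_m) (Om : set (Rnm R n m)),
  (muP Om < +oo)%E ->
  (forall x, Om x -> exists q, drect wn wm q x /\ drect wn wm q `<=` Om) ->
  (\esum_(q in [set q | drect wn wm q `<=` Om])
     CIJ mun mum muP lam1 lam2 K wn wm q.1.1.1 q.1.1.2 q.1.2 q.2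
   <= A%:E * muP Om)%E.

(* Main.v *)
(* By Tonelli, integrating the weights in x first gives C t_1^n t_2^m, so it suffices
   to bound the vertical square function, the L^2(dy dt_1/t_1 dt_2/t_2) norm of
   theta f, and one may treat the real and imaginary parts of K separately.

   Let E_1, E_2 be the averages over dyadic cells of size comparable to t_1, t_2 in
   each variable. Then theta f splits into three parts: the difference f - E_2 f, the
   difference E_2 f - E_1 E_2 f, and (theta 1) E_1 E_2 f. The first two are
   cancellative in one variable: in that variable they are almost orthogonal
   (size and regularity of the kernel, the small boundary of a dyadic cell, and
   martingale differences), with values in operators acting in the other variable,
   whose norms are controlled by a one-parameter T1 theorem or by its paraproduct.
   The one-parameter testing conditions give a Carleson condition, hence the
   paraproduct bound by the Bellman function proof of the Carleson embedding theorem.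
   The third part is bounded by the bi-parameter Carleson condition: the layer cake
   formula reduces it to the level sets of the averages, whose union lies in a level
   set of the strong maximal function, and the latter is bounded by Doob's inequality
   in each variable. General f in L^2 is reached by truncation and Fatou's lemma. *)

Require Import Defs.
From HB Require Import structures.
From mathcomp Require Import all_boot all_order all_algebra.
From mathcomp Require Import all_classical all_reals all_analysis measurable_realfun.
From mathcomp.real_closed Require Import complex.
From mathcomp Require Import ring lra zify.
Import Order.TTheory GRing.Theory Num.Theory.
Import numFieldNormedType.Exports.
Set Implicit Arguments.
Unset Strict Implicit.
Unset Printing Implicit Defensive.
Local Open Scope classical_set_scope.
Local Open Scope ring_scope.

(** * Measurability *)

(** The kernel is regular in its second argument only, and this decides the form of the splitting:
    at each scale the average subtracted from [f] is taken at the output point [y], not at [z]. The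
    operator [f -> T f - (T 1) E f] obtained in this way kills, near [y], whatever is constant on
    cells larger than [t]. What survives is mass crossing cell walls; averaged over a whole cell it
    is small, so one fixed grid suffices and no random choice of cubes is made.

    The average in the second variable is removed first, and each cancellative part is read as a
    kernel with values in operators of the other variable. [cancellative_bound] is therefore proved
    once, for arbitrary target spaces with a constant independent of them, and used three times:
    with one-point spaces in the one-parameter theorem, and with function spaces in both parts of
    the bi-parameter splitting.

    A time [t] is matched with cells of side [l] where [2 l <= t < 4 l]: then [l <= t / 2], as
    regularity requires, while the octave is the Whitney region of a cube of side [4 l]. This is the
    origin of the factors 4 next to scales. *)

Section MeasurabilityCalculus.
Context {dA dB dC dD dE dF dX dP : measure_display}.
Context {A : measurableType dA} {B : measurableType dB} {C : measurableType dC}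
  {D : measurableType dD} {E : measurableType dE} {F : measurableType dF}
  {X : measurableType dX} {P : measurableType dP}.

Definition mf2 (k : A -> B -> X) :=
  measurable_fun setT (fun q : A * B => k q.1 q.2).
Definition mf3 (k : A -> B -> C -> X) :=
  measurable_fun setT (fun q : A * B * C => k q.1.1 q.1.2 q.2).
Definition mf4 (k : A -> B -> C -> D -> X) :=
  measurable_fun setT (fun q : A * B * C * D => k q.1.1.1 q.1.1.2 q.1.2 q.2).
Definition mf5 (k : A -> B -> C -> D -> E -> X) :=
  measurable_fun setT
    (fun q : A * B * C * D * E => k q.1.1.1.1 q.1.1.1.2 q.1.1.2 q.1.2 q.2).
Definition mf6 (k : A -> B -> C -> D -> E -> F -> X) :=
  measurable_fun setT (fun q : A * B * C * D * E * F =>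
    k q.1.1.1.1.1 q.1.1.1.1.2 q.1.1.1.2 q.1.1.2 q.1.2 q.2).

Lemma mf1_comp (k : A -> X) (a : P -> A) : measurable_fun setT k ->
  measurable_fun setT a -> measurable_fun setT (fun p => k (a p)).
Proof. by move=> mk ma; apply: (measurableT_comp mk ma). Qed.

Lemma mf2_comp (k : A -> B -> X) (a : P -> A) (b : P -> B) : mf2 k ->
  measurable_fun setT a -> measurable_fun setT b ->
  measurable_fun setT (fun p => k (a p) (b p)).
Proof.
move=> mk ma mb.
exact: (measurableT_comp mk (measurable_fun_pair ma mb)).
Qed.

Lemma mf3_comp (k : A -> B -> C -> X) (a : P -> A) (b : P -> B) (c : P -> C) :
  mf3 k -> measurable_fun setT a -> measurable_fun setT b ->
  measurable_fun setT c -> measurable_fun setT (fun p => k (a p) (b p) (c p)).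
Proof.
move=> mk ma mb mc.
exact: (measurableT_comp mk
  (measurable_fun_pair (measurable_fun_pair ma mb) mc)).
Qed.

Lemma mf4_comp (k : A -> B -> C -> D -> X) (a : P -> A) (b : P -> B)
    (c : P -> C) (e : P -> D) :
  mf4 k -> measurable_fun setT a -> measurable_fun setT b ->
  measurable_fun setT c -> measurable_fun setT e ->
  measurable_fun setT (fun p => k (a p) (b p) (c p) (e p)).
Proof.
move=> mk ma mb mc md.
exact: (measurableT_comp mk (measurable_fun_pair
  (measurable_fun_pair (measurable_fun_pair ma mb) mc) md)).
Qed.

Lemma mf5_comp (k : A -> B -> C -> D -> E -> X) (a : P -> A) (b : P -> B)
    (c : P -> C) (e : P -> D) (f : P -> E) :
  mf5 k -> measurable_fun setT a -> measurable_fun setT b ->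
  measurable_fun setT c -> measurable_fun setT e -> measurable_fun setT f ->
  measurable_fun setT (fun p => k (a p) (b p) (c p) (e p) (f p)).
Proof.
move=> mk ma mb mc md mf.
exact: (measurableT_comp mk (measurable_fun_pair (measurable_fun_pair
  (measurable_fun_pair (measurable_fun_pair ma mb) mc) md) mf)).
Qed.

Lemma mf6_comp (k : A -> B -> C -> D -> E -> F -> X) (a : P -> A) (b : P -> B)
    (c : P -> C) (e : P -> D) (f : P -> E) (g : P -> F) :
  mf6 k -> measurable_fun setT a -> measurable_fun setT b ->
  measurable_fun setT c -> measurable_fun setT e -> measurable_fun setT f ->
  measurable_fun setT g ->
  measurable_fun setT (fun p => k (a p) (b p) (c p) (e p) (f p) (g p)).
Proof.
move=> mk ma mb mc md mf mg.
exact: (measurableT_comp mk (measurable_fun_pair (measurable_fun_pair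
  (measurable_fun_pair (measurable_fun_pair
    (measurable_fun_pair ma mb) mc) md) mf) mg)).
Qed.

End MeasurabilityCalculus.

Section MeasurabilityOperations.
Context {R : realType} {dP dA dT : measure_display}.
Context {P : measurableType dP} {A : measurableType dA} {T : measurableType dT}.
Local Notation mf := (measurable_fun setT).
Implicit Types (f g : P -> R) (F G : P -> \bar R).

Lemma mf_fst (f : P -> A * T) : mf f -> mf (fun p => (f p).1).
Proof. by move=> h; apply: (measurableT_comp measurable_fst h). Qed.
Lemma mf_snd (f : P -> A * T) : mf f -> mf (fun p => (f p).2).
Proof. by move=> h; apply: (measurableT_comp measurable_snd h). Qed.
Lemma mf_pair (f : P -> A) (g : P -> T) : mf f -> mf g -> mf (fun p => (f p, g p)).
Proof. exact: measurable_fun_pair. Qed.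
Lemma mfD f g : mf f -> mf g -> mf (fun p => f p + g p).
Proof. exact: measurable_funD. Qed.
Lemma mfM f g : mf f -> mf g -> mf (fun p => f p * g p).
Proof. exact: measurable_funM. Qed.
Lemma mfN f : mf f -> mf (fun p => - f p).
Proof. exact: measurable_funN. Qed.
Lemma mfX f n : mf f -> mf (fun p => f p ^+ n).
Proof. exact: measurable_funX. Qed.
Lemma mf_norm f : mf f -> mf (fun p => `|f p|).
Proof. by move=> h; apply: (measurableT_comp (@normr_measurable _ setT) h). Qed.
Lemma mf_max f g : mf f -> mf g -> mf (fun p => Num.max (f p) (g p)).
Proof. exact: measurable_maxr. Qed.
Lemma mf_powR f a : mf f -> mf (fun p => f p `^ a).
Proof. by move=> h; apply: (measurableT_comp (measurable_powR a) h). Qed.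

Lemma mfV f : mf f -> mf (fun p => (f p)^-1).
Proof.
move=> h; have h1 : mf (fun x : R => x^-1).
  have -> : (fun x : R => x^-1) =
      fun x => if x == 0 then (fun=> 0 : R) x else (fun x => x^-1) x.
    by apply/funext => x; case: eqP => // ->; rewrite invr0.
  apply: measurable_fun_if => //.
    by apply: measurable_fun_eqr.
  rewrite setTI.
  have -> : (fun x : R => x == 0) @^-1` [set false] = ~` [set 0].
    apply/seteqP; split => x /=; first by move=> /negbT/eqP.
    by move=> /eqP/negbTE.
  apply: open_continuous_measurable_fun; first exact/closed_openC/closed_eq.
  by move=> x; rewrite inE /= => /eqP x0; apply: inv_continuous.
exact: (measurableT_comp h1 h).
Qed.

Lemma mf_sum (I : Type) (s : seq I) (Q : pred I) (h : I -> P -> R) :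
  (forall i, mf (h i)) -> mf (fun p => \sum_(i <- s | Q i) h i p).
Proof.
move=> mh; under eq_fun do rewrite big_mkcond/=.
apply: (@measurable_sum _ _ R setT I s (fun i p => if Q i then h i p else 0)).
by move=> i; case: (Q i).
Qed.

Lemma mf_lt f g : mf f -> mf g -> mf (fun p => f p < g p).
Proof. exact: measurable_fun_ltr. Qed.
Lemma mf_le f g : mf f -> mf g -> mf (fun p => f p <= g p).
Proof. exact: measurable_fun_ler. Qed.
Lemma mf_and (a b : P -> bool) : mf a -> mf b -> mf (fun p => a p && b p).
Proof. exact: measurable_and. Qed.
Lemma mf_neg (a : P -> bool) : mf a -> mf (fun p => ~~ a p).
Proof. exact: measurable_neg. Qed.
Lemma mf_chi (a : P -> bool) : mf a -> mf (fun p => (a p)%:R : R).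
Proof.
move=> h; have -> : (fun p => (a p)%:R : R) = (fun p => if a p then 1 else 0 : R).
  by apply/funext => p; case: (a p).
exact: measurable_fun_ifT.
Qed.
Lemma mfE f : mf f -> mf (fun p => (f p)%:E).
Proof. by move=> h; apply/measurable_EFinP. Qed.
Lemma mf_fine F : mf F -> mf (fun p => fine (F p)).
Proof. by move=> h; apply: (measurableT_comp (fine_measurable measurableT) h). Qed.
Lemma mfDe F G : mf F -> mf G -> mf (fun p => F p + G p)%E.
Proof. exact: emeasurable_funD. Qed.
Lemma mfMe F G : mf F -> mf G -> mf (fun p => F p * G p)%E.
Proof. exact: emeasurable_funM. Qed.
Lemma mf_abse F : mf F -> mf (fun p => `|F p|)%E.
Proof. by move=> h; apply: (measurableT_comp (@abse_measurable _ setT) h). Qed.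
Lemma mf_sume (I : Type) (s : seq I) (h : I -> P -> \bar R) :
  (forall i, mf (h i)) -> mf (fun p => (\sum_(i <- s) h i p)%E).
Proof. by move=> mh; apply: emeasurable_sum. Qed.

Lemma mf_int (nu : {sigma_finite_measure set T -> \bar R}) (G : P -> T -> \bar R) :
  mf2 G -> mf (fun p => \int[nu]_x G p x)%E.
Proof.
move=> mG; rewrite (_ : (fun p => _) = fun p =>
  (\int[nu]_x (fun q => G q.1 q.2)^\+ (p, x) -
   \int[nu]_x (fun q => G q.1 q.2)^\- (p, x))%E).
  apply: emeasurable_funB.
    apply: (@measurable_fun_fubini_tonelli_F _ _ _ _ _ nu) => //.
    exact: measurable_funepos.
  apply: (@measurable_fun_fubini_tonelli_F _ _ _ _ _ nu) => //.
  exact: measurable_funeneg.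
apply/funext => p; rewrite [LHS]integralE; congr (_ - _)%E;
  by apply: eq_integral => x _; rewrite ?funeposE ?funenegE.
Qed.

End MeasurabilityOperations.

Lemma mf_Rint {R : realType} {dP dT} {P : measurableType dP}
    {T : measurableType dT} (nu : {sigma_finite_measure set T -> \bar R})
    (G : P -> T -> R) :
  mf2 G -> measurable_fun setT (fun p => \int[nu]_x G p x).
Proof. by move=> mG; apply: mf_fine; apply: mf_int; apply: (mfE mG). Qed.

(* [meas] decomposes a measurability goal along the syntax of the function. *)
Ltac meas1 := match goal with
 | |- mf2 _ => rewrite /mf2 /=
 | |- mf3 _ => rewrite /mf3 /=
 | |- mf4 _ => rewrite /mf4 /=
 | |- mf5 _ => rewrite /mf5 /=
 | |- mf6 _ => rewrite /mf6 /=
 | |- forall _, _ => move=> ?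
 | |- measurable_fun _ (fun x => x) => exact: measurable_id
 | |- measurable_fun _ (fun _ => ?c) => exact: measurable_cst
 | |- measurable_fun _ fst => exact: measurable_fst
 | |- measurable_fun _ snd => exact: measurable_snd
 | |- measurable_fun _ (fun p => (@?f p).1) => apply: mf_fst
 | |- measurable_fun _ (fun p => (@?f p).2) => apply: mf_snd
 | |- measurable_fun _ (fun p => (@?f p, @?g p)) => apply: mf_pair
 | |- measurable_fun _ (fun p => \int[_]_x (@?F p x))%E => apply: mf_int
 | |- measurable_fun _ (fun p => \int[_]_x (@?F p x)) => apply: mf_Rint
 | |- measurable_fun _ (fun p => (@EFin _ (@?f p))) => apply: mfE
 | |- measurable_fun _ (fun p => (@?f p * @?g p)%E) => apply: mfMe
 | |- measurable_fun _ (fun p => abse (@?f p)) => apply: mf_abse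
 | |- measurable_fun _ (fun p => fine (@?f p)) => apply: mf_fine
 | |- measurable_fun _ (fun p => (@?f p + @?g p)) => first [apply: mfD | apply: mfDe]
 | |- measurable_fun _ (fun p => (@?f p * @?g p)) => apply: mfM
 | |- measurable_fun _ (fun p => - (@?f p)) => apply: mfN
 | |- measurable_fun _ (fun p => (@?f p) ^-1) => apply: mfV
 | |- measurable_fun _ (fun p => (@?f p) ^+ _) => apply: mfX
 | |- measurable_fun _ (fun p => (@?f p) `^ _) => apply: mf_powR
 | |- measurable_fun _ (fun p => `|@?f p|) => apply: mf_norm
 | |- measurable_fun _ (fun p => Num.max (@?f p) (@?g p)) => apply: mf_max
 | |- measurable_fun _ (fun p => (nat_of_bool (@?f p))%:R) => apply: mf_chi
 | |- measurable_fun _ (fun p => (@?f p) && (@?g p)) => apply: mf_and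
 | |- measurable_fun _ (fun p => ~~ (@?f p)) => apply: mf_neg
 | |- measurable_fun _ (fun p => (@?f p < @?g p)) => apply: mf_lt
 | |- measurable_fun _ (fun p => (@?f p <= @?g p)) => apply: mf_le
 | |- measurable_fun _ (fun p => (\sum_(i <- _) _)%E) => apply: mf_sume
 | |- measurable_fun _ (fun p => \sum_(i <- _ | _) _) => apply: mf_sum
 | H : measurable_fun _ ?k |- measurable_fun _ ?k => exact: H
 | H : mf6 ?k |- measurable_fun _ (fun p => ?k (@?a p) (@?b p) (@?c p) (@?e p) (@?f p) (@?g p)) =>
     apply: (mf6_comp H)
 | H : mf5 ?k |- measurable_fun _ (fun p => ?k (@?a p) (@?b p) (@?c p) (@?e p) (@?f p)) =>
     apply: (mf5_comp H)
 | H : mf4 ?k |- measurable_fun _ (fun p => ?k (@?a p) (@?b p) (@?c p) (@?e p)) =>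
     apply: (mf4_comp H)
 | H : mf3 ?k |- measurable_fun _ (fun p => ?k (@?a p) (@?b p) (@?c p)) =>
     apply: (mf3_comp H)
 | H : mf2 ?k |- measurable_fun _ (fun p => ?k (@?a p) (@?b p)) =>
     apply: (mf2_comp H)
 | H : measurable_fun _ ?k |- measurable_fun _ (fun p => ?k (@?a p)) =>
     apply: (mf1_comp H)
 | H : mf2 ?k |- measurable_fun _ (?k ?a) =>
     change (measurable_fun setT (fun z => k a z))
 | H : mf3 ?k |- measurable_fun _ (?k ?a ?b) =>
     change (measurable_fun setT (fun z => k a b z))
 | H : mf4 ?k |- measurable_fun _ (?k ?a ?b ?c) =>
     change (measurable_fun setT (fun z => k a b c z))
 end.
Ltac meas_hook := fail.
Ltac meas_eta := lazymatch goal with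
 | |- measurable_fun _ (fun _ => _) => fail
 | |- measurable_fun ?D ?f => change (measurable_fun D (fun p => f p))
 end.
Ltac meas := cbv beta; repeat (first [meas1 | meas_hook | meas_eta; first [meas1 | meas_hook]]).

(** * Integrals *)

Section Integral.
Context {R : realType} {d : measure_display} {T : measurableType d}.
Local Notation mf := (measurable_fun [set: T]).

Section Measure.
Variable mu : {measure set T -> \bar R}.
Implicit Types (f g : T -> R) (c : R).

(* Unlike [ge0_le_integral], no measurability is required. *)
Lemma le_int (f g : T -> \bar R) : (forall x, (0 <= f x)%E) ->
  (forall x, (f x <= g x)%E) -> (\int[mu]_x f x <= \int[mu]_x g x)%E.
Proof.
move=> f0 fg; have g0 x : (0 <= g x)%E := le_trans (f0 x) (fg x).
rewrite !ge0_integralTE//; apply: le_ereal_sup => _ [h hf <-]; exists h => //.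
by move=> x; apply: le_trans (hf x) (fg x).
Qed.

Lemma le_int_in (D : set T) (f g : T -> \bar R) :
  (forall x, D x -> (0 <= f x)%E) -> (forall x, D x -> (f x <= g x)%E) ->
  (\int[mu]_(x in D) f x <= \int[mu]_(x in D) g x)%E.
Proof.
move=> f0 fg; rewrite integral_mkcond [leRHS]integral_mkcond; apply: le_int => x.
  by rewrite patchE; case: ifPn => // /[!inE] /f0.
by rewrite !patchE; case: ifPn => // /[!inE] /fg.
Qed.

Lemma int_ge0 (f : T -> \bar R) : (forall x, (0 <= f x)%E) ->
  (0 <= \int[mu]_x f x)%E.
Proof. by move=> f0; apply: integral_ge0. Qed.

Lemma intZ (c : R) (f : T -> \bar R) : 0 <= c -> mf f ->
  (forall x, (0 <= f x)%E) -> (\int[mu]_x (c%:E * f x) = c%:E * \int[mu]_x f x)%E.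
Proof. by move=> c0 mf f0; rewrite ge0_integralZl_EFin. Qed.

Lemma intZe (c : \bar R) (f : T -> \bar R) : (0 <= c)%E -> mf f ->
  (forall x, (0 <= f x)%E) -> (\int[mu]_x (c * f x) = c * \int[mu]_x f x)%E.
Proof. by move=> c0 mf f0; rewrite ge0_integralZl. Qed.

Lemma intD (f g : T -> \bar R) : mf f -> mf g -> (forall x, (0 <= f x)%E) ->
  (forall x, (0 <= g x)%E) ->
  (\int[mu]_x (f x + g x) = \int[mu]_x f x + \int[mu]_x g x)%E.
Proof. by move=> mf mg f0 g0; rewrite ge0_integralD. Qed.

Lemma int_sum (I : Type) (s : seq I) (f : I -> T -> \bar R) :
  (forall i, mf (f i)) -> (forall i x, (0 <= f i x)%E) ->
  (\int[mu]_x (\sum_(i <- s) f i x) = \sum_(i <- s) \int[mu]_x f i x)%E.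
Proof. by move=> mf f0; rewrite ge0_integral_sum. Qed.

Lemma eq_int (f g : T -> \bar R) : f =1 g ->
  (\int[mu]_x f x = \int[mu]_x g x)%E.
Proof. by move=> fg; apply: eq_integral => x _. Qed.

Lemma eq_Rint (f g : T -> R) : f =1 g -> \int[mu]_x f x = \int[mu]_x g x.
Proof. by move=> fg; apply: eq_Rintegral => x _. Qed.

Definition ibl (f : T -> R) := mu.-integrable setT (EFin \o f).

Lemma ibl_mf f : ibl f -> mf f.
Proof. by move=> /integrableP[/measurable_EFinP]. Qed.

Lemma ibl_lty f : ibl f -> (\int[mu]_x (`|f x|)%:E < +oo)%E.
Proof. by move=> /integrableP[]. Qed.

Lemma iblP f : mf f -> (\int[mu]_x (`|f x|)%:E < +oo)%E -> ibl f.
Proof. by move=> mfm fo; apply/integrableP; split => //; apply/measurable_EFinP. Qed.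

Lemma ibl_dom f g : mf f -> (forall x, `|f x| <= g x) -> ibl g -> ibl f.
Proof.
move=> mfm fg ig; apply: iblP => //; apply: le_lt_trans (ibl_lty ig).
by apply: le_int => x; rewrite lee_fin// (le_trans (fg x))// ler_norm.
Qed.

Lemma RintE f : ibl f -> (\int[mu]_x f x)%:E = (\int[mu]_x (f x)%:E)%E.
Proof. by move=> i; rewrite /Rintegral fineK//; apply: integrable_fin_num. Qed.

Lemma ibl0 : ibl (fun=> 0). Proof. exact: integrable0. Qed.
Lemma iblD f g : ibl f -> ibl g -> ibl (fun x => f x + g x).
Proof. by move=> i j; have := integrableD measurableT i j. Qed.
Lemma iblB f g : ibl f -> ibl g -> ibl (fun x => f x - g x).
Proof. by move=> i j; have := integrableB measurableT i j. Qed.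
Lemma iblZ c f : ibl f -> ibl (fun x => c * f x).
Proof. by move=> i; have := @integrableZl _ _ _ mu setT measurableT c _ i. Qed.
Lemma ibl_norm f : ibl f -> ibl (fun x => `|f x|).
Proof.
by move=> i; apply: iblP; [apply/mf_norm/ibl_mf|under eq_fun do rewrite normr_id; exact: ibl_lty].
Qed.

Lemma RintD f g : ibl f -> ibl g ->
  \int[mu]_x (f x + g x) = \int[mu]_x f x + \int[mu]_x g x.
Proof. by move=> i j; rewrite RintegralD. Qed.
Lemma RintB f g : ibl f -> ibl g ->
  \int[mu]_x (f x - g x) = \int[mu]_x f x - \int[mu]_x g x.
Proof. by move=> i j; rewrite RintegralB. Qed.
Lemma RintZ c f : ibl f -> \int[mu]_x (c * f x) = c * \int[mu]_x f x.
Proof. by move=> i; rewrite RintegralZl. Qed.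
Lemma Rint0 : \int[mu]_x (0 : R) = 0.
Proof. by rewrite /Rintegral integral0. Qed.
Lemma Rint_ge0 (f : T -> R) : (forall x, 0 <= f x) -> 0 <= \int[mu]_x f x.
Proof. by move=> f0; apply: Rintegral_ge0. Qed.
Lemma le_Rint f g : ibl f -> ibl g -> (forall x, f x <= g x) ->
  \int[mu]_x f x <= \int[mu]_x g x.
Proof. by move=> i j h; apply: le_Rintegral. Qed.

(** Integrability is not assumed: [Rintegral] takes the value 0 where the extended integral is not
    finite, and then the bound is trivial. *)
Lemma Rint_abs f : mf f -> ((`|\int[mu]_x f x|)%:E <= \int[mu]_x (`|f x|)%:E)%E.
Proof.
move=> mfm; rewrite /Rintegral.
have [fin|nfin] := boolP ((\int[mu]_x (f x)%:E)%E \is a fin_num).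
  rewrite -abse_EFin fineK//.
  by have := @le_abse_integral _ _ _ mu setT (EFin \o f) measurableT (mfE mfm).
suff -> : fine (\int[mu]_x (f x)%:E)%E = 0 by rewrite normr0 int_ge0.
by case: (\int[mu]_x (f x)%:E)%E nfin.
Qed.

Lemma Rint_le_norm f g : mf f -> ibl g -> (forall x, `|f x| <= g x) ->
  `|\int[mu]_x f x| <= \int[mu]_x g x.
Proof.
move=> mfm ig fg; rewrite -lee_fin RintE//; apply: le_trans (Rint_abs mfm) _.
by apply: le_int => // x; rewrite lee_fin.
Qed.

(** With [s = x / a] the hypothesis becomes [2 x <= x + a b / x]. This turns integrated
    arithmetic-geometric inequalities into Cauchy-Schwarz inequalities without square roots. *)
Lemma sqr_le_of_AM (x a b : R) : 0 <= x -> 0 < a -> 0 <= b ->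
  (forall s, 0 < s -> 2 * x <= s * a + b / s) -> x ^+ 2 <= a * b.
Proof.
move=> x0 a0 b0; rewrite le_eqVlt in x0; case/orP: x0 => [/eqP<- _|x0 /(_ (x / a))].
  by rewrite expr0n/= mulr_ge0// ltW.
rewrite divr_gt0// => /(_ isT); rewrite divfK ?gt_eqF// invf_div => h.
have {}h : x <= b * (a / x) by lra.
rewrite -(ler_pM2r x0) in h; rewrite expr2 (le_trans h)//.
by rewrite -mulrA divfK ?gt_eqF// mulrC.
Qed.

(** Cauchy-Schwarz for the factors [q^(1/2)] and [u / q^(1/2)], where [q] has mass at most [a].
    Integrating [2 |u| <= s q + u^2 / (s q)] for every [s > 0] gives it even when [u] is not known
    to be integrable. *)
Lemma CS_weight (u q : T -> R) (a : R) : mf u -> mf q -> (forall x, 0 < q x) ->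
  0 < a -> (\int[mu]_x (q x)%:E <= a%:E)%E ->
  (((\int[mu]_x u x) ^+ 2)%:E <= a%:E * \int[mu]_x ((u x) ^+ 2 / q x)%:E)%E.
Proof.
move=> mu' mq q0 a0 qa; set b := (\int[mu]_x ((u x) ^+ 2 / q x)%:E)%E.
have b0 : (0 <= b)%E.
  by apply: int_ge0 => x; rewrite lee_fin divr_ge0// ?sqr_ge0// ltW.
move: b0; rewrite le_eqVlt => /orP b0; case Eb : b => [b'| |]; last 2 first.
- by rewrite gt0_muley ?leey// lte_fin.
- by case: b0; rewrite Eb.
have b'0 : 0 <= b' by case: b0; rewrite Eb ?lte_fin//; [move/eqP=> [<-]|move/ltW].
rewrite -EFinM lee_fin -real_normK ?num_real//; apply: sqr_le_of_AM => // s s0.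
rewrite -lee_fin EFinM; apply: (@le_trans _ _ (2%:E * \int[mu]_x (`|u x|)%:E)%E).
  by rewrite lee_pmul2l// Rint_abs.
rewrite -intZ//; last by apply/mfE/mf_norm.
apply: (@le_trans _ _ (\int[mu]_x (s%:E * (q x)%:E + (s^-1)%:E * ((u x) ^+ 2 / q x)%:E))%E).
  apply: le_int => x; first by rewrite -EFinM lee_fin mulr_ge0.
  rewrite -!EFinM -EFinD lee_fin -[(u x) ^+ 2]real_normK ?num_real//.
  have := sqr_ge0 (s * q x - `|u x|); have := q0 x; move: (q x) `|u x| => c e c0 h.
  have sc : 0 < s * c by rewrite mulr_gt0.
  rewrite -subr_ge0 (_ : _ - _ = (s * c - e) ^+ 2 / (s * c)); last first.
    by field; rewrite !gt_eqF.
  by rewrite divr_ge0// ltW.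
have h1 : mf (fun x => ((u x) ^+ 2 / q x)%:E) by meas.
rewrite intD; first 1 last; [by meas|by meas|..].
- by move=> x; rewrite -EFinM lee_fin mulr_ge0// ltW.
- by move=> x; rewrite -EFinM lee_fin mulr_ge0 ?invr_ge0 ?divr_ge0 ?sqr_ge0// ltW.
rewrite !intZ//; [|by rewrite invr_ge0 ltW| by move=> x; rewrite lee_fin divr_ge0 ?sqr_ge0// ltW
  |exact: ltW|exact: mfE|by move=> x; rewrite lee_fin ltW].
rewrite -/b Eb EFinD [(b' / s)%:E]EFinM [(_ * s^-1%:E)%E]muleC leeD//.
by rewrite EFinM lee_pmul2l// lte_fin.
Qed.

Lemma sum_CS (N : nat) (u q : 'I_N -> R) (a : R) : (forall i, 0 < q i) -> 0 < a ->
  \sum_i q i <= a -> (\sum_i u i) ^+ 2 <= a * \sum_i (u i) ^+ 2 / q i.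
Proof.
move=> q0 a0 qa; rewrite -real_normK ?num_real//; apply: sqr_le_of_AM => //.
  by apply: sumr_ge0 => i _; rewrite divr_ge0 ?sqr_ge0// ltW.
move=> s s0; apply: (@le_trans _ _ (2 * \sum_i `|u i|)).
  by rewrite ler_wpM2l// ler_norm_sum.
apply: (@le_trans _ _ (s * \sum_i q i + (\sum_i (u i) ^+ 2 / q i) / s)); last first.
  by rewrite lerD2r ler_wpM2l// ltW.
rewrite !mulr_sumr mulr_suml -big_split/= ler_sum// => i _.
rewrite -[(u i) ^+ 2]real_normK ?num_real//.
have := sqr_ge0 (s * q i - `|u i|); have := q0 i; move: (q i) `|u i| => c e c0 h.
have sc : 0 < s * c by rewrite mulr_gt0.
rewrite -subr_ge0 (_ : _ - _ = (s * c - e) ^+ 2 / (s * c)); last first.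
  by field; rewrite !gt_eqF.
by rewrite divr_ge0// ltW.
Qed.

(** Bounded and integrable at once, hence closed under products: squares, cross terms and pairings
    with averages need no separate integrability argument. Functions of [L^2] are brought into this
    class by truncation. *)
Definition c1 (f : T -> R) :=
  [/\ mf f, (exists M, forall x, `|f x| <= M) & ibl f].

Lemma c1_ibl f : c1 f -> ibl f. Proof. by case. Qed.
Lemma c1_mf f : c1 f -> mf f. Proof. by case. Qed.
Lemma c1_norm f : c1 f -> c1 (fun x => `|f x|).
Proof.
case=> m [M hM] i; split; [exact: mf_norm|exists M => x; rewrite normr_id//|exact: ibl_norm].
Qed.
Lemma c1M f g : mf f -> (exists M, forall x, `|f x| <= M) -> c1 g ->
  c1 (fun x => f x * g x).
Proof.
move=> m [M hM] [m' [M' hM'] i]; split; first exact: mfM.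
  by exists (M * M') => x; rewrite normrM ler_pM.
apply: (@ibl_dom _ (fun x => M * `|g x|)); first exact: mfM.
  by move=> x; rewrite normrM ler_wpM2r.
exact/iblZ/ibl_norm.
Qed.
Lemma c1Z c f : c1 f -> c1 (fun x => c * f x).
Proof. by apply: c1M; [exact: measurable_cst|exists `|c|]. Qed.
Lemma c1D f g : c1 f -> c1 g -> c1 (fun x => f x + g x).
Proof.
move=> [m [M hM] i] [m' [M' hM'] i']; split; [exact: mfD| |exact: iblD].
by exists (M + M') => x; rewrite (le_trans (ler_normD _ _))// lerD.
Qed.
Lemma c1B f g : c1 f -> c1 g -> c1 (fun x => f x - g x).
Proof.
move=> [m [M hM] i] [m' [M' hM'] i']; split; [by meas| |exact: iblB].
by exists (M + M') => x; rewrite (le_trans (ler_normB _ _))// lerD.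
Qed.
Lemma c1MM f g : c1 f -> c1 g -> c1 (fun x => f x * g x).
Proof. by case=> m M _; exact: c1M. Qed.
Lemma c1_sq f : c1 f -> c1 (fun x => f x ^+ 2).
Proof. by move=> h; under eq_fun do rewrite expr2; exact: c1MM. Qed.
Lemma c1_dom f g : mf f -> (forall x, `|f x| <= g x) -> c1 g -> c1 f.
Proof.
move=> m fg [m' [M hM] i]; split => //; last exact: ibl_dom fg i.
by exists M => x; rewrite (le_trans (fg x))// (le_trans (ler_norm _)).
Qed.
Lemma c1_0 : c1 (fun=> 0).
Proof. by split=> //; [exists 0 => x; rewrite normr0|exact: ibl0]. Qed.
End Measure.
End Integral.

(** * Iterated integrals of functions dominated by a tensor product *)

Section DoubleIntegral.
Context {R : realType} {d e : measure_display} {S : measurableType d}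
  {T : measurableType e}.
Variables (mu : {sigma_finite_measure set S -> \bar R})
  (nu : {sigma_finite_measure set T -> \bar R}).

Lemma tonelli (F : S -> T -> \bar R) : mf2 F -> (forall x y, (0 <= F x y)%E) ->
  (\int[mu]_x \int[nu]_y F x y = \int[nu]_y \int[mu]_x F x y)%E.
Proof.
move=> mF F0.
exact: (@fubini_tonelli _ _ _ _ _ mu nu (fun q => F q.1 q.2) mF (fun q => F0 q.1 q.2)).
Qed.

Lemma tonelli_prod (F : S -> T -> \bar R) : mf2 F -> (forall x y, (0 <= F x y)%E) ->
  (\int[(mu \x nu)%E]_q F q.1 q.2 = \int[mu]_x \int[nu]_y F x y)%E.
Proof.
move=> mF F0.
exact: (@fubini_tonelli1 _ _ _ _ _ mu nu (fun q => F q.1 q.2) mF (fun q => F0 q.1 q.2)).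
Qed.

(** Domination by a product of integrable functions of one variable each makes the sections
    integrable at every point, not only almost everywhere, so that the linearity lemmas hold without
    exceptional sets. *)
Definition dom2 (F : S -> T -> R) := mf2 F /\
  exists v w, [/\ ibl mu v, ibl nu w & forall x y, `|F x y| <= v x * w y].

Lemma dom2_sec F x : dom2 F -> ibl nu (F x).
Proof.
case=> mF [v [w [iv iw h]]]; apply: (ibl_dom _ (h x)); last exact: iblZ.
by meas.
Qed.

Lemma dom2_int F : dom2 F -> ibl mu (fun x => \int[nu]_y F x y).
Proof.
case=> mF [v [w [iv iw h]]].
apply: (@ibl_dom _ _ _ mu _ (fun x => v x * \int[nu]_y w y)); first by meas.
  by move=> x; rewrite -RintZ//; apply: Rint_le_norm; [by meas|exact: iblZ|].
by under eq_fun do rewrite mulrC; exact: iblZ.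
Qed.

Lemma dom2Z c F : dom2 F -> dom2 (fun x y => c * F x y).
Proof.
case=> mF [v [w [iv iw h]]]; split; first by meas.
exists (fun x => `|c| * v x), w; split => //; first exact: iblZ.
by move=> x y; rewrite normrM -mulrA ler_wpM2l.
Qed.

Lemma dom2D F G : dom2 F -> dom2 G -> dom2 (fun x y => F x y + G x y).
Proof.
case=> mF [v [w [iv iw h]]] [mG [v' [w' [iv' iw' h']]]]; split; first by meas.
exists (fun x => `|v x| + `|v' x|), (fun y => `|w y| + `|w' y|); split.
- by apply: iblD; apply: ibl_norm.
- by apply: iblD; apply: ibl_norm.
move=> x y; rewrite (le_trans (ler_normD _ _))//.
have H1 := le_trans (h x y) (ler_norm _); have H2 := le_trans (h' x y) (ler_norm _).
rewrite !normrM in H1 H2; rewrite (le_trans (lerD H1 H2))//.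
rewrite mulrDl !mulrDr -addrA lerD2l addrA lerDr addr_ge0// mulr_ge0//.
Qed.

Lemma dom2B F G : dom2 F -> dom2 G -> dom2 (fun x y => F x y - G x y).
Proof.
move=> h /(dom2Z (-1)) h'; have := dom2D h h'.
by under [X in dom2 X -> _]eq_fun do under eq_fun do rewrite mulN1r.
Qed.

Lemma JJD F G : dom2 F -> dom2 G ->
  \int[mu]_x (\int[nu]_y (F x y + G x y)) =
  \int[mu]_x (\int[nu]_y F x y) + \int[mu]_x (\int[nu]_y G x y).
Proof.
move=> h h'; rewrite -RintD; [|exact: dom2_int..].
by apply: eq_Rint => x; rewrite RintD//; exact: dom2_sec.
Qed.

Lemma JJB F G : dom2 F -> dom2 G ->
  \int[mu]_x (\int[nu]_y (F x y - G x y)) =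
  \int[mu]_x (\int[nu]_y F x y) - \int[mu]_x (\int[nu]_y G x y).
Proof.
move=> h h'; rewrite -RintB; [|exact: dom2_int..].
by apply: eq_Rint => x; rewrite RintB//; exact: dom2_sec.
Qed.

Lemma dom2_prod F : dom2 F -> (mu \x nu)%E.-integrable setT (fun q => (F q.1 q.2)%:E).
Proof.
case=> mF [v [w [iv iw h]]]; apply/integrableP; split.
  by apply: mfE; exact: mF.
have h0 x y : 0 <= v x * w y by rewrite (le_trans _ (h x y)).
apply: (@le_lt_trans _ _ (\int[mu]_x \int[nu]_y (`|v x| * `|w y|)%:E)%E).
  rewrite -(@tonelli_prod (fun x y => (`|v x| * `|w y|)%:E)).
  - apply: le_int => q; rewrite lee_fin// (le_trans (h _ _))//.
    by rewrite -normrM ler_norm.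
  - by have := ibl_mf iv; have := ibl_mf iw; move=> *; meas.
  - by move=> x y; rewrite lee_fin mulr_ge0.
have mw := ibl_mf iw; have mv := ibl_mf iv.
have fw := ibl_lty iw; have fv := ibl_lty iv.
rewrite (eq_int _ (g := fun x => (\int[nu]_y (`|w y|)%:E * (`|v x|)%:E)%E)).
  rewrite intZe//; [|exact: int_ge0|by meas].
  by rewrite lte_mul_pinfty ?ge0_fin_numE ?int_ge0.
move=> x; rewrite muleC -intZ//; by meas.
Qed.

Lemma fubini_dom F : dom2 F ->
  \int[mu]_x (\int[nu]_y F x y) = \int[nu]_y (\int[mu]_x F x y).
Proof.
move=> h; have i := dom2_prod h; apply: EFin_inj.
have e1 := @integral12_prod_meas1 _ _ _ _ _ mu nu _ i.
have e2 := @integral21_prod_meas1 _ _ _ _ _ mu nu _ i.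
rewrite RintE; last exact: dom2_int.
rewrite RintE; last first.
  case: h => mF [v [w [iv iw h]]].
  apply: (@ibl_dom _ _ _ nu _ (fun y => w y * \int[mu]_x v x)); first by meas.
    move=> y; rewrite -RintZ//; apply: Rint_le_norm; [by meas|exact: iblZ|].
    by move=> x; rewrite mulrC.
  by under eq_fun do rewrite mulrC; exact: iblZ.
transitivity (\int[(mu \x nu)%E]_q (F q.1 q.2)%:E)%E.
  by rewrite -e1; apply: eq_int => x; rewrite RintE//; exact: dom2_sec.
rewrite -e2; apply: eq_int => y; rewrite RintE//.
case: h => mF [v [w [iv iw h]]].
apply: (@ibl_dom _ _ _ mu _ (fun x => w y * v x)); [by meas| |exact: iblZ].
by move=> x; rewrite mulrC.
Qed.

Lemma JJ_prod F : dom2 F ->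
  \int[(mu \x nu)%E]_q F q.1 q.2 = \int[mu]_x (\int[nu]_y F x y).
Proof.
move=> h; have i := dom2_prod h; apply: EFin_inj.
rewrite RintE// -(integral12_prod_meas1 i)//.
rewrite RintE; last exact: dom2_int.
by apply: eq_int => x; rewrite RintE//; exact: dom2_sec.
Qed.

End DoubleIntegral.

(** * Lebesgue measure on Euclidean space *)

Section EuclideanMeasurability.
Context {R : realType} {n : nat}.
Implicit Types (x y u : Rn R n) (a b : 'rV[R]_n).

Definition co (i : 'I_n) (x : Rn R n) : R := (x : 'rV[R]_n) ord0 i.
(** Row-vector operations retyped on [Rn], the type that carries the sigma-algebra; as named
    operations they can be recognised by [meas]. *)
Definition vadd (x y : Rn R n) : Rn R n := (x : 'rV[R]_n) + y.
Definition vsub (x y : Rn R n) : Rn R n := (x : 'rV[R]_n) - y.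

Lemma measurable_box a b : measurable (box a b : set (Rn R n)).
Proof. by apply: sub_sigma_algebra; exists a, b. Qed.

Lemma box_cover (x : 'rV[R]_n) :
  exists k : nat, box (const_mx (- k%:R)) (const_mx k%:R) x.
Proof.
pose M := \sum_(i < n) `|x ord0 i|.
have hM i : `|x ord0 i| <= M.
  by rewrite /M (bigD1 i)//= lerDl sumr_ge0.
exists (Num.bound M).+1 => i; rewrite !mxE.
have M0 : 0 <= M by rewrite sumr_ge0.
have := archi_boundP M0; move: (hM i); rewrite ler_norml => /andP[h1 h2] h3.
have h4 : (Num.bound M)%:R < (Num.bound M).+1%:R :> R by rewrite ltr_nat.
rewrite (le_trans _ h1) ?lerN2 ?(le_lt_trans h2)//=; first by lra.
by rewrite ltW// (lt_trans h3).
Qed.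

Lemma bigcup_boxes :
  \bigcup_(k : nat) (box (const_mx (- k%:R)) (const_mx k%:R)) = [set: Rn R n].
Proof. by apply/seteqP; split => // x _; have [k hk] := box_cover x; exists k. Qed.

Lemma half_space_measurable (i : 'I_n) (r : R) :
  measurable [set x : Rn R n | co i x < r].
Proof.
rewrite (_ : [set _ | _] = \bigcup_k box (const_mx (- k%:R))
   (\row_j if j == i then r else k%:R)).
  by apply: bigcupT_measurable => k; exact: measurable_box.
apply/seteqP; split => [x /= xr|x [k _ /(_ i)]]; last first.
  by rewrite !mxE eqxx /co => /andP[].
have [k hk] := box_cover x; exists k => // j; have := hk j; rewrite !mxE.
by case: eqP => // -> /andP[-> _].
Qed.

Lemma mf_co (i : 'I_n) : measurable_fun [set: Rn R n] (co i).
Proof.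
apply: (measurability _ (RGenInftyO.measurableE R)) => //.
move=> /= _ [_ [r ->] <-]; rewrite setTI.
rewrite (_ : _ @^-1` _ = [set x | co i x < r]); first exact: half_space_measurable.
by apply/seteqP; split => x; rewrite /= in_itv.
Qed.

Lemma bigcap_ord_measurable {d} {P : measurableType d} (F : 'I_n -> set P) :
  (forall i, measurable (F i)) -> measurable [set p | forall i, F i p].
Proof.
move=> mF; rewrite (_ : [set _ | _] = \bigcap_(i in [set: 'I_n]) F i).
  by apply: fin_bigcap_measurable => //; exact: finite_finset.
by apply/seteqP; split => [p h i _|p h i]; exact: h.
Qed.

Lemma mf_vec {d} {P : measurableType d} (f : P -> Rn R n) :
  (forall i, measurable_fun setT (fun p => co i (f p))) -> measurable_fun setT f.
Proof.
move=> h; apply: (@measurability _ _ P (Rn R n) setT f (@boxes R n)) => //.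
move=> _ [_ [a [b ->]] <-]; rewrite setTI.
apply: bigcap_ord_measurable => i.
rewrite (_ : (fun p => _) = (fun p => co i (f p)) @^-1` `[a ord0 i, b ord0 i[).
  by rewrite -[X in measurable X]setTI; apply: h.
by apply/seteqP; split => x; rewrite /= in_itv.
Qed.

Lemma mf_vadd {d} {P : measurableType d} (f g : P -> Rn R n) :
  measurable_fun setT f -> measurable_fun setT g ->
  measurable_fun setT (fun p => vadd (f p) (g p)).
Proof.
move=> mf mg; apply: mf_vec => i; rewrite /co /vadd.
under eq_fun do rewrite mxE; apply: mfD.
  exact: (mf1_comp (mf_co i) mf).
exact: (mf1_comp (mf_co i) mg).
Qed.

Lemma mf_vsub {d} {P : measurableType d} (f g : P -> Rn R n) :
  measurable_fun setT f -> measurable_fun setT g ->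
  measurable_fun setT (fun p => vsub (f p) (g p)).
Proof.
move=> mf mg; apply: mf_vec => i; rewrite /co /vsub.
under eq_fun do rewrite mxE mxE; apply: mfD.
  exact: (mf1_comp (mf_co i) mf).
by apply: mfN; exact: (mf1_comp (mf_co i) mg).
Qed.

Lemma mf_bigmax {d} {P : measurableType d} (I : Type) (s : seq I) (h : I -> P -> R) :
  (forall i, measurable_fun setT (h i)) ->
  measurable_fun setT (fun p => \big[Num.max/0]_(i <- s) h i p).
Proof.
move=> mh; elim: s => [|i s IH]; first
  by under eq_fun do rewrite big_nil; exact: measurable_cst.
by under eq_fun do rewrite big_cons; exact: mf_max.
Qed.

Lemma mf_ninf {d} {P : measurableType d} (f : P -> Rn R n) :
  measurable_fun setT f -> measurable_fun setT (fun p => ninf (f p)).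
Proof.
move=> mf; apply: mf_bigmax => i; apply: mf_norm.
exact: (mf1_comp (mf_co i) mf).
Qed.

Lemma ninf_ge0 (u : 'rV[R]_n) : 0 <= ninf u.
Proof. by rewrite /ninf; elim/big_rec: _ => // i r _ h; rewrite le_max h orbT. Qed.

Lemma ninf_leP (u : 'rV[R]_n) r : 0 <= r ->
  reflect (forall i, `|u ord0 i| <= r) (ninf u <= r).
Proof.
move=> r0; apply: (iffP idP) => [h i|h].
  by apply: le_trans h; rewrite /ninf (bigD1 i)//= le_max lexx.
by rewrite /ninf; elim/big_ind : _ => // x y hx hy; rewrite ge_max hx.
Qed.

Lemma ninf_ltP (u : 'rV[R]_n) r : 0 < r ->
  reflect (forall i, `|u ord0 i| < r) (ninf u < r).
Proof.
move=> r0; apply: (iffP idP) => [h i|h].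
  by apply: le_lt_trans h; rewrite /ninf (bigD1 i)//= le_max lexx.
by rewrite /ninf; elim/big_ind : _ => // x y hx hy; rewrite gt_max hx.
Qed.

Lemma ninfN (u : 'rV[R]_n) : ninf (- u) = ninf u.
Proof. by rewrite /ninf; apply: eq_bigr => i _; rewrite mxE normrN. Qed.

Lemma ninf_vsubC x y : ninf (vsub x y) = ninf (vsub y x).
Proof. by rewrite /vsub -ninfN opprB. Qed.

Lemma setI_closed_boxes : setI_closed (@boxes R n).
Proof.
move=> _ _ [a [b ->]] [c [d' ->]].
exists (\row_i Num.max (a ord0 i) (c ord0 i)), (\row_i Num.min (b ord0 i) (d' ord0 i)).
apply/seteqP; split => [x [h1 h2] i|x h].
  rewrite !mxE ge_max lt_min; have /andP[-> ->] := h1 i.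
  by have /andP[-> ->] := h2 i.
by split => i; have := h i; rewrite !mxE ge_max lt_min 
  => /andP[/andP[h1 h2] /andP[h3 h4]]; rewrite ?h1 ?h2 ?h3 ?h4.
Qed.

Lemma box_measure_unique (m1 m2 : {measure set (Rn R n) -> \bar R}) :
  (forall a b, m1 (box a b) = m2 (box a b)) ->
  (forall a b, (m1 (box a b) < +oo)%E) ->
  forall A, measurable A -> m1 A = m2 A.
Proof.
move=> h hoo A mA; apply: (@measure_unique _ R (Rn R n) (@boxes R n)
  (fun k : nat => box (const_mx (- k%:R)) (const_mx k%:R)) _ _ _ _ m1 m2) => //.
- exact: setI_closed_boxes.
- by move=> k; do 2 eexists.
- exact: bigcup_boxes.
- by move=> _ [a [b ->]].
Qed.

Variable mu : {measure set (Rn R n) -> \bar R}.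
Hypothesis lmu : is_lebesgue mu.

Lemma lebesgue_sigma_finite : sigma_finite setT mu.
Proof.
exists (fun k : nat => box (const_mx (- k%:R)) (const_mx k%:R)).
  by rewrite bigcup_boxes.
by move=> k; split; [exact: measurable_box|rewrite lmu ltry].
Qed.

(** The translate of [mu] agrees with [mu] on boxes, and boxes determine a measure that is finite on
    them. *)
Lemma int_shift (u : Rn R n) (h : Rn R n -> \bar R) :
  measurable_fun setT h -> (forall x, (0 <= h x)%E) ->
  (\int[mu]_x h (vadd x u) = \int[mu]_x h x)%E.
Proof.
move=> mh h0; have mphi : measurable_fun setT (fun x => vadd x u).
  by apply: mf_vadd; [exact: measurable_id|exact: measurable_cst].
rewrite -[LHS](ge0_integral_pushforward mphi mu measurableT mh)//.
apply: eq_measure_integral => A mA _; apply/esym.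
apply: (box_measure_unique (m2 := pushforward mu (fun x => vadd x u))) => //.
  move=> a b; rewrite /= /pushforward.
  rewrite (_ : _ @^-1` _ = box (a - u) (b - u)).
    by rewrite !lmu /vol; congr (_%:E); apply: eq_bigr => i _; rewrite !mxE; congr Num.max; ring.
  apply/seteqP; split => x h' i; have := h' i; rewrite /vadd !mxE; lra.
by move=> a b; rewrite lmu ltry.
Qed.

End EuclideanMeasurability.

Section ProductLebesgue.
Context {R : realType} {n m : nat}.
Variables (mun : {sigma_finite_measure set (Rn R n) -> \bar R})
  (mum : {sigma_finite_measure set (Rn R m) -> \bar R})
  (muP : {measure set (Rnm R n m) -> \bar R}).
Hypotheses (ln : is_lebesgue mun) (lm : is_lebesgue mum) (lP : is_lebesgue2 muP).

Let G : set (set (Rnm R n m)) :=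
  [set C | exists a b c e, C = box a b `*` box c e].

Let fst_generated : measurable_fun [set: g_sigma_algebraType G]
  (fst : g_sigma_algebraType G -> Rn R n).
Proof.
apply: (@measurability _ _ (g_sigma_algebraType G) (Rn R n) setT _ (@boxes R n)) => //.
move=> _ [_ [a [b ->]] <-]; rewrite setTI.
rewrite (_ : _ @^-1` _ =
  \bigcup_(k : nat) (box a b `*` box (const_mx (- k%:R)) (const_mx k%:R))).
  apply: bigcupT_measurable => k; apply: sub_sigma_algebra.
  by do 4 eexists.
apply/seteqP; split => [[x y] /= h|[x y] [k _ []]//].
by have [k hk] := box_cover y; exists k.
Qed.

Let snd_generated : measurable_fun [set: g_sigma_algebraType G]
  (snd : g_sigma_algebraType G -> Rn R m).
Proof.
apply: (@measurability _ _ (g_sigma_algebraType G) (Rn R m) setT _ (@boxes R m)) => //.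
move=> _ [_ [a [b ->]] <-]; rewrite setTI.
rewrite (_ : _ @^-1` _ =
  \bigcup_(k : nat) (box (const_mx (- k%:R)) (const_mx k%:R) `*` box a b)).
  apply: bigcupT_measurable => k; apply: sub_sigma_algebra.
  by do 4 eexists.
apply/seteqP; split => [[x y] /= h|[x y] [k _ []]//].
by have [k hk] := box_cover x; exists k.
Qed.

(** Uniqueness on the pi-system [G] of products of boxes. It generates the product sigma-algebra
    because both projections are measurable for it: the missing factor is exhausted by boxes. *)
Lemma lebesgue2_prod (A : set (Rnm R n m)) :
  measurable A -> muP A = (mun \x mum)%E A.
Proof.
move=> mA; apply: (measure_unique G (fun k : nat =>
  box (const_mx (- k%:R)) (const_mx k%:R) `*`
  box (const_mx (- k%:R)) (const_mx k%:R))) => //.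
- apply/seteqP; split; last first.
    apply: smallest_sub; first exact: sigma_algebra_measurable.
    by move=> _ [a [b [c [e ->]]]]; apply: measurableX; exact: measurable_box.
  rewrite measurable_prod_measurableType; apply: smallest_sub.
    exact: smallest_sigma_algebra.
  move=> _ [A1 mA1 [A2 mA2 <-]].
  rewrite (_ : A1 `*` A2 = (setT `&` fst @^-1` A1) `&` (setT `&` snd @^-1` A2)).
    by apply: (@measurableI _ (g_sigma_algebraType G));
      [exact: fst_generated|exact: snd_generated].
  by rewrite !setTI.
- move=> _ _ [a [b [c [e ->]]]] [a' [b' [c' [e' ->]]]].
  rewrite -setXI.
  have [a1 [b1 ->]] : boxes (box a b `&` box a' b').
    by apply: setI_closed_boxes; do 2 eexists.
  have [a2 [b2 ->]] : boxes (box c e `&` box c' e').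
    by apply: setI_closed_boxes; do 2 eexists.
  by do 4 eexists.
- by move=> k; do 4 eexists.
- apply/seteqP; split => // -[x y] _.
  have [k hk] := box_cover x; have [k' hk'] := box_cover y.
  have w p (z : 'rV[R]_p) (i j : nat) : (i <= j)%N ->
      box (const_mx (- i%:R)) (const_mx i%:R) z ->
      box (const_mx (- j%:R)) (const_mx j%:R) z.
    move=> ij h l; have := h l; rewrite !mxE => /andP[h1 h2].
    have ij' : i%:R <= j%:R :> R by rewrite ler_nat.
    by apply/andP; split; lra.
  by exists (maxn k k') => //; split => /=; [apply: w hk|apply: w hk'];
    rewrite ?leq_maxl ?leq_maxr.
- move=> _ [a [b [c [e ->]]]].
  rewrite lP; have := @product_measure1E _ _ _ _ _ mun mum (box a b) (box c e)
    (measurable_box _ _) (measurable_box _ _).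
  by move=> /= ->; rewrite ln lm.
- by move=> k; rewrite lP ltry.
Qed.

Lemma int_lebesgue2 (h : Rnm R n m -> \bar R) :
  (\int[muP]_x h x = \int[(mun \x mum)%E]_x h x)%E.
Proof. by apply: eq_measure_integral => A mA _; exact: lebesgue2_prod. Qed.

End ProductLebesgue.

Ltac meas_hook ::= match goal with
 | |- measurable_fun _ (fun p => vadd (@?f p) (@?g p)) => apply: mf_vadd
 | |- measurable_fun _ (fun p => vsub (@?f p) (@?g p)) => apply: mf_vsub
 | |- measurable_fun _ (fun p => ninf (@?f p)) => apply: mf_ninf
 end.

(** * Decay and cells *)

Section Decay.
Context {R : realType} {n : nat}.

Lemma powR_le (p x y : R) : 0 <= p -> 0 <= x -> x <= y -> x `^ p <= y `^ p.
Proof. by move=> p0 x0 xy; rewrite ge0_ler_powR// nnegrE// (le_trans x0). Qed.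

Lemma powR_exprn (x p : R) k : 0 <= x -> (x ^+ k) `^ p = (x `^ p) ^+ k.
Proof.
move=> x0; elim: k => [|k IH]; first by rewrite !expr0 powR1.
by rewrite !exprS powRM ?exprn_ge0// IH.
Qed.

Lemma mf_pdecay {d} {P : measurableType d} k a (t : P -> R) (f : P -> Rn R n) :
  measurable_fun setT t -> measurable_fun setT f ->
  measurable_fun setT (fun p => pdecay k a (t p) (f p)).
Proof. by move=> mt mf; rewrite /pdecay; meas. Qed.

Lemma pdecay_gt0 k a (t : R) (u : 'rV[R]_n) : 0 < t -> 0 < pdecay k a t u.
Proof.
by move=> t0; rewrite divr_gt0 ?powR_gt0// ltr_wpDr// ninf_ge0.
Qed.

Lemma pdecay_symm k a (t : R) (x y : Rn R n) :
  pdecay k a t (vsub x y) = pdecay k a t (vsub y x).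
Proof. by rewrite /pdecay ninf_vsubC. Qed.

Lemma pdecay_le a (t : R) (u : 'rV[R]_n) : 0 < t -> 0 <= a ->
  pdecay n a t u <= t ^- n.
Proof.
move=> t0 a0; rewrite /pdecay ler_pdivrMr ?powR_gt0 ?ltr_wpDr ?ninf_ge0//.
rewrite -powR_invn ?(ltW t0)//.
have h : t `^ (n%:R + a) <= (t + ninf u) `^ (n%:R + a).
  by rewrite powR_le ?lerDl ?ninf_ge0 ?(ltW t0)// addr_ge0.
rewrite (le_trans _ (ler_wpM2l (powR_ge0 _ _) h))//.
by rewrite -powRD ?(gt_eqF t0) ?implybT// addrA addNr add0r.
Qed.

Variable mu : {sigma_finite_measure set (Rn R n) -> \bar R}.
Hypothesis lmu : is_lebesgue mu.

Lemma vol_const (c : 'rV[R]_n) l : 0 <= l ->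
  vol c (c + const_mx l) = l ^+ n.
Proof.
move=> l0; rewrite /vol (eq_bigr (fun=> l)); first by rewrite prodr_const card_ord.
by move=> i _; rewrite !mxE addrAC subrr add0r max_l.
Qed.

Lemma int_box (c : 'rV[R]_n) l : 0 <= l -> forall b : Rn R n -> bool,
  (forall x, b x -> box c (c + const_mx l) x) ->
  (\int[mu]_x ((b x)%:R : R)%:E <= (l ^+ n)%:E)%E.
Proof.
move=> l0 b bx; rewrite -(vol_const c l0) -lmu -[leRHS]mul1e -integral_cst; last exact: measurable_box.
rewrite [leRHS]integral_mkcond; apply: le_int => x; first by rewrite lee_fin.
rewrite patchE; case: ifPn => [_|/negP h] /=; first by case: (b x).
case E : (b x) => //=; exfalso; apply: h; rewrite inE; exact: bx.
Qed.

Lemma geometric_sum_le (z : R) N : 0 < z -> z < 1 ->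
  \sum_(k < N) z ^+ k <= (1 - z)^-1.
Proof.
move=> z0 z1; have h : 0 < 1 - z by rewrite subr_gt0.
rewrite -[leRHS]mul1r ler_pdivlMr// mulrC -opprB mulNr -subrX1 opprB.
by rewrite lerBlDr lerDl exprn_ge0 ?(ltW z0).
Qed.

Lemma pow2_bound (x : R) : exists k : nat, x < 2 ^+ k.
Proof.
exists (Num.bound `|x|).
have h := archi_boundP (normr_ge0 x); rewrite (le_lt_trans (ler_norm x))//.
rewrite (lt_le_trans h)// -natrX ler_nat ltnW//; exact: ltn_expl.
Qed.

(* The decay factor is dominated by the sum over the dyadic shells
   [2^(k-1) t <= |u| < 2^k t]. *)
Lemma pdecay_shell a (t : R) (u : 'rV[R]_n) : 0 < t -> 0 < a ->
  exists k : nat, ninf u < 2 ^+ k * t /\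
    pdecay n a t u <= t ^- n * 2 `^ (n%:R + a) * (2 `^ (- (n%:R + a))) ^+ k.
Proof.
move=> t0 a0; have b0 : 0 < n%:R + a by rewrite ltr_wpDl.
have ex : exists k : nat, ninf u < 2 ^+ k * t.
  by have [k hk] := pow2_bound (ninf u / t); exists k; rewrite -ltr_pdivrMr.
case: (ex_minnP ex) => k hk kmin; exists k; split => //.
have [k0|k0] := posnP k.
  rewrite k0 expr0 mulr1 (le_trans (pdecay_le _ t0 (ltW a0)))//.
  rewrite ler_peMr ?invr_ge0 ?exprn_ge0 ?(ltW t0)//.
  by rewrite -[X in X <= _](powRr0 (2 : R)) ler_powR// ?ler1n// ltW.
have hk' : 2 ^+ k.-1 * t <= ninf u.
  rewrite leNgt; apply/negP => /kmin; by rewrite leqNgt prednK// leqnn.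
rewrite /pdecay ler_pdivrMr ?powR_gt0 ?ltr_wpDr ?ninf_ge0//.
have h : (2 ^+ k.-1 * t) `^ (n%:R + a) <= (t + ninf u) `^ (n%:R + a).
  apply: powR_le; [exact: ltW|by rewrite mulr_ge0 ?exprn_ge0// ltW|].
  by rewrite (le_trans hk')// lerDr ltW.
apply: (le_trans _ (ler_wpM2l _ h)); last first.
  by rewrite !mulr_ge0 ?invr_ge0 ?exprn_ge0 ?powR_ge0// ltW.
rewrite powRM ?exprn_ge0 ?(ltW t0)//.
have -> : (2 ^+ k.-1) `^ (n%:R + a) = (2 `^ (n%:R + a)) ^+ k.-1 :> R.
  by rewrite powR_exprn.
rewrite powRN; set z := 2 `^ (n%:R + a).
have z0 : 0 < z by rewrite powR_gt0.
have -> : z^-1 ^+ k = z^-1 / z ^+ k.-1 by rewrite -{1}(prednK k0) exprS exprVn.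
rewrite [leRHS](_ : _ = t ^- n * t `^ (n%:R + a)); last first.
  by field; rewrite !gt_eqF// exprn_gt0.
by rewrite -powR_invn ?(ltW t0)// -powRD ?(gt_eqF t0) ?implybT// addrA addNr add0r.
Qed.

(** Shell [k] has volume at most [(2 * 2^k * t)^n], and the height there is at most
    [t^(-n) 2^(n+a) 2^(-(n+a)k)]. The powers of [t] cancel and a geometric series of ratio
    [z = 2^(-a)] remains, whence a bound uniform in [t]. *)
Lemma decay_int a : 0 < a -> exists2 C : R, 0 < C & forall t, 0 < t ->
  (\int[mu]_u (pdecay n a t u)%:E <= C%:E)%E.
Proof.
move=> a0; pose z : R := 2 `^ (- a).
have z0 : 0 < z by rewrite powR_gt0.
have z1 : z < 1.
  by rewrite -(powRr0 2) /z /powR pnatr_eq0/= mul0r expR0 expR_lt1 mulNr oppr_lt0 mulr_gt0// ln_gt0// ltr1n.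
pose B : R := 2 `^ (n%:R + a) * 2 ^+ n.
have B0 : 0 < B by rewrite mulr_gt0 ?powR_gt0 ?exprn_gt0.
exists (B / (1 - z)); first by rewrite divr_gt0// subr_gt0.
move=> t t0; pose w : R := 2 `^ (- (n%:R + a)).
pose f k (u : Rn R n) : \bar R :=
  ((t ^- n * 2 `^ (n%:R + a) * w ^+ k) * ((ninf u < 2 ^+ k * t)%R%:R))%:E.
have c0 k : 0 <= t ^- n * 2 `^ (n%:R + a) * w ^+ k.
  by rewrite !mulr_ge0 ?invr_ge0 ?exprn_ge0 ?powR_ge0// ltW.
have f0 k u : (0 <= f k u)%E by rewrite lee_fin mulr_ge0.
apply: (@le_trans _ _ (\int[mu]_u \sum_(k <oo) f k u)%E).
  apply: le_int => u; first by rewrite lee_fin ltW// pdecay_gt0.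
  have [k [h1 h2]] := pdecay_shell u t0 a0.
  apply: (@le_trans _ _ (f k u)); first by rewrite lee_fin h1 mulr1.
  apply: (@le_trans _ _ (\sum_(i < k.+1) f i u)%E).
    by rewrite (bigD1 ord_max)//= leeDl// sume_ge0.
  rewrite -(big_mkord xpredT (f^~ u)); apply: nneseries_lim_ge => *; exact: f0.
have mf k : measurable_fun setT (f k).
  rewrite /f; meas.
rewrite integral_nneseries//.
apply: lime_le; first by apply: is_cvg_ereal_nneg_natsum => *; exact: int_ge0.
apply: nearW => N; rewrite big_mkord.
apply: (@le_trans _ _ (\sum_(k < N) (B * z ^+ k)%:E)%E); last first.
  by rewrite sumEFin lee_fin -mulr_sumr ler_pM2l// geometric_sum_le.
apply: lee_sum => k _; rewrite /f; under eq_int do rewrite EFinM.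
rewrite intZ//; last by meas.
pose l := 2 * (2 ^+ k * t).
have l0 : 0 <= l by rewrite !mulr_ge0 ?exprn_ge0// ltW.
apply: (@le_trans _ _ ((t ^- n * 2 `^ (n%:R + a) * w ^+ k)%:E * (l ^+ n)%:E)%E).
  rewrite lee_wpmul2l ?lee_fin//.
  apply: (@int_box (const_mx (- (2 ^+ k * t))) _ l0) => u.
  move=> /ninf_ltP h i; have p0 : 0 < 2 ^+ k * t by rewrite mulr_gt0 ?exprn_gt0.
  have := h p0 i.
  by rewrite !mxE /l ltr_norml => /andP[]; lra.
rewrite -EFinM lee_fin le_eqVlt; apply/orP; left; apply/eqP.
rewrite /B /l !exprMn.
have -> : z ^+ k = w ^+ k * (2 ^+ k) ^+ n.
  rewrite /z /w opprD powRD ?pnatr_eq0 ?implybT// exprMn powR_invn//.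
  by rewrite -exprM mulnC exprM exprVn; field; rewrite gt_eqF// exprn_gt0// exprn_gt0.
by field; rewrite gt_eqF// exprn_gt0.
Qed.

End Decay.

(** * Grid cells and the kernels of their averages *)

Section Cells.
Context {R : realType} {n : nat}.
Implicit Types (x y z : Rn R n) (l : R).

Definition fl (r : R) : R := (Num.floor r)%:~R.

(** Cells of side [l] are handled as the classes of this equivalence relation rather than as an
    indexed family of sets: functions constant on cells, averages and nesting are all expressed
    through it. *)
Definition same l x y : bool :=
  [forall i : 'I_n, fl (co i x / l) == fl (co i y / l)].

Lemma sameP l x y :
  reflect (forall i, fl (co i x / l) = fl (co i y / l)) (same l x y).
Proof. by apply: (iffP forallP) => h i; apply/eqP; have := h i. Qed.

Lemma same_sym l x y : same l x y = same l y x.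
Proof. by apply/sameP/sameP => h i; rewrite h. Qed.
Lemma same_trans l y x z : same l x y -> same l y z -> same l x z.
Proof. by move=> /sameP h /sameP h'; apply/sameP => i; rewrite h. Qed.
Lemma same_eq l x y z : same l x y -> same l x z = same l y z.
Proof.
move=> h; apply/idP/idP; first by apply: same_trans; rewrite same_sym.
exact: same_trans.
Qed.

Lemma fl_le (r : R) : fl r <= r < fl r + 1.
Proof. by have := real_floor_itv (num_real r); rewrite intrD1. Qed.

(** All grids share the origin as a vertex, so the grid of side [2 l] is coarser than that of side
    [l]. This nesting makes the averages a martingale. *)
Lemma fl_half (r s : R) : fl (r * 2) = fl (s * 2) -> fl r = fl s.
Proof.
rewrite /fl => /eqP; rewrite eqr_int => /eqP h; congr (_%:~R).
have key (p q : R) : Num.floor (p * 2) = Num.floor (q * 2) -> Num.floor p <= Num.floor q.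
  move=> e; rewrite real_floor_ge_int ?num_real//.
  rewrite -(ler_pM2r (x := 2))// -[2 in leLHS](_ : 2%:~R = 2)// -intrM.
  rewrite -real_floor_ge_int ?num_real// -e real_floor_ge_int ?num_real//.
  by rewrite intrM ler_pM2r// real_floor_le ?num_real.
by apply/eqP; rewrite eq_le !key.
Qed.

Lemma same_double l x y : same l x y -> same (2 * l) x y.
Proof.
move=> /sameP h; apply/sameP => i; apply: fl_half.
have e (r : R) : r / (2 * l) * 2 = r / l 
    by rewrite invfM [2^-1 * _]mulrC mulrA divfK.
by rewrite !e.
Qed.

Lemma same_ninf l x y : 0 < l -> same l x y -> ninf (vsub x y) < l.
Proof.
move=> l0 /sameP h; apply/ninf_ltP => // i; rewrite /vsub !mxE.
have := h i; rewrite /co; set a := (x : 'rV_n) ord0 i; set b := (y : 'rV_n) ord0 i.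
move=> e; have := fl_le (a / l); have := fl_le (b / l); rewrite e.
rewrite ler_pdivlMr// ltr_pdivrMr// ler_pdivlMr// ltr_pdivrMr//.
by rewrite !mulrDl mul1r ltr_norml => /andP[? ?] /andP[? ?]; apply/andP; split; lra.
Qed.

Lemma mf_fl {d} {P : measurableType d} (f : P -> R) :
  measurable_fun setT f -> measurable_fun setT (fun p => fl (f p)).
Proof.
move=> mf; apply: (mf1_comp (k := fl)) => //.
apply: nondecreasing_measurable => // r s rs.
by rewrite /fl ler_int le_floor.
Qed.

Lemma mf_same {d} {P : measurableType d} l (f g : P -> Rn R n) :
  measurable_fun setT f -> measurable_fun setT g ->
  measurable_fun setT (fun p => same l (f p) (g p)).
Proof.
move=> mf mg; rewrite /same.
have -> : (fun p => [forall i, fl (co i (f p) / l) == fl (co i (g p) / l)]) =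
    fun p => \big[andb/true]_i (fl (co i (f p) / l) == fl (co i (g p) / l)).
  by apply/funext => p; rewrite big_andE.
have h i : measurable_fun setT (fun p => fl (co i (f p) / l) == fl (co i (g p) / l)).
  by apply: measurable_fun_eqr; apply: mf_fl; apply: mfM => //;
    [exact: (mf1_comp (mf_co i) mf)|exact: (mf1_comp (mf_co i) mg)].
elim: (index_enum _) => [|i s IH].
  by under eq_fun do rewrite big_nil; exact: measurable_cst.
by under eq_fun do rewrite big_cons/=; exact: mf_and.
Qed.

Definition corner l x : 'rV[R]_n := \row_i (l * fl (co i x / l)).

Lemma same_box l x y : 0 < l ->
  same l x y <-> box (corner l x) (corner l x + const_mx l) y.
Proof.
move=> l0; split => [/sameP h i|h].
  have := fl_le (co i y / l); rewrite -h !mxE ler_pdivlMr// ltr_pdivrMr//.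
  by rewrite mulrDl mul1r mulrC.
apply/sameP => i; have := h i; rewrite !mxE.
move=> /andP[h1 h2]; apply/esym; rewrite {1}/fl; congr (_%:~R).
apply: floor_def; rewrite ler_pdivlMr// ltr_pdivrMr// intrD1 mulrDl mul1r.
by rewrite -/(fl (co i x / l)) mulrC h1 h2.
Qed.

(** Integral kernel of the conditional expectation on the cells of side [l]. *)
Definition ek l x y : R := (same l x y)%:R / l ^+ n.

Lemma ek_ge0 l x y : 0 < l -> 0 <= ek l x y.
Proof. by move=> l0; rewrite divr_ge0 ?exprn_ge0 ?(ltW l0)// ler0n. Qed.
Lemma ek_sym l x y : ek l x y = ek l y x.
Proof. by rewrite /ek same_sym. Qed.
Lemma ek_eq l x y z : same l x y -> ek l x z = ek l y z.
Proof. by move=> h; rewrite /ek (same_eq _ h). Qed.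
Lemma mf_ek {d} {P : measurableType d} l (f g : P -> Rn R n) :
  measurable_fun setT f -> measurable_fun setT g ->
  measurable_fun setT (fun p => ek l (f p) (g p)).
Proof. by move=> mf mg; apply: mfM => //; apply: mf_chi; apply: mf_same. Qed.

Lemma ek_bound l x y : 0 < l -> ek l x y <= l ^- n.
Proof.
move=> l0; rewrite /ek; case: same; rewrite ?mul1r// mul0r.
by rewrite invr_ge0 exprn_ge0// ltW.
Qed.

Lemma ek_double l x y : 0 < l -> ek l x y <= 2 ^+ n * ek (2 * l) x y.
Proof.
move=> l0; rewrite /ek; have [h|_] := boolP (same l x y); last first.
  by rewrite mul0r !mulr_ge0 ?exprn_ge0// ?invr_ge0 ?exprn_ge0 ?mulr_ge0// ltW.
by rewrite (same_double h) !mul1r exprMn invfM mulrA divff ?mul1r.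
Qed.

Variable mu : {sigma_finite_measure set (Rn R n) -> \bar R}.
Hypothesis lmu : is_lebesgue mu.

Lemma int_same l x : 0 < l -> (\int[mu]_y ((same l x y)%:R : R)%:E = (l ^+ n)%:E)%E.
Proof.
move=> l0; rewrite -(vol_const (corner l x) (ltW l0)) -lmu.
rewrite -[RHS]mul1e -integral_cst; last exact: measurable_box.
rewrite [RHS]integral_mkcond; apply: eq_int => y; rewrite patchE.
case: ifPn => [/[!inE] /(same_box x y l0)->//|/negP h].
case E : (same l x y) => //; exfalso; apply: h; rewrite inE.
exact/(same_box x y l0).
Qed.

Lemma int_ek l x : 0 < l -> (\int[mu]_y (ek l x y)%:E = 1)%E.
Proof.
move=> l0; rewrite /ek; under eq_int do rewrite mulrC EFinM.
rewrite intZ; last 3 first.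
- by rewrite invr_ge0 exprn_ge0// ltW.
- by apply: mfE; apply: mf_chi; apply: mf_same; meas.
- by move=> y; rewrite lee_fin ler0n.
by rewrite int_same// -EFinM mulVf// gt_eqF// exprn_gt0.
Qed.

End Cells.

Ltac meas_hook ::= match goal with
 | |- measurable_fun _ (fun p => vadd (@?f p) (@?g p)) => apply: mf_vadd
 | |- measurable_fun _ (fun p => vsub (@?f p) (@?g p)) => apply: mf_vsub
 | |- measurable_fun _ (fun p => ninf (@?f p)) => apply: mf_ninf
 | |- measurable_fun _ (fun p => pdecay _ _ (@?f p) (@?g p)) => apply: mf_pdecay
 | |- measurable_fun _ (fun p => ek _ (@?f p) (@?g p)) => apply: mf_ek
 | |- measurable_fun _ (fun p => same _ (@?f p) (@?g p)) => apply: mf_same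
 end.

Ltac pos1 := match goal with
 | |- is_true (Order.le _ (EFin _)) => rewrite lee_fin
 | |- is_true (Order.le _ (_ * _)%E) => apply: mule_ge0
 | |- is_true (Order.le _ (\int[_]_x _)%E) => apply: int_ge0 => ?
 | |- is_true (Order.le _ (\sum_(i <- _) _)%E) => apply: sume_ge0 => ? _
 | |- is_true (Order.le _ (_ * _)) => apply: mulr_ge0
 | |- is_true (Order.le _ (_ + _)) => first [apply: addr_ge0 | apply: adde_ge0]
 | |- is_true (Order.le _ (_ ^-1)) => rewrite invr_ge0
 | |- is_true (Order.le _ (_ ^+ 2)) => exact: sqr_ge0
 | |- is_true (Order.le _ (_ ^+ _)) => apply: exprn_ge0
 | |- is_true (Order.le _ (_ `^ _)) => exact: powR_ge0
 | |- is_true (Order.le _ (_%:R)) => exact: ler0n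
 | |- is_true (Order.le _ (`| _ |)) => exact: normr_ge0
 | |- is_true (Order.le _ (ninf _)) => exact: ninf_ge0
 | |- is_true (Order.le _ (ek _ _ _)) => apply: ek_ge0
 | |- is_true (Order.le _ (\int[_]_x _)) => apply: Rint_ge0 => ?
 | |- is_true (Order.le _ (\sum_(i <- _ | _) _)) => apply: sumr_ge0 => ? _
 | |- is_true (Order.le _ (pdecay _ _ _ _)) => apply: ltW; apply: pdecay_gt0
 | H : is_true (Order.lt ?y ?x) |- is_true (Order.le ?y ?x) => exact: (ltW H)
 end.
Ltac pos := intros; cbv beta; repeat (first [by [] | pos1]).

(** * Kernel mass that crosses the walls of a cell *)

Section Boundary.
Context {R : realType} {n : nat}.
Variable mu : {sigma_finite_measure set (Rn R n) -> \bar R}.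
Hypothesis lmu : is_lebesgue mu.
Implicit Types (x y z u : Rn R n).

(** A shift by [r] leaves an interval only from the strip of width [|r|] at the end towards which it
    moves. *)
Lemma slab_in (c l s r : R) : 0 < l -> c <= s < c + l ->
  ~~ (c <= s + r < c + l) ->
  (if 0 <= r then c + l - r else c) <= s < (if 0 <= r then c + l - r else c) + `|r|.
Proof.
move=> l0 /andP[h1 h2]; case: (leP 0 r) => r0; rewrite negb_and -ltNge -leNgt => /orP[] h3;
 rewrite ?(ger0_norm r0) ?(ltr0_norm r0); apply/andP; split; lra.
Qed.

(** A point moved out of its cell by [u] leaves it through some coordinate [i], hence lies in the
    slab [box (A i) (B i)] of thickness [|u_i|] along one face. The [n] slabs are summed. *)
Lemma cell_shift (l : R) x u : 0 < l -> ninf u <= l ->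
  (\int[mu]_y ((same l x y && ~~ same l y (vadd u y))%:R : R)%:E
   <= (n%:R * ninf u * l ^+ n.-1)%:E)%E.
Proof.
move=> l0 ul.
pose c := corner l x.
pose ci i := if 0 <= u ord0 i then c ord0 i + l - u ord0 i else c ord0 i.
pose A i : 'rV[R]_n := \row_j (if j == i then ci i else c ord0 j).
pose B i : 'rV[R]_n := \row_j (if j == i then ci i + `|u ord0 i| else c ord0 j + l).
apply: (@le_trans _ _ (\int[mu]_y (\sum_(i < n) (\1_(box (A i) (B i)) y)%:E))%E).
  apply: le_int => y; first by rewrite lee_fin ler0n.
  have [/andP[h1 h2]|_] := boolP (same l x y && ~~ same l y (vadd u y)); last first.
    by apply: sume_ge0 => i _; rewrite lee_fin indicE ler0n.
  have hb := (same_box x y l0).1 h1.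
  have : ~ box (corner l x) (corner l x + const_mx l) (vadd u y).
    by move=> /(same_box x _ l0) h3; move: h2; rewrite -(same_eq _ h1) h3.
  move=> /existsNP[i hi].
  apply: (@le_trans _ _ (\1_(box (A i) (B i)) y)%:E); last first.
    rewrite (bigD1 i)//= leeDl//.
    by apply: sume_ge0 => j _; rewrite lee_fin indicE ler0n.
  rewrite lee_fin indicE.
  suff /mem_set -> : box (A i) (B i) y by [].
  move=> j; rewrite !mxE.
  have := hb j; rewrite !mxE => hj; case: eqP => [ji|//].
  subst j; rewrite /ci; apply: slab_in => //; first by rewrite /c mxE.
  by move: hi; rewrite /c !mxE [_ + y ord0 i]addrC => /negP.
rewrite int_sum; last 2 first.
- by move=> i; apply: mfE; apply: measurable_indic; exact: measurable_box.
- by move=> i y; rewrite lee_fin indicE ler0n.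
apply: (@le_trans _ _ (\sum_(i < n) (ninf u * l ^+ n.-1)%:E)%E); last first.
  by rewrite sumEFin lee_fin sumr_const card_ord -mulrA mulr_natl.
apply: lee_sum => i _; rewrite integral_indic//; last exact: measurable_box.
rewrite setIT lmu lee_fin /vol (bigD1 i)//=.
rewrite !mxE eqxx addrAC subrr add0r max_l//.
rewrite (eq_bigr (fun=> l)); last first.
  by move=> j /negbTE ji; rewrite !mxE ji addrAC subrr add0r max_l// ltW.
rewrite prodr_const.
have -> : #|[pred j : 'I_n | j != i]| = n.-1.
  by have := cardC1 i; rewrite card_ord => <-; apply: eq_card.
rewrite ler_wpM2r ?exprn_ge0 ?(ltW l0)//.
by have /(ninf_leP _ (ninf_ge0 u)) h := lexx (ninf u); exact: h.
Qed.

(** The proportion moved out is at most [n |u| / l], and at most 1. For [e <= 1] both bounds are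
    absorbed by the power [e], which is lowered because a decaying kernel integrates only small
    powers of [|u|]. *)
Lemma cell_shift_avg (l e : R) x u : 0 < l -> 0 < e -> e <= 1 ->
  (\int[mu]_y (ek l x y * (~~ same l y (vadd u y))%:R)%:E
   <= ((n%:R + 1) * (ninf u / l) `^ e)%:E)%E.
Proof.
move=> l0 e0 e1.
have ln0 : 0 < l ^+ n by rewrite exprn_gt0.
have [ul|lu] := leP (ninf u) l; last first.
  apply: (@le_trans _ _ 1%E).
    rewrite -(int_ek lmu x l0); apply: le_int => y; rewrite lee_fin.
      by rewrite mulr_ge0 ?ek_ge0.
    by rewrite ler_piMr ?ek_ge0// lern1 leq_b1.
  rewrite lee_fin -[leLHS]mul1r ler_pM//; first by rewrite lerDr.
  have -> : 1 = 1 `^ e :> R by rewrite powR1.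
  rewrite powR_le ?(ltW e0)//.
  by rewrite ler_pdivlMr// mul1r ltW.
apply: (@le_trans _ _ ((l ^- n)%:E * (n%:R * ninf u * l ^+ n.-1)%:E)%E).
  apply: (@le_trans _ _ ((l ^- n)%:E * \int[mu]_y ((same l x y && ~~ same l y (vadd u y))%:R : R)%:E)%E).
    rewrite -intZ; last 3 first.
    - by rewrite invr_ge0 ltW.
    - by apply: mfE; apply: mf_chi; apply: mf_and; meas.
    - by move=> y; rewrite lee_fin ler0n.
    apply: le_int => y; rewrite -?EFinM lee_fin; first by rewrite mulr_ge0 ?ek_ge0.
    by rewrite /ek mulrAC mulrC ler_wpM2l ?invr_ge0 ?(ltW ln0)// -natrM mulnb.
  by rewrite lee_wpmul2l ?lee_fin ?invr_ge0 ?(ltW ln0)// cell_shift.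
rewrite -EFinM lee_fin.
apply: (@le_trans _ _ (n%:R * (ninf u / l))).
  (* The predecessor [n.-1] makes dimension 0 a separate case, in which both sides vanish. *)
  case: (n) (u) => [|k] v; first by rewrite !mul0r mulr0.
  by rewrite /= exprS invfM le_eqVlt; apply/orP; left; apply/eqP; field; rewrite !gt_eqF ?exprn_gt0.
rewrite ler_pM//; first by rewrite divr_ge0 ?ninf_ge0 ?ltW.
  by rewrite lerDl.
have [->|u0] := eqVneq (ninf u) 0; first by rewrite mul0r powR_ge0.
rewrite ger1_powR//; apply/andP; split; first by rewrite divr_gt0// lt_neqAle eq_sym u0 ninf_ge0.
by rewrite ler_pdivrMr// mul1r.
Qed.

(** Since [|u| <= t + |u|], the growth [|u|^e] uses up [e] of the decay exponent; what is left is a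
    kernel of order [a - e] and the ratio of the scales. *)
Lemma pdecay_split (a e t l : R) (u : 'rV[R]_n) : 0 < t -> 0 < l -> 0 < e -> e < a ->
  pdecay n a t u * (ninf u / l) `^ e <= (t / l) `^ e * pdecay n (a - e) t u.
Proof.
move=> t0 l0 e0 ea; rewrite /pdecay.
have l0' := ltW l0; have t0' := ltW t0; have u0 := ninf_ge0 u.
have tu : 0 < t + ninf u by rewrite ltr_wpDr.
rewrite !powRM ?invr_ge0//.
have -> : t `^ a = t `^ e * t `^ (a - e).
  by rewrite -powRD ?(gt_eqF t0) ?implybT// addrC subrK.
have -> : (t + ninf u) `^ (n%:R + a) = (t + ninf u) `^ e * (t + ninf u) `^ (n%:R + (a - e)).
  by rewrite -powRD ?(gt_eqF tu) ?implybT//; congr (_ `^ _); ring.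
have h : ninf u `^ e <= (t + ninf u) `^ e by rewrite powR_le ?(ltW e0)// lerDr.
set T := t `^ e; set T' := t `^ _; set U := _ `^ e in h *; set V := (t + ninf u) `^ e in h *.
set W := (t + ninf u) `^ _; set L := l^-1 `^ e.
have V0 : 0 < V by rewrite powR_gt0.
have W0 : 0 < W by rewrite powR_gt0.
have c0 : 0 <= T * L * (T' / W) by rewrite !mulr_ge0 ?invr_ge0 ?powR_ge0.
rewrite [leLHS](_ : _ = (T * L * (T' / W)) * (U / V)); last by field; rewrite !gt_eqF.
by rewrite ler_piMr// ler_pdivrMr// mul1r.
Qed.

(** After the substitution [z = y + u] and an exchange of integrals, the average over the cell is,
    for each fixed [u], the proportion of the cell that the shift by [u] moves out. The bound is
    small only because [y] is averaged: for [y] next to a wall the inner integral need not be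
    small. *)
Lemma boundary a : 0 < a -> exists e, [/\ 0 < e, e <= a & exists2 C : R, 0 < C &
  forall t l x, 0 < t -> 0 < l ->
  (\int[mu]_y ((ek l x y)%:E *
     \int[mu]_z ((~~ same l y z)%:R * pdecay n a t (vsub y z))%:E)
   <= (C * (t / l) `^ e)%:E)%E].
Proof.
(* [e <= 1] is required by [cell_shift_avg], and [e < a] leaves a positive order [a - e] of decay to
   integrate. *)
move=> a0; pose e := Num.min a 1 / 2.
have m0 : 0 < Num.min a 1 by rewrite lt_min a0 ltr01.
have e0 : 0 < e by rewrite divr_gt0.
have ma : Num.min a 1 <= a by rewrite ge_min lexx.
have m1 : Num.min a 1 <= 1 by rewrite ge_min lexx orbT.
have ea : e < a by rewrite /e; lra.
have e1 : e <= 1 by rewrite /e; lra.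
have ae0 : 0 < a - e by rewrite subr_gt0.
have [C C0 hC] := decay_int lmu ae0.
exists e; split => //; first exact: ltW.
exists ((n%:R + 1) * C); first by rewrite mulr_gt0// ltr_wpDl.
move=> t l x t0 l0.
have p0 (u : Rn R n) : 0 <= pdecay n a t u by rewrite ltW// pdecay_gt0.
pose F y u : \bar R := ((ek l x y * (~~ same l y (vadd u y))%:R) * pdecay n a t u)%:E.
have F0 y u : (0 <= F y u)%E by rewrite /F; pos.
have mF : mf2 F.
  by rewrite /F; meas.
apply: (@le_trans _ _ (\int[mu]_y \int[mu]_u F y u)%E).
  apply: le_int => y.
    by pos.
  rewrite -intZ ?ek_ge0//; last 2 first.
  - by meas.
  - by pos.
  rewrite -(@int_shift _ _ _ lmu y); last 2 first.
  - by meas.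
  - by pos.
  apply: le_int => u; first by pos.
  rewrite /F -EFinM lee_fin pdecay_symm [vsub (vadd u y) y](_ : _ = u) ?mulrA//.
  by rewrite /vsub /vadd addrK.
rewrite tonelli//.
apply: (@le_trans _ _ (\int[mu]_u (((n%:R + 1) * (t / l) `^ e)%:E * (pdecay n (a - e) t u)%:E))%E).
  apply: le_int => u; first by apply: int_ge0.
  rewrite /F; under eq_int do rewrite mulrC EFinM.
  rewrite intZ//; last 2 first.
  - by meas.
  - by pos.
  apply: (@le_trans _ _ ((pdecay n a t u)%:E * ((n%:R + 1) * (ninf u / l) `^ e)%:E)%E).
    by rewrite lee_wpmul2l ?lee_fin// cell_shift_avg.
  rewrite -!EFinM lee_fin mulrCA -[leRHS]mulrA.
  by apply: ler_wpM2l; [pos|exact: pdecay_split].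
rewrite intZ; last 3 first.
- by pos.
- by meas.
- by pos.
apply: (@le_trans _ _ (((n%:R + 1) * (t / l) `^ e)%:E * C%:E)%E).
  by apply: lee_wpmul2l; [pos|exact: hC].
by rewrite -EFinM lee_fin mulrAC.
Qed.

End Boundary.

(** * Averages over cells *)

Section Averaging.
Context {R : realType} {n : nat}.
Variable mu : {sigma_finite_measure set (Rn R n) -> \bar R}.
Hypothesis lmu : is_lebesgue mu.
Implicit Types (x y z u : Rn R n) (l : R) (f g h : Rn R n -> R).

Definition Ek l f y : R := \int[mu]_z (ek l y z * f z).

Lemma Ek0 l x : Ek l (fun=> 0) x = 0.
Proof.
rewrite /Ek (eq_Rint _ (g := fun=> 0)); first exact: Rint0.
by move=> z; rewrite mulr0.
Qed.

Lemma mf_Ek {d} {P : measurableType d} l (F : P -> Rn R n -> R) (a : P -> Rn R n) :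
  mf2 F -> measurable_fun setT a -> measurable_fun setT (fun p => Ek l (F p) (a p)).
Proof. by move=> mF ma; rewrite /Ek; meas. Qed.

Lemma c1_ek l x : 0 < l -> c1 mu (ek l x).
Proof.
move=> l0; have m : measurable_fun setT (ek l x).
  by apply: mf_ek; meas.
split => //.
  by exists (l ^- n) => y; rewrite ger0_norm ?ek_ge0// ek_bound.
apply: iblP => //; under eq_int do rewrite ger0_norm ?ek_ge0//.
by rewrite int_ek// ltry.
Qed.

Lemma Rint_ek l x : 0 < l -> \int[mu]_y (ek l x y) = 1.
Proof. by move=> l0; rewrite /Rintegral int_ek. Qed.

Lemma ibl_ekM l x f : 0 < l -> measurable_fun setT f ->
  (exists M, forall y, `|f y| <= M) -> ibl mu (fun y => ek l x y * f y).
Proof.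
move=> l0 mf bf; have [_ _] : c1 mu (fun y => f y * ek l x y) by apply: c1M => //; exact: c1_ek.
by under eq_fun do rewrite mulrC.
Qed.

Lemma c1_ekM l x f : 0 < l -> c1 mu f -> c1 mu (fun y => ek l x y * f y).
Proof. by move=> l0 cf; apply: c1MM => //; exact: c1_ek. Qed.

Lemma Ek_eq l f x y : same l x y -> Ek l f x = Ek l f y.
Proof. by move=> h; apply: eq_Rint => z; rewrite (ek_eq _ h). Qed.

Lemma Ek_bound l f M x : 0 < l -> measurable_fun setT f ->
  (forall y, `|f y| <= M) -> `|Ek l f x| <= M.
Proof.
move=> l0 mf hM; rewrite -[leRHS]mulr1 -(Rint_ek x l0) -RintZ; last by case: (c1_ek x l0).
apply: Rint_le_norm; first by meas.
  by apply: iblZ; case: (c1_ek x l0).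
by move=> y; rewrite normrM (ger0_norm (ek_ge0 _ _ l0)) mulrC ler_wpM2r ?ek_ge0.
Qed.

Lemma Ek_const l f x : 0 < l -> (forall y, same l x y -> f x = f y) -> Ek l f x = f x.
Proof.
move=> l0 hf; rewrite /Ek.
rewrite (eq_Rint _ (g := fun z => f x * ek l x z)); last first.
  by move=> z; rewrite mulrC /ek; case E : (same l x z); rewrite ?mul0r ?mulr0// (hf _ E).
by rewrite RintZ ?Rint_ek ?mulr1//; case: (c1_ek x l0).
Qed.

Lemma Ek_le l f g x : 0 < l -> c1 mu f -> c1 mu g -> (forall y, f y <= g y) ->
  Ek l f x <= Ek l g x.
Proof.
move=> l0 cf cg fg; apply: le_Rint.
- by case: (c1_ekM x l0 cf).
- by case: (c1_ekM x l0 cg).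
- by move=> y; rewrite ler_wpM2l ?ek_ge0.
Qed.

Lemma Ek_ge0 l f x : 0 < l -> (forall y, 0 <= f y) -> 0 <= Ek l f x.
Proof. by move=> l0 f0; apply: Rint_ge0 => z; rewrite mulr_ge0 ?ek_ge0. Qed.

Lemma EkD l f g x : 0 < l -> c1 mu f -> c1 mu g ->
  Ek l (fun y => f y + g y) x = Ek l f x + Ek l g x.
Proof.
move=> l0 cf cg; rewrite /Ek -RintD; [|by case: (c1_ekM x l0 cf)|by case: (c1_ekM x l0 cg)].
by apply: eq_Rint => z; rewrite mulrDr.
Qed.

Lemma EkB l f g x : 0 < l -> c1 mu f -> c1 mu g ->
  Ek l (fun y => f y - g y) x = Ek l f x - Ek l g x.
Proof.
move=> l0 cf cg; rewrite /Ek -RintB; [|by case: (c1_ekM x l0 cf)|by case: (c1_ekM x l0 cg)].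
by apply: eq_Rint => z; rewrite mulrBr.
Qed.

Lemma Ek_norm l f x : 0 < l -> c1 mu f -> `|Ek l f x| <= Ek l (fun y => `|f y|) x.
Proof.
move=> l0 cf; apply: Rint_le_norm.
- by case: (c1_ekM x l0 cf).
- by case: (c1_ekM x l0 (c1_norm cf)).
- by move=> z; rewrite normrM (ger0_norm (ek_ge0 _ _ l0)).
Qed.

Lemma Ek_c1 l f : 0 < l -> c1 mu f -> c1 mu (Ek l f).
Proof.
move=> l0 cf; have mf := c1_mf cf.
have mE : measurable_fun setT (Ek l f) by apply: (@mf_Ek _ _ l (fun=> f)); meas.
split => //.
  by case: cf => _ [M hM] _; exists M => x; exact: Ek_bound.
apply: iblP => //.
apply: (@le_lt_trans _ _ (\int[mu]_x \int[mu]_y (ek l x y * `|f y|)%:E)%E).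
  apply: le_int => x //; apply: le_trans (Rint_abs _ _) _; first by meas.
  by apply: le_int => y //; rewrite normrM (ger0_norm (ek_ge0 _ _ l0)).
rewrite tonelli; [|by meas|by pos].
rewrite (eq_int _ (g := fun y => (`|f y|)%:E)); first by apply: ibl_lty; case: cf.
move=> y; under eq_int do rewrite mulrC EFinM ek_sym.
by rewrite intZ ?int_ek ?mule1//; [meas|pos].
Qed.

(** Symmetry of [ek] and Fubini. The function [h] is merely bounded, so that it may be a partial sum
    of Carleson densities or a section of a kernel. *)
Lemma Ek_adj l g h : 0 < l -> c1 mu g -> measurable_fun setT h ->
  (exists M, forall y, `|h y| <= M) ->
  \int[mu]_y (g y * Ek l h y) = \int[mu]_y (Ek l g y * h y).
Proof.
move=> l0 cg mh [M hM]; have mg := c1_mf cg.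
pose F (q : Rn R n * Rn R n) : \bar R := (g q.1 * (ek l q.1 q.2 * h q.2))%:E.
have mF : measurable_fun setT F by rewrite /F; meas.
have iF : (mu \x mu)%E.-integrable setT F.
  apply/integrableP; split => //.
  apply: (@le_lt_trans _ _ (\int[mu]_x \int[mu]_y (M * `|g x| * ek l x y)%:E)%E).
    rewrite -(@tonelli_prod _ _ _ _ _ mu mu (fun x y => (M * `|g x| * ek l x y)%:E)).
    - apply: le_int => q //; rewrite /F lee_fin.
      rewrite normrM [`|ek _ _ _ * _|]normrM (ger0_norm (ek_ge0 _ _ l0)) mulrCA mulrC.
      by apply: ler_wpM2r; [pos|rewrite mulrC; apply: ler_wpM2r].
    - by meas.
    - have M0 : 0 <= M by rewrite (le_trans _ (hM point)).
      by pos.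
  have M0 : 0 <= M by rewrite (le_trans _ (hM point)).
  rewrite (eq_int _ (g := fun x => (M%:E * (`|g x|)%:E)%E)); last first.
    move=> x; under eq_int do rewrite EFinM.
    by rewrite intZ ?int_ek ?mule1//; [pos|meas|pos].
  rewrite intZ//; last by meas.
  by rewrite lte_mul_pinfty// ?lee_fin//; case: cg => _ _ /ibl_lty.
have e1 := @integral12_prod_meas1 _ _ _ _ _ mu mu _ iF.
have e2 := @integral21_prod_meas1 _ _ _ _ _ mu mu _ iF.
apply: EFin_inj.
have bh : exists M, forall y, `|h y| <= M by exists M.
have bE : exists M, forall y, `|Ek l h y| <= M by exists M => y; exact: Ek_bound.
have mE : measurable_fun setT (Ek l h) by apply: (@mf_Ek _ _ l (fun=> h)); meas.
have mEg : measurable_fun setT (Ek l g) by apply: (@mf_Ek _ _ l (fun=> g)); meas.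
have i1 : ibl mu (fun y => g y * Ek l h y).
  by have [_ _] := c1M mE bE cg; under eq_fun do rewrite mulrC.
have EF1 y : fubini_F mu F y = (g y * Ek l h y)%:E.
  rewrite /fubini_F /F /Ek -RintZ; last exact: ibl_ekM.
  by rewrite RintE//; apply: iblZ; exact: ibl_ekM.
have EF2 z : fubini_G mu F z = (Ek l g z * h z)%:E.
  rewrite /fubini_G /F /Ek mulrC -RintZ; last by case: (c1_ekM z l0 cg).
  rewrite RintE; last by apply: iblZ; case: (c1_ekM z l0 cg).
  by apply: eq_int => y; rewrite ek_sym; congr EFin; ring.
have i2 : ibl mu (fun y => Ek l g y * h y).
  by have [_ _] := c1M mh bh (Ek_c1 l0 cg); under eq_fun do rewrite mulrC.
rewrite !RintE//.
transitivity (\int[(mu \x mu)%E]_q F q)%E.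
  by rewrite -e1; apply: eq_int => y; rewrite EF1.
by rewrite -e2; apply: eq_int => y; rewrite EF2.
Qed.

Lemma Ek_adj_const l g h : 0 < l -> c1 mu g -> (forall x y, same l x y -> g x = g y) ->
  measurable_fun setT h -> (exists M, forall y, `|h y| <= M) ->
  \int[mu]_y (g y * Ek l h y) = \int[mu]_y (g y * h y).
Proof.
move=> l0 cg hg mh bh; rewrite Ek_adj//.
by apply: eq_Rint => y; rewrite Ek_const//; exact: hg.
Qed.

Definition nested l l' := forall x y, same l x y -> same l' x y.

Lemma Ek_nest_fine l l' f x : 0 < l -> nested l l' ->
  Ek l (Ek l' f) x = Ek l' f x.
Proof. by move=> l0 nst; apply: Ek_const => // y /nst; exact: Ek_eq. Qed.

Lemma Ek_nest l l' f x : 0 < l -> 0 < l' -> nested l l' -> c1 mu f ->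
  Ek l' (Ek l f) x = Ek l' f x.
Proof.
move=> l0 l'0 nst cf; have [mf bf _] := cf.
rewrite /Ek (@Ek_adj_const l (ek l' x))//; first exact: c1_ek.
by move=> y z h; rewrite !(ek_sym _ x) (ek_eq _ (nst _ _ h)).
Qed.

Lemma pyth l f : 0 < l -> c1 mu f ->
  \int[mu]_y (f y ^+ 2) =
  \int[mu]_y ((f y - Ek l f y) ^+ 2) + \int[mu]_y (Ek l f y ^+ 2).
Proof.
move=> l0 cf; have cE := Ek_c1 l0 cf; have [mf bf _] := cf; have [mE bE _] := cE.
have h : \int[mu]_y (Ek l f y * f y) = \int[mu]_y (Ek l f y ^+ 2).
  rewrite -(@Ek_adj_const l (Ek l f) f)//; first by move=> x y; exact: Ek_eq.
transitivity (\int[mu]_y ((f y - Ek l f y) ^+ 2 +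
   (2 * (Ek l f y * f y) - Ek l f y ^+ 2))).
  by apply: eq_Rint => y; ring.
have i1 := c1_ibl (c1_sq (c1B cf cE)).
have i2 := c1_ibl (c1Z 2 (c1MM cE cf)).
have i3 := c1_ibl (c1_sq cE).
rewrite RintD//; last exact: iblB.
by rewrite RintB// RintZ; [rewrite h; ring|exact/c1_ibl/c1MM].
Qed.

Lemma Ek_double l f x : 0 < l -> c1 mu f -> (forall y, 0 <= f y) ->
  Ek l f x <= 2 ^+ n * Ek (2 * l) f x.
Proof.
move=> l0 cf f0; have l20 : 0 < 2 * l by rewrite mulr_gt0.
rewrite /Ek -RintZ; last by case: (c1_ekM x l20 cf).
apply: le_Rint; [by case: (c1_ekM x l0 cf)|apply: iblZ; by case: (c1_ekM x l20 cf)|].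
by move=> y; rewrite mulrA ler_wpM2r// ek_double.
Qed.

End Averaging.

Ltac meas_hook ::= match goal with
 | |- measurable_fun _ (fun p => vadd (@?f p) (@?g p)) => apply: mf_vadd
 | |- measurable_fun _ (fun p => vsub (@?f p) (@?g p)) => apply: mf_vsub
 | |- measurable_fun _ (fun p => ninf (@?f p)) => apply: mf_ninf
 | |- measurable_fun _ (fun p => pdecay _ _ (@?f p) (@?g p)) => apply: mf_pdecay
 | |- measurable_fun _ (fun p => ek _ (@?f p) (@?g p)) => apply: mf_ek
 | |- measurable_fun _ (fun p => same _ (@?f p) (@?g p)) => apply: mf_same
 | |- measurable_fun _ (fun p => Ek _ _ (@?F p) (@?g p)) => apply: mf_Ek
 end.

(** * Carleson embedding and maximal functions *)

Section Scales.
Context {R : realType} {n : nat}.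
Variable l0 : R.
Hypothesis l0_gt0 : 0 < l0.

(** Scales grow with the index, starting from a finest one. All estimates are uniform in [l0] and in
    the number of scales; [l0] tends to 0 only in the final passage to the limit. *)
Definition sc (i : nat) : R := 2 ^+ i * l0.

Lemma sc_gt0 i : 0 < sc i. Proof. by rewrite mulr_gt0// exprn_gt0. Qed.
Lemma scS i : sc i.+1 = 2 * sc i. Proof. by rewrite /sc exprS mulrA. Qed.

Lemma nested_scS i : nested (n := n) (sc i) (sc i.+1).
Proof. by move=> x y; rewrite scS; exact: same_double. Qed.

Lemma nested_sc i j : (i <= j)%N -> nested (n := n) (sc i) (sc j).
Proof.
move=> /subnK <-; elim: (j - i)%N => [//|k IH] x y h.
by rewrite addSn; apply: nested_scS; exact: IH.
Qed.

End Scales.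

Section CarlesonEmbedding.
Context {R : realType} {n : nat}.
Variable mu : {sigma_finite_measure set (Rn R n) -> \bar R}.
Hypothesis lmu : is_lebesgue mu.
Variable l0 : R.
Hypothesis l0_gt0 : 0 < l0.
Implicit Types (f g h : Rn R n -> R).
Let sg i := sc_gt0 l0_gt0 i.

Section Bellman.
Variables (beta : nat -> Rn R n -> R) (A : R) (g : Rn R n -> R).
Hypotheses (A0 : 0 < A) (cg : c1 mu g).
Hypotheses (mb : forall k, measurable_fun setT (beta k))
  (bb : forall k, exists M, forall x, `|beta k x| <= M)
  (b0 : forall k x, 0 <= beta k x).

Let S k x := \sum_(j < k) beta j x.
(** Index 0 is [g] itself and index [j.+1] its average at scale [j], so that passing from [k] to
    [k.+1] always averages over the cells of scale [k]. [D] is shifted in the same way. *)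
Let F k : Rn R n -> R := if k is j.+1 then Ek mu (sc l0 j) g else g.
Let D k : Rn R n -> R :=
  if k is j.+1 then fun x => A + Ek mu (sc l0 j) (S j.+1) x else fun=> A.

Let mS k : measurable_fun setT (S k).
Proof. by rewrite /S; apply: mf_sum => j; exact: mb. Qed.
Let bS k : exists M, forall x, `|S k x| <= M.
Proof.
elim: k => [|k [M hM]]; first by exists 0 => x; rewrite /S big_ord0 normr0.
have [M' hM'] := bb k; exists (M + M') => x.
rewrite /S big_ord_recr/= (le_trans (ler_normD _ _))//.
exact: lerD (hM x) (hM' x).
Qed.
Let S0 k x : 0 <= S k x. Proof. by apply: sumr_ge0 => j _; exact: b0. Qed.
Let DA k x : A <= D k x.
Proof. by case: k => [//|k]; rewrite /D lerDl; apply: Ek_ge0 => // y; exact: S0. Qed.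
Let D0 k x : 0 < D k x. Proof. exact: lt_le_trans (DA k x). Qed.
Let mD k : measurable_fun setT (D k).
Proof.
case: k => [|k]; rewrite /D; first exact: measurable_cst.
by have mSk := mS k.+1; meas.
Qed.
Let bD k : exists M, forall x, `|D k x| <= M.
Proof.
case: k => [|k]; first by exists `|A| => x.
have [M hM] := bS k.+1; exists (`|A| + M) => x; rewrite (le_trans (ler_normD _ _))// lerD//.
exact: (Ek_bound lmu).
Qed.
Let cF k : c1 mu (F k).
Proof. by case: k => [//|k]; exact: Ek_c1. Qed.
Let mDV k : measurable_fun setT (fun x => (D k x)^-1).
Proof. by apply: mfV; exact: mD. Qed.
Let bDV k : exists M, forall x, `|(D k x)^-1| <= M.
Proof.
exists A^-1 => x; rewrite ger0_norm; last by rewrite invr_ge0 ltW.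
by rewrite lef_pV2// posrE.
Qed.
Let c k x := (D k.+1 x)^-1 * F k.+1 x.
Let cc k : c1 mu (c k). Proof. exact: c1M. Qed.
Let c_const k x y : same (sc l0 k) x y -> c k x = c k y.
Proof. by move=> h; rewrite /c /D /F !(Ek_eq _ _ h). Qed.

Let int_cF k : \int[mu]_x (c k x * F k x) = \int[mu]_x (c k x * F k.+1 x).
Proof.
have [mg bg _] := cg.
rewrite [RHS](Ek_adj_const lmu (sg k) (cc k) (@c_const k))//.
case: k => [//|k]; rewrite (Ek_adj_const lmu (sg k) (cc k.+1))// => x y h.
by apply: c_const; apply: (nested_scS h).
Qed.

(** [c k] is constant on the cells of scale [k], hence on all finer ones, so against it the average
    hidden in [D j] may be dropped. *)
Let int_cD k j : (j <= k.+1)%N -> \int[mu]_x (c k x ^+ 2 * D j x) =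
  \int[mu]_x (c k x ^+ 2 * (A + S j x)).
Proof.
case: j => [_|j jk]; first by apply: eq_Rint => x; rewrite /D /S big_ord0 addr0.
have c2 := c1_sq (cc k).
have i1 : ibl mu (fun x => A * (c k x ^+ 2)) by apply: iblZ; case: c2.
have i2 : ibl mu (fun x => c k x ^+ 2 * Ek mu (sc l0 j) (S j.+1) x).
  have [M hM] := bS j.+1; have mSj := mS j.+1.
  have [] := @c1M _ _ _ mu (Ek mu (sc l0 j) (S j.+1)) _ _ _ c2 => [||_ _].
  - by apply: (@mf_Ek _ _ mu _ _ _ (fun=> S j.+1)); meas.
  - by exists M => x; exact: (Ek_bound lmu).
  - by under eq_fun do rewrite mulrC.
have i3 : ibl mu (fun x => c k x ^+ 2 * S j.+1 x).
  by have [_ _] := c1M (mS j.+1) (bS j.+1) c2; under eq_fun do rewrite mulrC.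
transitivity (\int[mu]_x (A * (c k x ^+ 2) + c k x ^+ 2 * Ek mu (sc l0 j) (S j.+1) x)).
  by apply: eq_Rint => x; rewrite /D mulrDr mulrC.
transitivity (\int[mu]_x (A * (c k x ^+ 2) + c k x ^+ 2 * S j.+1 x)).
  rewrite !RintD//; congr (_ + _).
  apply: (Ek_adj_const lmu (sg j) c2) => // x y h.
  by rewrite (@c_const k x y)//; apply: (nested_sc _ h).
by apply: eq_Rint => x; rewrite mulrDr; congr (_ + _); rewrite mulrC.
Qed.

(** The function [x^2 / D] is jointly convex and decreasing in [D]: averaging over larger cells
    lowers its integral, and the mass [beta k] that enters [D] at each step yields a quantitative
    gain. *)
Let Phi k := \int[mu]_x (F k x ^+ 2 / D k x).

Let iPhi k : ibl mu (fun x => F k x ^+ 2 / D k x).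
Proof.
have [_ _] := c1M (mDV k) (bDV k) (c1_sq (cF k)).
by under eq_fun do rewrite mulrC.
Qed.

(** The tangent plane bound [F^2 / D >= 2 c F - c^2 D] holds for every [c], with equality at
    [c = F / D]. It is used at level [k] with the [c] that is optimal at level [k.+1]; the
    integrated right-hand sides at the two levels differ by the single term [c^2 beta k]. *)
Let step k : \int[mu]_x (c k x ^+ 2 * beta k x) + Phi k.+1 <= Phi k.
Proof.
have ic2 (f : Rn R n -> R) : measurable_fun setT f -> (exists M, forall x, `|f x| <= M) ->
    ibl mu (fun x => c k x ^+ 2 * f x).
  move=> mf bf; have [_ _] := c1M mf bf (c1_sq (cc k)).
  by under eq_fun do rewrite mulrC.
have icF j : ibl mu (fun x => 2 * (c k x * F j x)).
  by apply: iblZ; case: (c1MM (cc k) (cF j)).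
have bAS j : exists M, forall x, `|A + S j x| <= M.
  have [M hM] := bS j; exists (`|A| + M) => x.
  by rewrite (le_trans (ler_normD _ _))// lerD.
have mAS j : measurable_fun setT (fun x => A + S j x) by have := mS j; move=> ?; meas.
apply: (@le_trans _ _ (\int[mu]_x (2 * (c k x * F k x) - c k x ^+ 2 * D k x))); last first.
  apply: le_Rint; [by apply: iblB => //; exact: ic2|exact: iPhi|move=> x].
  rewrite -subr_ge0 (_ : _ - _ = (F k x - c k x * D k x) ^+ 2 / D k x).
    by rewrite divr_ge0 ?sqr_ge0// ltW.
  by field; rewrite gt_eqF.
rewrite RintB//; last exact: ic2.
rewrite (int_cD (j := k))// RintZ; last by case: (c1MM (cc k) (cF k)).
rewrite int_cF.
have -> : Phi k.+1 = \int[mu]_x (2 * (c k x * F k.+1 x) - c k x ^+ 2 * D k.+1 x).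
  by apply: eq_Rint => x; rewrite /c; field; rewrite gt_eqF.
rewrite RintB//; last exact: ic2.
rewrite (int_cD (j := k.+1))// RintZ; last by case: (c1MM (cc k) (cF k.+1)).
rewrite addrCA lerD2l.
have -> : \int[mu]_x (c k x ^+ 2 * (A + S k.+1 x)) =
    \int[mu]_x (c k x ^+ 2 * (A + S k x)) + \int[mu]_x (c k x ^+ 2 * beta k x).
  rewrite -RintD; [|exact: ic2|exact: ic2].
  by apply: eq_Rint => x; rewrite /S big_ord_recr/=; ring.
by rewrite opprD addrCA subrr addr0.
Qed.

(** [step] is telescoped. By the packing hypothesis [D <= 2 A], hence [(E g)^2 <= 4 A^2 c^2], and
    [Phi 0] is the integral of [g^2 / A]; together they give the constant [4 A]. *)
Lemma carleson_embedding N :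
  (forall k x, (k < N)%N -> Ek mu (sc l0 k) (fun y => \sum_(j < k.+1) beta j y) x <= A) ->
  \sum_(k < N) \int[mu]_x (beta k x * (Ek mu (sc l0 k) g x) ^+ 2)
    <= 4 * A * \int[mu]_x (g x ^+ 2).
Proof.
move=> hA.
have ib k : ibl mu (fun x => beta k x * (Ek mu (sc l0 k) g x) ^+ 2).
  by case: (c1M (mb k) (bb k) (c1_sq (cF k.+1))).
have ic k : ibl mu (fun x => c k x ^+ 2 * beta k x).
  have [_ _] := c1M (mb k) (bb k) (c1_sq (cc k)).
  by under eq_fun do rewrite mulrC.
have D2A k x : (k < N)%N -> D k.+1 x <= 2 * A.
  by move=> kN; have := hA k x kN; rewrite /D /S; lra.
have h k : (k < N)%N -> \int[mu]_x (beta k x * (Ek mu (sc l0 k) g x) ^+ 2) <=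
    4 * A ^+ 2 * \int[mu]_x (c k x ^+ 2 * beta k x).
  move=> kN; rewrite -RintZ//; apply: le_Rint => //; first exact: iblZ.
  move=> x; rewrite [leRHS](_ : _ = beta k x * (4 * A ^+ 2 * c k x ^+ 2)); last by ring.
  rewrite ler_wpM2l// /c -/(F k.+1 x) exprMn exprVn mulrA ler_peMl ?sqr_ge0//.
  rewrite ler_pdivlMr ?mul1r ?exprn_gt0//.
  have -> : 4 * A ^+ 2 = (2 * A) ^+ 2 by ring.
  by rewrite lerXn2r ?nnegrE ?D2A ?mulr_ge0 ?(ltW A0) ?(ltW (D0 _ _)).
have sm j : (j <= N)%N -> \sum_(k < j) \int[mu]_x (c k x ^+ 2 * beta k x) + Phi j <= Phi 0.
  elim: j => [|j IH] jN; first by rewrite big_ord0 add0r.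
  apply: le_trans (IH (ltnW jN)); rewrite big_ord_recr/= -addrA lerD2l.
  exact: step.
have P0 k : 0 <= Phi k by apply: Rint_ge0 => x; rewrite divr_ge0 ?sqr_ge0// ltW.
have Phi0 : A * Phi 0 = \int[mu]_x (g x ^+ 2).
  by rewrite -RintZ//; apply: eq_Rint => x; rewrite /D /F; field; rewrite gt_eqF.
apply: (@le_trans _ _ (4 * A ^+ 2 * \sum_(k < N) \int[mu]_x (c k x ^+ 2 * beta k x))).
  by rewrite mulr_sumr; apply: ler_sum => k _; exact: h.
rewrite -Phi0 (_ : 4 * A * (A * _) = 4 * A ^+ 2 * Phi 0); last by ring.
apply: ler_wpM2l; first by rewrite mulr_ge0// exprn_ge0// ltW.
by have := sm N (leqnn _); have := P0 N; lra.
Qed.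

End Bellman.

Section Doob.
Variable h : Rn R n -> R.
Hypotheses (ch : c1 mu h) (h0 : forall x, 0 <= h x).

(** Maximum of the averages at the [k] scales from [i] on. The recursion removes the finest scale,
    so what remains is constant on the next coarser cells; the maximum with 0 costs nothing because
    [h] is nonnegative. *)
Fixpoint Mx k i : Rn R n -> R :=
  if k is k'.+1 then fun x => Num.max (Ek mu (sc l0 i) h x) (Mx k' i.+1 x)
  else fun=> 0.

Lemma Mx_ge0 k i x : 0 <= Mx k i x.
Proof. by case: k => [//|k]; rewrite /= le_max Ek_ge0. Qed.

Lemma Mx_ub k i j x : (j < k)%N -> Ek mu (sc l0 (i + j)) h x <= Mx k i x.
Proof.
elim: k i j => [//|k IH] i [|j] jk; first by rewrite addn0 /= le_max lexx.
by rewrite /= le_max addnS -addSn IH ?orbT.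
Qed.

Lemma c1_Mx k i : c1 mu (Mx k i).
Proof.
elim: k i => [|k IH] i; first exact: c1_0.
have cE := Ek_c1 lmu (sg i) ch.
apply: (c1_dom _ _ (c1D (c1_norm cE) (c1_norm (IH i.+1)))).
  by apply: mf_max; [case: cE|case: (IH i.+1)].
move=> x; rewrite /=; have := ler_norm (Ek mu (sc l0 i) h x).
have := normr_ge0 (Ek mu (sc l0 i) h x); have := normr_ge0 (Mx k i.+1 x).
have [?|?] := leP (Ek mu (sc l0 i) h x) (Mx k i.+1 x); lra.
Qed.

Lemma Mx_const k i x y : same (sc l0 i) x y -> Mx k i x = Mx k i y.
Proof.
elim: k i => [//|k IH] i xy /=; rewrite (Ek_eq _ _ xy) (IH i.+1)//.
exact: nested_scS.
Qed.

(** Against a function constant on cells of scale [i], [h] may be replaced by its average [E] there.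
    Then [x^2 - 2 x E] is smallest at [x = E], so replacing the coarser maximum by [E] where [E] is
    larger does not increase the integral. *)
Let doob_aux k i : \int[mu]_x (Mx k i x ^+ 2 - 2 * (Mx k i x * h x)) <= 0.
Proof.
have [mh bh _] := ch.
elim: k i => [|k IH] i.
  rewrite (eq_Rint _ (g := fun=> 0)) ?Rint0// => x /=; ring.
have cE := Ek_c1 lmu (sg i) ch.
have int_h T : c1 mu T -> (forall x y, same (sc l0 i) x y -> T x = T y) ->
    \int[mu]_x (T x ^+ 2 - 2 * (T x * h x)) =
    \int[mu]_x (T x ^+ 2 - 2 * (T x * Ek mu (sc l0 i) h x)).
  move=> cT kT; have i1 := c1_ibl (c1_sq cT).
  have i2 := c1_ibl (c1MM cT ch); have i3 := c1_ibl (c1MM cT cE).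
  rewrite !RintB ?RintZ//; [|exact: iblZ|exact: iblZ].
  by rewrite (Ek_adj_const lmu (sg i) cT kT mh bh).
apply: (le_trans _ (IH i.+1)).
rewrite (int_h _ (c1_Mx k.+1 i)); last by move=> x y; exact: Mx_const.
rewrite (int_h _ (c1_Mx k i.+1)); last by move=> x y xy; apply: Mx_const; exact: nested_scS.
have ib T : c1 mu T -> ibl mu (fun x => T x ^+ 2 - 2 * (T x * Ek mu (sc l0 i) h x)).
  by move=> cT; apply: iblB; [apply/c1_ibl/c1_sq|apply: iblZ; apply/c1_ibl/c1MM].
apply: le_Rint; [exact/ib/c1_Mx|exact/ib/c1_Mx|move=> x /=].
have [//|_] := leP (Ek mu (sc l0 i) h x) (Mx k i.+1 x).
rewrite -subr_ge0; apply: le_trans (sqr_ge0 (Mx k i.+1 x - Ek mu (sc l0 i) h x)) _.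
by rewrite le_eqVlt; apply/orP; left; apply/eqP; ring.
Qed.

(** From [doob_aux], the integral of [M^2] is at most that of [2 M h], and
    [2 M h <= M^2 / 2 + 2 h^2]. *)
Lemma doob N : \int[mu]_x (Mx N 0 x ^+ 2) <= 4 * \int[mu]_x (h x ^+ 2).
Proof.
have cM := c1_Mx N 0; have i1 := c1_ibl (c1_sq cM); have i3 := c1_ibl (c1_sq ch).
have i2 := c1_ibl (c1MM cM ch).
have := doob_aux N 0; rewrite RintB//; last exact: iblZ.
have : \int[mu]_x (2 * (Mx N 0 x * h x)) <=
    \int[mu]_x (2^-1 * Mx N 0 x ^+ 2 + 2 * h x ^+ 2).
  apply: le_Rint; [exact: iblZ|by apply: iblD; exact: iblZ|move=> x].
  have := sqr_ge0 (2^-1 * Mx N 0 x - h x); nra.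
rewrite RintD ?RintZ//; try exact: iblZ.
lra.
Qed.

End Doob.

End CarlesonEmbedding.

(** * Cancellative square functions *)

Section Schur.
Context {R : realType} {d e : measure_display} {Z : measurableType d}
  {S : measurableType e}.
Variables (mu : {sigma_finite_measure set Z -> \bar R})
  (nu : {sigma_finite_measure set S -> \bar R}).

(** Cauchy-Schwarz in [z] with the weight [p]. In the applications [p] is the decay of the kernel,
    and [b] collects the squared operator norm and the energy of the function at [z]. *)
Lemma schur (u : Z -> S -> R) (p : Z -> R) (b : Z -> \bar R) (C : R) :
  mf2 u -> measurable_fun setT p -> (forall z, 0 < p z) -> 0 < C ->
  (\int[mu]_z (p z)%:E <= C%:E)%E -> (forall z, (0 <= b z)%E) ->
  (forall z, (\int[nu]_s ((u z s) ^+ 2)%:E <= (p z ^+ 2)%:E * b z)%E) ->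
  (\int[nu]_s ((\int[mu]_z u z s) ^+ 2)%:E <=
   C%:E * \int[mu]_z ((p z)%:E * b z))%E.
Proof.
move=> mfu mp p0 C0 pC b0 ub.
have mfu' : mf2 (fun s z => u z s).
  by rewrite /mf2; apply: (mf2_comp mfu); meas.
have q0 z s : (0 <= (u z s ^+ 2 / p z)%:E)%E.
  by rewrite lee_fin divr_ge0 ?sqr_ge0// ltW.
apply: (@le_trans _ _ (\int[nu]_s (C%:E * \int[mu]_z (u z s ^+ 2 / p z)%:E))%E).
  apply: le_int => s; first by pos.
  by apply: CS_weight => //; meas.
rewrite intZ; [|exact: ltW|by meas|by move=> s; apply: int_ge0].
rewrite lee_wpmul2l ?lee_fin ?(ltW C0)//.
rewrite tonelli; [|by meas|by move=> *; exact: q0].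
apply: le_int => z; first exact: int_ge0.
under eq_int do rewrite mulrC EFinM.
rewrite intZ; [|by rewrite invr_ge0 ltW|by meas|by pos].
apply: (@le_trans _ _ (((p z)^-1)%:E * ((p z ^+ 2)%:E * b z))%E).
  by rewrite lee_wpmul2l// lee_fin invr_ge0 ltW.
by rewrite muleA -EFinM expr2 mulrA mulVf ?mul1r// gt_eqF.
Qed.

End Schur.

(** * Operator-valued kernels at one time, tested on one martingale difference *)

Section FixedTime.
Context {R : realType} {n : nat}.
Variable mu : {sigma_finite_measure set (Rn R n) -> \bar R}.
Hypothesis lmu : is_lebesgue mu.
Variables (a C0 C1 eps : R).
Hypotheses (a0 : 0 < a) (C0_gt0 : 0 < C0) (C1_gt0 : 0 < C1).
Hypothesis Hdec : forall t, 0 < t -> (\int[mu]_u (pdecay n a t u)%:E <= C0%:E)%E.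
Hypothesis Hbd : forall t l x, 0 < t -> 0 < l ->
  (\int[mu]_y ((ek l x y)%:E *
     \int[mu]_z ((~~ same l y z)%:R * pdecay n a t (vsub y z))%:E)
   <= (C1 * (t / l) `^ eps)%:E)%E.
Context {dS dW : measure_display} {S : measurableType dS} {W : measurableType dW}.
Variables (nuS : {sigma_finite_measure set S -> \bar R})
  (nuW : {sigma_finite_measure set W -> \bar R}).
Local Notation Z := (Rn R n).

Lemma int_pdecay t (y : Z) : 0 < t ->
  (\int[mu]_z (pdecay n a t (vsub y z))%:E <= C0%:E)%E.
Proof.
move=> t0; rewrite -(int_shift lmu y); [|by meas|by pos].
apply: le_trans (Hdec t0); apply: le_int => z; first by pos.
by rewrite pdecay_symm /vsub /vadd addrK.
Qed.

Definition c2 (F : Z -> W -> R) := mf2 F /\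
  exists v w, [/\ c1 mu v, c1 nuW w & forall z u, `|F z u| <= v z * w u].

Definition nrm (F : Z -> W -> R) : \bar R :=
  (\int[mu]_z \int[nuW]_w ((F z w) ^+ 2)%:E)%E.

Lemma c2_mf F : c2 F -> mf2 F. Proof. by case. Qed.

Lemma c2_sec F z : c2 F -> c1 nuW (F z).
Proof.
case=> mF [v [w [cv cw h]]]; apply: (c1_dom _ (h z)); last exact: c1Z.
by meas.
Qed.

Lemma c2_sec' F w : c2 F -> c1 mu (F^~ w).
Proof.
case=> mF [v [u [cv cu h]]]; apply: (c1_dom (g := fun z => u w * v z)); last exact: c1Z.
  by meas.
by move=> z; rewrite mulrC.
Qed.

Lemma c2_Ek F l : 0 < l -> c2 F -> c2 (fun y w => Ek mu l (F^~ w) y).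
Proof.
move=> l0 cF; have [mF [v [u [cv cu h]]]] := cF; split; first by meas.
exists (Ek mu l v), u; split => //; first exact: Ek_c1.
move=> y w; apply: le_trans (Ek_norm lmu y l0 (c2_sec' w cF)) _.
apply: (@le_trans _ _ (Ek mu l (fun z => u w * v z) y)).
  apply: Ek_le => //; [exact/c1_norm/c2_sec'|exact: c1Z|].
  by move=> z; rewrite mulrC.
rewrite /Ek mulrC -RintZ; last by case: (c1_ekM lmu y l0 cv).
by apply: le_Rint; [case: (c1_ekM lmu y l0 (c1Z (u w) cv))|apply: iblZ; case: (c1_ekM lmu y l0 cv)|move=> z; rewrite mulrCA].
Qed.

Lemma c2D F G : c2 F -> c2 G -> c2 (fun z w => F z w + G z w).
Proof.
move=> [mF [v [u [cv cu h]]]] [mG [v' [u' [cv' cu' h']]]]; split; first by meas.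
exists (fun x => `|v x| + `|v' x|), (fun y => `|u y| + `|u' y|); split.
- by apply: c1D; apply: c1_norm.
- by apply: c1D; apply: c1_norm.
move=> x y; rewrite (le_trans (ler_normD _ _))//.
have H1 := le_trans (h x y) (ler_norm _); have H2 := le_trans (h' x y) (ler_norm _).
rewrite !normrM in H1 H2; rewrite (le_trans (lerD H1 H2))//.
rewrite mulrDl !mulrDr -addrA lerD2l addrA lerDr addr_ge0// mulr_ge0//.
Qed.

Lemma c2Z c F : c2 F -> c2 (fun z w => c * F z w).
Proof.
move=> [mF [v [u [cv cu h]]]]; split; first by meas.
exists (fun x => `|c| * v x), u; split => //; first exact: c1Z.
by move=> z w; rewrite normrM -mulrA ler_wpM2l.
Qed.

Lemma c2B F G : c2 F -> c2 G -> c2 (fun z w => F z w - G z w).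
Proof.
move=> h /(c2Z (-1)) h'; have := c2D h h'.
by rewrite (_ : (fun z w => F z w + -1 * G z w) = fun z w => F z w - G z w)//;
  apply/funext => z; apply/funext => w; rewrite mulN1r.
Qed.

Lemma c2_dom2 F : c2 F -> dom2 mu nuW F.
Proof. by case=> m [v [u [[_ _ cv] [_ _ cu] h]]]; split => //; exists v, u. Qed.

Variables (t N : R) (k : Z -> Z -> S -> W -> R).
Hypotheses (t0 : 0 < t) (N0 : 0 <= N) (mk : mf4 k).
Hypothesis ksize : forall y s, exists M, forall z w,
  `|k y z s w| <= M * pdecay n a t (vsub y z).
Hypothesis H1 : forall y z g, c1 nuW g ->
  (\int[nuS]_s ((\int[nuW]_w (k y z s w * g w)) ^+ 2)%:E <=
   (pdecay n a t (vsub y z) ^+ 2)%:E * (N%:E * \int[nuW]_w (g w ^+ 2)%:E))%E.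
Hypothesis H2 : forall y z z' r g, 0 < r -> r <= t / 2 ->
  ninf (vsub z z') < r -> c1 nuW g ->
  (\int[nuS]_s ((\int[nuW]_w ((k y z s w - k y z' s w) * g w)) ^+ 2)%:E <=
   (pdecay n a t (vsub y z) ^+ 2)%:E *
   (N%:E * (((r / t) `^ a) ^+ 2)%:E * \int[nuW]_w (g w ^+ 2)%:E))%E.

Definition KH (H : Z -> W -> R) y s : R :=
  \int[mu]_z (\int[nuW]_w (k y z s w * H z w)).

(** This is [T F - (T 1) E_l F] as a single integral. The average sits at the output point [y], so
    for [F] constant on the cell of [y] the integrand vanishes on that whole cell. *)
Definition Rop l (F : Z -> W -> R) y s : R :=
  KH (fun z w => F z w - Ek mu l (F^~ w) y) y s.

Lemma dom2_kM (H : Z -> W -> R) y s : mf2 H ->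
  (exists (v : Z -> R) (u : W -> R), [/\ (exists M, forall z, `|v z| <= M), measurable_fun setT v,
    c1 nuW u & forall z w, `|H z w| <= v z * u w]) ->
  dom2 mu nuW (fun z w => k y z s w * H z w).
Proof.
move=> mH [v [u [[Mv hv] mv cu h]]]; have [M hM] := ksize y s.
split; first by meas.
have cp : c1 mu (fun z => v z * pdecay n a t (vsub y z)).
  apply: c1M => //; first by exists Mv.
  split; first by meas.
    exists (t ^- n) => z; rewrite ger0_norm; last by pos.
    by apply: pdecay_le => //; exact: ltW.
  apply: iblP; first by meas.
  rewrite (eq_int _ (g := fun z => (pdecay n a t (vsub y z))%:E)); last first.
    by move=> z; rewrite ger0_norm//; pos.
  exact: le_lt_trans (int_pdecay y t0) (ltry _).
exists (fun z => `|M * (v z * pdecay n a t (vsub y z))|), (fun w => `|u w|); split.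
- by apply/ibl_norm/iblZ; case: cp.
- by case: (c1_norm cu).
move=> z w; rewrite normrM (le_trans (ler_pM _ _ (hM z w) (h z w)))//.
rewrite -normrM (_ : _ * _ * (_ * _) = M * (v z * pdecay n a t (vsub y z)) * u w); last by ring.
exact: ler_norm.
Qed.

Lemma dom2_k_c2 H y s : c2 H -> dom2 mu nuW (fun z w => k y z s w * H z w).
Proof.
by move=> [mH [v [u [[mv bv _] cu h]]]]; apply: dom2_kM => //; exists v, u.
Qed.

Lemma dom2_k_c1 (g : W -> R) y s : c1 nuW g ->
  dom2 mu nuW (fun z w => k y z s w * g w).
Proof.
move=> cg; have mg := c1_mf cg.
apply: (@dom2_kM (fun=> g)); first by meas.
exists (fun=> 1), (fun w => `|g w|); split; [by exists 1 => z; rewrite normr1|exact: measurable_cst|exact: c1_norm|].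
by move=> z w; rewrite mul1r.
Qed.

Lemma RopD l F G y s : 0 < l -> c2 F -> c2 G ->
  Rop l (fun z w => F z w + G z w) y s = Rop l F y s + Rop l G y s.
Proof.
move=> l0 cF cG.
have d1 H : c2 H -> dom2 mu nuW (fun z w => k y z s w * (H z w - Ek mu l (H^~ w) y)).
  move=> cH; have h := dom2B (dom2_k_c2 y s cH) (dom2_k_c1 y s (c2_sec y (c2_Ek l0 cH))).
  rewrite (_ : (fun z w => _) = (fun z w =>
     k y z s w * H z w - k y z s w * Ek mu l (H^~ w) y))//.
  by apply/funext => z; apply/funext => w; rewrite mulrBr.
rewrite /Rop /KH -JJD; [|exact: d1|exact: d1].
apply: eq_Rint => z; apply: eq_Rint => w.
rewrite EkD//; [by ring|exact: c2_sec'|exact: c2_sec'].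
Qed.

Lemma mf_Rop l F : mf2 F -> mf2 (Rop l F).
Proof. by move=> mF; rewrite /Rop /KH; meas. Qed.

(** Here [E_l F (y) = F y], so only points [z] outside the [l']-cell of [y] contribute, with
    [(F z - F y)^2] at most twice the sum of squares. The constant is [C0] from Schur, [2 N] from
    the kernel with this factor 2, another 2 from symmetrisation, and [C1] from the boundary
    estimate. *)
Lemma coarse_bound l l' F : 0 < l -> 0 < l' -> nested (n := n) l l' -> c2 F ->
  (forall z z' w, same l' z z' -> F z w = F z' w) ->
  (\int[mu]_y \int[nuS]_s ((Rop l F y s) ^+ 2)%:E <=
   (4 * C0 * C1 * N * (t / l') `^ eps)%:E * nrm F)%E.
Proof.
move=> l0 l'0 nst cF hF; have mF := c2_mf cF.
pose g2 (z : Z) : \bar R := (\int[nuW]_w ((F z w) ^+ 2)%:E)%E.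
have g20 z : (0 <= g2 z)%E by rewrite /g2; pos.
have mg2 : measurable_fun setT g2 by rewrite /g2; meas.
pose ch (y z : Z) : R := (~~ same l' y z)%:R.
pose p (y z : Z) : R := pdecay n a t (vsub y z).
have p0 y z : 0 < p y z by exact: pdecay_gt0.
have mp : mf2 p by rewrite /p; meas.
have mch : mf2 ch by rewrite /ch; meas.
pose b (y z : Z) : \bar R := ((2 * N * ch y z)%:E * (g2 z + g2 y))%E.
have b0 y z : (0 <= b y z)%E by rewrite /b /ch; pos.
have step1 y : (\int[nuS]_s ((Rop l F y s) ^+ 2)%:E <=
    C0%:E * \int[mu]_z ((p y z)%:E * b y z))%E.
  apply: schur => //.
  - by have := c2_Ek l0 cF => -[mE _]; meas.
  - by meas.
  - exact: int_pdecay.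
  move=> z; have [sz|nsz] := boolP (same l' y z).
    rewrite (eq_int _ (g := fun=> 0%E)); first by rewrite integral0; apply: mule_ge0 => //; pos.
    move=> s.
    rewrite (eq_Rint _ (g := fun=> 0)) ?Rint0 ?expr0n// => w.
    rewrite Ek_const//; first by rewrite (hF _ _ w sz) subrr mulr0.
    by move=> x /nst /(hF _ _ w).
  have cg : c1 nuW (fun w => F z w - F y w) by apply: c1B; exact: c2_sec.
  rewrite (eq_int _ (g := fun s =>
     ((\int[nuW]_w (k y z s w * (F z w - F y w))) ^+ 2)%:E)); last first.
    move=> s; congr (_ ^+ 2)%:E; apply: eq_Rint => w.
    rewrite (@Ek_const _ _ mu lmu l (F^~ w) y)// => x /nst; exact: hF.
  apply: le_trans (H1 y z cg) _; rewrite lee_wpmul2l ?lee_fin ?sqr_ge0//.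
  rewrite /b /ch nsz mulr1 mulrC EFinM -muleA lee_wpmul2l ?lee_fin//.
  apply: (@le_trans _ _ (\int[nuW]_w (2%:E * ((F z w ^+ 2)%:E + (F y w ^+ 2)%:E)))%E).
    apply: le_int => w; first by pos.
    rewrite -EFinD -EFinM lee_fin.
    by have := sqr_ge0 (F z w + F y w); nra.
  rewrite intZ; [|by pos|by meas|by pos].
  by rewrite intD; [|by meas|by meas|by pos|by pos].
apply: (@le_trans _ _ (\int[mu]_y (C0%:E * \int[mu]_z ((p y z)%:E * b y z)))%E).
  by apply: le_int => y; [pos|exact: step1].
have mb : mf2 b by rewrite /b; meas.
have pb0 y z : (0 <= (p y z)%:E * b y z)%E by rewrite mule_ge0// lee_fin ltW.
rewrite intZ; [|exact: ltW|by meas|by move=> y; apply: int_ge0].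
pose q (y z : Z) : \bar R := ((2 * N * ch y z * p y z)%:E)%E.
have q0 y z : (0 <= q y z)%E by rewrite /q /ch /p; pos.
have mq : mf2 q by rewrite /q; meas.
have qs y z : q y z = q z y by rewrite /q /ch /p same_sym pdecay_symm.
(* [q] is symmetric, so the terms with [g2 z] and with [g2 y] have the same integral. *)
have -> : (\int[mu]_y \int[mu]_z ((p y z)%:E * b y z) =
   2%:E * \int[mu]_y (g2 y * \int[mu]_z q y z))%E.
  transitivity (\int[mu]_y \int[mu]_z (q y z * g2 z + q y z * g2 y))%E.
    apply: eq_int => y; apply: eq_int => z.
    rewrite /b muleA -EFinM mulrC -ge0_muleDr//.
  have i1 : (\int[mu]_y \int[mu]_z (q y z * g2 y) = \int[mu]_y (g2 y * \int[mu]_z q y z))%E.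
    apply: eq_int => y; rewrite -intZe//; last by meas.
    by apply: eq_int => z; rewrite muleC.
  transitivity (\int[mu]_y \int[mu]_z (q y z * g2 z) + \int[mu]_y \int[mu]_z (q y z * g2 y))%E.
    rewrite -intD; [|by meas|by meas|by move=> y; apply: int_ge0 => z; rewrite mule_ge0|by move=> y; apply: int_ge0 => z; rewrite mule_ge0].
    apply: eq_int => y; rewrite intD//; [by meas|by meas|by move=> z; rewrite mule_ge0|by move=> z; rewrite mule_ge0].
  have i2 : (\int[mu]_y \int[mu]_z (q y z * g2 z) = \int[mu]_y (g2 y * \int[mu]_z q y z))%E.
    rewrite tonelli; [|by meas|by move=> *; rewrite mule_ge0].
    by rewrite -i1; apply: eq_int => y; apply: eq_int => x; rewrite qs.
  by rewrite i1 i2 -mule2n mule_natl.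
(* [g2] is constant on cells, so it equals its own average. The average is then moved onto the mass
   leaving the cell, which is small in mean though not pointwise. *)
have gE y : g2 y = (\int[mu]_x ((ek l' y x)%:E * g2 x))%E.
  rewrite (eq_int _ (g := fun x => (g2 y * (ek l' y x)%:E)%E)); last first.
    move=> x; rewrite muleC /ek; have [h|_] := boolP (same l' y x); last by rewrite mul0r !mule0.
    by congr (_ * _)%E; apply: eq_int => w; rewrite (hF _ _ w h).
  by rewrite intZe ?int_ek ?mule1//; [meas|pos].
have h0 y : (0 <= \int[mu]_z q y z)%E by exact: int_ge0.
rewrite (eq_int _ (g := fun y => (\int[mu]_x (g2 x * ((ek l' x y)%:E * \int[mu]_z q y z)))%E)); last first.
  move=> y; rewrite {1}gE muleC -intZe; [|by []|by meas|by move=> x; rewrite mule_ge0// lee_fin ek_ge0].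
  by apply: eq_int => x; rewrite ek_sym muleC -muleA muleCA.
rewrite tonelli; last 2 first.
- by meas.
- by move=> y x; rewrite !mule_ge0// lee_fin ek_ge0.
apply: (@le_trans _ _ (C0%:E * (2%:E * \int[mu]_x ((2 * N * (C1 * (t / l') `^ eps))%:E * g2 x)))%E).
  rewrite lee_wpmul2l ?lee_fin ?(ltW C0_gt0)// lee_wpmul2l//.
  apply: le_int => x.
    by apply: int_ge0 => y; rewrite !mule_ge0// lee_fin ek_ge0.
  rewrite intZe; [|by []|by meas|by move=> y; rewrite mule_ge0// lee_fin ek_ge0].
  rewrite [leRHS]muleC lee_wpmul2l//.
  rewrite (eq_int _ (g := fun y => ((2 * N)%:E * ((ek l' x y)%:E * \int[mu]_z (ch y z * p y z)%:E))%E)); last first.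
    move=> y; rewrite muleCA; congr (_ * _)%E.
    rewrite -intZ; [|by rewrite mulr_ge0|by meas|by rewrite /ch /p; pos].
    by apply: eq_int => z; rewrite -EFinM; congr EFin; ring.
  rewrite intZ; [|by rewrite mulr_ge0|by meas|by rewrite /ch /p; pos].
  by rewrite [leRHS]EFinM; apply: lee_wpmul2l; [pos|exact: Hbd].
rewrite intZ; [|by pos|by meas|by []].
rewrite !muleA -!EFinM lee_wpmul2r ?int_ge0// lee_fin.
by rewrite le_eqVlt; apply/orP; left; apply/eqP; ring.
Qed.

Definition cornerf l (z : Z) : Z := corner l z.

Lemma mf_cornerf {d} {P : measurableType d} l (f : P -> Z) :
  measurable_fun setT f -> measurable_fun setT (fun p => cornerf l (f p)).
Proof.
move=> mf; apply: mf_vec => i; rewrite /cornerf /corner /co.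
under eq_fun do rewrite mxE; apply: mfM => //.
by apply: mf_fl; apply: mfM => //; exact: (mf1_comp (mf_co i) mf).
Qed.

Lemma same_corner l z : 0 < l -> same l z (cornerf l z).
Proof.
move=> l0; apply/sameP => i; rewrite [in RHS]/co /cornerf mxE.
by rewrite mulrAC mulfV ?gt_eqF// mul1r [in RHS]/fl intrKfloor.
Qed.

Lemma corner_eq l z z' : same l z z' -> cornerf l z = cornerf l z'.
Proof. by move=> /sameP h; apply/rowP => i; rewrite !mxE h. Qed.

(* The cancellation of [F] on the cells of side [l'] allows one to subtract from
   the kernel its value at the corner of the cell. *)
Lemma fine_bound l l' F : 0 < l -> 0 < l' -> l' <= t / 2 -> nested (n := n) l' l -> c2 F ->
  (forall y w, Ek mu l' (F^~ w) y = 0) ->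
  (\int[mu]_y \int[nuS]_s ((Rop l F y s) ^+ 2)%:E <=
   (C0 ^+ 2 * N * ((l' / t) `^ a) ^+ 2)%:E * nrm F)%E.
Proof.
move=> l0 l'0 l't nst cF hF; have mF := c2_mf cF.
pose c := cornerf l'.
have mc : measurable_fun setT c by apply: mf_cornerf; meas.
pose g2 (z : Z) : \bar R := (\int[nuW]_w ((F z w) ^+ 2)%:E)%E.
have g20 z : (0 <= g2 z)%E by rewrite /g2; pos.
have mg2 : measurable_fun setT g2 by rewrite /g2; meas.
pose p (y z : Z) : R := pdecay n a t (vsub y z).
have p0 y z : 0 < p y z by exact: pdecay_gt0.
have mp : mf2 p by rewrite /p; meas.
pose A : \bar R := (N%:E * (((l' / t) `^ a) ^+ 2)%:E)%E.
have A0 : (0 <= A)%E by rewrite /A; pos.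
have mkc : mf4 (fun y z s w => k y (c z) s w).
  by meas.
have Rc y s : Rop l F y s =
    \int[mu]_z (\int[nuW]_w ((k y z s w - k y (c z) s w) * F z w)).
  have E0 w : Ek mu l (F^~ w) y = 0.
    rewrite -(Ek_nest lmu y l'0 l0 nst (c2_sec' w cF)).
    have -> : Ek mu l' (F^~ w) = fun=> 0 by apply/funext => z; exact: hF.
    exact: Ek0.
  have [M hM] := ksize y s.
  have M0 : 0 <= M.
    by have := le_trans (normr_ge0 _) (hM y point); rewrite pmulr_lge0// pdecay_gt0.
  have kb z w : `|k y (c z) s w| <= M * t ^- n.
    rewrite (le_trans (hM _ _))// ler_wpM2l//; apply: pdecay_le => //; exact: ltW.
  have dc : dom2 mu nuW (fun z w => k y (c z) s w * F z w).
    have [_ [v [u [[_ _ iv] [_ _ iu] h]]]] := cF; split; first by meas.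
    exists (fun z => M * t ^- n * v z), u; split => //; first exact: iblZ.
    by move=> z w; rewrite normrM -mulrA ler_pM.
  (* As a function of [z], [k y (c z) s w] is constant on the cells of side [l'], so it equals its
     average; by adjointness the average passes to [F], where it is 0. *)
  have Z0 : \int[mu]_z (\int[nuW]_w (k y (c z) s w * F z w)) = 0.
    rewrite fubini_dom// (eq_Rint _ (g := fun=> 0)) ?Rint0// => w.
    have mkw : measurable_fun setT (fun z => k y (c z) s w) by meas.
    have bkw : exists M, forall z, `|k y (c z) s w| <= M by exists (M * t ^- n).
    have := Ek_adj lmu l'0 (c2_sec' w cF) mkw bkw.
    rewrite [RHS](eq_Rint _ (g := fun=> 0)) ?Rint0; last by move=> z; rewrite hF mul0r.
    move=> <-; apply: eq_Rint => z.
    by rewrite mulrC Ek_const// => x /corner_eq; rewrite /c => ->.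
  have -> : Rop l F y s = KH F y s.
    by apply: eq_Rint => z; apply: eq_Rint => w; rewrite E0 subr0.
  transitivity (KH F y s - 0); first by rewrite subr0.
  rewrite -Z0 /KH -JJB; [|exact: dom2_k_c2|exact: dc].
  by apply: eq_Rint => z; apply: eq_Rint => w; ring.
have step1 y : (\int[nuS]_s ((Rop l F y s) ^+ 2)%:E <=
    C0%:E * \int[mu]_z ((p y z)%:E * (A * g2 z)))%E.
  under eq_int do rewrite Rc.
  apply: schur => //.
  - by meas.
  - by meas.
  - exact: int_pdecay.
  - by move=> z; rewrite mule_ge0.
  move=> z; apply: H2 => //; last exact: c2_sec.
  exact/same_ninf/same_corner.
apply: (@le_trans _ _ (\int[mu]_y (C0%:E * \int[mu]_z ((p y z)%:E * (A * g2 z))))%E).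
  by apply: le_int => y; [pos|exact: step1].
have pA0 y z : (0 <= (p y z)%:E * (A * g2 z))%E.
  by apply: mule_ge0; [rewrite lee_fin ltW|apply: mule_ge0].
rewrite intZ; [|exact: ltW|by rewrite /A; meas|by move=> y; apply: int_ge0].
rewrite tonelli//; last by rewrite /A; meas.
apply: (@le_trans _ _ (C0%:E * \int[mu]_z ((C0%:E * A) * g2 z))%E).
  rewrite lee_wpmul2l ?lee_fin ?(ltW C0_gt0)//; apply: le_int => z; first exact: int_ge0.
  under eq_int do rewrite muleC.
  rewrite intZe; [|by rewrite mule_ge0|by meas|by move=> y; rewrite lee_fin ltW].
  rewrite -[leRHS]muleA [leRHS]muleC; apply: lee_wpmul2l; first exact: mule_ge0.
  apply: le_trans (int_pdecay z t0); apply: le_int => y; first by rewrite lee_fin ltW.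
  by rewrite /p pdecay_symm.
rewrite intZe; [|by apply: mule_ge0 => //; rewrite lee_fin ltW|by meas|by []].
rewrite muleA lee_wpmul2r ?int_ge0// /A -!EFinM lee_fin.
by rewrite le_eqVlt; apply/orP; left; apply/eqP; ring.
Qed.

End FixedTime.

Section Octaves.
Context {R : realType}.

(* The measure [dt/t] on the octave [2 l <= t < 4 l]. *)
Definition om (l t : R) : R := ((2 * l <= t) && (t < 4 * l))%:R / t.

Lemma om_ge0 l t : 0 < l -> 0 <= om l t.
Proof.
move=> l0; rewrite /om; case: andP => [[h _]|_]; last by rewrite mul0r.
by rewrite mul1r invr_ge0 (le_trans _ h)// mulr_ge0// ltW.
Qed.

Lemma om_neq0 l t : 0 < l -> om l t != 0 -> [/\ 0 < t, 2 * l <= t & t < 4 * l].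
Proof.
move=> l0; rewrite /om; case: andP => [[h h'] _|_]; last by rewrite mul0r eqxx.
by split => //; rewrite (lt_le_trans _ h)// mulr_gt0.
Qed.

Lemma mf_om {d} {P : measurableType d} l (f : P -> R) :
  measurable_fun setT f -> measurable_fun setT (fun p => om l (f p)).
Proof. by move=> mf; rewrite /om; meas. Qed.

Local Notation leb := (@lebesgue_measure R).

Lemma int_om l : 0 < l -> (\int[leb]_t (om l t)%:E <= 1)%E.
Proof.
move=> l0; apply: (@le_trans _ _ (\int[leb]_(t in `[(2 * l)%R, (4 * l)%R[) ((2 * l)^-1)%:E)%E).
  rewrite [leRHS]integral_mkcond; apply: le_int => t; first by rewrite lee_fin om_ge0.
  rewrite patchE; case: ifPn => [|/negP h].
    rewrite inE /= in_itv/= => /andP[h1 h2].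
    rewrite /om h1 h2 mul1r lee_fin lef_pV2// posrE ?mulr_gt0//.
    by rewrite (lt_le_trans _ h1)// mulr_gt0.
  rewrite /om; case: andP => [[h1 h2]|_]; last by rewrite mul0r.
  by exfalso; apply: h; rewrite inE /= in_itv/= h1.
rewrite integral_cst//= lebesgue_measure_itv/= lte_fin ltr_pM2r// ltr_nat/=.
rewrite -EFinB -EFinM lee_fin le_eqVlt; apply/orP; left; apply/eqP.
by field; rewrite gt_eqF.
Qed.

Lemma int_om_le l (f : R -> \bar R) (B : \bar R) : 0 < l -> (0 <= B)%E ->
  (forall t, (0 <= f t)%E) ->
  (forall t, 0 < t -> 2 * l <= t -> t < 4 * l -> (f t <= B)%E) ->
  (\int[leb]_t ((om l t)%:E * f t) <= B)%E.
Proof.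
move=> l0 B0 f0 fB.
apply: (@le_trans _ _ (\int[leb]_t (B * (om l t)%:E))%E).
  apply: le_int => t; first by rewrite mule_ge0// lee_fin om_ge0.
  have [->|h] := eqVneq (om l t) 0; first by rewrite mul0e mule0.
  have [h1 h2 h3] := om_neq0 l0 h.
  by rewrite muleC lee_wpmul2r ?lee_fin ?om_ge0// fB.
rewrite intZe//; last 2 first.
- by apply: mfE; apply: mf_om; meas.
- by move=> t; rewrite lee_fin om_ge0.
by rewrite -[leRHS]mule1; apply: lee_wpmul2l => //; exact: int_om.
Qed.

Lemma sum_om (l0 t : R) M : 0 < l0 -> \sum_(i < M.+1) om (sc l0 i) t =
  ((2 * l0 <= t) && (t < 4 * sc l0 M))%:R / t.
Proof.
move=> l00; elim: M => [|M IH].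
  by rewrite big_ord_recr big_ord0/= add0r /om /sc expr0 mul1r.
rewrite big_ord_recr/= IH /om -mulrDl; congr (_ / _).
have e1 : 2 * sc l0 M.+1 = 4 * sc l0 M by rewrite scS; ring.
have h1 : 4 * sc l0 M <= 4 * sc l0 M.+1.
  by rewrite ler_pM2l// scS ler_peMl ?ler1n// ltW// sc_gt0.
have h2 : 2 * l0 <= 4 * sc l0 M.
  rewrite /sc; have : 1 <= 2 ^+ M :> R by rewrite exprn_ege1// ler1n.
  move=> h; have : l0 <= 2 ^+ M * l0 by rewrite ler_peMl// ltW.
  by move: (2 ^+ M * l0) => x; have := l00; lra.
rewrite e1; case: (leP (2 * l0) t) => /= h3.
  case: (ltP t (4 * sc l0 M)) => /= h4; last by rewrite add0r.
  by rewrite addr0 (lt_le_trans h4 h1).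
by rewrite add0r leNgt (lt_le_trans h3 h2).
Qed.

End Octaves.

Section GeometricWeights.
Context {R : realType}.
Implicit Types (th : R).

(** By truncated subtraction one of the two factors is 1, so this is [th ^ |i - j|]. *)
Definition gw th (i j : nat) : R := th ^+ (i - j) * th ^+ (j - i).

Lemma gwC th i j : gw th i j = gw th j i. Proof. by rewrite /gw mulrC. Qed.
Lemma gw_gt0 th i j : 0 < th -> 0 < gw th i j.
Proof. by move=> h; rewrite mulr_gt0// exprn_gt0. Qed.
Lemma gwM th i j : gw (th ^+ 2) i j = gw th i j ^+ 2.
Proof. by rewrite /gw !(exprAC th 2) -exprMn. Qed.

Lemma sum_gw th i M : 0 < th -> th < 1 -> \sum_(j < M) gw th i j <= 2 / (1 - th).
Proof.
move=> h0 h1; have h : 0 < 1 - th by rewrite subr_gt0.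
apply: (@le_trans _ _ (\sum_(0 <= j < i + M) gw th i j)).
  rewrite -(big_mkord xpredT (gw th i)) [leRHS](@big_cat_nat _ _ _ M)//=; last by rewrite leq_addl.
  by rewrite lerDl sumr_ge0// => j _; rewrite ltW// gw_gt0.
rewrite (@big_cat_nat _ _ _ i)//=; last by rewrite leq_addr.
have -> : 2 / (1 - th) = (1 - th)^-1 + (1 - th)^-1 by ring.
apply: lerD.
  rewrite big_nat_rev/= big_mkord; apply: le_trans (geometric_sum_le i h0 h1).
  apply: ler_sum => j _; rewrite /gw add0n subKn; last exact: ltn_ord.
  rewrite (_ : (i - j.+1 - i)%N = 0%N); last by lia.
  by rewrite mulr1 exprS ler_piMl ?exprn_ge0 ?ltW.
rewrite -[X in \sum_(X <= _ < _) _]add0n big_addn addnC addnK big_mkord.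
apply: le_trans (geometric_sum_le M h0 h1).
apply: ler_sum => j _; rewrite /gw addnK (_ : (i - (j + i))%N = 0%N) ?mul1r//; lia.
Qed.

End GeometricWeights.

Section CancellativeSquareFunction.
Context {R : realType} {n : nat}.
Variable mu : {sigma_finite_measure set (Rn R n) -> \bar R}.
Hypothesis lmu : is_lebesgue mu.
Local Notation Z := (Rn R n).

Section Decomposition.
Context {dW : measure_display} {W : measurableType dW}.
Variables (nuW : {sigma_finite_measure set W -> \bar R}) (l0 : R).
Hypothesis l0_gt0 : 0 < l0.
Variable F : Z -> W -> R.
Hypothesis cF : c2 mu nuW F.
Let sg i := sc_gt0 l0_gt0 i.

(** The index is shifted by one to make room for [F] itself: [PF j.+1] is constant on the cells of
    scale [j]. *)
Definition PF j : Z -> W -> R :=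
  if j is i.+1 then fun z w => Ek mu (sc l0 i) (F^~ w) z else F.

(** Martingale differences for [j < M], completed at [j = M] by the coarsest average so that the
    finite sum is exactly [F]. A difference of index [j] has mean zero on cells of scale [j]; one of
    index [j.+1] is constant on them. *)
Definition DF M j : Z -> W -> R :=
  if (j < M)%N then fun z w => PF j z w - PF j.+1 z w else PF j.

Lemma c2_PF j : c2 mu nuW (PF j).
Proof. by case: j => [//|j]; exact: c2_Ek. Qed.

Lemma c2_DF M j : c2 mu nuW (DF M j).
Proof. by rewrite /DF; case: ifP => _; [apply: c2B|]; exact: c2_PF. Qed.

Lemma sum_DF M z w : F z w = \sum_(j < M.+1) DF M j z w.
Proof.
rewrite big_ord_recr/= {2}/DF ltnn.
rewrite (eq_bigr (fun j : 'I_M => PF j z w - PF j.+1 z w)); last first.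
  by move=> j _; rewrite /DF ltn_ord.
rewrite -(big_mkord xpredT (fun j => PF j z w - PF j.+1 z w)).
elim: M => [|M IH]; first by rewrite big_geq// add0r.
by rewrite big_nat_recr//= -addrA subrK.
Qed.

Lemma Ek_PF j w z : Ek mu (sc l0 j) ((PF j)^~ w) z = PF j.+1 z w.
Proof.
case: j => [//|j] /=.
by apply: Ek_nest => //; [exact: nested_scS|exact: c2_sec' cF].
Qed.

Lemma DF_fine M j w z : (j < M)%N -> Ek mu (sc l0 j) ((DF M j)^~ w) z = 0.
Proof.
move=> jM; rewrite /DF jM EkB//; [|exact: c2_sec' (c2_PF j)|exact: c2_sec' (c2_PF j.+1)].
rewrite Ek_PF (_ : (PF j.+1)^~ w = Ek mu (sc l0 j) (F^~ w))// Ek_nest_fine// ?subrr//.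
Qed.

Lemma PF_const j z z' w : same (sc l0 j) z z' -> PF j.+1 z w = PF j.+1 z' w.
Proof. exact: Ek_eq. Qed.

Lemma DF_coarse M j z z' w : (j < M)%N -> same (sc l0 j) z z' ->
  DF M j.+1 z w = DF M j.+1 z' w.
Proof.
move=> jM h; rewrite /DF; case: ifP => _; last exact: PF_const.
rewrite (PF_const _ h) (@PF_const j.+1 z z')//.
exact: nested_scS.
Qed.

Lemma nrm_swap (G : Z -> W -> R) : mf2 G ->
  nrm mu nuW G = (\int[nuW]_w \int[mu]_z ((G z w) ^+ 2)%:E)%E.
Proof. by move=> mG; rewrite /nrm tonelli//; [meas|pos]. Qed.

Lemma nrm_pyth (G : Z -> W -> R) l : 0 < l -> c2 mu nuW G ->
  nrm mu nuW G = (nrm mu nuW (fun z w => G z w - Ek mu l (G^~ w) z)%R +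
    nrm mu nuW (fun z w => Ek mu l (G^~ w) z))%E.
Proof.
move=> l_0 cG; have mG := c2_mf cG; have cE := c2_Ek lmu l_0 cG; have mE := c2_mf cE.
rewrite !nrm_swap//; last by meas.
rewrite -intD; [|by meas|by meas|by pos|by pos].
apply: eq_int => w; have cg := c2_sec' w cG; have cEg := c2_sec' w cE.
rewrite -RintE; last by apply/c1_ibl/c1_sq.
rewrite (pyth lmu l_0 cg) EFinD -!RintE//.
- exact/c1_ibl/c1_sq.
- exact/c1_ibl/c1_sq/c1B.
Qed.

Lemma sume_telescope (p q : nat -> \bar R) : (forall j, p j = (q j + p j.+1)%E) ->
  forall M, (\sum_(j < M) q j + p M = p 0%N)%E.
Proof.
move=> h; elim=> [|M IH]; first by rewrite big_ord0 add0e.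
by rewrite big_ord_recr/= -addeA -h.
Qed.

Lemma nrm_PF j : nrm mu nuW (PF j) =
  (nrm mu nuW (fun z w => PF j z w - PF j.+1 z w)%R + nrm mu nuW (PF j.+1))%E.
Proof.
have e2 : (fun z w => Ek mu (sc l0 j) ((PF j)^~ w) z) = PF j.+1.
  by apply/funext => z; apply/funext => w; rewrite Ek_PF.
have e3 : (fun z w => PF j z w - Ek mu (sc l0 j) ((PF j)^~ w) z) =
    (fun z w => PF j z w - PF j.+1 z w).
  by apply/funext => z; apply/funext => w; rewrite Ek_PF.
by rewrite (nrm_pyth (sg j) (c2_PF j)) e3 e2.
Qed.

Lemma nrm_DF M : (\sum_(j < M.+1) nrm mu nuW (DF M j) = nrm mu nuW F)%E.
Proof.
rewrite big_ord_recr/= [X in (_ + nrm mu nuW X)%E]/DF ltnn.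
rewrite (eq_bigr (fun j : 'I_M => nrm mu nuW (fun z w => PF j z w - PF j.+1 z w)%R)); last first.
  by move=> j _; rewrite /DF ltn_ord.
exact: (@sume_telescope (fun j => nrm mu nuW (PF j)) _ nrm_PF M).
Qed.

End Decomposition.

(* An operator-valued kernel: [k y z] maps functions on [W] to functions on [S],
   and the last two conditions bound its operator norm. *)
Definition canc_kernel {dS dW} {S : measurableType dS} {W : measurableType dW}
    (nuS : {sigma_finite_measure set S -> \bar R})
    (nuW : {sigma_finite_measure set W -> \bar R})
    (a t N : R) (k : Z -> Z -> S -> W -> R) :=
  [/\ mf4 k,
   forall y s, exists M, forall z w, `|k y z s w| <= M * pdecay n a t (vsub y z),
   forall y z g, c1 nuW g ->
    (\int[nuS]_s ((\int[nuW]_w (k y z s w * g w)) ^+ 2)%:E <=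
     (pdecay n a t (vsub y z) ^+ 2)%:E * (N%:E * \int[nuW]_w (g w ^+ 2)%:E))%E &
   forall y z z' r g, 0 < r -> r <= t / 2 ->
    ninf (vsub z z') < r -> c1 nuW g ->
    (\int[nuS]_s ((\int[nuW]_w ((k y z s w - k y z' s w) * g w)) ^+ 2)%:E <=
     (pdecay n a t (vsub y z) ^+ 2)%:E *
     (N%:E * (((r / t) `^ a) ^+ 2)%:E * \int[nuW]_w (g w ^+ 2)%:E))%E].

(** Almost orthogonality: octave [i] and difference [j] interact with a gain geometric in [|i - j|].
    The constant is fixed before the spaces [S] and [W], so the same bound serves scalar kernels and
    kernels with values in operators on functions of the other variable. *)
Lemma cancellative_bound a : 0 < a -> exists2 C : R, 0 < C &
  forall dS dW (S : measurableType dS) (W : measurableType dW)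
    (nuS : {sigma_finite_measure set S -> \bar R})
    (nuW : {sigma_finite_measure set W -> \bar R})
    (N : R) (k : R -> Z -> Z -> S -> W -> R) (l0 : R) (M : nat) (F : Z -> W -> R),
  0 <= N -> 0 < l0 -> (forall t, 0 < t -> canc_kernel nuS nuW a t N (k t)) ->
  c2 mu nuW F ->
  (\sum_(i < M) \int[@lebesgue_measure R]_t ((om (sc l0 i) t)%:E *
     \int[mu]_y \int[nuS]_s ((Rop mu nuW (k t) (sc l0 i) F y s) ^+ 2)%:E)
   <= (C * N)%:E * nrm mu nuW F)%E.
Proof.
move=> a0; have [C0 C0_gt0 Hdec] := decay_int lmu a0.
have [e [e0 ea [C1 C1_gt0 Hbd]]] := boundary lmu a0.
(* The interaction of octave [i] and difference [j] decays like [th^2] to the power [|i - j|]. One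
   factor [th] is spent on the weighted Cauchy-Schwarz sum over [j], the other is left to sum over
   [i]. *)
pose th : R := 2 `^ (- (e / 2)).
have th0 : 0 < th by rewrite powR_gt0.
have th1 : th < 1.
  by rewrite /th /powR pnatr_eq0/= expR_lt1 mulNr oppr_lt0 mulr_gt0// ?divr_gt0// ln_gt0// ltr1n.
have h2 p k : ((2 : R) ^- k) `^ p = 2 `^ (- (p * k%:R)).
  by rewrite -powR_invn// -powRrM; congr (_ `^ _); ring.
have thE k : (th ^+ 2) ^+ k = (2 ^- k) `^ e.
  by rewrite h2 /th -exprM -powR_mulrn ?powR_ge0// -powRrM natrM; congr (_ `^ _); field.
pose B0 := C0 ^+ 2 + 4 * C0 * C1 * 8 `^ e.
have B00 : 0 < B0.
  by rewrite addr_gt0 ?exprn_gt0// !mulr_gt0// powR_gt0.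
pose G := 2 / (1 - th).
have G0 : 0 < G by rewrite divr_gt0// subr_gt0.
exists (G ^+ 2 * B0); first by rewrite mulr_gt0// exprn_gt0.
move=> dS dW S W nuS nuW N k l0 M F N0 l0_gt0 hk cF.
have sg := sc_gt0 l0_gt0.
pose nd j := nrm mu nuW (DF l0 F M j).
have nd0 j : (0 <= nd j)%E by rewrite /nd /nrm; pos.
have piece i j t : (i < M)%N -> (j < M.+1)%N -> 0 < t -> 2 * sc l0 i <= t -> t < 4 * sc l0 i ->
    (\int[mu]_y \int[nuS]_s ((Rop mu nuW (k t) (sc l0 i) (DF l0 F M j) y s) ^+ 2)%:E
     <= (B0 * N * gw (th ^+ 2) i j)%:E * nd j)%E.
  move=> iM jM t0 t2 t4; have [mk ks H1 H2] := hk t t0.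
  (* For [j <= i] the difference has mean zero on cells of side at most [t / 2], and the regularity
     of the kernel gives the gain. *)
  have [ji|ij] := leqP j i.
    have le_ji : sc l0 j <= sc l0 i.
      by rewrite ler_wpM2r ?(ltW l0_gt0)// ler_weXn2l ?ler1n.
    have p1 : sc l0 j <= t / 2.
      by rewrite ler_pdivlMr// mulrC (le_trans _ t2)// ler_pM2l.
    have p2 y w : Ek mu (sc l0 j) ((DF l0 F M j)^~ w) y = 0.
      by apply: (DF_fine l0_gt0 cF); exact: leq_ltn_trans iM.
    have h := fine_bound lmu a0 C0_gt0 Hdec t0 N0 mk ks H2
      (sg i) (sg j) p1 (nested_sc ji) (c2_DF l0_gt0 cF M j) p2.
    apply: le_trans h _.
    have ji0 : (j - i)%N = 0%N by apply/eqP; rewrite subn_eq0.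
    apply: lee_wpmul2r; first exact: nd0.
    rewrite lee_fin /gw ji0 expr0 mulr1.
    have x0 : 0 < sc l0 j / t by rewrite divr_gt0.
    have x1 : sc l0 j / t <= 2 ^- (i - j).
      rewrite ler_pdivrMr// mulrC ler_pdivlMr ?exprn_gt0//.
      rewrite /sc mulrAC -exprD subnKC// (le_trans _ t2)// /sc ler_peMl ?mulr_ge0 ?exprn_ge0 ?(ltW l0_gt0)//.
      by rewrite ler1n.
    have x2 : sc l0 j / t <= 1.
      by rewrite (le_trans x1)// invf_le1 ?exprn_gt0// exprn_ege1// ler1n.
    have y1 : ((sc l0 j / t) `^ a) ^+ 2 <= (th ^+ 2) ^+ (i - j).
      rewrite thE; apply: (@le_trans _ _ ((sc l0 j / t) `^ a)).
        rewrite expr2 ler_piMl ?powR_ge0// -(powRr0 (sc l0 j / t)).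
        by apply: ger_powR; [rewrite x0|exact: ltW].
      apply: (@le_trans _ _ ((sc l0 j / t) `^ e)).
        by apply: ger_powR; rewrite ?x0.
      by apply: powR_le => //; exact: ltW.
    rewrite [leRHS]mulrAC -[C0 ^+ 2 * N * _]mulrAC ler_wpM2r//.
    apply: ler_pM; rewrite ?exprn_ge0 ?powR_ge0 ?(ltW C0_gt0)//.
    by rewrite /B0 lerDl !mulr_ge0 ?powR_ge0 ?(ltW C0_gt0) ?(ltW C1_gt0).
  (* The index now exceeds [i]: the function is constant on cells of scale [j >= i], and the gain
     comes from the cell walls. The coarsest average, of index [M], always falls in this case. *)
  case: j ij jM => [//|j] ij jM.
  have ij' : (i <= j)%N by [].
  have p2 z z' w : same (sc l0 j) z z' -> DF l0 F M j.+1 z w = DF l0 F M j.+1 z' w.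
    exact: DF_coarse.
  have h := coarse_bound lmu C0_gt0 C1_gt0 Hdec Hbd t0 N0 mk H1
    (sg i) (sg j) (nested_sc ij') (c2_DF l0_gt0 cF M j.+1) p2.
  apply: le_trans h _.
  have ji0 : (i - j.+1)%N = 0%N by apply/eqP; rewrite subn_eq0 (leq_trans ij').
  apply: lee_wpmul2r; first exact: nd0.
  rewrite lee_fin /gw ji0 expr0 mul1r.
  (* The 8 is the 4 of [t < 4 * sc l0 i], doubled because the exponent counts from [j.+1] while the
     cells have scale [j]. *)
  have x1 : t / sc l0 j <= 8 * 2 ^- (j.+1 - i).
    rewrite ler_pdivrMr// (le_trans (ltW t4))//.
    rewrite /sc subSn// exprS invfM -{2}(subnK ij') exprD le_eqVlt; apply/orP; left; apply/eqP.
    by field; rewrite gt_eqF// exprn_gt0.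
  have y1 : (t / sc l0 j) `^ e <= 8 `^ e * (th ^+ 2) ^+ (j.+1 - i).
    rewrite thE -powRM ?invr_ge0 ?exprn_ge0//.
    by apply: powR_le => //; [exact: ltW|rewrite divr_ge0 ?ltW].
  apply: (@le_trans _ _ (4 * C0 * C1 * N * (8 `^ e * (th ^+ 2) ^+ (j.+1 - i)))).
    by apply: ler_wpM2l => //; rewrite !mulr_ge0 ?(ltW C0_gt0) ?(ltW C1_gt0).
  rewrite (_ : _ * _ = 4 * C0 * C1 * 8 `^ e * (N * (th ^+ 2) ^+ (j.+1 - i))); last by ring.
  rewrite -[leRHS]mulrA; apply: ler_wpM2r.
    by rewrite mulr_ge0// !exprn_ge0// ltW.
  by rewrite /B0 lerDr exprn_ge0// ltW.
have oct i t : (i < M)%N -> 0 < t -> 2 * sc l0 i <= t -> t < 4 * sc l0 i ->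
    (\int[mu]_y \int[nuS]_s ((Rop mu nuW (k t) (sc l0 i) F y s) ^+ 2)%:E
     <= \sum_(j < M.+1) (G * B0 * N * gw th i j)%:E * nd j)%E.
  move=> iM t0 t2 t4; have [mk ks H1 H2] := hk t t0.
  have RS y s : Rop mu nuW (k t) (sc l0 i) F y s =
      \sum_(j < M.+1) Rop mu nuW (k t) (sc l0 i) (DF l0 F M j) y s.
    have key m : Rop mu nuW (k t) (sc l0 i)
        (fun z w => \sum_(j < m) DF l0 F M j z w) y s =
        \sum_(j < m) Rop mu nuW (k t) (sc l0 i) (DF l0 F M j) y s /\
        c2 mu nuW (fun z w => \sum_(j < m) DF l0 F M j z w).
      elim: m => [|m [IH c]].
        rewrite big_ord0; split; last first.
          rewrite (_ : (fun z w => _) = fun z w => 0 * F z w); first exact: c2Z.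
          by apply/funext => z; apply/funext => w; rewrite big_ord0 mul0r.
        rewrite /Rop /KH (eq_Rint _ (g := fun=> 0)) ?Rint0// => z.
        rewrite (eq_Rint _ (g := fun=> 0)) ?Rint0// => w.
        rewrite big_ord0 (_ : (fun z => _) = fun=> 0) ?Ek0 ?subr0 ?mulr0//.
        by apply/funext => x; rewrite big_ord0.
      have e1 : (fun z w => \sum_(j < m.+1) DF l0 F M j z w) =
          (fun z w => \sum_(j < m) DF l0 F M j z w + DF l0 F M m z w).
        by apply/funext => z; apply/funext => w; rewrite big_ord_recr.
      rewrite e1 big_ord_recr/= -IH; split.
        by rewrite (RopD lmu a0 Hdec t0 mk ks)//; exact: c2_DF.
      by apply: c2D => //; exact: c2_DF.
    have [<- _] := key M.+1.
    suff {1}-> : F = (fun z w => \sum_(j < M.+1) DF l0 F M j z w) by [].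
    by apply/funext => z; apply/funext => w; exact: sum_DF.
  have mD j : mf2 (DF l0 F M j) := c2_mf (c2_DF l0_gt0 cF M j).
  have mR j : mf2 (Rop mu nuW (k t) (sc l0 i) (DF l0 F M j)).
    by apply: mf_Rop.
  (* Cauchy-Schwarz over [j] with the weights [gw th i j], whose sum is at most [G]. *)
  apply: (@le_trans _ _ (\int[mu]_y \int[nuS]_s (\sum_(j < M.+1)
     (G / gw th i j)%:E * ((Rop mu nuW (k t) (sc l0 i) (DF l0 F M j) y s) ^+ 2)%:E))%E).
    apply: le_int => y; first by pos.
    apply: le_int => s; first by pos.
    rewrite RS; apply: (@le_trans _ _ (G * \sum_(j < M.+1)
      (Rop mu nuW (k t) (sc l0 i) (DF l0 F M j) y s) ^+ 2 / gw th i j)%:E).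
      rewrite lee_fin; apply: sum_CS => //; first by move=> j; exact: gw_gt0.
      exact: sum_gw.
    rewrite mulr_sumr -sumEFin; apply: lee_sum => j _.
    by rewrite -EFinM lee_fin le_eqVlt; apply/orP; left; apply/eqP; ring.
  have c0 j : 0 <= G / gw th i j by rewrite divr_ge0 ?ltW// gw_gt0.
  rewrite (eq_int _ (g := fun y => (\sum_(j < M.+1) (G / gw th i j)%:E * \int[nuS]_s
     ((Rop mu nuW (k t) (sc l0 i) (DF l0 F M j) y s) ^+ 2)%:E)%E)); last first.
    move=> y; rewrite int_sum; last 2 first.
    - by move=> j; have mRj := mR j; meas.
    - by move=> j s; rewrite mule_ge0 ?lee_fin ?sqr_ge0.
    by apply: eq_bigr => j _; have mRj := mR j; rewrite intZ//; [meas|pos].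
  rewrite int_sum; last 2 first.
  - by move=> j; have mRj := mR j; meas.
  - by move=> j s; rewrite mule_ge0 ?lee_fin// int_ge0// => ?; rewrite lee_fin sqr_ge0.
  apply: lee_sum => j _; have mRj := mR j; rewrite intZ//; [|by meas|by pos].
  apply: (@le_trans _ _ ((G / gw th i j)%:E * ((B0 * N * gw (th ^+ 2) i j)%:E * nd j))%E).
    by rewrite lee_wpmul2l ?lee_fin// piece.
  rewrite muleA -EFinM; apply: lee_wpmul2r; [exact: nd0|]; rewrite lee_fin gwM le_eqVlt; apply/orP; left; apply/eqP.
  by field; rewrite gt_eqF// gw_gt0.
have GB0 i j : (0 <= (G * B0 * N * gw th i j)%:E)%E.
  rewrite lee_fin; apply: mulr_ge0; last by rewrite ltW// gw_gt0.
  by apply: mulr_ge0 => //; apply: mulr_ge0; exact: ltW.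
apply: (@le_trans _ _ (\sum_(i < M) \sum_(j < M.+1) (G * B0 * N * gw th i j)%:E * nd j)%E).
  apply: lee_sum => i _; apply: int_om_le; first exact: sg.
  - by apply: sume_ge0 => j _; apply: mule_ge0; [exact: GB0|exact: nd0].
  - by move=> t; pos.
  - by move=> t t0 t2 t4; exact: oct.
(* With [j] outside, the weights are summed over [i], which costs the second [G]; the orthogonality
   of the differences then recovers the norm of [F]. *)
rewrite exchange_big/= -(nrm_DF l0_gt0 cF M) ge0_sume_distrr; last by move=> j _; exact: nd0.
apply: lee_sum => j _; rewrite -ge0_sume_distrl; last first.
  by move=> i _; exact: GB0.
apply: lee_wpmul2r; [exact: nd0|]; rewrite sumEFin lee_fin -mulr_sumr.
rewrite (_ : G ^+ 2 * B0 * N = G * B0 * N * G); last by ring.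
apply: ler_wpM2l; first by apply: mulr_ge0 => //; apply: mulr_ge0; exact: ltW.
under eq_bigr do rewrite gwC.
exact: sum_gw.
Qed.

End CancellativeSquareFunction.

(** * One-parameter kernels *)

Section UnitMeasure.
Context {R : realType}.

(** On a one-point space an operator is a number, so a scalar kernel becomes an operator-valued one
    and [cancellative_bound] applies to it. *)
Definition umeas : {sigma_finite_measure set unit -> \bar R} := \d_tt.

Lemma mf_unit {d} {T : measurableType d} (f : unit -> T) : measurable_fun setT f.
Proof. by []. Qed.

Lemma int_unit (f : unit -> \bar R) : (\int[umeas]_x f x = f tt)%E.
Proof.
by rewrite /umeas integral_dirac// diracT mul1e.
Qed.

Lemma Rint_unit (f : unit -> R) : \int[umeas]_x f x = f tt.
Proof. by rewrite /Rintegral int_unit. Qed.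

Lemma c1_unit (f : unit -> R) : c1 umeas f.
Proof.
split; first exact: mf_unit.
  by exists `|f tt| => -[].
by apply: iblP; [exact: mf_unit|rewrite int_unit ltry].
Qed.

End UnitMeasure.

Section OneParameter.
Context {R : realType} {n : nat}.
Variable mu : {sigma_finite_measure set (Rn R n) -> \bar R}.
Hypothesis lmu : is_lebesgue mu.
Local Notation Z := (Rn R n).
Local Notation leb := (@lebesgue_measure R).

(** A single constant governs size, regularity and testing, so that all three can be scaled
    together. Displacements enter through a positive bound [r]: the constant of a difference kernel
    is then positive, as the one-parameter bounds require. *)
Definition t1_kernel (a N : R) (k : R -> Z -> Z -> R) :=
  [/\ mf3 k,
   forall t y z, 0 < t -> `|k t y z| <= N * pdecay n a t (vsub y z),
   forall t y z z' r, 0 < t -> 0 < r -> r <= t / 2 -> ninf (vsub z z') < r ->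
     `|k t y z - k t y z'| <= N * (r / t) `^ a * pdecay n a t (vsub y z) &
   forall l x, 0 < l ->
    (\int[leb]_t ((((0 < t) && (t < l))%R%:R / t)%:E *
      \int[mu]_y (((same l x y)%:R *
        (\int[mu]_z ((same l x z)%:R * k t y z)) ^+ 2)%R)%:E)
     <= (N ^+ 2 * l ^+ n)%:E)%E].

(** * The Carleson condition for the image of 1, and the paraproduct *)

Section Paraproduct.
Variables (a C0 C1 e : R).
Hypotheses (a0 : 0 < a) (C0_gt0 : 0 < C0) (C1_gt0 : 0 < C1) (e0 : 0 < e).
Hypothesis Hdec : forall t, 0 < t -> (\int[mu]_u (pdecay n a t u)%:E <= C0%:E)%E.
Hypothesis Hbd : forall t l x, 0 < t -> 0 < l ->
  (\int[mu]_y ((ek l x y)%:E *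
     \int[mu]_z ((~~ same l y z)%:R * pdecay n a t (vsub y z))%:E)
   <= (C1 * (t / l) `^ e)%:E)%E.
Variables (N : R) (k : R -> Z -> Z -> R).
Hypotheses (N0 : 0 < N) (kk : t1_kernel a N k).

Definition th1 t y := \int[mu]_z k t y z.

Lemma c1_pdecay t (y : Z) : 0 < t -> c1 mu (fun z => pdecay n a t (vsub y z)).
Proof.
move=> t0; split; first by meas.
  exists (t ^- n) => z; rewrite ger0_norm; last by pos.
  by apply: pdecay_le => //; exact: ltW.
apply: iblP; first by meas.
rewrite (eq_int _ (g := fun z => (pdecay n a t (vsub y z))%:E)); last first.
  by move=> z; rewrite ger0_norm//; pos.
exact: le_lt_trans (int_pdecay lmu Hdec y t0) (ltry _).
Qed.

Lemma c1_k t y : 0 < t -> c1 mu (k t y).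
Proof.
case: kk => mk ks _ _ t0; apply: (c1_dom _ _ (c1Z N (c1_pdecay y t0))).
  by meas.
by move=> z; exact: ks.
Qed.

Lemma mf_th1 : mf2 th1.
Proof. by case: kk => mk _ _ _; rewrite /th1; meas. Qed.

Lemma th1_bound t y : 0 < t -> `|th1 t y| <= N * C0.
Proof.
case: kk => mk ks _ _ t0; have cp := c1_ibl (c1_pdecay y t0).
apply: (@le_trans _ _ (\int[mu]_z (N * pdecay n a t (vsub y z)))).
  by apply: Rint_le_norm; [by meas|exact: iblZ|move=> z; exact: ks].
rewrite RintZ// ler_pM2l// -lee_fin RintE//.
exact: (int_pdecay lmu Hdec).
Qed.

Definition outer_mass l t y : \bar R :=
  (\int[mu]_z ((~~ same l y z)%:R * pdecay n a t (vsub y z))%:E)%E.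

(** Splits [T 1] into the images of the cell and of its complement. In the square of the second, one
    factor is bounded by the total mass [C0], so the outer mass enters linearly, the form in which
    [Hbd] averages it. *)
Lemma th1_local l x y t : 0 < t -> 0 < l -> same l x y ->
  (((th1 t y) ^+ 2)%:E <=
   (2 * (\int[mu]_z ((same l x z)%:R * k t y z)) ^+ 2)%:E +
   (2 * N ^+ 2 * C0)%:E * outer_mass l t y)%E.
Proof.
case: kk => mk ks _ _ t0 l0 sxy.
have ck := c1_k y t0.
have i1 : c1 mu (fun z => (same l x z)%:R * k t y z).
  apply: c1M => //; first by meas.
  by exists 1 => z; rewrite ger0_norm// lern1 leq_b1.
have i2 : c1 mu (fun z => (~~ same l x z)%:R * k t y z).
  apply: c1M => //; first by meas.
  by exists 1 => z; rewrite ger0_norm// lern1 leq_b1.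
have -> : th1 t y = \int[mu]_z ((same l x z)%:R * k t y z) +
    \int[mu]_z ((~~ same l x z)%:R * k t y z).
  rewrite -RintD; [|exact: c1_ibl|exact: c1_ibl].
  by apply: eq_Rint => z; rewrite -mulrDl; case: same; rewrite /= ?addr0 ?add0r mul1r.
set A := \int[mu]_z _; set B := \int[mu]_z _.
have hB : ((B ^+ 2)%:E <= (N ^+ 2 * C0)%:E * outer_mass l t y)%E.
  have ip : c1 mu (fun z => (~~ same l y z)%:R * pdecay n a t (vsub y z)).
    apply: c1M; [by meas| |exact: c1_pdecay].
    by exists 1 => z; rewrite ger0_norm// lern1 leq_b1.
  have b1 : `|B| <= N * \int[mu]_z ((~~ same l y z)%:R * pdecay n a t (vsub y z)).
    rewrite -RintZ; last exact: c1_ibl.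
    apply: Rint_le_norm; [by case: i2|apply: iblZ; exact: c1_ibl|].
    move=> z; rewrite -(same_eq _ sxy) normrM ger0_norm// mulrCA.
    by apply: ler_wpM2l => //; exact: ks.
  have b2 : \int[mu]_z ((~~ same l y z)%:R * pdecay n a t (vsub y z)) <= C0.
    rewrite -lee_fin RintE; last exact: c1_ibl.
    apply: le_trans (int_pdecay lmu Hdec y t0); apply: le_int => z; first by pos.
    rewrite lee_fin ler_piMl//; first by pos.
    by rewrite lern1 leq_b1.
  rewrite /outer_mass -RintE; last exact: c1_ibl.
  move: b1 b2; set b := \int[mu]_z _ => b1 b2.
  have b_0 : 0 <= b by rewrite /b; pos.
  rewrite -EFinM lee_fin -real_normK ?num_real//.
  apply: (@le_trans _ _ ((N * b) ^+ 2)).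
    by rewrite lerXn2r ?nnegrE ?mulr_ge0 ?(ltW N0).
  rewrite (exprMn 2 N b) -[leRHS]mulrA; apply: ler_wpM2l; first exact: sqr_ge0.
  by rewrite [leLHS]expr2; apply: ler_wpM2r.
apply: (@le_trans _ _ ((2 * A ^+ 2)%:E + (2 * B ^+ 2)%:E)%E).
  rewrite -EFinD lee_fin; have := sqr_ge0 (A - B); nra.
rewrite leeD2l// EFinM -(mulrA 2) [in leRHS]EFinM -muleA.
by apply: lee_wpmul2l.
Qed.

Variable l0 : R.
Hypothesis l0_gt0 : 0 < l0.

Lemma sum_om_le M t : \sum_(i < M.+1) om (sc l0 i) t <=
  ((0 < t) && (t < 4 * sc l0 M))%:R / t.
Proof.
rewrite sum_om//; have [h|h] := leP (2 * l0) t.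
  by rewrite (lt_le_trans _ h)//= mulr_gt0.
by rewrite /= mul0r; case: (ltP 0 t) => t0; rewrite ?mul0r// divr_ge0// ltW.
Qed.

Definition beta i y := \int[leb]_t (om (sc l0 i) t * th1 t y ^+ 2).

Let sg i := sc_gt0 l0_gt0 i.

Lemma beta_dom i y t : `|om (sc l0 i) t * th1 t y ^+ 2| <= (N * C0) ^+ 2 * om (sc l0 i) t.
Proof.
have o0 := om_ge0 t (sg i).
rewrite ger0_norm; last by apply: mulr_ge0 => //; exact: sqr_ge0.
have [->|h] := eqVneq (om (sc l0 i) t) 0; first by rewrite mulr0 mul0r.
have [t0 _ _] := om_neq0 (sg i) h.
rewrite mulrC ler_wpM2r// -real_normK ?num_real//.
by rewrite lerXn2r ?nnegrE ?mulr_ge0 ?(ltW N0) ?(ltW C0_gt0)// th1_bound.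
Qed.

Lemma ibl_om i : ibl leb (om (sc l0 i)).
Proof.
apply: iblP; first by apply: mf_om; meas.
rewrite (@eq_int _ _ _ leb _ (fun t => (om (sc l0 i) t)%:E)); last first.
  by move=> t; rewrite ger0_norm// om_ge0.
exact: le_lt_trans (int_om (sg i)) (ltry _).
Qed.

Lemma Rint_om i : \int[leb]_t om (sc l0 i) t <= 1.
Proof. by rewrite -lee_fin RintE; [exact: int_om|exact: ibl_om]. Qed.

Lemma ibl_beta i y : ibl leb (fun t => om (sc l0 i) t * th1 t y ^+ 2).
Proof.
have mt := mf_th1.
apply: (@ibl_dom _ _ _ leb _ (fun t => (N * C0) ^+ 2 * om (sc l0 i) t)).
- by apply: mfM; [apply: mf_om|]; meas.
- by move=> t; exact: beta_dom.
- exact/iblZ/ibl_om.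
Qed.

Lemma betaE i y : (beta i y)%:E = (\int[leb]_t ((om (sc l0 i) t)%:E * (th1 t y ^+ 2)%:E))%E.
Proof. by rewrite /beta RintE//; exact: ibl_beta. Qed.

Lemma beta_ge0 i y : 0 <= beta i y.
Proof. by apply: Rint_ge0 => t; apply: mulr_ge0; [exact: om_ge0|exact: sqr_ge0]. Qed.

Lemma beta_bound i y : `|beta i y| <= (N * C0) ^+ 2.
Proof.
apply: (@le_trans _ _ (\int[leb]_t ((N * C0) ^+ 2 * om (sc l0 i) t))).
  apply: Rint_le_norm; [exact: ibl_mf (ibl_beta i y)|exact/iblZ/ibl_om|].
  by move=> t; exact: beta_dom.
rewrite RintZ; last exact: ibl_om.
by rewrite ler_piMr ?sqr_ge0// Rint_om.
Qed.

Lemma mf_beta i : measurable_fun setT (beta i).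
Proof.
have mt := mf_th1; apply: mf_Rint; rewrite /mf2.
by apply: mfM; [apply: mf_om|]; meas.
Qed.

(** The first 2 comes from testing inside the cell; the other term sums the boundary losses of all
    the octaves below. *)
Definition carleson_const : R := 2 + 2 * C0 * C1 / (1 - 2 `^ (- e)).

(** The cells have side [4 * sc l0 m] because the octaves up to [m] reach the time [4 * sc l0 m]:
    they fill the part of the box over the cell that the testing condition controls. *)
Lemma beta_carleson m x :
  Ek mu (4 * sc l0 m) (fun y => \sum_(j < m.+1) beta j y) x <= N ^+ 2 * carleson_const.
Proof.
case: kk => mk ks _ ktest; have mt := mf_th1.
set l := 4 * sc l0 m; have l_0 : 0 < l by rewrite mulr_gt0// sg.
pose loc t y := (\int[mu]_z ((same l x z)%:R * k t y z)) ^+ 2.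
have mloc : mf2 loc by rewrite /loc; meas.
have mb i := mf_beta i.
have mS : measurable_fun setT (fun y => \sum_(j < m.+1) beta j y).
  by apply: mf_sum => j; exact: mb.
have mom i : measurable_fun setT (om (sc l0 i)) by apply: mf_om; meas.
have o0 i t : 0 <= om (sc l0 i) t by apply: om_ge0.
have mout : mf2 (outer_mass l) by rewrite /outer_mass; meas.
have out0 t y : (0 <= outer_mass l t y)%E -> True by [].
rewrite -lee_fin /Ek RintE; last first.
  apply: ibl_ekM => //; exists (\sum_(j < m.+1) (N * C0) ^+ 2) => y.
  by rewrite (le_trans (ler_norm_sum _ _ _))// ler_sum// => j _; exact: beta_bound.
pose X t : \bar R := (\int[mu]_y ((ek l x y)%:E * (th1 t y ^+ 2)%:E))%E.
have mX : measurable_fun setT X by rewrite /X; meas.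
have X0 t : (0 <= X t)%E by rewrite /X; pos.
have -> : (\int[mu]_y (ek l x y * \sum_(j < m.+1) beta j y)%:E =
   \sum_(j < m.+1) \int[leb]_t ((om (sc l0 j) t)%:E * X t))%E.
  rewrite (eq_int _ (g := fun y => (\sum_(j < m.+1) \int[leb]_t
     ((om (sc l0 j) t)%:E * ((ek l x y)%:E * (th1 t y ^+ 2)%:E)))%E)); last first.
    move=> y; rewrite mulr_sumr -sumEFin; apply: eq_bigr => j _.
    rewrite EFinM betaE -intZ; [|by pos|by have mj := mom j; meas|by move=> t; rewrite -EFinM lee_fin mulr_ge0 ?sqr_ge0].
    by apply: eq_int => t; rewrite muleCA.
  have F0 j t y : (0 <= (om (sc l0 j) t)%:E * ((ek l x y)%:E * (th1 t y ^+ 2)%:E))%E.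
    by rewrite !mule_ge0 ?lee_fin ?sqr_ge0 ?o0 ?ek_ge0.
  rewrite int_sum; last 2 first.
  - by move=> j; have mj := mom j; meas.
  - by move=> j y; apply: int_ge0 => t; exact: F0.
  apply: eq_bigr => j _; have mj := mom j.
  rewrite tonelli; [|by meas|by move=> *; exact: F0].
  by apply: eq_int => t; rewrite -intZ//; [meas|pos].
pose Y t : \bar R := ((2 * l ^- n)%:E * \int[mu]_y ((same l x y)%:R * loc t y)%:E)%E.
have Y0 t : (0 <= Y t)%E by rewrite /Y /loc; pos.
have mY : measurable_fun setT Y by rewrite /Y; meas.
pose D := 2 * N ^+ 2 * C0.
have D0 : 0 <= D by rewrite /D; pos.
have XY t : 0 < t -> (X t <= Y t + (D * (C1 * (t / l) `^ e))%:E)%E.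
  move=> t0; have om0 y : (0 <= outer_mass l t y)%E by rewrite /outer_mass; pos.
  apply: (@le_trans _ _ (\int[mu]_y ((2 * l ^- n)%:E * ((same l x y)%:R * loc t y)%:E +
     D%:E * ((ek l x y)%:E * outer_mass l t y)))%E).
    apply: le_int => y; first by pos.
    rewrite -EFinM /ek; case: (boolP (same l x y)) => sxy; last first.
      by rewrite !mul0r mul0e !mule0 adde0.
    rewrite !mul1r.
    apply: (@le_trans _ _ ((l ^- n)%:E * ((2 * loc t y)%:E + D%:E * outer_mass l t y))%E).
      rewrite EFinM; apply: lee_wpmul2l; first by pos.
      exact: th1_local.
    rewrite ge0_muleDr//; [|by rewrite /loc; pos|by apply: mule_ge0].
    by rewrite -!EFinM muleCA le_eqVlt; apply/orP; left; apply/eqP; congr (_%:E + _)%E; ring.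
  rewrite intD; [|by meas|by meas|by rewrite /loc; pos|by move=> y; rewrite !mule_ge0// lee_fin ek_ge0].
  rewrite intZ; [|by pos|by meas|by rewrite /loc; pos].
  rewrite leeD2l// intZ//; [|by meas|by move=> y; rewrite mule_ge0// lee_fin ek_ge0].
  by rewrite [leRHS]EFinM; apply: lee_wpmul2l => //; exact: Hbd.
(* In octave [j] one has [t / l <= 2^(-(m - j))], so the boundary terms form a geometric series of
   ratio [z] in [m - j]. *)
pose z : R := 2 `^ (- e).
have z0 : 0 < z by rewrite powR_gt0.
have z1 : z < 1.
  by rewrite /z /powR pnatr_eq0/= expR_lt1 mulNr oppr_lt0 mulr_gt0// ln_gt0// ltr1n.
apply: (@le_trans _ _ (\sum_(j < m.+1) (\int[leb]_t ((om (sc l0 j) t)%:E * Y t) +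
    (D * C1 * z ^+ (m - j))%:E))%E).
  apply: lee_sum => j _; have mj := mom j.
  have c0 : 0 <= D * C1 * z ^+ (m - j) by pos.
  apply: (@le_trans _ _ (\int[leb]_t ((om (sc l0 j) t)%:E * Y t +
      (om (sc l0 j) t)%:E * (D * C1 * z ^+ (m - j))%:E))%E).
    apply: le_int => t; first by apply: mule_ge0 => //; rewrite lee_fin.
    have [->|h] := eqVneq (om (sc l0 j) t) 0; first by rewrite !mul0e adde0.
    have [t0 h1 h2] := om_neq0 (sg j) h.
    rewrite -ge0_muleDr//; apply: lee_wpmul2l; first by rewrite lee_fin.
    apply: le_trans (XY t t0) _; rewrite leeD2l// lee_fin -mulrA.
    apply: ler_wpM2l => //; apply: ler_wpM2l; first exact: ltW.
    have -> : z ^+ (m - j) = (2 ^- (m - j)) `^ e.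
      by rewrite -powR_invn// -powRrM /z -powR_mulrn ?powR_ge0// -powRrM; congr (_ `^ _); ring.
    apply: powR_le; [exact: ltW|by rewrite divr_ge0// ltW|].
    rewrite ler_pdivrMr//; apply: le_trans (ltW h2) _.
    rewrite /l [leRHS]mulrCA; apply: ler_wpM2l => //; rewrite /sc.
    have jm : (j <= m)%N by rewrite -ltnS.
    have -> : 2 ^+ m = 2 ^+ (m - j) * 2 ^+ j :> R by rewrite -exprD subnK.
    by rewrite !mulrA mulVf ?mul1r// gt_eqF// exprn_gt0.
  rewrite intD; [|by meas|by meas|by move=> t; apply: mule_ge0 => //; rewrite lee_fin|by move=> t; apply: mule_ge0; rewrite lee_fin].
  rewrite leeD2l// (@eq_int _ _ _ leb _ (fun t => ((D * C1 * z ^+ (m - j))%:E * (om (sc l0 j) t)%:E)%E)); last first.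
    by move=> t; rewrite muleC.
  rewrite intZ//; [|by meas|by move=> t; rewrite lee_fin].
  by rewrite -[leRHS]mule1; apply: lee_wpmul2l; [rewrite lee_fin|exact: int_om].
rewrite big_split/=; apply: (@le_trans _ _ ((2 * N ^+ 2)%:E + (D * C1 / (1 - z))%:E)%E); last first.
  rewrite -EFinD lee_fin /carleson_const -/z /D le_eqVlt; apply/orP; left; apply/eqP.
  by field; rewrite subr_eq0 gt_eqF.
apply: leeD; last first.
  rewrite sumEFin lee_fin -mulr_sumr ler_wpM2l//; first by rewrite mulr_ge0// ltW.
  apply: le_trans (geometric_sum_le m.+1 z0 z1).
  rewrite (reindex_inj rev_ord_inj)/= le_eqVlt; apply/orP; left; apply/eqP.
  by apply: eq_bigr => j _; rewrite subSS subKn// -ltnS.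
rewrite -int_sum; last 2 first.
- by move=> j; have mj := mom j; meas.
- by move=> j t; apply: mule_ge0 => //; rewrite lee_fin.
apply: (@le_trans _ _ ((2 * l ^- n)%:E * (N ^+ 2 * l ^+ n)%:E)%E); last first.
  rewrite -EFinM lee_fin le_eqVlt; apply/orP; left; apply/eqP.
  by field; rewrite gt_eqF// exprn_gt0.
apply: (@le_trans _ _ (\int[leb]_t ((((0 < t) && (t < l))%R%:R / t)%:E * Y t))%E).
  apply: le_int => t.
    by apply: sume_ge0 => j _; apply: mule_ge0 => //; rewrite lee_fin.
  rewrite -ge0_sume_distrl; last by move=> j _; rewrite lee_fin.
  apply: lee_wpmul2r => //; rewrite sumEFin lee_fin.
  exact: sum_om_le.
have q0 t : (0 <= (((0 < t) && (t < l))%R%:R / t)%:E :> \bar R)%E.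
  by rewrite lee_fin; case: ltP => t0; rewrite /= ?mul0r// divr_ge0// ltW.
rewrite (@eq_int _ _ _ leb _ (fun t => ((2 * l ^- n)%:E * ((((0 < t) && (t < l))%R%:R / t)%:E *
   \int[mu]_y ((same l x y)%:R * loc t y)%:E))%E)); last by move=> t; rewrite muleCA.
rewrite intZ; [|by pos|by meas|by move=> t; apply: mule_ge0 => //; rewrite /loc; pos].
by apply: lee_wpmul2l; [pos|exact: ktest].
Qed.

(** Carleson embedding for [|g|] with the densities [beta]. These are controlled on cells four times
    larger than the averaging cells, and [E_s |g| <= 4^n E_(4s) |g|]; squaring gives the factor
    [(4^n)^2]. *)
Lemma paraproduct M g : c1 mu g ->
  (\sum_(i < M) \int[leb]_t ((om (sc l0 i) t)%:E *
     \int[mu]_y ((th1 t y * Ek mu (sc l0 i) g y) ^+ 2)%:E)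
   <= ((4 ^+ n) ^+ 2 * 4 * carleson_const * N ^+ 2)%:E * \int[mu]_y (g y ^+ 2)%:E)%E.
Proof.
move=> cg; have mt := mf_th1; have mg := c1_mf cg.
pose h y := `|g y|.
have ch : c1 mu h by exact: c1_norm.
(* The embedding is applied to the scales that start at [4 * l0]. *)
have l4 : 0 < 4 * l0 by rewrite mulr_gt0.
have sc4 i : sc (4 * l0) i = 4 * sc l0 i by rewrite /sc mulrCA.
have z1 : 0 < 1 - (2 : R) `^ (- e).
  by rewrite subr_gt0 /powR pnatr_eq0/= expR_lt1 mulNr oppr_lt0 mulr_gt0// ln_gt0// ltr1n.
have cc0 : 0 < carleson_const.
  by rewrite /carleson_const ltr_wpDr// divr_ge0 ?(ltW z1)// !mulr_ge0// ltW.
have A0 : 0 < N ^+ 2 * carleson_const by rewrite mulr_gt0// exprn_gt0.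
have CE := @carleson_embedding _ _ mu lmu _ l4 beta _ h A0 ch mf_beta
  (fun i => ex_intro _ _ (beta_bound i)) beta_ge0 M.
have {}CE := CE (fun m x _ => eq_ind_r (fun q => Ek mu q _ x <= _) (beta_carleson m x) (sc4 m)).
have cE i : c1 mu (Ek mu (sc (4 * l0) i) h) by apply: Ek_c1 => //; exact: sc_gt0.
apply: (@le_trans _ _ (((4 ^+ n) ^+ 2)%:E * (\sum_(i < M) \int[mu]_y (beta i y * (Ek mu (sc (4 * l0) i) h y) ^+ 2))%:E)%E); last first.
  have -> : (\int[mu]_y (g y ^+ 2)%:E = (\int[mu]_y (h y ^+ 2))%:E)%E.
    rewrite RintE; last exact/c1_ibl/c1_sq.
    by apply: eq_int => y; rewrite /h real_normK ?num_real.
  rewrite -!EFinM lee_fin.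
  rewrite (_ : _ * _ * _ * _ * _ = (4 ^+ n) ^+ 2 * (4 * (N ^+ 2 * carleson_const) * \int[mu]_y (h y ^+ 2))); last by ring.
  by rewrite ler_pM2l ?exprn_gt0.
rewrite -sumEFin ge0_sume_distrr; last first.
  move=> i _; rewrite lee_fin; apply: Rint_ge0 => y.
  by rewrite mulr_ge0 ?sqr_ge0// beta_ge0.
apply: lee_sum => i _; have mi := c1_mf (cE i); have mb := mf_beta i.
have mo : measurable_fun setT (om (sc l0 i)) by apply: mf_om; meas.
rewrite RintE; last by case: (c1M mb (ex_intro _ _ (beta_bound i)) (c1_sq (cE i))).
have ct : 0 <= (4 ^+ n) ^+ 2 :> R by rewrite sqr_ge0.
rewrite -intZ//; [|by meas|by move=> y; rewrite lee_fin mulr_ge0 ?sqr_ge0// beta_ge0].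
rewrite (@eq_int _ _ _ leb _ (fun t => (\int[mu]_y ((om (sc l0 i) t)%:E * ((th1 t y * Ek mu (sc l0 i) g y) ^+ 2)%:E))%E)); last first.
  move=> t; rewrite -intZ//; [by rewrite om_ge0|by meas|by pos].
have q0 t y : (0 <= (om (sc l0 i) t)%:E * ((th1 t y * Ek mu (sc l0 i) g y) ^+ 2)%:E)%E.
  by rewrite mule_ge0// lee_fin ?sqr_ge0// om_ge0.
rewrite tonelli//; last by meas.
apply: le_int => y; first exact: int_ge0.
rewrite (@eq_int _ _ _ leb _ (fun t => ((Ek mu (sc l0 i) g y ^+ 2)%:E * ((om (sc l0 i) t)%:E * (th1 t y ^+ 2)%:E))%E)); last first.
  by move=> t; rewrite -!EFinM; congr EFin; ring.
rewrite intZ ?sqr_ge0//; [|by meas|by move=> t; rewrite mule_ge0// lee_fin ?sqr_ge0// om_ge0].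
rewrite -betaE -!EFinM lee_fin [leRHS]mulrCA mulrC ler_wpM2l ?beta_ge0//.
rewrite sc4 -exprMn -real_normK ?num_real// lerXn2r ?nnegrE//.
  by rewrite mulr_ge0 ?exprn_ge0// Ek_ge0// => [|*]; rewrite ?mulr_gt0 ?normr_ge0.
apply: le_trans (Ek_norm lmu y (sg i) cg) _.
apply: le_trans (Ek_double lmu y (sg i) ch _) _; first by move=> ?; rewrite /h.
have -> : 4 ^+ n = 2 ^+ n * 2 ^+ n :> R by rewrite -exprMn; congr (_ ^+ _); ring.
rewrite -mulrA ler_wpM2l ?exprn_ge0//.
rewrite (_ : 4 * sc l0 i = 2 * (2 * sc l0 i)); last by ring.
by apply: Ek_double => //; [rewrite mulr_gt0|move=> ?; rewrite /h].
Qed.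

End Paraproduct.
End OneParameter.

Section OneParameterTheorem.
Context {R : realType} {n : nat}.
Variable mu : {sigma_finite_measure set (Rn R n) -> \bar R}.
Hypothesis lmu : is_lebesgue mu.
Local Notation Z := (Rn R n).
Local Notation leb := (@lebesgue_measure R).

Lemma paraproduct_bound a : 0 < a -> exists2 C : R, 0 < C &
  forall (N : R) (k : R -> Z -> Z -> R) (l0 : R) (M : nat) (g : Z -> R),
  0 < N -> t1_kernel mu a N k -> 0 < l0 -> c1 mu g ->
  (\sum_(i < M) \int[leb]_t ((om (sc l0 i) t)%:E *
     \int[mu]_y ((th1 mu k t y * Ek mu (sc l0 i) g y) ^+ 2)%:E)
   <= (C * N ^+ 2)%:E * \int[mu]_y (g y ^+ 2)%:E)%E.
Proof.
move=> a0; have [C0 C0_gt0 Hdec] := decay_int lmu a0.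
have [e [e0 ea [C1 C1_gt0 Hbd]]] := boundary lmu a0.
have z1 : 0 < 1 - (2 : R) `^ (- e).
  by rewrite subr_gt0 /powR pnatr_eq0/= expR_lt1 mulNr oppr_lt0 mulr_gt0// ln_gt0// ltr1n.
exists ((4 ^+ n) ^+ 2 * 4 * carleson_const C0 C1 e).
  rewrite mulr_gt0 ?mulr_gt0 ?exprn_gt0// /carleson_const.
  by rewrite ltr_wpDr// divr_ge0 ?(ltW z1)// !mulr_ge0// ltW.
by move=> N k l0 M g N0 kk l0_gt0 cg; exact: paraproduct Hdec Hbd _ _ N0 kk _ l0_gt0 M g cg.
Qed.

Lemma sqr_le_norm (x y : R) : `|x| <= y -> x ^+ 2 <= y ^+ 2.
Proof.
move=> h; rewrite -[x ^+ 2]real_normK ?num_real// lerXn2r ?nnegrE//.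
exact: le_trans (normr_ge0 x) h.
Qed.

Lemma t1_canc_kernel a N k t : t1_kernel mu a N k -> 0 < N -> 0 < t ->
  canc_kernel umeas umeas a t (N ^+ 2) (fun y z (_ _ : unit) => k t y z).
Proof.
move=> [mk ks kh _] N0 t0; split.
- by meas.
- by move=> y s; exists N => z w; exact: ks.
- move=> y z g _; rewrite !int_unit Rint_unit -!EFinM lee_fin.
  rewrite exprMn mulrA ler_wpM2r ?sqr_ge0// -exprMn.
  by apply: sqr_le_norm; rewrite mulrC; exact: ks.
- move=> y z z' r g r0 rt zz _; rewrite !int_unit Rint_unit -!EFinM lee_fin.
  rewrite exprMn mulrA ler_wpM2r ?sqr_ge0// -!exprMn.
  by apply: sqr_le_norm; rewrite mulrC; exact: kh.
Qed.

(** [Rop] differs from the operator exactly by [(T 1) E_l f], so the cancellative bound on one-point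
    spaces and the paraproduct add up, with a factor 2 for the square of a sum. *)
Lemma one_parameter_T1 a : 0 < a -> exists2 C : R, 0 < C &
  forall (N : R) (k : R -> Z -> Z -> R) (l0 : R) (M : nat) (f : Z -> R),
  0 < N -> t1_kernel mu a N k -> 0 < l0 -> c1 mu f ->
  (\sum_(i < M) \int[leb]_t ((om (sc l0 i) t)%:E *
     \int[mu]_y ((\int[mu]_z (k t y z * f z)) ^+ 2)%:E)
   <= (C * N ^+ 2)%:E * \int[mu]_y (f y ^+ 2)%:E)%E.
Proof.
move=> a0; have [Ca Ca0 Hc] := cancellative_bound lmu a0.
have [Cp Cp0 Hp] := paraproduct_bound a0.
have [C0 C0_gt0 Hdec] := decay_int lmu a0.
exists (2 * Ca + 2 * Cp); first by rewrite addr_gt0 ?mulr_gt0.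
move=> N k l0 M f N0 kk l0_gt0 cf.
have sg := sc_gt0 l0_gt0.
have mk : mf3 k by case: kk.
have mf := c1_mf cf.
pose K t : Z -> Z -> unit -> unit -> R := fun y z _ _ => k t y z.
pose F : Z -> unit -> R := fun z _ => f z.
have cF : c2 mu umeas F.
  split; first by rewrite /F; meas.
  exists (fun z => `|f z|), (fun=> 1); split; [exact: c1_norm|exact: c1_unit|].
  by move=> z u; rewrite mulr1.
have hA := Hc _ _ _ _ umeas umeas (N ^+ 2) K l0 M F (sqr_ge0 N) l0_gt0
  (fun t t0 => t1_canc_kernel kk N0 t0) cF.
have hB := Hp N k l0 M f N0 kk l0_gt0 cf.
pose T1 i t y := Rop mu umeas (K t) (sc l0 i) F y tt.
pose T2 i t y := th1 mu k t y * Ek mu (sc l0 i) f y.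
have dec i t y : 0 < t -> \int[mu]_z (k t y z * f z) = T1 i t y + T2 i t y.
  move=> t0; have ck := c1_k lmu a0 Hdec kk y t0.
  rewrite /T1 /T2 /Rop /KH /th1.
  rewrite [X in X + _](eq_Rint _ (g := fun z => k t y z * f z - Ek mu (sc l0 i) f y * k t y z)); last first.
    by move=> z; rewrite Rint_unit /K /F; ring.
  rewrite RintB; [|exact: c1_ibl (c1MM ck cf)|exact: iblZ (c1_ibl ck)].
  rewrite (RintZ _ (c1_ibl ck)) [Ek mu (sc l0 i) f y * _]mulrC.
  by rewrite subrK.
have mth := mf_th1 kk.
have mF : mf2 F by case: cF.
have mT2 i : mf2 (T2 i) by rewrite /T2; meas.
have mT1 i t : measurable_fun setT (T1 i t).
  by have mKt : mf4 (K t) by [rewrite /K; meas]; rewrite /T1 /Rop /KH; meas.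
have e1 i t : (\int[mu]_y \int[umeas]_s (Rop mu umeas (K t) (sc l0 i) F y s ^+ 2)%:E =
    \int[mu]_y (T1 i t y ^+ 2)%:E)%E by apply: eq_int => y; rewrite int_unit.
pose A i t : \bar R := (\int[mu]_y (T1 i t y ^+ 2)%:E)%E.
pose B i t : \bar R := (\int[mu]_y (T2 i t y ^+ 2)%:E)%E.
have A0 i t : (0 <= A i t)%E by rewrite /A; pos.
have B0 i t : (0 <= B i t)%E by rewrite /B; pos.
have mom i : measurable_fun setT (om (sc l0 i)) by apply: mf_om; meas.
have o0 i t : (0 <= (om (sc l0 i) t)%:E)%E by rewrite lee_fin om_ge0.
have mK5 : mf5 K by rewrite /K; meas.
have mA i : measurable_fun setT (A i).
  rewrite /A /T1 /Rop /KH; meas.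
have mB i : measurable_fun setT (B i) by have mTi := mT2 i; rewrite /B; meas.
apply: (@le_trans _ _ (\sum_(i < M) (2%:E * \int[leb]_t ((om (sc l0 i) t)%:E * A i t) +
   2%:E * \int[leb]_t ((om (sc l0 i) t)%:E * B i t)))%E).
  apply: lee_sum => i _; have mi := mom i; have mAi := mA i; have mBi := mB i.
  have oA0 t : (0 <= (om (sc l0 i) t)%:E * A i t)%E by exact: mule_ge0.
  have oB0 t : (0 <= (om (sc l0 i) t)%:E * B i t)%E by exact: mule_ge0.
  rewrite -!intZ//; [|by meas|by meas].
  rewrite -intD; [|by meas|by meas|by move=> t; exact: mule_ge0|by move=> t; exact: mule_ge0].
  apply: le_int => t; first by apply: mule_ge0 => //; pos.
  have [->|h] := eqVneq (om (sc l0 i) t) 0; first by rewrite !mul0e !mule0 adde0.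
  have [t0 _ _] := om_neq0 (sg i) h.
  rewrite ![(2%:E * (_ * _))%E]muleCA -ge0_muleDr ?mule_ge0//; apply: lee_wpmul2l => //.
  have mTi : measurable_fun setT (T2 i t) by have mTi := mT2 i; meas.
  have mT1i := mT1 i t.
  rewrite /A /B -!intZ//; [|by meas|by pos|by meas|by pos].
  rewrite -intD; [|by meas|by meas|by pos|by pos].
  apply: le_int => y; first by pos.
  rewrite (dec i)// -!EFinM -EFinD lee_fin.
  by have := sqr_ge0 (T1 i t y - T2 i t y); nra.
rewrite big_split/= -!ge0_sume_distrr; last 2 first.
- by move=> i _; apply: int_ge0 => t; exact: mule_ge0.
- by move=> i _; apply: int_ge0 => t; exact: mule_ge0.
have nE : nrm mu umeas F = (\int[mu]_y (f y ^+ 2)%:E)%E.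
  by apply: eq_int => y; rewrite int_unit.
have f0 : (0 <= \int[mu]_y (f y ^+ 2)%:E)%E by pos.
have -> : ((2 * Ca + 2 * Cp) * N ^+ 2)%:E = ((2 * (Ca * N ^+ 2))%:E + (2 * (Cp * N ^+ 2))%:E)%E.
  by rewrite -EFinD; congr EFin; ring.
rewrite ge0_muleDl; [|by rewrite lee_fin; pos|by rewrite lee_fin; pos].
rewrite [X in (X * _ + _)%E]EFinM [X in (_ + X * _)%E]EFinM -!muleA.
apply: leeD; apply: lee_wpmul2l => //.
rewrite -nE; apply: le_trans hA; apply: lee_sum => i _.
by apply: le_int => t; [exact: mule_ge0|rewrite e1].
Qed.

End OneParameterTheorem.

(** * The bi-parameter Carleson condition *)

Section FiniteExists.
Context {d : measure_display} {P : measurableType d}.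

Lemma mf_has (I : Type) (s : seq I) (f : I -> P -> bool) :
  (forall i, measurable_fun setT (f i)) ->
  measurable_fun setT (fun p => has (f^~ p) s).
Proof.
move=> mf; elim: s => [|i s IH] /=; first exact: measurable_cst.
under eq_fun do rewrite -[_ || _]negbK negb_or.
by apply: mf_neg; apply: mf_and; apply: mf_neg.
Qed.

Lemma mf_exists (I : finType) (f : I -> P -> bool) :
  (forall i, measurable_fun setT (f i)) ->
  measurable_fun setT (fun p => [exists i, f i p]).
Proof.
move=> mf; rewrite (_ : (fun p => _) = fun p => has (f^~ p) (enum I)).
  exact: mf_has.
apply/funext => p; apply/existsP/hasP => [[i hi]|[i _ hi]]; last by exists i.
by exists i => //; rewrite mem_enum.
Qed.

End FiniteExists.

Section LayerCake.
Context {R : realType}.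
Local Notation leb := (@lebesgue_measure R).

Lemma layer_cake (v : R) : 0 <= v ->
  (\int[leb]_tau ((((0 < tau) && (tau < v))%R)%:R : R)%:E = v%:E)%E.
Proof.
move=> v0; transitivity (leb `]0, v[%classic).
  rewrite -[RHS]mul1e -integral_cst//= [RHS]integral_mkcond.
  apply: eq_integral => t _; rewrite patchE mem_setE /= in_itv/=.
  by case: ifP.
rewrite lebesgue_measure_itv/= lte_fin; case: (ltgtP 0 v) v0 => // [_ _|<- _].
  by rewrite oppr0 adde0.
by [].
Qed.

End LayerCake.

Section MaximalFunctionParameters.
Context {R : realType} {n : nat}.
Variable mu : {sigma_finite_measure set (Rn R n) -> \bar R}.
Hypothesis lmu : is_lebesgue mu.
Variable l0 : R.
Hypothesis l0_gt0 : 0 < l0.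

Lemma mf_Mx {d} {P : measurableType d} (F : P -> Rn R n -> R) (a : P -> Rn R n) k i :
  mf2 F -> measurable_fun setT a ->
  measurable_fun setT (fun p => Mx mu l0 (F p) k i (a p)).
Proof.
move=> mF ma; elim: k i => [|k IH] i /=; first exact: measurable_cst.
by apply: mf_max; [meas|exact: IH].
Qed.

Lemma Mx_dom (f w : Rn R n -> R) c k i y : c1 mu f -> c1 mu w -> 0 <= c ->
  (forall x, 0 <= w x) -> (forall x, f x <= c * w x) ->
  Mx mu l0 f k i y <= c * Mx mu l0 w k i y.
Proof.
move=> cf cw c0 w0 fw; elim: k i => [|k IH] i /=; first by rewrite mulr0.
have sg := sc_gt0 l0_gt0 i.
rewrite ge_max; apply/andP; split.
  apply: (@le_trans _ _ (c * Ek mu (sc l0 i) w y)).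
    rewrite /Ek -RintZ; last by case: (c1_ekM lmu y sg cw).
    apply: le_Rint; [by case: (c1_ekM lmu y sg cf)|apply: iblZ; by case: (c1_ekM lmu y sg cw)|].
    by move=> x; rewrite mulrCA ler_wpM2l// ek_ge0.
  by rewrite ler_wpM2l// le_max lexx.
by apply: le_trans (IH i.+1) _; rewrite ler_wpM2l// le_max lexx orbT.
Qed.

End MaximalFunctionParameters.

Section BiparameterCarleson.
Context {R : realType} {n m : nat}.
Variables (mu1 : {sigma_finite_measure set (Rn R n) -> \bar R})
  (mu2 : {sigma_finite_measure set (Rn R m) -> \bar R}).
Hypotheses (lmu1 : is_lebesgue mu1) (lmu2 : is_lebesgue mu2).
Local Notation leb := (@lebesgue_measure R).
Variables (l1 l2 : R).
Hypotheses (l1_gt0 : 0 < l1) (l2_gt0 : 0 < l2).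
Variables (M1 M2 : nat) (gam : nat -> nat -> Rn R n -> Rn R m -> \bar R) (A : R).
Hypotheses (A0 : 0 <= A) (gam0 : forall i j x y, (0 <= gam i j x y)%E)
  (mgam : forall i j, mf2 (gam i j)).

Definition some_rect (e : nat -> nat -> Rn R n -> Rn R m -> bool) x y :=
  [exists i : 'I_M1, [exists j : 'I_M2, e i j x y]].

(** The Carleson condition for unions of cells: [e i j] selects cells of the scales [(i, j)], and
    the open set is the union of all selected rectangles. Superlevel sets of averages are selections
    of this kind, since averages are constant on cells. *)
Hypothesis H : forall e : nat -> nat -> Rn R n -> Rn R m -> bool,
  (forall i j, mf2 (e i j)) ->
  (forall i j x x' y y', same (sc l1 i) x x' -> same (sc l2 j) y y' ->
     e i j x y = e i j x' y') ->
  (\int[mu1]_x \int[mu2]_y ((some_rect e x y)%:R : R)%:E < +oo)%E ->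
  (\sum_(i < M1) \sum_(j < M2)
     \int[mu1]_x \int[mu2]_y (gam i j x y * ((e i j x y)%:R : R)%:E)
   <= A%:E * \int[mu1]_x \int[mu2]_y ((some_rect e x y)%:R : R)%:E)%E.

Variable F : Rn R n -> Rn R m -> R.
Hypotheses (cF : c2 mu1 mu2 F) (F0 : forall x y, 0 <= F x y).

Definition V2 i j x y := Ek mu1 (sc l1 i) (fun x' => Ek mu2 (sc l2 j) (F x') y) x.
Definition m2F y x := Mx mu2 l2 (F x) M2 0 y.
(** Iterated maximal function: it dominates all rectangle averages [V2] at once, and each of its two
    layers is an ordinary dyadic maximal function. *)
Definition mmF x y := Mx mu1 l1 (m2F y) M1 0 x.

Let s1 i := sc_gt0 l1_gt0 i.
Let s2 i := sc_gt0 l2_gt0 i.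
Let mF : mf2 F := c2_mf cF.

Let cm2F y : c1 mu1 (m2F y).
Proof.
have [_ [v [w [cv cw h]]]] := cF; rewrite /m2F.
apply: (c1_dom (g := fun x => Mx mu2 l2 (fun z => `|w z|) M2 0 y * `|v x|)).
- by apply: mf_Mx; meas.
- move=> x; rewrite ger0_norm ?Mx_ge0// mulrC.
  apply: Mx_dom => //; [exact: c2_sec cF|exact: c1_norm|].
  by move=> z; rewrite (le_trans (ler_norm _))// (le_trans (h x z))// -normrM ler_norm.
- by apply: c1Z; exact: c1_norm.
Qed.

Let mm2F : mf2 m2F.
Proof. by rewrite /m2F /mf2; apply: mf_Mx; meas. Qed.

Let mmmF : mf2 mmF.
Proof. by rewrite /mmF /mf2; apply: mf_Mx; meas. Qed.

Let m2F_ge0 y x : 0 <= m2F y x.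
Proof. by apply: Mx_ge0. Qed.

Let mmF_ge0 x y : 0 <= mmF x y.
Proof. by apply: Mx_ge0 => // z; exact: m2F_ge0. Qed.

Let V2_ge0 i j x y : 0 <= V2 i j x y.
Proof. by apply: Ek_ge0 => // z; apply: Ek_ge0. Qed.

Let mV2 i j : mf2 (V2 i j).
Proof. by rewrite /V2; meas. Qed.

Let c1V j y : c1 mu1 (fun x' => Ek mu2 (sc l2 j) (F x') y).
Proof.
have [_ [v [w [cv cw h]]]] := cF.
apply: (c1_dom (g := fun x => Ek mu2 (sc l2 j) w y * v x)).
- by meas.
- move=> x; apply: le_trans (Ek_norm lmu2 y (s2 j) (c2_sec x cF)) _.
  apply: (@le_trans _ _ (Ek mu2 (sc l2 j) (fun z => v x * w z) y)).
    by apply: Ek_le => //; [exact: c1_norm (c2_sec x cF)|exact: c1Z].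
  rewrite /Ek mulrC -RintZ; last by case: (c1_ekM lmu2 y (s2 j) cw).
  apply: le_Rint.
  + by case: (c1_ekM lmu2 y (s2 j) (c1Z (v x) cw)).
  + by apply: iblZ; case: (c1_ekM lmu2 y (s2 j) cw).
  + by move=> z; rewrite mulrCA.
- exact: c1Z.
Qed.

Let V2_le i j x y : (i < M1)%N -> (j < M2)%N -> V2 i j x y <= mmF x y.
Proof.
move=> iM jM; apply: (@le_trans _ _ (Ek mu1 (sc l1 i) (m2F y) x)).
  by apply: Ek_le => // z; exact: (@Mx_ub R m mu2 l2 (F z) M2 0 j y jM).
exact: (@Mx_ub R n mu1 l1 (m2F y) M1 0 i x iM).
Qed.

Lemma strong_maximal :
  (\int[mu1]_x \int[mu2]_y (mmF x y ^+ 2)%:E <=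
   16%:E * \int[mu1]_x \int[mu2]_y (F x y ^+ 2)%:E)%E.
Proof.
rewrite tonelli; [|by meas|by pos].
apply: (@le_trans _ _ (\int[mu2]_y (4%:E * \int[mu1]_x (m2F y x ^+ 2)%:E))%E).
  apply: le_int => y; first by pos.
  rewrite -!RintE; [|by apply/c1_ibl/c1_sq|by apply/c1_ibl/c1_sq/c1_Mx].
  by rewrite -EFinM lee_fin; apply: doob => // x; apply: Mx_ge0.
rewrite intZ//; [|by meas|by pos].
rewrite tonelli; [|by meas|by pos].
rewrite (_ : 16 = 4 * 4 :> R); last by ring.
rewrite EFinM -muleA; apply: lee_wpmul2l; first by pos.
rewrite -intZ//; [|by meas|by pos].
apply: le_int => x; first by pos.
have cx := c2_sec x cF.
rewrite -!RintE; [|by apply/c1_ibl/c1_sq|by apply/c1_ibl/c1_sq/c1_Mx].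
by rewrite -EFinM lee_fin; apply: doob.
Qed.

Lemma int_F_fin : (\int[mu1]_x \int[mu2]_y (F x y ^+ 2)%:E < +oo)%E.
Proof.
have [_ [v [w [cv cw h]]]] := cF; have mv := c1_mf cv; have mw := c1_mf cw.
apply: (@le_lt_trans _ _ (\int[mu1]_x \int[mu2]_y ((v x ^+ 2)%:E * (w y ^+ 2)%:E))%E).
  apply: le_int => x; first by pos.
  apply: le_int => y; first by pos.
  by rewrite -EFinM lee_fin -exprMn; apply: sqr_le_norm.
have fin_sq d (T : measurableType d) (nu : {sigma_finite_measure set T -> \bar R}) f :
    c1 nu f -> (\int[nu]_y (f y ^+ 2)%:E < +oo)%E.
  by move=> cf; rewrite -RintE ?ltry//; apply/c1_ibl/c1_sq.
rewrite (eq_int _ (g := fun x => ((\int[mu2]_y (w y ^+ 2)%:E) * (v x ^+ 2)%:E)%E)); last first.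
  by move=> x; rewrite intZ ?sqr_ge0//; [rewrite muleC|meas|pos].
rewrite intZe; [|by pos|by meas|by pos].
by rewrite lte_mul_pinfty ?ge0_fin_numE ?fin_sq//; pos.
Qed.

(** For each level [tau] the rectangles where [V2^2 > tau] lie in the set where [mmF^2 > tau]. The
    Carleson condition bounds their total by the measure of that set, and the integral over [tau]
    returns the norm of [mmF]. *)
Lemma biparameter_carleson :
  (\sum_(i < M1) \sum_(j < M2)
     \int[mu1]_x \int[mu2]_y (gam i j x y * (V2 i j x y ^+ 2)%:E)
   <= (16 * A)%:E * \int[mu1]_x \int[mu2]_y (F x y ^+ 2)%:E)%E.
Proof.
(* The levels are those of the square, so that the layer cake formula carries no extra factor;
   [0 < tau] discards the negative half of the line of integration. *)
pose e tau i j x y := (0 < tau) && (tau < V2 i j x y ^+ 2).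
pose chi tau i j x y : \bar R := ((e tau i j x y)%:R : R)%:E.
have me3 i j : mf3 (fun tau x y => e tau i j x y).
  by have mv := mV2 i j; rewrite /e; meas.
have mchi i j : mf3 (fun tau x y => chi tau i j x y).
  by have mv := mV2 i j; rewrite /chi /e; meas.
have chi0 tau i j x y : (0 <= chi tau i j x y)%E by rewrite lee_fin ler0n.
have mE : mf3 (fun tau x y => some_rect (e tau) x y).
  rewrite /mf3 /some_rect; apply: mf_exists => i; apply: mf_exists => j.
  by have mi := me3 i j; meas.
have V2E i j x y : ((V2 i j x y ^+ 2)%:E = \int[leb]_tau chi tau i j x y)%E.
  by rewrite layer_cake// sqr_ge0.
have swap i j : (\int[mu1]_x \int[mu2]_y (gam i j x y * (V2 i j x y ^+ 2)%:E) =
   \int[leb]_tau \int[mu1]_x \int[mu2]_y (gam i j x y * chi tau i j x y))%E.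
  have mg := mgam i j; have mc := mchi i j.
  have p0 tau x y : (0 <= gam i j x y * chi tau i j x y)%E by rewrite mule_ge0.
  have mv := mV2 i j.
  rewrite [RHS]tonelli; last 2 first.
  - by meas.
  - by move=> tau x; apply: int_ge0 => y; exact: p0.
  apply: eq_int => x; rewrite [RHS]tonelli; last 2 first.
  - by rewrite /mf2 /=; apply: mfMe; rewrite ?/chi ?/e; meas.
  - by move=> *; exact: p0.
  apply: eq_int => y; rewrite V2E intZe//.
  by rewrite /chi /e; meas.
under eq_bigr do under eq_bigr do rewrite swap.
have q0 tau i j : (0 <= \int[mu1]_x \int[mu2]_y (gam i j x y * chi tau i j x y))%E.
  by apply: int_ge0 => x; apply: int_ge0 => y; rewrite mule_ge0.
have mq i j : measurable_fun setT
    (fun tau => \int[mu1]_x \int[mu2]_y (gam i j x y * chi tau i j x y))%E.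
  by have mg := mgam i j; have mc := mchi i j; meas.
rewrite (eq_bigr (fun i : 'I_M1 => \int[leb]_tau (\sum_(j < M2) \int[mu1]_x \int[mu2]_y
   (gam i j x y * chi tau i j x y)))%E); last first.
  move=> i _; symmetry; apply: (@int_sum _ _ _ leb _ _ (fun (j : 'I_M2) tau =>
    \int[mu1]_x \int[mu2]_y (gam i j x y * chi tau i j x y))%E).
  - by move=> j; exact: mq.
  - by move=> j tau; exact: q0.
rewrite -int_sum; last 2 first.
- by move=> i; apply: mf_sume => j; exact: mq.
- by move=> i tau; apply: sume_ge0 => j _; exact: q0.
pose Om tau : \bar R := (\int[mu1]_x \int[mu2]_y ((some_rect (e tau) x y)%:R : R)%:E)%E.
have mOm : measurable_fun setT Om by rewrite /Om; meas.
have Om0 tau : (0 <= Om tau)%E by rewrite /Om; pos.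
have some_le tau x y : some_rect (e tau) x y -> (0 < tau) && (tau < mmF x y ^+ 2).
  move=> /existsP[i /existsP[j /andP[-> h]]] /=; apply: (lt_le_trans h).
  by rewrite lerXn2r ?nnegrE// V2_le.
have maxfin : (\int[mu1]_x \int[mu2]_y (mmF x y ^+ 2)%:E < +oo)%E.
  apply: le_lt_trans strong_maximal _.
  by rewrite lte_mul_pinfty// ?lee_fin// int_F_fin.
apply: (@le_trans _ _ (\int[leb]_tau (A%:E * Om tau))%E).
  apply: le_int => tau.
    by apply: sume_ge0 => i _; apply: sume_ge0 => j _; exact: q0.
  apply: (@H (e tau)).
  - by move=> i j; have mv := mV2 i j; rewrite /e; meas.
  - move=> i j x x' y y' hx hy; rewrite /e /V2 (Ek_eq _ _ hx).
    suff -> : (fun z => Ek mu2 (sc l2 j) (F z) y) = (fun z => Ek mu2 (sc l2 j) (F z) y') by [].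
    by apply/funext => z; exact: Ek_eq.
  have [t0|t0] := ltP 0 tau; last first.
    rewrite (eq_int _ (g := fun=> 0%E)) ?integral0// => x.
    rewrite (eq_int _ (g := fun=> 0%E)) ?integral0// => y.
    case E : (some_rect _ _ _) => //.
    by have := some_le _ _ _ E; rewrite ltNge t0.
  (* Chebyshev: the union has finite measure, as the Carleson condition demands. *)
  apply: (@le_lt_trans _ _ ((tau^-1)%:E * \int[mu1]_x \int[mu2]_y (mmF x y ^+ 2)%:E)%E); last first.
    by rewrite lte_mul_pinfty// lee_fin invr_ge0 ltW.
  rewrite -intZ; [|by rewrite invr_ge0 ltW|by meas|by pos].
  apply: le_int => x; first by pos.
  rewrite -intZ; [|by rewrite invr_ge0 ltW|by meas|by pos].
  apply: le_int => y; first by pos.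
  rewrite -EFinM lee_fin; case E : (some_rect _ _ _); last by rewrite mulr_ge0 ?sqr_ge0// invr_ge0 ltW.
  have /andP[_ h] := some_le _ _ _ E.
  by rewrite mulrC ler_pdivlMr// mul1r ltW.
rewrite intZ//.
rewrite [(16 * A)%R]mulrC EFinM -muleA; apply: lee_wpmul2l; first by rewrite lee_fin.
apply: le_trans strong_maximal.
rewrite /Om tonelli; last 2 first.
- by meas.
- by pos.
apply: le_int => x; first by pos.
have mEx : mf2 (fun tau y => some_rect (e tau) x y).
  by apply: (mf3_comp mE (b := fun=> x)); meas.
rewrite tonelli; [|exact: (mfE (mf_chi mEx))|by pos].
apply: le_int => y; first by pos.
rewrite -[leRHS]layer_cake ?sqr_ge0//; apply: le_int => tau; first by pos.
rewrite lee_fin ler_nat; case E : (some_rect _ _ _) => //.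
by rewrite (some_le _ _ _ E).
Qed.

End BiparameterCarleson.

(** * Bi-parameter kernels *)

Section ProductMeasure.
Context {R : realType} {d e : measure_display} {S : measurableType d}
  {T : measurableType e}.
Variables (mu : {sigma_finite_measure set S -> \bar R})
  (nu : {sigma_finite_measure set T -> \bar R}).

(** The product measure under a name of its own, which carries a sigma-finite structure and can thus
    be a factor of a further product. *)
Definition prodm : set (S * T)%type -> \bar R := (mu \x nu)%E.

HB.instance Definition _ := Measure.copy prodm (mu \x nu)%E.

Lemma prodm_sigma_finite : sigma_finite setT prodm.
Proof.
have /sigma_finiteP[F [TF ndF Foo]] := sigma_finiteT mu.
have /sigma_finiteP[G [TG ndG Goo]] := sigma_finiteT nu.
exists (fun k => F k `*` G k).
  rewrite -setXTT TF TG; apply/seteqP; split => [[x y] /= [[i _ Fi] [j _ Gj]]|[x y] /= [i _ [Fi Gi]]].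
    exists (maxn i j) => //; split.
    - by move: x Fi; exact/subsetPset/ndF/leq_maxl.
    - by move: y Gj; exact/subsetPset/ndG/leq_maxr.
  by split; exists i.
move=> k; have [? ?] := Foo k; have [? ?] := Goo k.
split; first exact: measurableX.
by rewrite /prodm product_measure1E// lte_mul_pinfty// ge0_fin_numE.
Qed.

HB.instance Definition _ := Measure_isSigmaFinite.Build _ _ _ prodm prodm_sigma_finite.

Lemma int_prodm (F : S * T -> \bar R) : measurable_fun setT F ->
  (forall q, (0 <= F q)%E) ->
  (\int[prodm]_q F q = \int[mu]_x \int[nu]_y F (x, y))%E.
Proof. by move=> mF F0; apply: fubini_tonelli1. Qed.

End ProductMeasure.

Section OctaveSelection.
Context {R : realType}.

Implicit Types (l t : R).

(** Multiplying a kernel by this square root puts the measure [dt / t] of the octave into the square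
    of its values. *)
Definition sqom l t : R := om l t `^ 2^-1.

Lemma mf_sqom {d} {P : measurableType d} l (f : P -> R) :
  measurable_fun setT f -> measurable_fun setT (fun p => sqom l (f p)).
Proof. by move=> mf; rewrite /sqom; apply: mf_powR; apply: mf_om. Qed.

Lemma sqom_sqr l t : 0 < l -> sqom l t ^+ 2 = om l t.
Proof. by move=> l0; rewrite /sqom powR12_sqrt ?sqr_sqrtr// om_ge0. Qed.

Lemma om_disjoint l0 i j t : 0 < l0 -> (i < j)%N ->
  om (sc l0 i) t != 0 -> om (sc l0 j) t = 0.
Proof.
move=> l00 ij h; have [t0 _ h1] := om_neq0 (sc_gt0 l00 i) h.
rewrite /om; case: andP => [[h2 _]|_]; last by rewrite mul0r.
suff : 2 * (2 ^+ i * l0) <= 2 ^+ j * l0.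
  by move: h1 h2; rewrite /sc => h1 h2 h3; lra.
by rewrite mulrA -exprS ler_wpM2r ?(ltW l00)// ler_weXn2l// ler1n.
Qed.

(* Since the octaves are disjoint, at a given time at most one term survives. *)
Lemma octave_select l0 M t : 0 < l0 -> exists c j0,
  (forall X : nat -> R, \sum_(j < M) sqom (sc l0 j) t * X j = c * X j0) /\
  (forall X : nat -> R, \sum_(j < M) om (sc l0 j) t * X j = c ^+ 2 * X j0).
Proof.
move=> l00; case: (pickP (fun j : 'I_M => om (sc l0 j) t != 0)) => [j hj|h].
  have oth (i : 'I_M) : i != j -> om (sc l0 i) t = 0.
    move=> ij; case: (ltngtP i j) => [lt|lt|e].
    - by apply/eqP; case: eqVneq => // hi; move: hj; rewrite (om_disjoint l00 lt hi) eqxx.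
    - exact: om_disjoint l00 lt hj.
    - by move: ij; rewrite (val_inj e) eqxx.
  exists (sqom (sc l0 j) t), j; split => X; rewrite (bigD1 j)//= big1 ?addr0//.
  - by move=> i /oth e; rewrite /sqom e powR0 ?mul0r// invr_neq0.
  - by rewrite sqom_sqr// sc_gt0.
  - by move=> i /oth ->; rewrite mul0r.
exists 0, 0%N; split => X; rewrite ?expr0n/= mul0r big1// => i _.
  by have /negbFE/eqP e := h i; rewrite /sqom e powR0 ?mul0r// invr_neq0.
by have /negbFE/eqP -> := h i; rewrite mul0r.
Qed.

(** Because octaves are disjoint, the square of this sum is the sum of the densities [om]. A kernel
    times [oct] therefore maps into the plain [L^2] space of [(t, y)], which serves as the target
    space [S]. *)
Definition oct M l0 t := \sum_(i < M) sqom (sc l0 i) t.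

Lemma oct_sqr M l0 t : 0 < l0 -> oct M l0 t ^+ 2 = \sum_(i < M) om (sc l0 i) t.
Proof.
move=> h; have [c [j [h1 h2]]] := octave_select M t h.
have := h1 (fun=> 1); have := h2 (fun=> 1); rewrite !mulr1.
under eq_bigr do rewrite mulr1; under [X in _ -> X = _ -> _]eq_bigr do rewrite mulr1.
by move=> -> ; rewrite /oct => ->.
Qed.

Lemma om_neg l t : 0 < l -> t <= 0 -> om l t = 0.
Proof.
move=> l0 t0; rewrite /om; case: andP => [[h _]|_]; last by rewrite mul0r.
by have := le_trans h t0; rewrite pmulr_rle0// leNgt l0.
Qed.

Lemma sqom_neg l t : 0 < l -> t <= 0 -> sqom l t = 0.
Proof. by move=> l0 t0; rewrite /sqom om_neg// powR0// invr_neq0. Qed.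

Lemma oct_neg M l0 t : 0 < l0 -> t <= 0 -> oct M l0 t = 0.
Proof. by move=> h t0; rewrite /oct big1// => i _; rewrite sqom_neg// sc_gt0. Qed.

Lemma mf_oct {d} {P : measurableType d} M l0 (f : P -> R) :
  measurable_fun setT f -> measurable_fun setT (fun p => oct M l0 (f p)).
Proof. by move=> mf; apply: mf_sum => i; apply: mf_sqom. Qed.

End OctaveSelection.

Section OctaveIntegral.
Context {R : realType} {d : measure_display} {Y : measurableType d}.
Variable mu : {sigma_finite_measure set Y -> \bar R}.
Local Notation leb := (@lebesgue_measure R).

Lemma int_octaves_ereal (l0 : R) M (G : nat -> R -> Y -> \bar R) : 0 < l0 ->
  (forall j, mf2 (G j)) -> (forall j t y, (0 <= G j t y)%E) ->
  (\int[prodm leb mu]_s (\sum_(j < M) (om (sc l0 j) s.1)%:E * G j s.1 s.2) =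
   \sum_(j < M) \int[leb]_t ((om (sc l0 j) t)%:E * \int[mu]_y G j t y))%E.
Proof.
move=> l00 mG G0; have o0 j t := om_ge0 t (sc_gt0 l00 j).
have p0 j t y : (0 <= (om (sc l0 j) t)%:E * G j t y)%E by rewrite mule_ge0// lee_fin.
rewrite int_prodm; last 2 first.
- apply: mf_sume => j; have mj := mG j.
  by apply: mfMe; [apply/mfE/mf_om|]; meas.
- by move=> q; rewrite sume_ge0// => j _; exact: p0.
rewrite -(@int_sum _ _ _ leb _ _ (fun (j : 'I_M) t =>
    (om (sc l0 j) t)%:E * \int[mu]_y G j t y)%E); last 2 first.
- by move=> j; have mj := mG j; apply: mfMe; [apply/mfE/mf_om|]; meas.
- by move=> j t; apply: mule_ge0; [rewrite lee_fin|exact: int_ge0].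
apply: eq_int => t /=; rewrite int_sum; last 2 first.
- by move=> j; have mj := mG j; apply/mfMe; meas.
- by move=> j y; exact: p0.
apply: eq_bigr => j _; have mj := mG j.
by rewrite intZ//; meas.
Qed.

Lemma int_octaves (l0 : R) M (X : nat -> R -> Y -> R) : 0 < l0 -> (forall j, mf2 (X j)) ->
  (\int[prodm leb mu]_s (\sum_(j < M) om (sc l0 j) s.1 * X j s.1 s.2 ^+ 2)%:E =
   \sum_(j < M) \int[leb]_t ((om (sc l0 j) t)%:E * \int[mu]_y (X j t y ^+ 2)%:E))%E.
Proof.
move=> l00 mX; rewrite -(@int_octaves_ereal l0 M (fun j t y => (X j t y ^+ 2)%:E))//.
- by apply: eq_int => s; rewrite -sumEFin.
- by move=> j; have mj := mX j; meas.
- by move=> j t y; rewrite lee_fin sqr_ge0.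
Qed.

End OctaveIntegral.

Section Biparameter.
Context {R : realType} {n m : nat}.
Variables (mu1 : {sigma_finite_measure set (Rn R n) -> \bar R})
  (mu2 : {sigma_finite_measure set (Rn R m) -> \bar R}).
Hypotheses (lmu1 : is_lebesgue mu1) (lmu2 : is_lebesgue mu2).
Local Notation leb := (@lebesgue_measure R).
Local Notation Z1 := (Rn R n).
Local Notation Z2 := (Rn R m).
Local Notation nu1 := (prodm leb mu1).
Local Notation nu2 := (prodm leb mu2).

(* Freezing one variable leaves a one-parameter kernel in the other, whose
   constant carries the decay and the regularity in the frozen variable. *)
Definition bi_kernel (a b N : R) (k : R -> R -> Z1 -> Z1 -> Z2 -> Z2 -> R) :=
  [/\ mf6 k,
    forall t2 y2 z2, 0 < t2 ->
      t1_kernel mu1 a (N * pdecay m b t2 (vsub y2 z2))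
        (fun t1 y1 z1 => k t1 t2 y1 z1 y2 z2) /\
      (forall z2' r, 0 < r -> r <= t2 / 2 -> ninf (vsub z2 z2') < r ->
        t1_kernel mu1 a (N * ((r / t2) `^ b * pdecay m b t2 (vsub y2 z2)))
          (fun t1 y1 z1 => k t1 t2 y1 z1 y2 z2 - k t1 t2 y1 z1 y2 z2')) &
    forall t1 y1 z1, 0 < t1 ->
      t1_kernel mu2 b (N * pdecay n a t1 (vsub y1 z1))
        (fun t2 y2 z2 => k t1 t2 y1 z1 y2 z2) /\
      (forall z1' r, 0 < r -> r <= t1 / 2 -> ninf (vsub z1 z1') < r ->
        t1_kernel mu2 b (N * ((r / t1) `^ a * pdecay n a t1 (vsub y1 z1)))
          (fun t2 y2 z2 => k t1 t2 y1 z1 y2 z2 - k t1 t2 y1 z1' y2 z2))].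

Lemma c2M (F G : Z1 -> Z2 -> R) (M : R) : mf2 G -> (forall x y, `|G x y| <= M) ->
  c2 mu1 mu2 F -> c2 mu1 mu2 (fun x y => F x y * G x y).
Proof.
move=> mG GM [mF [v [w [cv cw h]]]]; split; first by meas.
exists (fun x => M * v x), w; split => //; first exact: c1Z.
move=> x y; rewrite normrM mulrC -mulrA ler_pM//.
Qed.

Lemma c2_swap (F : Z1 -> Z2 -> R) : c2 mu1 mu2 F -> c2 mu2 mu1 (fun y x => F x y).
Proof.
move=> [mF [v [w [cv cw h]]]]; split; first by meas.
by exists w, v; split => // y x; rewrite mulrC.
Qed.

Lemma c2_bounded (F : Z1 -> Z2 -> R) : c2 mu1 mu2 F -> exists M, forall x y, `|F x y| <= M.
Proof.
move=> [mF [v [w [[_ [V hV] _] [_ [W hW] _] h]]]]; exists (V * W) => x y.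
by apply: le_trans (h x y) _; apply: le_trans (ler_norm _) _; rewrite normrM ler_pM.
Qed.

Lemma Ek_comm (F : Z1 -> Z2 -> R) l l' x y : 0 < l -> 0 < l' -> c2 mu1 mu2 F ->
  Ek mu2 l' (fun w => Ek mu1 l (F^~ w) x) y = Ek mu1 l (fun z => Ek mu2 l' (F z) y) x.
Proof.
move=> l0 l'0 cF; have mF := c2_mf cF.
have d : dom2 mu1 mu2 (fun z w => ek l x z * ek l' y w * F z w).
  apply: c2_dom2; rewrite (_ : (fun z w => _) = fun z w => F z w * (ek l x z * ek l' y w)).
    apply: (@c2M _ _ (l ^- n * l' ^- m)) => //; first by meas.
    move=> z w; rewrite ger0_norm; last by pos.
    by rewrite ler_pM ?ek_ge0// ek_bound.
  by apply/funext => z; apply/funext => w; rewrite mulrC.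
rewrite /Ek; transitivity (\int[mu1]_z \int[mu2]_w (ek l x z * ek l' y w * F z w)).
  rewrite fubini_dom//; apply: eq_Rint => w.
  rewrite -RintZ; last exact: c1_ibl (c1_ekM lmu1 x l0 (c2_sec' w cF)).
  by apply: eq_Rint => z; rewrite mulrCA mulrA.
apply: eq_Rint => z; rewrite -RintZ; last exact: c1_ibl (c1_ekM lmu2 y l'0 (c2_sec z cF)).
by apply: eq_Rint => w; rewrite mulrA.
Qed.

Section Decomposition.
Variables (a b N : R) (k : R -> R -> Z1 -> Z1 -> Z2 -> Z2 -> R).
Hypotheses (a0 : 0 < a) (b0 : 0 < b) (N0 : 0 < N) (kk : bi_kernel a b N k).
Let mk : mf6 k. Proof. by case: kk. Qed.

Lemma bi_size t1 t2 y1 z1 y2 z2 : 0 < t1 -> 0 < t2 ->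
  `|k t1 t2 y1 z1 y2 z2| <=
  N * pdecay m b t2 (vsub y2 z2) * pdecay n a t1 (vsub y1 z1).
Proof. by move=> t10 t20; case: kk => _ /(_ t2 y2 z2 t20)[[_ + _ _] _] _; exact. Qed.

Lemma c2_bi_kernel t1 t2 y1 y2 : 0 < t1 -> 0 < t2 ->
  c2 mu1 mu2 (fun z1 z2 => k t1 t2 y1 z1 y2 z2).
Proof.
move=> t10 t20; split; first by meas.
have [C0 _ Hd1] := decay_int lmu1 a0; have [C1 _ Hd2] := decay_int lmu2 b0.
exists (fun z1 => N * pdecay n a t1 (vsub y1 z1)), (fun z2 => pdecay m b t2 (vsub y2 z2)).
split; [exact/c1Z/(c1_pdecay lmu1 a0 Hd1)|exact: (c1_pdecay lmu2 b0 Hd2)|].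
by move=> z w; apply: le_trans (bi_size _ _ _ _ t10 t20) _; rewrite mulrAC.
Qed.

Definition mass2 t1 t2 y1 z1 y2 := \int[mu2]_z2 k t1 t2 y1 z1 y2 z2.
Definition mass t1 t2 y1 y2 := \int[mu1]_z1 mass2 t1 t2 y1 z1 y2.
Definition bi_op (f : Z1 -> Z2 -> R) t1 t2 y1 y2 :=
  \int[mu1]_z1 \int[mu2]_z2 (k t1 t2 y1 z1 y2 z2 * f z1 z2).

Variable f : Z1 -> Z2 -> R.
Hypothesis cf : c2 mu1 mu2 f.
Let mf : mf2 f := c2_mf cf.
Variables (s1 s2 : R).
Hypotheses (s10 : 0 < s1) (s20 : 0 < s2).

(** The [z2] integral is outermost: this is [Rop] in the second variable, for a kernel whose values
    are operators in the first. *)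
Definition part2 t1 t2 y1 y2 := \int[mu2]_z2 \int[mu1]_z1
  (k t1 t2 y1 z1 y2 z2 * (f z1 z2 - Ek mu2 s2 (f z1) y2)).
Definition avg2 z1 y2 := Ek mu2 s2 (f z1) y2.
Definition avg12 y1 y2 := Ek mu1 s1 (fun z => avg2 z y2) y1.
(** After the average at [y2] nothing but [k] depends on [z2], so the inner integral leaves [mass2]:
    in the second variable the operator is a paraproduct. *)
Definition part1 t1 t2 y1 y2 := \int[mu1]_z1
  (mass2 t1 t2 y1 z1 y2 * (avg2 z1 y2 - avg12 y1 y2)).

Lemma bi_op_split t1 t2 y1 y2 : 0 < t1 -> 0 < t2 ->
  bi_op f t1 t2 y1 y2 =
  part2 t1 t2 y1 y2 + part1 t1 t2 y1 y2 + mass t1 t2 y1 y2 * avg12 y1 y2.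
Proof.
move=> t10 t20; have ck := c2_bi_kernel y1 y2 t10 t20.
have [Mf hf] := c2_bounded cf.
have ma2 : mf2 avg2 by rewrite /avg2; meas.
have ba2 z : `|avg2 z y2| <= Mf.
  by apply: Ek_bound => //; meas.
have d1 : dom2 mu1 mu2 (fun z1 z2 => k t1 t2 y1 z1 y2 z2 * f z1 z2).
  by apply/c2_dom2/(c2M (M := Mf)).
have d2 : dom2 mu1 mu2 (fun z1 z2 => k t1 t2 y1 z1 y2 z2 * avg2 z1 y2).
  by apply/c2_dom2/(c2M (M := Mf) (G := fun z1 _ => avg2 z1 y2)) => //; meas.
have d3 : dom2 mu1 mu2 (fun z1 z2 => k t1 t2 y1 z1 y2 z2 * avg12 y1 y2).
  by apply/c2_dom2/(c2M (M := `|avg12 y1 y2|) (G := fun _ _ => avg12 y1 y2)) => //; meas.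
have e2 : part2 t1 t2 y1 y2 = bi_op f t1 t2 y1 y2 -
    \int[mu1]_z1 \int[mu2]_z2 (k t1 t2 y1 z1 y2 z2 * avg2 z1 y2).
  rewrite /bi_op -JJB// (fubini_dom (dom2B d1 d2)).
  by apply: eq_Rint => z2; apply: eq_Rint => z1; rewrite mulrBr.
have eM c z1 : \int[mu2]_z2 (k t1 t2 y1 z1 y2 z2 * c) = mass2 t1 t2 y1 z1 y2 * c.
  rewrite mulrC -RintZ; last exact: c1_ibl (c2_sec z1 ck).
  by apply: eq_Rint => z2; rewrite mulrC.
have e1 : part1 t1 t2 y1 y2 =
    \int[mu1]_z1 \int[mu2]_z2 (k t1 t2 y1 z1 y2 z2 * avg2 z1 y2) -
    mass t1 t2 y1 y2 * avg12 y1 y2.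
  have -> : mass t1 t2 y1 y2 * avg12 y1 y2 =
      \int[mu1]_z1 \int[mu2]_z2 (k t1 t2 y1 z1 y2 z2 * avg12 y1 y2).
    rewrite mulrC -RintZ; last exact: dom2_int (c2_dom2 ck).
    by apply: eq_Rint => z1; rewrite eM mulrC.
  rewrite -JJB//; apply: eq_Rint => z1.
  by rewrite -eM; apply: eq_Rint => z2; rewrite mulrBr.
by rewrite e2 e1; ring.
Qed.

End Decomposition.

(** For fixed [t2, y2, z2] the kernel maps functions of [z1] to functions of [(t1, y1)], and by the
    one-parameter theorem its norm is bounded by [N] times the decay in [y2 - z2]. Differences in
    [z2] gain their Holder factor in the same way, which makes it a cancellative kernel in the
    second variable. *)
Lemma part2_bound a b : 0 < a -> 0 < b -> exists2 C : R, 0 < C &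
  forall N k (f : Z1 -> Z2 -> R) (l1 l2 : R) M1 M2,
  0 < N -> bi_kernel a b N k -> 0 < l1 -> 0 < l2 -> c2 mu1 mu2 f ->
  (\sum_(j < M2) \int[leb]_t2 ((om (sc l2 j) t2)%:E *
     \int[mu2]_y2 \int[nu1]_s
       ((\sum_(i < M1) om (sc l1 i) s.1) * part2 k f (sc l2 j) s.1 t2 s.2 y2 ^+ 2)%:E)
   <= (C * N ^+ 2)%:E * nrm mu1 mu2 f)%E.
Proof.
move=> a0 b0; have [C1 C10 H1] := one_parameter_T1 lmu1 a0.
have [C2 C20 H2] := cancellative_bound lmu2 b0.
exists (C2 * C1); first exact: mulr_gt0.
move=> N k f l1 l2 M1 M2 N0 kk l10 l20 cf.
have [mk k1 k2] := kk; have mf := c2_mf cf.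
pose K t2 y2 z2 (s : R * Z1) z1 := oct M1 l1 s.1 * k s.1 t2 s.2 z1 y2 z2.
(* Integrability of the kernel sections is known at positive times; at all others [oct] vanishes. *)
have octM t1 (h : Z1 -> R) : (0 < t1 -> ibl mu1 h) ->
    \int[mu1]_z (oct M1 l1 t1 * h z) = oct M1 l1 t1 * \int[mu1]_z h z.
  have [t0|t0] := ltP 0 t1; first by move=> /(_ isT) ih; rewrite RintZ.
  move=> _; rewrite oct_neg// mul0r (eq_Rint _ (g := fun=> 0)) ?Rint0// => z.
  by rewrite mul0r.
have T1 N' (h : R -> Z1 -> Z1 -> R) (g : Z1 -> R) : 0 < N' -> t1_kernel mu1 a N' h -> c1 mu1 g ->
    (\int[nu1]_s ((\int[mu1]_w (oct M1 l1 s.1 * h s.1 s.2 w * g w)) ^+ 2)%:E <=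
     (C1 * N' ^+ 2)%:E * \int[mu1]_y (g y ^+ 2)%:E)%E.
  move=> N'0 hh cg; have [mh _ _ _] := hh; have mg := c1_mf cg.
  have [C0 _ Hd1] := decay_int lmu1 a0.
  apply: le_trans (H1 N' h l1 M1 g N'0 hh l10 cg).
  rewrite -(@int_octaves _ _ _ mu1 l1 M1 (fun _ t y => \int[mu1]_z (h t y z * g z))) //; last first.
    by move=> j; meas.
  apply: le_int => s; first by rewrite lee_fin sqr_ge0.
  rewrite lee_fin -mulr_suml -oct_sqr// -exprMn -octM//.
    by rewrite (eq_Rint _ (g := fun w => oct M1 l1 s.1 * (h s.1 s.2 w * g w)))// => w; rewrite mulrA.
  by move=> t0; apply/c1_ibl/c1MM => //; exact: (c1_k lmu1 a0 Hd1 hh).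
have moct (e : measure_display) (P : measurableType e) (g : P -> R) : measurable_fun setT g ->
  measurable_fun setT (fun p => oct M1 l1 (g p)) by exact: mf_oct.
have cK t : 0 < t -> canc_kernel nu1 mu1 b t (C1 * N ^+ 2) (K t).
  move=> t0; split.
  - by rewrite /K /mf4; apply: mfM; [apply: moct|]; meas.
  - move=> y s; exists (oct M1 l1 s.1 * N * s.1 ^- n) => z w.
    have o0 : 0 <= oct M1 l1 s.1 by apply: sumr_ge0 => i _; exact: powR_ge0.
    rewrite /K; have [s0|s0] := ltP 0 s.1; last by rewrite oct_neg// !mul0r normr0.
    rewrite normrM ger0_norm// -!mulrA; apply: ler_wpM2l => //.
    apply: le_trans (bi_size kk _ _ _ _ s0 t0) _; rewrite -mulrA ler_pM2l// mulrC.
    by rewrite ler_wpM2r ?(ltW (pdecay_gt0 _ _ _ _))// pdecay_le// ltW.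
  - move=> y z g cg; have [kt _] := k1 t y z t0.
    have N'0 : 0 < N * pdecay m b t (vsub y z) by rewrite mulr_gt0// pdecay_gt0.
    apply: le_trans (T1 _ _ _ N'0 kt cg) _.
    rewrite !muleA -!EFinM; apply: lee_wpmul2r; first by pos.
    by rewrite lee_fin le_eqVlt; apply/orP; left; apply/eqP; ring.
  - move=> y z z' r g r0 rt zz cg; have [_ /(_ z' r r0 rt zz) kt] := k1 t y z t0.
    have N'0 : 0 < N * ((r / t) `^ b * pdecay m b t (vsub y z)).
      by rewrite mulr_gt0// mulr_gt0 ?pdecay_gt0 ?powR_gt0 ?divr_gt0.
    apply: le_trans (le_trans (T1 _ _ _ N'0 kt cg) _).
      apply: le_int => s; first by rewrite lee_fin sqr_ge0.
      rewrite lee_fin (eq_Rint _ (g := fun w => oct M1 l1 s.1 *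
        (k s.1 t s.2 w y z - k s.1 t s.2 w y z') * g w))// => w.
      by rewrite /K mulrBr.
    rewrite !muleA -!EFinM; apply: lee_wpmul2r; first by pos.
    by rewrite lee_fin le_eqVlt; apply/orP; left; apply/eqP; ring.
have cN : 0 <= C1 * N ^+ 2 by rewrite mulr_ge0 ?(ltW C10)// sqr_ge0.
have h := H2 _ _ _ _ nu1 mu1 (C1 * N ^+ 2) K l2 M2 (fun y x => f x y) cN l20 cK (c2_swap cf).
rewrite -mulrA (_ : nrm mu1 mu2 f = nrm mu2 mu1 (fun y x => f x y)); last first.
  by rewrite /nrm tonelli//; [meas|pos].
apply: le_trans h; apply: lee_sum => j _; have sj := sc_gt0 l20 j.
have om1 t : (0 <= \sum_(i < M1) om (sc l1 i) t) by rewrite -oct_sqr// sqr_ge0.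
apply: le_int => t2.
  by apply: mule_ge0; [rewrite lee_fin om_ge0|apply: int_ge0 => y; apply: int_ge0 => s;
    rewrite lee_fin mulr_ge0// sqr_ge0].
have [->|o0] := eqVneq (om (sc l2 j) t2) 0; first by rewrite !mul0e.
have [t20 _ _] := om_neq0 sj o0.
apply: lee_wpmul2l; first by rewrite lee_fin om_ge0.
apply: le_int => y2; first by apply: int_ge0 => s; rewrite lee_fin mulr_ge0// sqr_ge0.
apply: le_int => s; first by rewrite lee_fin mulr_ge0// sqr_ge0.
rewrite lee_fin -oct_sqr// -exprMn le_eqVlt; apply/orP; left; apply/eqP; congr (_ ^+ 2).
rewrite /Rop /KH /part2 /K; have [t10|t10] := ltP 0 s.1; last first.
  rewrite oct_neg// mul0r [RHS](eq_Rint _ (g := fun=> 0)) ?Rint0// => z2.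
  by rewrite (eq_Rint _ (g := fun=> 0)) ?Rint0// => z1; rewrite !mul0r.
have d : dom2 mu2 mu1 (fun z2 z1 => k s.1 t2 s.2 z1 y2 z2 * (f z1 z2 - Ek mu2 (sc l2 j) (f z1) y2)).
  have [Mf hf] := c2_bounded cf; apply/c2_dom2/(@c2_swap (fun z1 z2 => _ * _)).
  apply: (@c2M _ _ (2 * Mf)); [by meas| |exact: (c2_bi_kernel a0 b0 kk)].
  move=> x z; apply: le_trans (ler_normB _ _) _; rewrite mulr2n mulrDl mul1r lerD//.
  by apply: Ek_bound => //; meas.
rewrite -RintZ; last exact: dom2_int d.
apply: eq_Rint => z2; rewrite -octM; last by move=> _; exact: dom2_sec d.
by apply: eq_Rint => z1; rewrite mulrA.
Qed.

(** The roles of the variables are exchanged. For fixed [t1, y1, z1] the operator in the second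
    variable multiplies averages by [mass2], so its norm comes from the paraproduct bound, applied
    also to differences in [z1]. *)
Lemma part1_bound a b : 0 < a -> 0 < b -> exists2 C : R, 0 < C &
  forall N k (f : Z1 -> Z2 -> R) (l1 l2 : R) M1 M2,
  0 < N -> bi_kernel a b N k -> 0 < l1 -> 0 < l2 -> c2 mu1 mu2 f ->
  (\sum_(i < M1) \int[leb]_t1 ((om (sc l1 i) t1)%:E *
     \int[mu1]_y1 \int[nu2]_s
       (\sum_(j < M2) om (sc l2 j) s.1 *
          part1 k f (sc l1 i) (sc l2 j) t1 s.1 y1 s.2 ^+ 2)%:E)
   <= (C * N ^+ 2)%:E * nrm mu1 mu2 f)%E.
Proof.
move=> a0 b0; have [C1 C10 H1] := paraproduct_bound lmu2 b0.
have [C2 C20 H2] := cancellative_bound lmu1 a0.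
have [C0 C00 Hd2] := decay_int lmu2 b0.
exists (C2 * C1); first exact: mulr_gt0.
move=> N k f l1 l2 M1 M2 N0 kk l10 l20 cf.
have [mk k1 k2] := kk; have mf := c2_mf cf.
(* The averaging scale depends on the time: [ow] is the averaging kernel of the octave containing
   [t], times the square root of its density. *)
pose ow (t : R) (y w : Z2) := \sum_(j < M2) sqom (sc l2 j) t * ek (sc l2 j) y w.
have mow : mf3 ow.
  by rewrite /ow /mf3; apply: mf_sum => j; apply: mfM; [apply: mf_sqom|apply: mf_ek]; meas.
have ow0 t y w : t <= 0 -> ow t y w = 0.
  by move=> t0; rewrite /ow big1// => j _; rewrite sqom_neg ?mul0r// sc_gt0.
have owE t y : exists c j, (forall w, ow t y w = c * ek (sc l2 j) y w) /\
    (forall X : nat -> R, \sum_(j < M2) om (sc l2 j) t * X j = c ^+ 2 * X j).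
  have [c [j [h1 h2]]] := octave_select M2 t l20; exists c, j; split => // w.
  by rewrite /ow (h1 (fun j => ek (sc l2 j) y w)).
have mm2 : mf5 (mass2 k) by rewrite /mass2; meas.
pose K t1 y1 z1 (s : R * Z2) w := mass2 k t1 s.1 y1 z1 s.2 * ow s.1 s.2 w.
have P N' (h : R -> Z2 -> Z2 -> R) (g : Z2 -> R) : 0 < N' -> t1_kernel mu2 b N' h -> c1 mu2 g ->
    (\int[nu2]_s ((\int[mu2]_w (th1 mu2 h s.1 s.2 * ow s.1 s.2 w * g w)) ^+ 2)%:E <=
     (C1 * N' ^+ 2)%:E * \int[mu2]_y (g y ^+ 2)%:E)%E.
  move=> N'0 hh cg; have [mh _ _ _] := hh; have mg := c1_mf cg; have mt := mf_th1 hh.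
  apply: le_trans (H1 N' h l2 M2 g N'0 hh l20 cg).
  rewrite -(@int_octaves _ _ _ mu2 l2 M2 (fun j t y => th1 mu2 h t y * Ek mu2 (sc l2 j) g y)) //; last first.
    by move=> j; meas.
  apply: le_int => s; first by rewrite lee_fin sqr_ge0.
  have [c [j [e1 e2]]] := owE s.1 s.2.
  rewrite lee_fin (e2 (fun j => (th1 mu2 h s.1 s.2 * Ek mu2 (sc l2 j) g s.2) ^+ 2)) -exprMn.
  rewrite le_eqVlt; apply/orP; left; apply/eqP; congr (_ ^+ 2).
  rewrite mulrA /Ek -RintZ; last exact: c1_ibl (c1_ekM lmu2 _ (sc_gt0 l20 j) cg).
  by apply: eq_Rint => w; rewrite e1; ring.
have cK t : 0 < t -> canc_kernel nu2 mu2 a t (C1 * N ^+ 2) (K t).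
  move=> t0; split.
  - by rewrite /K; meas.
  - move=> y s; have [s0|s0] := ltP 0 s.1; last first.
      by exists 0 => z w; rewrite /K ow0// mulr0 mul0r normr0.
    exists (N * C0 * \sum_(j < M2) sqom (sc l2 j) s.1 * (sc l2 j) ^- m) => z w.
    have p0 : 0 < pdecay n a t (vsub y z) by exact: pdecay_gt0.
    have [kt _] := k2 t y z t0.
    rewrite /K normrM mulrAC; apply: ler_pM => //.
      have Np : 0 < N * pdecay n a t (vsub y z) by rewrite mulr_gt0.
      apply: le_trans (th1_bound lmu2 b0 Hd2 Np kt _ s0) _.
      by rewrite mulrAC lexx.
    rewrite ger0_norm; last first.
      by apply: sumr_ge0 => j _; apply: mulr_ge0; [exact: powR_ge0|exact/ek_ge0/sc_gt0].
    by apply: ler_sum => j _; apply: ler_wpM2l; [exact: powR_ge0|exact/ek_bound/sc_gt0].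
  - move=> y z g cg; have [kt _] := k2 t y z t0.
    have N'0 : 0 < N * pdecay n a t (vsub y z) by rewrite mulr_gt0// pdecay_gt0.
    apply: le_trans (P _ _ _ N'0 kt cg) _.
    rewrite !muleA -!EFinM; apply: lee_wpmul2r; first by pos.
    by rewrite lee_fin le_eqVlt; apply/orP; left; apply/eqP; ring.
  - move=> y z z' r g r0 rt zz cg; have [kt0 /(_ z' r r0 rt zz) kt] := k2 t y z t0.
    have [kt1 _] := k2 t y z' t0.
    have N'0 : 0 < N * ((r / t) `^ a * pdecay n a t (vsub y z)).
      by rewrite mulr_gt0// mulr_gt0 ?pdecay_gt0 ?powR_gt0 ?divr_gt0.
    apply: le_trans (le_trans (P _ _ _ N'0 kt cg) _).
      apply: le_int => s; first by rewrite lee_fin sqr_ge0.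
      rewrite lee_fin le_eqVlt; apply/orP; left; apply/eqP; congr (_ ^+ 2).
      apply: eq_Rint => w; congr (_ * _); rewrite /K -mulrBl.
      have [s0|s0] := ltP 0 s.1; last by rewrite ow0// !mulr0.
      congr (_ * _); rewrite /th1 RintB//.
        exact: c1_ibl (c1_k lmu2 b0 Hd2 kt0 _ s0).
      exact: c1_ibl (c1_k lmu2 b0 Hd2 kt1 _ s0).
    rewrite !muleA -!EFinM; apply: lee_wpmul2r; first by pos.
    by rewrite lee_fin le_eqVlt; apply/orP; left; apply/eqP; ring.
have cN : 0 <= C1 * N ^+ 2 by rewrite mulr_ge0 ?(ltW C10)// sqr_ge0.
have h := H2 _ _ _ _ nu2 mu2 (C1 * N ^+ 2) K l1 M1 f cN l10 cK cf.
rewrite -mulrA; apply: le_trans h; apply: lee_sum => i _; have si := sc_gt0 l10 i.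
have om2 t (X : nat -> R) : 0 <= \sum_(j < M2) om (sc l2 j) t * X j ^+ 2.
  by apply: sumr_ge0 => j _; apply: mulr_ge0; [exact/om_ge0/sc_gt0|exact: sqr_ge0].
apply: le_int => t1.
  apply: mule_ge0; [by rewrite lee_fin om_ge0|apply: int_ge0 => y; apply: int_ge0 => s].
  by rewrite lee_fin; exact: (om2 _ (fun j => part1 k f (sc l1 i) (sc l2 j) t1 s.1 y s.2)).
have [->|o0] := eqVneq (om (sc l1 i) t1) 0; first by rewrite !mul0e.
have [t10 _ _] := om_neq0 si o0.
apply: lee_wpmul2l; first by rewrite lee_fin om_ge0.
apply: le_int => y1.
  apply: int_ge0 => s; rewrite lee_fin.
  exact: (om2 _ (fun j => part1 k f (sc l1 i) (sc l2 j) t1 s.1 y1 s.2)).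
apply: le_int => s.
  by rewrite lee_fin; exact: (om2 _ (fun j => part1 k f (sc l1 i) (sc l2 j) t1 s.1 y1 s.2)).
have [s0|s0] := ltP 0 s.1; last first.
  rewrite big1 ?lee_fin ?sqr_ge0// => j _; rewrite om_neg ?mul0r//; exact: sc_gt0.
have [c [j [e1 e2]]] := owE s.1 s.2; have sj := sc_gt0 l20 j.
rewrite (e2 (fun j => part1 k f (sc l1 i) (sc l2 j) t1 s.1 y1 s.2 ^+ 2)) -exprMn lee_fin.
rewrite le_eqVlt; apply/orP; left; apply/eqP; congr (_ ^+ 2).
have [Mf hf] := c2_bounded cf.
have bE (g : Z2 -> R) l y : 0 < l -> measurable_fun setT g -> (forall z, `|g z| <= Mf) -> `|Ek mu2 l g y| <= Mf.
  by move=> l0 mg hg; exact: Ek_bound.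
rewrite /part1 -RintZ; last first.
  have ci := c2_dom2 (c2_bi_kernel a0 b0 kk y1 s.2 t10 s0).
  apply: (@ibl_dom _ _ _ mu1 _ (fun z => 2 * Mf * `|mass2 k t1 s.1 y1 z s.2|)).
  + by rewrite /avg2 /avg12; meas.
  + move=> z; rewrite normrM mulrC ler_wpM2r//.
    apply: le_trans (ler_normB _ _) _; rewrite mulr2n mulrDl mul1r lerD//.
      by apply: bE => //; meas.
    apply: Ek_bound => //; first by rewrite /avg2; meas.
    by move=> x; apply: bE => //; meas.
  + exact/iblZ/ibl_norm/(dom2_int ci).
rewrite /Rop /KH; apply: eq_Rint => z1.
have cE := c2_Ek lmu1 si cf.
(* The averages commute, so the difference is the second-variable average of [f - E_1 f]; pulling
   that average out as an integral in [w] exhibits [Rop] for [K]. *)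
rewrite /avg12 -(Ek_comm _ _ si sj cf) /avg2 -EkB//; last 2 first.
- exact: c2_sec z1 cf.
- exact: (c2_sec y1 cE).
rewrite mulrA /Ek -RintZ; last first.
  by apply/c1_ibl/c1_ekM => //; apply: c1B; [exact: c2_sec z1 cf|exact: (c2_sec y1 cE)].
by apply: eq_Rint => w; rewrite /K e1; ring.
Qed.

Definition bi_carleson (l1 l2 : R) M1 M2 (A : R) (gam : nat -> nat -> Z1 -> Z2 -> \bar R) :=
  forall e : nat -> nat -> Z1 -> Z2 -> bool,
  (forall i j, mf2 (e i j)) ->
  (forall i j x x' y y', same (sc l1 i) x x' -> same (sc l2 j) y y' ->
     e i j x y = e i j x' y') ->
  (\int[mu1]_x \int[mu2]_y ((some_rect M1 M2 e x y)%:R : R)%:E < +oo)%E ->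
  (\sum_(i < M1) \sum_(j < M2)
     \int[mu1]_x \int[mu2]_y (gam i j x y * ((e i j x y)%:R : R)%:E)
   <= A%:E * \int[mu1]_x \int[mu2]_y ((some_rect M1 M2 e x y)%:R : R)%:E)%E.

(** Square of the image of 1, integrated over one pair of octaves at a fixed point. Its integral
    over a rectangle is what the Carleson coefficient of the rectangle will control. *)
Definition mass_density k l1 l2 i j y1 y2 : \bar R :=
  (\int[leb]_t2 \int[leb]_t1
     (om (sc l2 j) t2 * om (sc l1 i) t1 * mass k t1 t2 y1 y2 ^+ 2)%:E)%E.

Lemma Ek_quad (d : nat) (mu : {sigma_finite_measure set (Rn R d) -> \bar R}) l h x :
  is_lebesgue mu -> 0 < l -> c1 mu h -> (forall y, 0 <= h y) ->
  Ek mu l h x <= 4 ^+ d * Ek mu (4 * l) h x.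
Proof.
move=> lmu l0 ch h0; have l20 : 0 < 2 * l by rewrite mulr_gt0.
apply: le_trans (Ek_double lmu x l0 ch h0) _.
rewrite (_ : 4 = 2 * 2 :> R); last by ring.
by rewrite exprMn -!mulrA ler_wpM2l ?exprn_ge0//; exact: Ek_double.
Qed.

(** The Carleson condition lives on rectangles of sides [4 * s1] and [4 * s2], over which the
    octaves are Whitney regions; passing to these larger cells costs [4^n] and [4^m]. *)
Lemma avg12_bound f s1 s2 y1 y2 : 0 < s1 -> 0 < s2 -> c2 mu1 mu2 f ->
  `|avg12 f s1 s2 y1 y2| <= 4 ^+ n * 4 ^+ m *
    Ek mu1 (4 * s1) (fun x => Ek mu2 (4 * s2) (fun z => `|f x z|) y2) y1.
Proof.
move=> s10 s20 cf; have mf := c2_mf cf.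
have cf' : c2 mu1 mu2 (fun x z => `|f x z|).
  have [_ [v [w [cv cw h]]]] := cf; split; first by meas.
  by exists v, w; split => // x z; rewrite normr_id.
have s1' : 0 < 4 * s1 by rewrite mulr_gt0.
have s2' : 0 < 4 * s2 by rewrite mulr_gt0.
have cE F s : c2 mu1 mu2 F -> 0 < s -> c1 mu1 (fun x => Ek mu2 s (F x) y2).
  by move=> cF s0; exact: (c2_sec y2 (c2_Ek lmu2 s0 (c2_swap cF))).
apply: le_trans (Ek_norm lmu1 y1 s10 (cE f s2 cf s20)) _.
apply: (@le_trans _ _ (Ek mu1 s1 (fun x => 4 ^+ m * Ek mu2 (4 * s2) (fun z => `|f x z|) y2) y1)).
  apply: Ek_le => //; [exact/c1_norm/cE|exact/c1Z/cE|].
  move=> x; apply: le_trans (Ek_norm lmu2 y2 s20 (c2_sec x cf)) _.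
  by apply: Ek_quad => //; exact: c2_sec x cf'.
have ->: Ek mu1 s1 (fun x => 4 ^+ m * Ek mu2 (4 * s2) (fun z => `|f x z|) y2) y1 =
  4 ^+ m * Ek mu1 s1 (fun x => Ek mu2 (4 * s2) (fun z => `|f x z|) y2) y1.
  rewrite /Ek -RintZ; last exact: c1_ibl (c1_ekM lmu1 _ s10 (cE _ _ cf' s2')).
  by apply: eq_Rint => x; rewrite mulrCA.
rewrite [4 ^+ n * _]mulrC -mulrA ler_wpM2l ?exprn_ge0//.
by apply: Ek_quad => //; [exact: cE|move=> x; exact: Ek_ge0].
Qed.

Lemma tonelli4 (G : R -> R -> Z1 -> Z2 -> \bar R) : mf4 G ->
  (forall t1 t2 y1 y2, (0 <= G t1 t2 y1 y2)%E) ->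
  (\int[leb]_t1 \int[mu1]_y1 \int[leb]_t2 \int[mu2]_y2 G t1 t2 y1 y2 =
   \int[mu1]_y1 \int[mu2]_y2 \int[leb]_t2 \int[leb]_t1 G t1 t2 y1 y2)%E.
Proof.
move=> mG G0; rewrite tonelli; [|by meas|by pos].
apply: eq_int => y1.
transitivity (\int[leb]_t1 \int[mu2]_y2 \int[leb]_t2 G t1 t2 y1 y2)%E.
  by apply: eq_int => t1; rewrite tonelli//; meas.
rewrite tonelli; [|by meas|by pos].
by apply: eq_int => y2; rewrite tonelli//; meas.
Qed.

(** The average does not depend on the times, so integrating them first leaves [mass_density] times
    a squared average, the quantity of [biparameter_carleson] after the passage to the larger
    cells. *)
Lemma mass_part_bound k l1 l2 M1 M2 A f : mf6 k -> 0 < l1 -> 0 < l2 -> 0 <= A ->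
  bi_carleson (4 * l1) (4 * l2) M1 M2 A (mass_density k l1 l2) -> c2 mu1 mu2 f ->
  (\int[nu1]_u \int[nu2]_v (\sum_(i < M1) \sum_(j < M2)
     om (sc l1 i) u.1 * (om (sc l2 j) v.1 *
     (mass k u.1 v.1 u.2 v.2 * avg12 f (sc l1 i) (sc l2 j) u.2 v.2) ^+ 2))%:E
   <= ((4 ^+ n * 4 ^+ m) ^+ 2 * (16 * A))%:E * nrm mu1 mu2 f)%E.
Proof.
move=> mk l10 l20 A0 hA cf; have mf := c2_mf cf.
have mm : mf4 (mass k) by rewrite /mass /mass2; meas.
have ma i j : mf2 (avg12 f (sc l1 i) (sc l2 j)) by rewrite /avg12 /avg2; meas.
have o1 i t := om_ge0 t (sc_gt0 l10 i); have o2 j t := om_ge0 t (sc_gt0 l20 j).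
pose X i j t1 t2 y1 y2 := (mass k t1 t2 y1 y2 * avg12 f (sc l1 i) (sc l2 j) y1 y2) ^+ 2.
have mX i j : mf4 (X i j) by have mij := ma i j; rewrite /X; meas.
have X0 i j t1 t2 y1 y2 : 0 <= X i j t1 t2 y1 y2 by exact: sqr_ge0.
pose G i j t1 t2 y1 y2 := (om (sc l1 i) t1 * (om (sc l2 j) t2 * X i j t1 t2 y1 y2))%:E.
have mo d (P : measurableType d) l (g : P -> R) : measurable_fun setT g ->
   measurable_fun setT (fun p => om l (g p)) by exact: mf_om.
have mG i j : mf4 (G i j).
  have mij := mX i j; rewrite /G /mf4; apply/mfE/mfM; [apply: mo; meas|].
  by apply: mfM; [apply: mo|]; meas.
have G0 i j t1 t2 y1 y2 : (0 <= G i j t1 t2 y1 y2)%E.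
  by rewrite lee_fin; apply: mulr_ge0 => //; apply: mulr_ge0.
have mGu i j u : mf2 (fun t2 y2 => (X i j u.1 t2 u.2 y2)%:E) by have mij := mX i j; meas.
pose H i t1 y1 := (\sum_(j < M2) \int[leb]_t2 ((om (sc l2 j) t2)%:E *
   \int[mu2]_y2 (X i j t1 t2 y1 y2)%:E))%E.
have H0 i t1 y1 : (0 <= H i t1 y1)%E.
  apply: sume_ge0 => j _; apply: int_ge0 => t2; apply: mule_ge0; first by rewrite lee_fin.
  by apply: int_ge0 => y2; rewrite lee_fin.
have mH i : mf2 (H i).
  rewrite /H /mf2; apply: mf_sume => j; have mij := mX i j.
  by apply: mf_int; apply: mfMe; [apply/mfE/mo|]; meas.
have -> : (\int[nu1]_u \int[nu2]_v (\sum_(i < M1) \sum_(j < M2)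
     om (sc l1 i) u.1 * (om (sc l2 j) v.1 * X i j u.1 v.1 u.2 v.2))%:E =
   \sum_(i < M1) \int[leb]_t1 ((om (sc l1 i) t1)%:E * \int[mu1]_y1 H i t1 y1))%E.
  rewrite -int_octaves_ereal//; apply: eq_int => u; under eq_int do rewrite -sumEFin; rewrite int_sum; last 2 first.
  - move=> i; apply/mfE/mf_sum => j; have mij := mX i j.
    by rewrite -/(X i j _ _ _ _); apply: mfM; [|apply: mfM; [apply: mo|]]; meas.
  - move=> i v; rewrite lee_fin; apply: sumr_ge0 => j _.
    by apply: mulr_ge0 => //; apply: mulr_ge0 => //; exact: X0.
  apply: eq_bigr => i _.
  rewrite /H -(@int_octaves_ereal _ _ _ mu2 l2 M2 (fun j t2 y2 => (X i j u.1 t2 u.2 y2)%:E))//; last first.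
    by move=> j t2 y2; rewrite lee_fin; exact: X0.
  rewrite -[RHS]intZ//; last 2 first.
  - apply: mf_sume => j; have mij := mX i j.
    by apply: mfMe; [apply/mfE/mo|]; meas.
  - by move=> v; apply: sume_ge0 => j _; rewrite -EFinM lee_fin; apply: mulr_ge0.
  apply: eq_int => v; rewrite -mulr_sumr EFinM -sumEFin.
  by congr (_ * _)%E; apply: eq_bigr => j _; rewrite EFinM.
pose F x z := `|f x z|.
have cF : c2 mu1 mu2 F.
  have [_ [v [w [cv cw h]]]] := cf; split; first by rewrite /F; meas.
  by exists v, w; split => // x z; rewrite normr_id.
have mgam i j : mf2 (mass_density k l1 l2 i j).
  rewrite /mass_density /mf2; apply: mf_int; apply: mf_int; apply/mfE.
  by apply: mfM; [apply: mfM; apply: mo|]; meas.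
have gam0 i j x y : (0 <= mass_density k l1 l2 i j x y)%E.
  apply: int_ge0 => t2; apply: int_ge0 => t1; rewrite lee_fin.
  by apply: mulr_ge0; [exact: mulr_ge0|exact: sqr_ge0].
have l10' : 0 < 4 * l1 by rewrite mulr_gt0.
have l20' : 0 < 4 * l2 by rewrite mulr_gt0.
have F0 x z : 0 <= F x z by exact: normr_ge0.
have := biparameter_carleson lmu1 lmu2 l10' l20' A0 gam0 mgam hA cF F0.
set D := ((4 ^+ n * 4 ^+ m) ^+ 2) => hC.
apply: (@le_trans _ _ (D%:E * ((16 * A)%:E * \int[mu1]_x \int[mu2]_y (F x y ^+ 2)%:E))%E); last first.
  rewrite muleA -EFinM /nrm; apply: lee_wpmul2l; first by rewrite lee_fin mulr_ge0// ?sqr_ge0// mulr_ge0.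
  by apply: le_int => x; [pos|apply: le_int => y; [pos|rewrite lee_fin real_normK ?num_real]].
apply: le_trans (lee_wpmul2l _ hC); last by rewrite lee_fin sqr_ge0.
rewrite ge0_sume_distrr; last by move=> i _; apply: sume_ge0 => j _;
  apply: int_ge0 => x; apply: int_ge0 => y; rewrite mule_ge0// lee_fin sqr_ge0.
apply: lee_sum => i _; rewrite ge0_sume_distrr; last by move=> j _;
  apply: int_ge0 => x; apply: int_ge0 => y; rewrite mule_ge0// lee_fin sqr_ge0.
have -> : (\int[leb]_t1 ((om (sc l1 i) t1)%:E * \int[mu1]_y1 H i t1 y1) =
   \sum_(j < M2) \int[leb]_t1 \int[mu1]_y1 \int[leb]_t2 \int[mu2]_y2 G i j t1 t2 y1 y2)%E.
  rewrite -(@int_sum _ _ _ leb _ _ (fun (j : 'I_M2) t1 =>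
    \int[mu1]_y1 \int[leb]_t2 \int[mu2]_y2 G i j t1 t2 y1 y2))%E; last 2 first.
  - by move=> j; have mij := mG i j; meas.
  - by move=> j t1; apply: int_ge0 => y1; apply: int_ge0 => t2; apply: int_ge0 => y2.
  apply: eq_int => t1; rewrite -intZ//; last by have mi := mH i; meas.
  rewrite -(@int_sum _ _ _ mu1 _ _ (fun (j : 'I_M2) y1 =>
    \int[leb]_t2 \int[mu2]_y2 G i j t1 t2 y1 y2))%E; last 2 first.
  - by move=> j; have mij := mG i j; meas.
  - by move=> j y1; apply: int_ge0 => t2; apply: int_ge0 => y2.
  apply: eq_int => y1; rewrite /H ge0_sume_distrr; last first.
    move=> j _; apply: int_ge0 => t2; apply: mule_ge0; first by rewrite lee_fin.
    by apply: int_ge0 => y2; rewrite lee_fin.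
  apply: eq_bigr => j _; have mij := mX i j; rewrite -intZ//; last 2 first.
  - by apply: mfMe; [apply/mfE/mo|]; meas.
  - move=> t2; apply: mule_ge0; first by rewrite lee_fin.
    by apply: int_ge0 => y2; rewrite lee_fin.
  apply: eq_int => t2; rewrite muleA -EFinM -intZ; [|exact: mulr_ge0|by meas|]; last first.
    by move=> y2; rewrite lee_fin.
  by apply: eq_int => y2; rewrite /G -EFinM mulrA.
apply: lee_sum => j _; rewrite tonelli4//.
have mv : mf2 (V2 mu1 mu2 (4 * l1) (4 * l2) F i j) by have mF := c2_mf cF; rewrite /V2; meas.
rewrite -[leRHS]intZ; [|exact: sqr_ge0| |]; last 2 first.
- by have mg := mgam i j; meas.
- by move=> x; apply: int_ge0 => y; rewrite mule_ge0// lee_fin sqr_ge0.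
apply: le_int => y1; first by do 3 apply: int_ge0 => ?.
rewrite -[leRHS]intZ; [|exact: sqr_ge0| |]; last 2 first.
- by have mg := mgam i j; meas.
- by move=> y; rewrite mule_ge0// lee_fin sqr_ge0.
apply: le_int => y2; first by do 2 apply: int_ge0 => ?.
pose c := avg12 f (sc l1 i) (sc l2 j) y1 y2 ^+ 2.
have -> : (\int[leb]_t2 \int[leb]_t1 G i j t1 t2 y1 y2 = c%:E * mass_density k l1 l2 i j y1 y2)%E.
  rewrite /mass_density -intZ; [|exact: sqr_ge0| |]; last 2 first.
  - apply: mf_int; apply/mfE; rewrite /mf2.
    by apply: mfM; [apply: mfM; apply: mo|]; meas.
  - by move=> t2; apply: int_ge0 => t1; rewrite lee_fin; apply: mulr_ge0; [exact: mulr_ge0|exact: sqr_ge0].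
  apply: eq_int => t2; rewrite -intZ; [|exact: sqr_ge0| |]; last 2 first.
  - by apply/mfE; apply: mfM; [apply: mfM; apply: mo|]; meas.
  - by move=> t1; rewrite lee_fin; apply: mulr_ge0; [exact: mulr_ge0|exact: sqr_ge0].
  by apply: eq_int => t1; rewrite /G /X /c -EFinM exprMn; congr (_%:E); ring.
rewrite muleC muleCA; apply: lee_wpmul2l => //.
rewrite -EFinM lee_fin /c /D -exprMn; apply: sqr_le_norm.
have e4 (l : R) p : sc (4 * l) p = 4 * sc l p by rewrite /sc mulrCA.
rewrite /V2 !e4; apply: avg12_bound => //; exact: sc_gt0.
Qed.

(** The averages depend on the scales, so [f] is split anew for each pair of octaves;
    [(x + y + z)^2 <= 3 (x^2 + y^2 + z^2)] then separates the parts. *)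
Lemma biparameter_square_function a b : 0 < a -> 0 < b -> exists2 C : R, 0 < C &
  forall N A k (f : Z1 -> Z2 -> R) (l1 l2 : R) M1 M2,
  0 < N -> 0 <= A -> bi_kernel a b N k -> 0 < l1 -> 0 < l2 ->
  bi_carleson (4 * l1) (4 * l2) M1 M2 A (mass_density k l1 l2) -> c2 mu1 mu2 f ->
  (\int[nu1]_u \int[nu2]_v
     ((\sum_(i < M1) om (sc l1 i) u.1) * (\sum_(j < M2) om (sc l2 j) v.1) *
      bi_op k f u.1 v.1 u.2 v.2 ^+ 2)%:E
   <= (C * (N ^+ 2 + A))%:E * nrm mu1 mu2 f)%E.
Proof.
move=> a0 b0; have [C1 C10 H1] := part1_bound a0 b0.
have [C2 C20 H2] := part2_bound a0 b0.
pose C3 : R := (4 ^+ n * 4 ^+ m) ^+ 2 * 16.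
have C30 : 0 < C3 by rewrite mulr_gt0// exprn_gt0// mulr_gt0// exprn_gt0.
exists (3 * (C1 + C2 + C3)); first by rewrite mulr_gt0// addr_gt0// addr_gt0.
move=> N A k f l1 l2 M1 M2 N0 A0 kk l10 l20 hA cf; have mf := c2_mf cf.
have [mk _ _] := kk.
have o1 i t := om_ge0 t (sc_gt0 l10 i); have o2 j t := om_ge0 t (sc_gt0 l20 j).
have mo d (P : measurableType d) l (g : P -> R) : measurable_fun setT g ->
   measurable_fun setT (fun p => om l (g p)) by exact: mf_om.
pose W1 t := \sum_(i < M1) om (sc l1 i) t; pose W2 t := \sum_(j < M2) om (sc l2 j) t.
have W10 t : 0 <= W1 t by apply: sumr_ge0 => i _.
have W20 t : 0 <= W2 t by apply: sumr_ge0 => i _.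
have mW1 : measurable_fun setT W1 by apply: mf_sum => i; apply: mo; meas.
pose p1 i j := part1 k f (sc l1 i) (sc l2 j).
pose p2 j := part2 k f (sc l2 j).
pose p3 i j t1 t2 y1 y2 := mass k t1 t2 y1 y2 * avg12 f (sc l1 i) (sc l2 j) y1 y2.
have mp1 i j : mf4 (p1 i j) by rewrite /p1 /part1 /mass2 /avg12 /avg2; meas.
have mp2 j : mf4 (p2 j) by rewrite /p2 /part2; meas.
have mp3 i j : mf4 (p3 i j) by rewrite /p3 /mass /mass2 /avg12 /avg2; meas.
pose F1 (u : R * Z1) (v : R * Z2) := \sum_(i < M1) om (sc l1 i) u.1 *
  \sum_(j < M2) om (sc l2 j) v.1 * p1 i j u.1 v.1 u.2 v.2 ^+ 2.
pose F2 (u : R * Z1) (v : R * Z2) := \sum_(j < M2) om (sc l2 j) v.1 *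
  (W1 u.1 * p2 j u.1 v.1 u.2 v.2 ^+ 2).
pose F3 (u : R * Z1) (v : R * Z2) := \sum_(i < M1) \sum_(j < M2)
  om (sc l1 i) u.1 * (om (sc l2 j) v.1 * p3 i j u.1 v.1 u.2 v.2 ^+ 2).
have F10 u v : 0 <= F1 u v.
  by apply: sumr_ge0 => i _; apply: mulr_ge0 => //; apply: sumr_ge0 => j _;
    apply: mulr_ge0 => //; exact: sqr_ge0.
have F20 u v : 0 <= F2 u v.
  by apply: sumr_ge0 => j _; apply: mulr_ge0 => //; apply: mulr_ge0 => //; exact: sqr_ge0.
have F30 u v : 0 <= F3 u v.
  by apply: sumr_ge0 => i _; apply: sumr_ge0 => j _;
    apply: mulr_ge0 => //; apply: mulr_ge0 => //; exact: sqr_ge0.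
have mF1 : mf2 F1.
  rewrite /F1 /mf2; apply: mf_sum => i; apply: mfM; [apply: mo; meas|].
  by apply: mf_sum => j; have mj := mp1 i j; apply: mfM; [apply: mo|]; meas.
have mF2 : mf2 F2.
  rewrite /F2 /mf2; apply: mf_sum => j; have mj := mp2 j.
  by apply: mfM; [apply: mo|]; meas.
have mF3 : mf2 F3.
  rewrite /F3 /mf2; apply: mf_sum => i; apply: mf_sum => j; have mj := mp3 i j.
  by apply: mfM; [apply: mo|apply: mfM; [apply: mo|]]; meas.
have nf0 : (0 <= nrm mu1 mu2 f)%E by rewrite /nrm; pos.
apply: (@le_trans _ _ (\int[nu1]_u \int[nu2]_v
   (3%:E * ((F1 u v)%:E + (F2 u v)%:E + (F3 u v)%:E)))%E).
  have w00 (u : R * Z1) (v : R * Z2) := mulr_ge0 (mulr_ge0 (W10 u.1) (W20 v.1))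
    (sqr_ge0 (bi_op k f u.1 v.1 u.2 v.2)).
  apply: le_int => u; first by apply: int_ge0 => v; exact: w00.
  apply: le_int => v; first exact: w00.
  rewrite -!EFinD -EFinM lee_fin.
  rewrite mulr_suml mulr_suml !mulrDr /F1 /F2 /F3 /W1.
  under [X in _ + _ * X + _]eq_bigr do rewrite mulr_suml mulr_sumr.
  rewrite [X in _ + _ * X + _]exchange_big/= !mulr_sumr -!big_split/=.
  apply: ler_sum => i _; rewrite mulr_sumr mulr_suml !mulr_sumr -!big_split/=.
  apply: ler_sum => j _.
  rewrite -/(p1 i j _ _ _ _) -/(p2 j _ _ _ _) -/(p3 i j _ _ _ _).
  have [->|x1] := eqVneq (om (sc l1 i) u.1) 0; first by rewrite !(mul0r, mulr0, addr0).
  have [->|x2] := eqVneq (om (sc l2 j) v.1) 0; first by rewrite !(mul0r, mulr0, addr0).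
  have [t10 _ _] := om_neq0 (sc_gt0 l10 i) x1.
  have [t20 _ _] := om_neq0 (sc_gt0 l20 j) x2.
  rewrite (bi_op_split a0 b0 kk cf (sc l1 i) (sc_gt0 l20 j) _ _ t10 t20).
  rewrite -/(p1 i j _ _ _ _) -/(p2 j _ _ _ _) -/(p3 i j _ _ _ _).
  set x := p1 _ _ _ _ _ _; set y := p2 _ _ _ _ _; set z := p3 _ _ _ _ _ _.
  have w0 : 0 <= om (sc l1 i) u.1 * om (sc l2 j) v.1 by apply: mulr_ge0.
  rewrite [leRHS](_ : _ = om (sc l1 i) u.1 * om (sc l2 j) v.1 * (3 * (x ^+ 2 + y ^+ 2 + z ^+ 2))).
    apply: ler_wpM2l => //.
    have := sqr_ge0 (x - y); have := sqr_ge0 (x - z); have := sqr_ge0 (y - z).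
    by move=> h1 h2 h3; nra.
  by ring.
have e3 u : (\int[nu2]_v (3%:E * ((F1 u v)%:E + (F2 u v)%:E + (F3 u v)%:E)) =
   3%:E * (\int[nu2]_v (F1 u v)%:E + \int[nu2]_v (F2 u v)%:E + \int[nu2]_v (F3 u v)%:E))%E.
  rewrite intZ//; [|by meas|by move=> v; rewrite -!EFinD lee_fin !addr_ge0].
  rewrite intD; [|by meas|by meas|by move=> v; rewrite -EFinD lee_fin addr_ge0|by move=> v; rewrite lee_fin].
  by rewrite intD; [|by meas|by meas|by move=> v; rewrite lee_fin|by move=> v; rewrite lee_fin].
have i0 (F : R * Z1 -> R * Z2 -> R) u : (forall u v, 0 <= F u v) -> (0 <= \int[nu2]_v (F u v)%:E)%E.
  by move=> F0; apply: int_ge0 => v; rewrite lee_fin.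
have -> : (\int[nu1]_u \int[nu2]_v (3%:E * ((F1 u v)%:E + (F2 u v)%:E + (F3 u v)%:E)) =
   3%:E * (\int[nu1]_u \int[nu2]_v (F1 u v)%:E + \int[nu1]_u \int[nu2]_v (F2 u v)%:E +
     \int[nu1]_u \int[nu2]_v (F3 u v)%:E))%E.
  under eq_int do rewrite e3.
  rewrite intZ//; [|by meas|by move=> u; apply: adde_ge0; [apply: adde_ge0|]; exact: i0].
  rewrite intD; [|by meas|by meas|by move=> u; apply: adde_ge0; exact: i0|by move=> u; exact: i0].
  by rewrite intD; [|by meas|by meas|by move=> u; exact: i0|by move=> u; exact: i0].
rewrite -mulrA EFinM -muleA; apply: lee_wpmul2l => //.
apply: (@le_trans _ _ ((C1 * N ^+ 2)%:E * nrm mu1 mu2 f + (C2 * N ^+ 2)%:E * nrm mu1 mu2 f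
  + (C3 * A)%:E * nrm mu1 mu2 f)%E); last first.
  have N20 : 0 <= N ^+ 2 by exact: sqr_ge0.
  have q1 := mulr_ge0 (ltW C10) N20; have q2 := mulr_ge0 (ltW C20) N20.
  have q3 := mulr_ge0 (ltW C30) A0.
  rewrite -!ge0_muleDl ?adde_ge0 ?lee_fin//.
  rewrite -!EFinD; apply: lee_wpmul2r => //; rewrite lee_fin.
  have : 0 <= C1 * A by rewrite mulr_ge0// ltW.
  have : 0 <= C2 * A by rewrite mulr_ge0// ltW.
  have : 0 <= C3 * N ^+ 2 by rewrite mulr_ge0// ltW.
  by move=> *; lra.
apply: leeD; [apply: leeD|].
- apply: le_trans (H1 N k f l1 l2 M1 M2 N0 kk l10 l20 cf).
  rewrite -(@int_octaves_ereal _ _ _ mu1 l1 M1 (fun i t1 y1 => \int[nu2]_v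
     (\sum_(j < M2) om (sc l2 j) v.1 * p1 i j t1 v.1 y1 v.2 ^+ 2)%:E)%E) //; last 2 first.
  + move=> i; apply: mf_int; apply/mfE/mf_sum => j; have mj := mp1 i j.
    by apply: mfM; [apply: mo|]; meas.
  + move=> i t1 y1; apply: int_ge0 => v; rewrite lee_fin; apply: sumr_ge0 => j _.
    by apply: mulr_ge0 => //; exact: sqr_ge0.
  apply: le_int => u; first exact: i0.
  rewrite /F1; under eq_int do rewrite -sumEFin.
  rewrite int_sum; last 2 first.
  + move=> i; apply/mfE/mfM; first by meas.
    by apply: mf_sum => j; have mj := mp1 i j; apply: mfM; [apply: mo|]; meas.
  + move=> i v; rewrite lee_fin; apply: mulr_ge0 => //; apply: sumr_ge0 => j _.
    by apply: mulr_ge0 => //; exact: sqr_ge0.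
  apply: lee_sum => i _; rewrite -intZ//; last 2 first.
  + by apply/mfE/mf_sum => j; have mj := mp1 i j; apply: mfM; [apply: mo|]; meas.
  + move=> v; rewrite lee_fin; apply: sumr_ge0 => j _.
    by apply: mulr_ge0 => //; exact: sqr_ge0.
- apply: le_trans (H2 N k f l1 l2 M1 M2 N0 kk l10 l20 cf).
  rewrite tonelli; [|by meas|by move=> u v; rewrite lee_fin].
  rewrite -(@int_octaves_ereal _ _ _ mu2 l2 M2 (fun j t2 y2 => \int[nu1]_u
     (W1 u.1 * p2 j u.1 t2 u.2 y2 ^+ 2)%:E)%E) //; last 2 first.
  + by move=> j; have mj := mp2 j; meas.
  + move=> j t2 y2; apply: int_ge0 => u; rewrite lee_fin.
    by apply: mulr_ge0 => //; exact: sqr_ge0.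
  apply: le_int => v; first by apply: int_ge0 => u; rewrite lee_fin.
  rewrite /F2; under eq_int do rewrite -sumEFin.
  rewrite int_sum; last 2 first.
  + by move=> j; have mj := mp2 j; meas.
  + move=> j u; rewrite lee_fin; apply: mulr_ge0 => //.
    by apply: mulr_ge0 => //; exact: sqr_ge0.
  apply: lee_sum => j _; rewrite -intZ//; last 2 first.
  + by have mj := mp2 j; meas.
  + by move=> u; rewrite lee_fin; apply: mulr_ge0 => //; exact: sqr_ge0.
- apply: le_trans (mass_part_bound mk l10 l20 A0 hA cf) _.
  by rewrite /C3 mulrA lexx.
Qed.

End Biparameter.

(** * Kernels satisfying the assumptions *)

Lemma sqrte_le_sqr (R : realType) (X : \bar R) (Y : R) :
  (0 <= X)%E -> (sqrte X <= Y%:E)%E -> (X <= (Y ^+ 2)%:E)%E.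
Proof.
case: X => [r| |] //=; rewrite !lee_fin => r0 h.
by rewrite -(sqr_sqrtr r0) lerXn2r ?nnegrE ?sqrtr_ge0// (le_trans _ h)// sqrtr_ge0.
Qed.

Section WeightMass.
Context {R : realType} {n : nat}.
Variable mu : {sigma_finite_measure set (Rn R n) -> \bar R}.
Hypothesis lmu : is_lebesgue mu.
Local Notation Z := (Rn R n).
Local Notation leb := (@lebesgue_measure R).

Lemma wgt_ge0 lam t (u : 'rV[R]_n) : 0 <= wgt n lam t u.
Proof. exact: powR_ge0. Qed.

Lemma mf_wgt {d} {P : measurableType d} lam (t : P -> R) (f : P -> Z) :
  measurable_fun setT t -> measurable_fun setT f ->
  measurable_fun setT (fun p => wgt n lam (t p) (f p)).
Proof. by move=> mt mf; rewrite /wgt; meas. Qed.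

Lemma wgt_ge lam t c (u : Z) : 0 < t -> 0 <= c -> 0 <= lam -> ninf u <= c * t ->
  ((1 + c)^-1) `^ (n%:R * lam) <= wgt n lam t u.
Proof.
move=> t0 c0 l0 h; have u0 := ninf_ge0 u.
apply: powR_le; [exact: mulr_ge0|by rewrite invr_ge0 addr_ge0|].
have h1 : 0 < 1 + c by rewrite ltr_wpDr.
have h2 : 0 < t + ninf u by rewrite ltr_wpDr.
by rewrite ler_pdivlMr// ler_pdivrMl//; nra.
Qed.

(** Lower bound of the weight at distance at most [t / 2], times [2^(-n)] from the volume
    [(t / 2)^n] of a cube. *)
Definition wgt_const (lam : R) : R := (1 + 2^-1)^-1 `^ (n%:R * lam) * 2 ^- n.

Lemma wgt_const_gt0 lam : 0 < wgt_const lam.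
Proof. by rewrite mulr_gt0// powR_gt0// invr_gt0 addr_gt0. Qed.

(** From any point [u] of a cell of side [l > t] one can move by up to [t / 2] in each coordinate
    and stay inside, towards the farther wall. The vector [a] picks this direction coordinatewise,
    which gives a cube of side [t / 2] of admissible [y]. *)
Lemma wgt_mass lam t l x (u : Z) : 0 <= lam -> 0 < t -> t < l -> same l x u ->
  ((wgt_const lam * t ^+ n)%:E <=
   \int[mu]_y ((same l x (vadd u y))%:R * wgt n lam t y)%:E)%E.
Proof.
move=> lam0 t0 tl sxu; have l0 := lt_trans t0 tl.
pose c := corner l x; have bu : box c (c + const_mx l) u by exact/same_box.
pose a : 'rV[R]_n := \row_i (if co i u - c ord0 i < l / 2 then 0 else - (t / 2)).
have t20 : 0 <= t / 2 by rewrite divr_ge0// ltW.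
have hb (y : Z) : box a (a + const_mx (t / 2)) y ->
    same l x (vadd u y) /\ ninf y <= 2^-1 * t.
  move=> hy; split.
    apply/same_box => // i; have := hy i; have := bu i; rewrite !mxE -/c /co.
    by case: ifP => h /andP[h1 h2] /andP[h3 h4]; apply/andP; split; lra.
  apply/ninf_leP; first by rewrite mulr_ge0// ltW.
  move=> i; have := hy i; rewrite !mxE ler_norml.
  by case: ifP => h /andP[h3 h4]; apply/andP; split; lra.
rewrite (_ : wgt_const lam * t ^+ n = (1 + 2^-1)^-1 `^ (n%:R * lam) * (t / 2) ^+ n); last first.
  by rewrite /wgt_const expr_div_n -mulrA [2 ^- n * _]mulrC.
rewrite EFinM -(vol_const a t20) -lmu -integral_cst; last exact: measurable_box.
rewrite integral_mkcond; apply: le_int => y.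
  by rewrite patchE; case: ifP => // _; rewrite lee_fin powR_ge0.
rewrite patchE; case: ifPn => [|_]; last by rewrite lee_fin mulr_ge0// powR_ge0.
rewrite inE => /hb[-> h]; rewrite mul1r lee_fin; exact: wgt_ge.
Qed.

(* Only translation invariance is used: with the order of integration exchanged,
   [x1 = u + y1] turns the double integral into a convolution with the weight. *)
Lemma testing_untwist lam (A : R) (H : R -> 'rV[R]_n -> Z -> R[i]) (k : R -> Z -> Z -> R) l x :
  0 <= lam -> 0 < l -> mf3 k ->
  (forall t u, 0 < t -> (\int[mu]_z ((same l x z)%:R * k t u z)) ^+ 2 <=
     cabs (cint mu (cube (corner l x) l) (H t u)) ^+ 2) ->
  (lhs2_1 mu lam (corner l x) l H <= A%:E)%E ->
  (\int[leb]_t ((((0 < t) && (t < l))%R%:R / t)%:E *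
      \int[mu]_y (((same l x y)%:R *
        (\int[mu]_z ((same l x z)%:R * k t y z)) ^+ 2)%R)%:E)
     <= ((wgt_const lam)^-1 * A ^+ 2)%:E)%E.
Proof.
move=> lam0 l0 mk hk /sqrte_le_sqr hA.
pose G t u := (\int[mu]_z ((same l x z)%:R * k t u z)) ^+ 2.
have mG : mf2 G by rewrite /G; meas.
have G0 t u : 0 <= G t u by exact: sqr_ge0.
have kap := wgt_const_gt0 lam.
have cubeE : cube (corner l x) l = [set z : Z | same l x z].
  apply/seteqP; split => z.
    by move=> h; apply/same_box => // i; have := h i; rewrite !mxE.
  by move=> /same_box h i; have := h l0 i; rewrite !mxE.
have oE : oitv 0 l = [set t : R | (0 < t) && (t < l)].
  by apply/seteqP; split => t; rewrite /oitv /= in_itv.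
pose Q t : \bar R := ((((0 < t) && (t < l))%R%:R : R)%:E *
  \int[mu]_(x1 in cube (corner l x) l) \int[mu]_y
      (G t (vsub x1 y) * wgt n lam t y / t ^+ n.+1)%:E)%E.
pose P t : \bar R := ((wgt_const lam)%:E * ((((0 < t) && (t < l))%R%:R / t)%:E *
     \int[mu]_y (((same l x y)%:R * (\int[mu]_z ((same l x z)%:R * k t y z)) ^+ 2)%R)%:E))%E.
have key t : (P t <= Q t)%E.
  rewrite /P /Q.
  case: andP => [[t0 tl]|_]; last by rewrite mul0r !mul0e mule0.
  rewrite mul1e mul1r.
  have -> : (\int[mu]_(x1 in cube (corner l x) l) \int[mu]_y
      (G t (vsub x1 y) * wgt n lam t y / t ^+ n.+1)%:E =
     \int[mu]_x1 \int[mu]_y ((same l x x1)%:R * (G t (vsub x1 y) * wgt n lam t y / t ^+ n.+1))%:E)%E.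
    rewrite integral_mkcond; apply: eq_int => x1; rewrite patchE cubeE.
    case: ifPn => [|/negP]; rewrite inE => sx.
      by apply: eq_int => y; rewrite sx mul1r.
    rewrite [RHS](eq_int _ (g := fun=> 0%E)) ?integral0// => y.
    by rewrite (negPf (introN idP sx)) mul0r.
  have w0 (y : Z) : 0 <= wgt n lam t y by exact: wgt_ge0.
  have mw : measurable_fun setT (wgt n lam t : Z -> R) by apply: mf_wgt; meas.
  have tn : 0 <= (t ^+ n.+1)^-1 by rewrite invr_ge0 exprn_ge0// ltW.
  have p0 (b : bool) u (y : Z) : 0 <= b%:R * (G t u * wgt n lam t y / t ^+ n.+1).
    by apply: mulr_ge0 => //; apply: mulr_ge0 => //; apply: mulr_ge0.
  rewrite tonelli; last 2 first.
  - by meas.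
  - by move=> x1 y; rewrite lee_fin p0.
  have -> : (\int[mu]_y \int[mu]_x1 ((same l x x1)%:R * (G t (vsub x1 y) * wgt n lam t y / t ^+ n.+1))%:E =
     \int[mu]_y \int[mu]_u ((same l x (vadd u y))%:R * (G t u * wgt n lam t y / t ^+ n.+1))%:E)%E.
    apply: eq_int => y; rewrite -(int_shift lmu y); last 2 first.
    - by meas.
    - by move=> x1; rewrite lee_fin p0.
    by apply: eq_int => u; rewrite /vsub /vadd addrK.
  rewrite tonelli; last 2 first.
  - by meas.
  - by move=> y u; rewrite lee_fin p0.
  rewrite muleA -EFinM -intZ; last 3 first.
  - by rewrite mulr_ge0 ?(ltW kap)// invr_ge0 ltW.
  - by meas.
  - by move=> y; rewrite lee_fin mulr_ge0// sqr_ge0.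
  have kt0 : 0 <= wgt_const lam / t by apply: mulr_ge0; rewrite ?invr_ge0 ltW.
  apply: le_int => u.
    by rewrite -EFinM lee_fin; apply: mulr_ge0 => //; apply: mulr_ge0 => //; exact: sqr_ge0.
  have [sxu|_] := boolP (same l x u); last first.
    by rewrite mul0r mule0; apply: int_ge0 => y; rewrite lee_fin p0.
  rewrite mul1r -/(G t u).
  have -> : (\int[mu]_y ((same l x (vadd u y))%:R * (G t u * wgt n lam t y / t ^+ n.+1))%:E =
     (G t u / t ^+ n.+1)%:E * \int[mu]_y ((same l x (vadd u y))%:R * wgt n lam t y)%:E)%E.
    rewrite -intZ; last 3 first.
    - exact: mulr_ge0.
    - by meas.
    - by move=> y; rewrite lee_fin mulr_ge0.
    by apply: eq_int => y; rewrite -EFinM; congr (_%:E); ring.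
  (* The weight integrates to at least a multiple of [t^n], which reduces [t^(n+1)] to the [1 / t]
     of the unweighted condition. *)
  apply: le_trans (lee_wpmul2l _ (wgt_mass lam0 t0 tl sxu)); last first.
    by rewrite lee_fin; apply: mulr_ge0.
  rewrite -!EFinM lee_fin le_eqVlt; apply/orP; left; apply/eqP.
  by rewrite exprS; field; rewrite ?gt_eqF// exprn_gt0.
rewrite -(@lee_pmul2l _ (wgt_const lam)%:E)//.
rewrite -[leRHS]EFinM mulrA mulfV ?gt_eqF// mul1r -intZ; last 3 first.
- exact: ltW.
- by meas.
- move=> t; apply: mule_ge0; last by pos.
  by rewrite lee_fin; case: andP => [[t0 _]|_]; rewrite ?mul0r// mul1r invr_ge0 ltW.
have c0 t x1 (y : Z) : 0 < t ->
    0 <= cabs (cint mu (cube (corner l x) l) (H t ((x1 : 'rV[R]_n) - y))) ^+ 2 *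
      wgt n lam t (y : 'rV[R]_n) / t ^+ n.+1.
  move=> t0; apply: mulr_ge0; last by rewrite invr_ge0 exprn_ge0// ltW.
  by apply: mulr_ge0; [exact: sqr_ge0|exact: wgt_ge0].
apply: le_trans (hA _); last first.
  apply: integral_ge0 => t; rewrite oE /= => /andP[t0 _]; apply: integral_ge0 => x1 _.
  by apply: integral_ge0 => y _; rewrite lee_fin; exact: c0.
apply: (@le_trans _ _ (\int[leb]_t Q t)%E).
  apply: (@le_int _ _ _ leb P Q) => t; last exact: key.
  rewrite /P muleA -EFinM; apply: mule_ge0; last by pos.
  rewrite lee_fin mulr_ge0 ?(ltW kap)//.
  by case: andP => [[t0 _]|_]; rewrite ?mul0r// mul1r invr_ge0 ltW.
rewrite [leRHS]integral_mkcond; apply: le_int => t; rewrite /Q.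
  case: andP => [[t0 _]|_]; last by rewrite mul0e.
  rewrite mul1e; apply: integral_ge0 => x1 _; apply: int_ge0 => y.
  rewrite lee_fin; apply: mulr_ge0; last by rewrite invr_ge0 exprn_ge0// ltW.
  by apply: mulr_ge0 => //; exact: wgt_ge0.
rewrite patchE oE; case: ifPn => [|/negP]; rewrite inE /= => ht; last first.
  by rewrite (negPf (introN idP ht)) mul0e.
rewrite ht mul1e; have /andP[t0 _] := ht.
have tn : 0 <= (t ^+ n.+1)^-1 by rewrite invr_ge0 exprn_ge0// ltW.
apply: le_int_in => x1 _.
  apply: int_ge0 => y; rewrite lee_fin; apply: mulr_ge0 => //.
  by apply: mulr_ge0 => //; exact: wgt_ge0.
apply: le_int => y.
  rewrite lee_fin; apply: mulr_ge0 => //; apply: mulr_ge0 => //; exact: wgt_ge0.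
rewrite lee_fin; apply: ler_wpM2r => //; apply: ler_wpM2r; [exact: wgt_ge0|exact: hk].
Qed.

End WeightMass.

Arguments wgt_const {R} n lam.

Section RealPart.
Context {R : realType}.

(** A boolean selects the real or the imaginary part, so that one argument covers both. *)
Definition pr (b : bool) (z : R[i]) : R := if b then complex.Re z else complex.Im z.

Lemma pr_le b z : `|pr b z| <= cabs z.
Proof.
rewrite /cabs; case: b => /=.
  by rewrite -sqrtr_sqr ler_wsqrtr// lerDl sqr_ge0.
by rewrite -sqrtr_sqr ler_wsqrtr// lerDr sqr_ge0.
Qed.

Lemma prB b z w : pr b (z - w) = pr b z - pr b w.
Proof. by case: b z w => -[? ?] [? ?]. Qed.

Lemma pr_sqr z : cabs z ^+ 2 = pr true z ^+ 2 + pr false z ^+ 2.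
Proof. by rewrite /cabs sqr_sqrtr// addr_ge0// sqr_ge0. Qed.

Lemma pr_cint {d} {T : measurableType d} b (mu : {measure set T -> \bar R}) D
    (h : T -> R[i]) : pr b (cint mu D h) = \int[mu]_(x in D) pr b (h x).
Proof. by case: b. Qed.

End RealPart.

Section TestedKernel.
Context {R : realType} {n : nat}.
Variable mu : {sigma_finite_measure set (Rn R n) -> \bar R}.
Hypothesis lmu : is_lebesgue mu.
Local Notation Z := (Rn R n).

Lemma pholder_le a t r (h u : 'rV[R]_n) : 0 < t -> 0 <= a -> ninf h < r ->
  pholder n a t h u <= (r / t) `^ a * pdecay n a t u.
Proof.
move=> t0 a0 hr; have h0 := ninf_ge0 h; have r0 := le_lt_trans h0 hr.
rewrite /pholder /pdecay mulrA -powRM ?divr_ge0 ?(ltW t0) ?(ltW r0)//.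
rewrite divfK ?gt_eqF//; apply: ler_wpM2r; first by rewrite invr_ge0 powR_ge0.
by apply: powR_le => //; exact: ltW.
Qed.

Lemma tested_t1_kernel lam a A B N b (k : R -> Z -> Z -> R) (H : R -> 'rV[R]_n -> Z -> R[i]) :
  0 <= lam -> 0 <= B -> (wgt_const n lam)^-1 * A ^+ 2 <= N ^+ 2 -> mf3 k ->
  (forall t u z, 0 < t -> k t u z = pr b (H t u z)) ->
  (forall t y z, 0 < t -> `|k t y z| <= N * B * pdecay n a t (vsub y z)) ->
  (forall t y z z' r, 0 < t -> 0 < r -> r <= t / 2 -> ninf (vsub z z') < r ->
     `|k t y z - k t y z'| <= N * B * (r / t) `^ a * pdecay n a t (vsub y z)) ->
  (forall c l, 0 < l -> (lhs2_1 mu lam c l H <= (A * Num.sqrt (l ^+ n) * B)%:E)%E) ->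
  t1_kernel mu a (N * B) k.
Proof.
move=> lam0 B0 hN mk kH ks kh ht; split => // l x l0.
apply: le_trans (testing_untwist lmu lam0 l0 mk _ (ht (corner l x) l l0)) _.
  move=> t u t0; apply: sqr_le_norm; apply: le_trans (pr_le b _).
  rewrite pr_cint [X in _ <= `|X|]Rintegral_mkcond.
  rewrite (@eq_Rint _ _ _ mu _ ((fun z => pr b (H t u z)) \_ (cube (corner l x) l)))// => z.
  rewrite patchE; case: ifPn => [|/negP]; rewrite inE => hz.
    rewrite (_ : same l x z) ?mul1r ?kH//; apply/same_box => // i.
    by have := hz i; rewrite !mxE.
  rewrite (_ : same l x z = false) ?mul0r//; apply/negbTE/negP => /same_box h; apply: hz => i.
  by have := h l0 i; rewrite !mxE.
rewrite lee_fin !exprMn sqr_sqrtr ?exprn_ge0 ?(ltW l0)//.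
have -> : (wgt_const n lam)^-1 * (A ^+ 2 * l ^+ n * B ^+ 2) =
  (wgt_const n lam)^-1 * A ^+ 2 * (B ^+ 2 * l ^+ n) by ring.
rewrite -[leRHS]mulrA; apply: (ler_wpM2r _ hN).
by apply: mulr_ge0; [exact: sqr_ge0|exact/exprn_ge0/ltW].
Qed.

End TestedKernel.

Section KernelOfAssumptions.
Context {R : realType} {n m : nat}.
Variables (mu1 : {sigma_finite_measure set (Rn R n) -> \bar R})
  (mu2 : {sigma_finite_measure set (Rn R m) -> \bar R}).
Hypotheses (lmu1 : is_lebesgue mu1) (lmu2 : is_lebesgue mu2).
Local Notation Z1 := (Rn R n).
Local Notation Z2 := (Rn R m).
Variables (lam1 lam2 a b A1 A2 N : R) (K : gkernel R n m).
Hypotheses (lam10 : 0 <= lam1) (lam20 : 0 <= lam2) (a0 : 0 < a) (b0 : 0 < b)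
  (mK : kernel_measurable K) (hA1 : assumption1 a b A1 K)
  (hA2 : assumption2 mu1 mu2 lam1 lam2 a b A2 K).
Hypotheses (N0 : 0 < N) (N1 : A1 <= N)
  (N21 : (wgt_const n lam1)^-1 * A2 ^+ 2 <= N ^+ 2)
  (N22 : (wgt_const m lam2)^-1 * A2 ^+ 2 <= N ^+ 2).

(** Extended by 0 to nonpositive times: [K] is measurable on positive times, whereas the integrals
    in [t] below run over the whole line. *)
Definition real_kernel (e : bool) (t1 t2 : R) (y1 z1 : Z1) (y2 z2 : Z2) : R :=
  ((0 < t1) && (0 < t2))%:R * pr e (K t1 t2 (y1, y2) (z1, z2)).

Lemma real_kernelE e t1 t2 y1 z1 y2 z2 : 0 < t1 -> 0 < t2 ->
  real_kernel e t1 t2 y1 z1 y2 z2 = pr e (K t1 t2 (y1, y2) (z1, z2)).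
Proof. by move=> t10 t20; rewrite /real_kernel t10 t20 mul1r. Qed.

Lemma mf_real_kernel e : mf6 (real_kernel e).
Proof.
pose D := [set q : (R * R) * (Rnm R n m * Rnm R n m) | 0 < q.1.1 /\ 0 < q.1.2].
pose h (q : (R * R) * (Rnm R n m * Rnm R n m)) := pr e (K q.1.1 q.1.2 q.2.1 q.2.2).
have mD : measurable D.
  rewrite (_ : D = setT `&` (fun q => (0 < q.1.1) && (0 < q.1.2)) @^-1` [set true]).
    by apply: (_ : measurable_fun setT _) => //; meas.
  by apply/seteqP; split => q /=; [move=> [-> ->]|move=> [_ /andP[]]].
have mh : measurable_fun D h.
  by rewrite /h; move: (e) => e'; case: mK => h1 h2; rewrite /pr; case: e'.
have {}mh : measurable_fun setT (h \_ D) by apply/(measurable_restrictT _ mD).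
have -> : mf6 (real_kernel e) = measurable_fun setT
   (fun q : R * R * Z1 * Z1 * Z2 * Z2 => (h \_ D) ((q.1.1.1.1.1, q.1.1.1.1.2),
     ((q.1.1.1.2, q.1.2), (q.1.1.2, q.2)))).
  rewrite /mf6; congr measurable_fun; apply/funext => q; rewrite patchE /real_kernel.
  case: ifPn => [|/negP]; rewrite inE /D /= => hq.
    by case: hq => -> ->; rewrite mul1r.
  by case: andP => [//|_]; rewrite mul0r.
by apply: (mf1_comp mh); meas.
Qed.

Let pN t2 (y2 z2 : Z2) : 0 < t2 -> 0 <= pdecay m b t2 (vsub y2 z2).
Proof. by move=> t0; exact/ltW/pdecay_gt0. Qed.
Let pM t1 (y1 z1 : Z1) : 0 < t1 -> 0 <= pdecay n a t1 (vsub y1 z1).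
Proof. by move=> t0; exact/ltW/pdecay_gt0. Qed.

Lemma real_bi_kernel e : bi_kernel mu1 mu2 a b N (real_kernel e).
Proof.
have mk := mf_real_kernel e.
have half r t : 0 < r -> r <= t / 2 -> 0 < t by move=> r0 h; have := lt_le_trans r0 h; rewrite pmulr_lgt0.
have wr (x y z c : R) : 0 <= y -> 0 <= z -> x <= c * y * z -> c <= N -> x <= N * y * z.
  move=> y_0 z_0 h cN; apply: le_trans h _; apply: ler_wpM2r => //.
  exact: ler_wpM2r.
(* No sign of [A2] is given, so it is replaced by its absolute value before the right-hand side is
   enlarged. *)
have ht (X : \bar R) (s B B' : R) : 0 <= s -> 0 <= B -> B <= B' ->
    (X <= (A2 * s * B)%:E)%E -> (X <= (`|A2| * s * B')%:E)%E.
  move=> s0 B0 BB h; apply: le_trans h _; rewrite lee_fin.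
  apply: (@le_trans _ _ (`|A2| * s * B)).
    by apply: ler_wpM2r => //; apply: ler_wpM2r => //; exact: ler_norm.
  by apply: ler_wpM2l => //; apply: mulr_ge0.
have n21 : (wgt_const n lam1)^-1 * `|A2| ^+ 2 <= N ^+ 2 by rewrite real_normK ?num_real.
have n22 : (wgt_const m lam2)^-1 * `|A2| ^+ 2 <= N ^+ 2 by rewrite real_normK ?num_real.
have q0 (r t s : R) : 0 <= (r / t) `^ s by exact: powR_ge0.
split => //.
- move=> t2 y2 z2 t20; have p2 := pN y2 z2 t20; split.
  + apply: (@tested_t1_kernel _ _ _ lmu1 lam1 a `|A2| _ _ e _
      (fun t1 u z1 => K t1 t2 (u, y2) (z1, z2))) => //.
    * by meas.
    * by move=> t1 u z1 t10; rewrite real_kernelE.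
    * move=> t1 y1 z1 t10; rewrite real_kernelE//; apply: le_trans (pr_le _ _) _.
      have p1 := pM y1 z1 t10; rewrite mulrAC; apply: (wr _ _ _ A1) => //.
      by have [h _] := hA1 t10 t20 (y1, y2) (z1, z2) (z1, z2).
    * move=> t1 y1 z1 z1' r t10 r0 rt hz; rewrite !real_kernelE// -prB.
      apply: le_trans (pr_le _ _) _; have p1 := pM y1 z1 t10.
      have h1 := pholder_le (y1 - z1) t10 (ltW a0) hz.
      rewrite (_ : _ * _ * _ * _ = N * ((r / t1) `^ a * pdecay n a t1 (vsub y1 z1)) *
        pdecay m b t2 (vsub y2 z2)); last by ring.
      have h10 : 0 <= pholder n a t1 (vsub z1 z1') (y1 - z1).
        by rewrite /pholder mulr_ge0 ?powR_ge0// invr_ge0 powR_ge0.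
      apply: le_trans (wr _ _ _ A1 h10 p2 _ N1) _.
        have [_ [_ [_ h]]] := hA1 t10 t20 (y1, y2) (z1, z2) (z1', z2).
        exact: h (lt_le_trans hz rt).
      by apply: ler_wpM2r => //; rewrite ler_pM2l.
    (* The condition involves [x2 - y2], so the given point is written as [y2 - 0]; [z2'] receives
       the dummy value [z2]. *)
    * move=> c l l0; have [/(_ c l l0 y2 0 z2 z2 t2 t20)[h _] _] := hA2.
      by rewrite subr0 in h; apply: ht h.
  + move=> z2' r r0 rt hz.
    have h2 := pholder_le (y2 - z2) t20 (ltW b0) hz.
    have h20 : 0 <= pholder m b t2 (vsub z2 z2') (y2 - z2).
      by rewrite /pholder mulr_ge0 ?powR_ge0// invr_ge0 powR_ge0.
    apply: (@tested_t1_kernel _ _ _ lmu1 lam1 a `|A2| _ _ e _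
      (fun t1 u z1 => K t1 t2 (u, y2) (z1, z2) - K t1 t2 (u, y2) (z1, z2'))) => //.
    * exact: mulr_ge0.
    * by meas.
    * by move=> t1 u z1 t10; rewrite !real_kernelE// prB.
    * move=> t1 y1 z1 t10; rewrite !real_kernelE// -prB; apply: le_trans (pr_le _ _) _.
      have p1 := pM y1 z1 t10; rewrite mulrAC.
      apply: le_trans (wr _ _ _ A1 p1 h20 _ N1) _.
        have [_ [_ [h _]]] := hA1 t10 t20 (y1, y2) (z1, z2) (z1, z2').
        exact: h (lt_le_trans hz rt).
      by apply: ler_wpM2l => //; apply: mulr_ge0 => //; exact: ltW.
    * move=> t1 y1 z1 z1' r' t10 r'0 rt' hz'; rewrite !real_kernelE// -!prB.
      have p1 := pM y1 z1 t10.
      have h1 := pholder_le (y1 - z1) t10 (ltW a0) hz'.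
      have h10 : 0 <= pholder n a t1 (vsub z1 z1') (y1 - z1).
        by rewrite /pholder mulr_ge0 ?powR_ge0// invr_ge0 powR_ge0.
      apply: le_trans (pr_le _ _) _.
      rewrite (_ : N * _ * _ * _ = N * ((r' / t1) `^ a * pdecay n a t1 (vsub y1 z1)) *
        ((r / t2) `^ b * pdecay m b t2 (vsub y2 z2))); last by ring.
      apply: le_trans (wr _ _ _ A1 h10 h20 _ N1) _.
        have [_ [h _]] := hA1 t10 t20 (y1, y2) (z1, z2) (z1', z2').
        rewrite opprB addrA addrAC; exact: h (lt_le_trans hz' rt') (lt_le_trans hz rt).
      by apply: ler_pM => //; [apply: mulr_ge0 => //; exact: ltW|rewrite ler_pM2l].
    * move=> c l l0; have [/(_ c l l0 y2 0 z2 z2' t2 t20)[_ h] _] := hA2.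
      have {h} := h (lt_le_trans hz rt); rewrite subr0 => h; exact: ht h.
- move=> t1 y1 z1 t10; have p1 := pM y1 z1 t10; split.
  + apply: (@tested_t1_kernel _ _ _ lmu2 lam2 b `|A2| _ _ e _
      (fun t2 u z2 => K t1 t2 (y1, u) (z1, z2))) => //.
    * by meas.
    * by move=> t2 u z2 t20; rewrite real_kernelE.
    * move=> t2 y2 z2 t20; rewrite real_kernelE//; apply: le_trans (pr_le _ _) _.
      have p2 := pN y2 z2 t20; apply: (wr _ _ _ A1) => //.
      by have [h _] := hA1 t10 t20 (y1, y2) (z1, z2) (z1, z2).
    * move=> t2 y2 z2 z2' r t20 r0 rt hz; rewrite !real_kernelE// -prB.
      apply: le_trans (pr_le _ _) _; have p2 := pN y2 z2 t20.
      have h2 := pholder_le (y2 - z2) t20 (ltW b0) hz.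
      have h20 : 0 <= pholder m b t2 (vsub z2 z2') (y2 - z2).
        by rewrite /pholder mulr_ge0 ?powR_ge0// invr_ge0 powR_ge0.
      apply: le_trans (wr _ _ _ A1 p1 h20 _ N1) _.
        have [_ [_ [h _]]] := hA1 t10 t20 (y1, y2) (z1, z2) (z1, z2').
        exact: h (lt_le_trans hz rt).
      by rewrite -[leRHS]mulrA; apply: ler_wpM2l => //; apply: mulr_ge0 => //; exact: ltW.
    * move=> c l l0; have [_ /(_ c l l0 y1 0 z1 z1 t1 t10)[h _]] := hA2.
      by rewrite subr0 in h; apply: ht h.
  + move=> z1' r r0 rt hz.
    have h1 := pholder_le (y1 - z1) t10 (ltW a0) hz.
    have h10 : 0 <= pholder n a t1 (vsub z1 z1') (y1 - z1).
      by rewrite /pholder mulr_ge0 ?powR_ge0// invr_ge0 powR_ge0.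
    apply: (@tested_t1_kernel _ _ _ lmu2 lam2 b `|A2| _ _ e _
      (fun t2 u z2 => K t1 t2 (y1, u) (z1, z2) - K t1 t2 (y1, u) (z1', z2))) => //.
    * exact: mulr_ge0.
    * by meas.
    * by move=> t2 u z2 t20; rewrite !real_kernelE// prB.
    * move=> t2 y2 z2 t20; rewrite !real_kernelE// -prB; apply: le_trans (pr_le _ _) _.
      have p2 := pN y2 z2 t20.
      apply: le_trans (wr _ _ _ A1 h10 p2 _ N1) _.
        have [_ [_ [_ h]]] := hA1 t10 t20 (y1, y2) (z1, z2) (z1', z2).
        exact: h (lt_le_trans hz rt).
      by apply: ler_wpM2r => //; rewrite ler_pM2l.
    * move=> t2 y2 z2 z2' r' t20 r'0 rt' hz'; rewrite !real_kernelE// -!prB.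
      have p2 := pN y2 z2 t20.
      have h2 := pholder_le (y2 - z2) t20 (ltW b0) hz'.
      have h20 : 0 <= pholder m b t2 (vsub z2 z2') (y2 - z2).
        by rewrite /pholder mulr_ge0 ?powR_ge0// invr_ge0 powR_ge0.
      apply: le_trans (pr_le _ _) _; rewrite -[leRHS]mulrA.
      apply: le_trans (wr _ _ _ A1 h10 h20 _ N1) _.
        have [_ [h _]] := hA1 t10 t20 (y1, y2) (z1, z2) (z1', z2').
        rewrite opprB addrA addrAC [X in X + _]addrAC.
        exact: h (lt_le_trans hz rt) (lt_le_trans hz' rt').
      by apply: ler_pM => //; [apply: mulr_ge0 => //; exact: ltW|rewrite ler_pM2l].
    * move=> c l l0; have [_ /(_ c l l0 y1 0 z1 z1' t1 t10)[_ h]] := hA2.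
      have {h} := h (lt_le_trans hz rt); rewrite subr0 => h; exact: ht h.
Qed.

End KernelOfAssumptions.

(** * From Carleson coefficients of dyadic rectangles to selections of cells *)

Section CarlesonOfAssumptions.
Context {R : realType} {n m : nat}.
Variables (mu1 : {sigma_finite_measure set (Rn R n) -> \bar R})
  (mu2 : {sigma_finite_measure set (Rn R m) -> \bar R})
  (muP : {measure set (Rnm R n m) -> \bar R}).
Hypotheses (lmu1 : is_lebesgue mu1) (lmu2 : is_lebesgue mu2) (lmuP : is_lebesgue2 muP).
Local Notation Z1 := (Rn R n).
Local Notation Z2 := (Rn R m).
Local Notation leb := (@lebesgue_measure R).

Lemma Rint_lebesgue2 (F : Z1 -> Z2 -> R) : dom2 mu1 mu2 F ->
  \int[muP]_z F z.1 z.2 = \int[mu1]_x \int[mu2]_y F x y.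
Proof.
move=> dF; rewrite -JJ_prod// /Rintegral; congr fine.
exact: (int_lebesgue2 lmu1 lmu2 lmuP).
Qed.

Lemma int_lebesgue2_iter (F : Z1 -> Z2 -> \bar R) : mf2 F -> (forall x y, (0 <= F x y)%E) ->
  (\int[muP]_z F z.1 z.2 = \int[mu1]_x \int[mu2]_y F x y)%E.
Proof.
by move=> mF F0; rewrite (int_lebesgue2 lmu1 lmu2 lmuP) tonelli_prod.
Qed.

Lemma tonelli_time_space (G : R -> R -> Z1 -> Z2 -> \bar R) : mf4 G ->
  (forall t1 t2 y1 y2, (0 <= G t1 t2 y1 y2)%E) ->
  (\int[leb]_t2 \int[leb]_t1 \int[mu1]_y1 \int[mu2]_y2 G t1 t2 y1 y2 =
   \int[mu1]_y1 \int[mu2]_y2 \int[leb]_t2 \int[leb]_t1 G t1 t2 y1 y2)%E.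
Proof.
move=> mG G0; rewrite tonelli; [|by meas|by pos].
rewrite -(tonelli4 mu1 mu2 mG G0); apply: (@eq_int _ _ _ leb) => t1.
by apply: (@tonelli _ _ _ _ _ leb mu1); [meas|pos].
Qed.

(** The octaves of [om] are half-open and the Whitney regions open; they differ by an endpoint of
    measure 0. *)
Lemma int_octave (s : R) (F : R -> \bar R) : measurable_fun setT F ->
  (\int[leb]_(t in oitv (2 * s) (4 * s)) ((t^-1)%:E * F t) =
   \int[leb]_t ((om s t)%:E * F t))%E.
Proof.
move=> mF; rewrite /oitv -(integral_itv_bndoo true true); last first.
  by apply: measurable_funTS; meas.
rewrite integral_mkcond; apply: eq_int => t; rewrite patchE /om.
case: ifPn => [|/negP]; rewrite inE /= in_itv/= => h; first by rewrite h mul1r.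
by rewrite (negPf (introN idP h)) mul0r mul0e.
Qed.

(** The lower corner of a dyadic cube, used as its representative for [same]. *)
Definition cell_point (d : nat) (k : int) (j : 'rV[int]_d) : Rn R d :=
  \row_i ((2 : R) ^ k * (j ord0 i)%:~R).

Lemma dcubeE (d : nat) (k : int) (j : 'rV[int]_d) :
  dcube (0 : 'rV[R]_d) k j = [set z : Rn R d | same (2 ^ k) (cell_point k j) z].
Proof.
have k0 : 0 < (2 : R) ^ k by rewrite exprz_gt0.
have e : corner (2 ^ k) (cell_point k j) = \row_i ((2 : R) ^ k * (j ord0 i)%:~R).
  apply/rowP => i; rewrite !mxE /co /cell_point mxE [_ * _ / _]mulrC mulKf ?gt_eqF//.
  by rewrite /fl intrKfloor.
apply/seteqP; split => z.
  move=> h; apply/same_box => // i; have := h i.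
  by rewrite e !mxE add0r.
by move=> /(same_box _ _ k0) h i; have := h i; rewrite e !mxE add0r.
Qed.

Lemma measurable_dcube (d : nat) k (j : 'rV[int]_d) :
  measurable (dcube (0 : 'rV[R]_d) k j : set (Rn R d)).
Proof.
rewrite dcubeE; rewrite (_ : [set z | _] = setT `&` (same (2 ^ k) (cell_point k j)) @^-1` [set true]).
  by apply: (_ : measurable_fun setT _) => //; apply: mf_same; meas.
by rewrite setTI.
Qed.

Lemma measure_dcube (d : nat) (mu : {sigma_finite_measure set (Rn R d) -> \bar R}) k (j : 'rV[int]_d) :
  is_lebesgue mu -> mu (dcube (0 : 'rV[R]_d) k j) = ((2 ^ k) ^+ d)%:E.
Proof.
move=> lmu; have k0 : 0 < (2 : R) ^ k by rewrite exprz_gt0.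
rewrite -(vol_const (\row_i ((0 : 'rV[R]_d) ord0 i + (2 : R) ^ k * (j ord0 i)%:~R)) (ltW k0)) -lmu.
congr (mu _); apply/seteqP; split => z h i; have := h i.
  by rewrite !mxE.
by rewrite !mxE.
Qed.

Section CellBound.
Variables (lam1 lam2 a b N : R) (K : gkernel R n m) (e : bool).
Hypotheses (lam10 : 0 <= lam1) (lam20 : 0 <= lam2) (a0 : 0 < a) (b0 : 0 < b)
  (kk : bi_kernel mu1 mu2 a b N (real_kernel K e)).
Local Notation ms := (mass mu1 mu2 (real_kernel K e)).

Lemma mass_le_theta t1 t2 y1 y2 : 0 < t1 -> 0 < t2 ->
  ms t1 t2 y1 y2 ^+ 2 <= cabs (theta muP K t1 t2 (@Defs.one_fun R n m) (y1, y2)) ^+ 2.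
Proof.
move=> t10 t20; apply: sqr_le_norm; apply: le_trans (pr_le e _).
have d := c2_dom2 (c2_bi_kernel lmu1 lmu2 a0 b0 kk y1 y2 t10 t20).
rewrite /theta pr_cint /mass /mass2 -(Rint_lebesgue2 d).
rewrite (@eq_Rint _ _ _ muP _ (fun z => pr e (K t1 t2 (y1, y2) z * @Defs.one_fun R n m z)))// => -[z1 z2].
by rewrite real_kernelE// /Defs.one_fun mulr1.
Qed.

(** Lower bound for the two weights when [x] and [y] lie in one cell of side [l] and [t > l / 2]:
    then [|x - y| < l < 2 t], whence the 2. *)
Definition cell_const : R := (1 + 2)^-1 `^ (n%:R * lam1) * (1 + 2)^-1 `^ (m%:R * lam2).

Lemma cell_const_gt0 : 0 < cell_const.
Proof. by rewrite mulr_gt0// powR_gt0// invr_gt0 addr_gt0. Qed.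

Definition octave_density s1 s2 y1 y2 : \bar R :=
  (\int[leb]_t2 \int[leb]_t1 (om s2 t2 * om s1 t1 * ms t1 t2 y1 y2 ^+ 2)%:E)%E.

(** In the coefficient, [y] is restricted to the rectangle itself, where the weights are at least
    [cell_const]. The integrals in [x1] and [x2] over the sides then give at least [t1^n] and
    [t2^m], leaving the measures [dt / t]. *)
Lemma CIJ_ge s1 s2 k1 j1 k2 j2 : 4 * s1 = 2 ^ k1 -> 4 * s2 = 2 ^ k2 ->
  (cell_const%:E * \int[mu1]_x \int[mu2]_y
     (((same (2 ^ k1) (cell_point k1 j1) x)%:R *
       (same (2 ^ k2) (cell_point k2 j2) y)%:R)%:E * octave_density s1 s2 x y)
   <= CIJ mu1 mu2 muP lam1 lam2 K 0 0 k1 j1 k2 j2)%E.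
Proof.
move=> hs1 hs2.
have L1 : 0 < (2 : R) ^ k1 by rewrite exprz_gt0.
have L2 : 0 < (2 : R) ^ k2 by rewrite exprz_gt0.
have s10 : 0 < s1 by rewrite -(pmulr_rgt0 s1 (_ : 0 < 4)) ?hs1.
have s20 : 0 < s2 by rewrite -(pmulr_rgt0 s2 (_ : 0 < 4)) ?hs2.
have c0 := ltW cell_const_gt0.
have mk : mf6 (real_kernel K e) by case: kk.
have mms : mf4 ms by rewrite /mass /mass2; meas.
pose b1 y1 := same (2 ^ k1) (cell_point k1 j1) y1.
pose b2 y2 := same (2 ^ k2) (cell_point k2 j2) y2.
have mb1 : measurable_fun setT b1 by apply: mf_same; meas.
have mb2 : measurable_fun setT b2 by apply: mf_same; meas.
pose g t1 t2 y1 y2 := (b1 y1)%:R * (b2 y2)%:R * ms t1 t2 y1 y2 ^+ 2.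
have g0 t1 t2 y1 y2 : 0 <= g t1 t2 y1 y2.
  by apply: mulr_ge0; [exact: mulr_ge0|exact: sqr_ge0].
have mg : mf4 g by rewrite /g; meas.
pose Phi t1 t2 : \bar R := (\int[mu1]_y1 \int[mu2]_y2 (g t1 t2 y1 y2)%:E)%E.
have Phi0 t1 t2 : (0 <= Phi t1 t2)%E by rewrite /Phi; pos.
have mPhi : mf2 Phi by rewrite /Phi; meas.
have o1E : oitv (2 ^ k1 / 2) (2 ^ k1) = oitv (2 * s1) (4 * s1).
  by rewrite -hs1; congr (oitv _ _); field.
have o2E : oitv (2 ^ k2 / 2) (2 ^ k2) = oitv (2 * s2) (4 * s2).
  by rewrite -hs2; congr (oitv _ _); field.
have mo d (P : measurableType d) l (h : P -> R) : measurable_fun setT h ->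
   measurable_fun setT (fun p => om l (h p)) by exact: mf_om.
pose V t2 : \bar R := (\int[leb]_(t1 in oitv (2 * s1) (4 * s1))
   ((t1^-1)%:E * (cell_const%:E * Phi t1 t2)))%E.
have VE t2 : V t2 = (\int[leb]_t1 ((om s1 t1)%:E * (cell_const%:E * Phi t1 t2)))%E.
  by rewrite /V int_octave//; meas.
have V0 t2 : (0 <= V t2)%E.
  by rewrite VE; apply: int_ge0 => t1; rewrite mule_ge0 ?lee_fin ?om_ge0// mule_ge0.
have mV : measurable_fun setT V.
  rewrite (_ : V = fun t2 => (\int[leb]_t1 ((om s1 t1)%:E * (cell_const%:E * Phi t1 t2)))%E).
    by apply: mf_int; apply: mfMe; [apply/mfE/mo|]; meas.
  by apply/funext.
apply: (@le_trans _ _ (\int[leb]_(t2 in oitv (2 * s2) (4 * s2)) ((t2^-1)%:E * V t2))%E).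
  rewrite int_octave//; pose G t1 t2 y1 y2 := (om s2 t2 * om s1 t1 * g t1 t2 y1 y2)%:E.
  have G0 t1 t2 y1 y2 : (0 <= G t1 t2 y1 y2)%E.
    by rewrite lee_fin; apply: mulr_ge0 => //; apply: mulr_ge0; exact: om_ge0.
  have mG : mf4 G by apply/mfE/mfM; [apply: mfM; apply: mo|]; meas.
  have mms' y1 y2 : mf2 (fun t2 t1 => (om s2 t2 * om s1 t1 * ms t1 t2 y1 y2 ^+ 2)%:E).
    by apply/mfE/mfM; [apply: mfM; apply: mo|]; meas.
  have mms0 t1 t2 y1 y2 : (0 <= (om s2 t2 * om s1 t1 * ms t1 t2 y1 y2 ^+ 2)%:E)%E.
    by rewrite lee_fin; apply: mulr_ge0; [apply: mulr_ge0; exact: om_ge0|exact: sqr_ge0].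
  have -> : (\int[mu1]_x \int[mu2]_y (((b1 x)%:R * (b2 y)%:R)%:E * octave_density s1 s2 x y) =
      \int[mu1]_x \int[mu2]_y \int[leb]_t2 \int[leb]_t1 G t1 t2 x y)%E.
    apply: eq_int => x; apply: eq_int => y; have mxy := mms' x y.
    rewrite /octave_density -intZ; [|exact: mulr_ge0|by apply: mf_int|by move=> t2; apply: int_ge0].
    apply: eq_int => t2; rewrite -intZ; [|exact: mulr_ge0| |by move=> t1]; last first.
      by apply/mfE/mfM; [apply: mfM; apply: mo|]; meas.
    by apply: eq_int => t1; rewrite -EFinM /G /g; congr (_%:E); ring.
  have G2 t2 : (0 <= \int[leb]_t1 \int[mu1]_y1 \int[mu2]_y2 G t1 t2 y1 y2)%E.
    by apply: int_ge0 => t1; apply: int_ge0 => y1; exact: int_ge0.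
  rewrite -tonelli_time_space// -intZ//; last first.
    by apply: mf_int; apply: mf_int; apply: mf_int; apply: (mf4_comp mG); meas.
  apply: le_int => t2; first by rewrite mule_ge0// lee_fin.
  have G3 t1 : (0 <= \int[mu1]_y1 \int[mu2]_y2 G t1 t2 y1 y2)%E.
    by apply: int_ge0 => y1; exact: int_ge0.
  rewrite -[leLHS]intZ//; last by apply: mf_int; apply: mf_int; apply: (mf4_comp mG); meas.
  rewrite VE -[leRHS]intZ ?om_ge0//; last 2 first.
  - by apply: mfMe; [apply/mfE/mo|]; meas.
  - by move=> t1; rewrite mule_ge0 ?lee_fin ?om_ge0// mule_ge0.
  apply: le_int => t1; first by rewrite mule_ge0// lee_fin.
  rewrite [X in (X <= _)%E](_ : _ = cell_const%:E * ((om s2 t2 * om s1 t1)%:E * Phi t1 t2))%E.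
    by rewrite !muleA -!EFinM; apply: lee_wpmul2r => //; rewrite lee_fin le_eqVlt;
      apply/orP; left; apply/eqP; ring.
  congr (_ * _)%E; have o12 : 0 <= om s2 t2 * om s1 t1 by apply: mulr_ge0; exact: om_ge0.
  rewrite /Phi -intZ; [|by []|by meas|by pos].
  by apply: eq_int => y1; rewrite -intZ; [apply: eq_int => y2; rewrite -EFinM|by []|by meas|by pos].
rewrite /CIJ /= o1E o2E.
have ot (s t : R) : 0 < s -> oitv (2 * s) (4 * s) t -> [/\ 0 < t, 2 * s < t & t < 4 * s].
  rewrite /oitv /= in_itv/= => s0 /andP[h1 h2]; split => //.
  by apply: lt_trans h1; rewrite mulr_gt0.
have w2 (d : nat) (l lam t : R) (x y : Rn R d) : 0 <= lam -> 0 < l -> l / 2 < t ->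
    same l x y -> (1 + 2)^-1 `^ (d%:R * lam) <= wgt d lam t ((x : 'rV[R]_d) - y).
  move=> lam0 l0 lt sxy; apply: wgt_ge => //; first by apply: lt_trans lt; rewrite divr_gt0.
  by apply/ltW/(lt_trans (same_ninf l0 sxy)); move: lt; rewrite ltr_pdivrMr// mulrC.
have mus1 : mu1 (dcube (0 : 'rV[R]_n) k1 j1) = (((2 : R) ^ k1) ^+ n)%:E by exact: measure_dcube.
have mus2 : mu2 (dcube (0 : 'rV[R]_m) k2 j2) = (((2 : R) ^ k2) ^+ m)%:E by exact: measure_dcube.
have md1 : measurable (dcube (0 : 'rV[R]_n) k1 j1 : set Z1) by exact: measurable_dcube.
have md2 : measurable (dcube (0 : 'rV[R]_m) k2 j2 : set Z2) by exact: measurable_dcube.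
apply: le_int_in => t2 /(ot _ _ s20)[t20 ht2 ht2'].
  by apply: mule_ge0; rewrite ?lee_fin ?invr_ge0 ?(ltW t20).
(* integrating the constant over the cell gains [|J| / t2 ^ m >= 1] *)
apply: (@le_trans _ _ (\int[mu2]_(x2 in dcube (0 : 'rV[R]_m) k2 j2)
   ((t2 ^- m / t2)%:E * V t2))%E).
  rewrite integral_cst// [X in (_ <= _ * X)%E]mus2 muleAC -EFinM.
  apply: lee_wpmul2r => //; rewrite lee_fin.
  rewrite -mulrA [X in _ <= _ * X]mulrC mulrA ler_pMl ?invr_gt0//.
  by rewrite mulrC ler_pdivlMr ?exprn_gt0// mul1r lerXn2r ?nnegrE ?(ltW t20) ?(ltW L2)// -hs2 ltW.
apply: le_int_in => x2 /= hx2.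
  by apply: mule_ge0 => //; rewrite lee_fin mulr_ge0// invr_ge0 ?exprn_ge0// ltW.
have {}hx2 : b2 x2 by move: hx2; rewrite dcubeE.
have t2m : 0 <= t2 ^- m / t2 by rewrite mulr_ge0// invr_ge0 ?exprn_ge0// ltW.
have tPhi : (0 <= t2 ^- m / t2)%R by [].
rewrite /V -ge0_integralZl; last 3 first.
- by apply: measurable_funTS; meas.
- by move=> t1 /(ot _ _ s10)[t10 _ _]; apply: mule_ge0; rewrite ?mule_ge0// lee_fin invr_ge0 ltW.
- by [].
apply: le_int_in => t1 /(ot _ _ s10)[t10 ht1 ht1'].
  by apply: mule_ge0 => //; apply: mule_ge0; rewrite ?mule_ge0// lee_fin invr_ge0 ltW.
have t1n : 0 <= t1^-1 by rewrite invr_ge0 ltW.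
have t2n : 0 <= t2^-1 by rewrite invr_ge0 ltW.
have tnm : 0 <= (t1 ^+ n * t2 ^+ m)^-1 by rewrite invr_ge0 mulr_ge0// exprn_ge0// ltW.
have ct : 0 <= cell_const / (t1 ^+ n * t2 ^+ m) / t1 / t2.
  by apply: mulr_ge0 => //; apply: mulr_ge0 => //; apply: mulr_ge0.
have tt : 0 <= (t1 ^+ n * t2 ^+ m)^-1 / t1 / t2.
  by apply: mulr_ge0 => //; apply: mulr_ge0.
apply: (@le_trans _ _ (\int[mu1]_(x1 in dcube (0 : 'rV[R]_n) k1 j1)
   ((cell_const / (t1 ^+ n * t2 ^+ m) / t1 / t2)%:E * Phi t1 t2))%E).
  rewrite integral_cst// [X in (_ <= _ * X)%E]mus1 !muleA -!EFinM [leRHS]muleAC -EFinM.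
  apply: lee_wpmul2r => //; rewrite lee_fin.
  rewrite [leRHS](_ : _ = t2 ^- m / t2 / t1 * cell_const * ((2 ^ k1) ^+ n / t1 ^+ n)); last first.
    by field; rewrite ?gt_eqF ?exprn_gt0.
  rewrite [leLHS](_ : _ = t2 ^- m / t2 / t1 * cell_const * 1); last by field; rewrite ?gt_eqF ?exprn_gt0.
  apply: ler_wpM2l; first by apply: mulr_ge0 => //; apply: mulr_ge0.
  by rewrite ler_pdivlMr ?exprn_gt0// mul1r lerXn2r ?nnegrE ?(ltW t10) ?(ltW L1)// -hs1 ltW.
apply: le_int_in => x1 /= hx1.
  exact: mule_ge0.
have {}hx1 : b1 x1 by move: hx1; rewrite dcubeE.
have mphi : mf2 (fun y1 y2 => (cell_const * ((t1 ^+ n * t2 ^+ m)^-1 / t1 / t2) * g t1 t2 y1 y2)%:E) by meas.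
apply: (@le_trans _ _ (\int[muP]_y (cell_const * ((t1 ^+ n * t2 ^+ m)^-1 / t1 / t2) * g t1 t2 y.1 y.2)%:E)%E).
  rewrite (@int_lebesgue2_iter (fun y1 y2 => (cell_const * ((t1 ^+ n * t2 ^+ m)^-1 / t1 / t2) * g t1 t2 y1 y2)%:E))//; last first.
    by move=> y1 y2; rewrite lee_fin; apply: mulr_ge0 => //; apply: mulr_ge0.
  rewrite /Phi -intZ; [|by []|by meas|by move=> y1; apply: int_ge0 => y2; rewrite lee_fin].
  apply: le_int => y1.
    by apply: mule_ge0 => //; apply: int_ge0 => y2; rewrite lee_fin.
  rewrite -intZ; [|by []|by meas|by move=> y2; rewrite lee_fin].
  apply: le_int => y2; first by rewrite -EFinM lee_fin; apply: mulr_ge0.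
  by rewrite -EFinM lee_fin !mulrA.
apply: le_int => y.
  by rewrite lee_fin; apply: mulr_ge0 => //; apply: mulr_ge0.
rewrite lee_fin [leRHS](_ : _ = ((t1 ^+ n * t2 ^+ m)^-1 / t1 / t2) *
  (cabs (theta muP K t1 t2 (@Defs.one_fun R n m) y) ^+ 2 *
   (wgt n lam1 t1 ((x1 : 'rV[R]_n) - y.1) * wgt m lam2 t2 ((x2 : 'rV[R]_m) - y.2)))); last by ring.
rewrite [leLHS](_ : _ = ((t1 ^+ n * t2 ^+ m)^-1 / t1 / t2) * (cell_const * g t1 t2 y.1 y.2)); last by ring.
apply: ler_wpM2l => //.
have th0 : 0 <= cabs (theta muP K t1 t2 (@Defs.one_fun R n m) y) ^+ 2 by exact: sqr_ge0.
have [h1|h1] := boolP (b1 y.1); last first.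
  rewrite /g (negPf h1) !mul0r mulr0; apply: mulr_ge0 => //.
  by apply: mulr_ge0; exact: wgt_ge0.
have [h2|h2] := boolP (b2 y.2); last first.
  rewrite /g (negPf h2) mulr0 !mul0r mulr0; apply: mulr_ge0 => //.
  by apply: mulr_ge0; exact: wgt_ge0.
rewrite /g h1 h2 !mul1r mulrC; apply: ler_pM => //; [exact: sqr_ge0| |].
  by case: y h1 h2 {th0} => y1 y2 _ _; exact: mass_le_theta.
apply: ler_pM; [exact: powR_ge0|exact: powR_ge0| |].
  apply: (@w2 n (2 ^ k1)) => //; first by rewrite -hs1 [X in X < _](_ : _ = 2 * s1)//; field.
  by apply: same_trans h1; rewrite same_sym.
apply: (@w2 m (2 ^ k2)) => //; first by rewrite -hs2 [X in X < _](_ : _ = 2 * s2)//; field.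
by apply: same_trans h2; rewrite same_sym.
rewrite /oitv; exact: measurable_itv.
Qed.

Lemma nneseries_le_ub (u : nat -> \bar R) (B : \bar R) : (forall c, (0 <= u c)%E) ->
  (forall C, (\sum_(c < C) u c <= B)%E) -> (\big[+%E/0]_(0 <= c <oo) u c <= B)%E.
Proof.
move=> u0 h; apply: lime_le; first by apply: is_cvg_nneseries.
by near=> C; rewrite big_mkord.
Unshelve. all: by end_near.
Qed.

Lemma nneseries_ge_term (u : nat -> \bar R) c : (forall c, (0 <= u c)%E) ->
  (u c <= \big[+%E/0]_(0 <= c <oo) u c)%E.
Proof.
move=> u0; apply: le_trans (nneseries_lim_ge c.+1 _); last by [].
by rewrite big_mkord big_ord_recr/= leeDr// sume_ge0.
Qed.

Lemma same_cell_point (d : nat) (k : int) (x : Rn R d) :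
  same (2 ^ k) (cell_point k (\row_i Num.floor (co i x / 2 ^ k))) x.
Proof.
have k0 : 0 < (2 : R) ^ k by rewrite exprz_gt0.
apply/sameP => i; rewrite {1}/co /cell_point !mxE [_ * _ / _]mulrC mulKf ?gt_eqF//.
by rewrite /fl intrKfloor.
Qed.

Variable A3 : R.
Hypothesis hA3 : assumption3 mu1 mu2 muP lam1 lam2 A3 K.

(** The selected set of each pair of scales is cut into countably many cells. A selected cell is a
    dyadic rectangle inside [Om], its integral is at most its coefficient divided by [cell_const],
    and distinct cells give distinct terms of the assumed sum. *)
Lemma carleson_of_assumption3 s1 s2 (k1 k2 : int) M1 M2 : 0 < s1 -> 0 < s2 ->
  4 * s1 = 2 ^ k1 -> 4 * s2 = 2 ^ k2 ->
  bi_carleson mu1 mu2 (4 * s1) (4 * s2) M1 M2 (cell_const^-1 * `|A3|)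
    (mass_density mu1 mu2 (real_kernel K e) s1 s2).
Proof.
move=> s10 s20 hs1 hs2 ev mev inv fin.
set gam := mass_density _ _ _ _ _.
have mk : mf6 (real_kernel K e) by case: kk.
have mms : mf4 ms by rewrite /mass /mass2; meas.
have mo d (P : measurableType d) l (h : P -> R) : measurable_fun setT h ->
   measurable_fun setT (fun p => om l (h p)) by exact: mf_om.
have mgam i j : mf2 (gam i j).
  by apply: mf_int; apply: mf_int; apply/mfE/mfM; [apply: mfM; apply: mo|]; meas.
have gam0 i j x y : (0 <= gam i j x y)%E.
  apply: int_ge0 => t2; apply: int_ge0 => t1; rewrite lee_fin; apply: mulr_ge0; last exact: sqr_ge0.
  by apply: mulr_ge0; apply: om_ge0; exact: sc_gt0.
have scE s k i : 4 * s = 2 ^ k -> sc (4 * s) i = (2 : R) ^ (k + i%:Z).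
  by move=> h; rewrite /sc h expfzDr ?pnatr_eq0// exprnP mulrC.
have sc4 (s : R) i : sc (4 * s) i = 4 * sc s i by rewrite /sc mulrCA.
pose Om : set (Rnm R n m) := [set p | some_rect M1 M2 ev p.1 p.2].
have mrect : mf2 (some_rect M1 M2 ev).
  by rewrite /mf2 /some_rect; apply: mf_exists => i; apply: mf_exists => j; exact: mev.
have mOm : measurable Om.
  rewrite (_ : Om = setT `&` (fun p => some_rect M1 M2 ev p.1 p.2) @^-1` [set true]).
    exact: (mrect measurableT).
  by rewrite setTI.
have muOm : (muP Om = \int[mu1]_x \int[mu2]_y ((some_rect M1 M2 ev x y)%:R : R)%:E)%E.
  rewrite -(setIT Om) -integral_indic// -(@int_lebesgue2_iter (fun x y => ((some_rect M1 M2 ev x y)%:R : R)%:E)).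
  - apply: eq_int => p; rewrite indicE; congr (_%:R%:E); congr nat_of_bool.
    by apply/idP/idP; rewrite inE.
  - by apply/mfE/mf_chi.
  - by move=> x y; rewrite lee_fin ler0n.
pose Q i j (ab : 'rV[int]_n * 'rV[int]_m) : int * 'rV[int]_n * int * 'rV[int]_m :=
  (k1 + i%:Z, ab.1, k2 + j%:Z, ab.2).
have cellOm i j ab x0 y0 : (i < M1)%N -> (j < M2)%N -> ev i j x0 y0 ->
    same (2 ^ (k1 + i%:Z)) (cell_point (k1 + i%:Z) ab.1) x0 ->
    same (2 ^ (k2 + j%:Z)) (cell_point (k2 + j%:Z) ab.2) y0 ->
    drect (0 : 'rV[R]_n) (0 : 'rV[R]_m) (Q i j ab) `<=` Om.
  move=> iM jM h hx hy -[x y] []; rewrite !dcubeE /= => hx' hy'.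
  apply/existsP; exists (Ordinal iM); apply/existsP; exists (Ordinal jM) => /=.
  rewrite (inv i j x x0 y y0)//.
  - by rewrite (scE _ _ _ hs1); apply: same_trans hx; rewrite same_sym.
  - by rewrite (scE _ _ _ hs2); apply: same_trans hy; rewrite same_sym.
have esumOm := hA3 (wn := 0) (wm := 0) (Om := Om).
rewrite muOm in esumOm; have {}esumOm := esumOm fin.
have {}esumOm := esumOm _; set E := (\esum_(q in _) _)%E in esumOm.
have CIJ0 q : (0 <= CIJ mu1 mu2 muP lam1 lam2 K (0 : 'rV[R]_n) (0 : 'rV[R]_m) q.1.1.1 q.1.1.2 q.1.2 q.2)%E.
  have h (l t : R) : 0 < l -> oitv (l / 2) l t -> 0 <= t^-1.
    rewrite /oitv /= in_itv/= invr_ge0 => l0 /andP[h _]; apply/ltW/(lt_trans _ h).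
    by rewrite divr_gt0.
  apply: integral_ge0 => t2 /(h _ _ (exprz_gt0 _ (ltr0Sn _ _))) h2; apply: integral_ge0 => x2 _.
  apply: integral_ge0 => t1 /(h _ _ (exprz_gt0 _ (ltr0Sn _ _))) h1; apply: integral_ge0 => x1 _.
  apply: integral_ge0 => y _; rewrite lee_fin.
  apply: mulr_ge0 => //; apply: mulr_ge0 => //; apply: mulr_ge0; last first.
    by rewrite invr_ge0 mulr_ge0// exprn_ge0// -invr_ge0.
  by apply: mulr_ge0; [apply: mulr_ge0; [exact: sqr_ge0|]|]; exact: wgt_ge0.
have cc0 := cell_const_gt0.
suff main : (\sum_(i < M1) \sum_(j < M2)
     \int[mu1]_x \int[mu2]_y (gam i j x y * ((ev i j x y)%:R : R)%:E) <= (cell_const^-1)%:E * E)%E.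
  apply: le_trans main _; rewrite EFinM -muleA; apply: lee_wpmul2l.
    by rewrite lee_fin invr_ge0 ltW.
  apply: le_trans (esumOm _) _; last by apply: lee_wpmul2r; [pos|rewrite lee_fin ler_norm].
  move=> [x y] /existsP[i /existsP[j h]].
  exists (Q i j (\row_i' Num.floor (co i' x / 2 ^ (k1 + i%:Z)), \row_j' Num.floor (co j' y / 2 ^ (k2 + j%:Z)))).
  have hx := same_cell_point (k1 + i%:Z) x; have hy := same_cell_point (k2 + j%:Z) y.
  by split; [split; rewrite dcubeE|apply: (cellOm i j _ x y)].
(* Cells are enumerated by the integer codes of their index pairs, so that the decomposition is a
   series over [nat]; codes of nothing give the empty cell. *)
pose cell i j c x y := if @pickle_inv ('rV[int]_n * 'rV[int]_m)%type c is Some ab then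
  same (2 ^ (k1 + i%:Z)) (cell_point (k1 + i%:Z) ab.1) x &&
  same (2 ^ (k2 + j%:Z)) (cell_point (k2 + j%:Z) ab.2) y else false.
have mcell i j c : mf2 (cell i j c).
  rewrite /cell /mf2; case: pickle_inv => [ab|]; last exact: measurable_cst.
  by apply: mf_and; apply: mf_same; meas.
pose u i j c x y : \bar R := (((cell i j c x y && ev i j x y)%:R : R)%:E * gam i j x y)%E.
have u0 i j c x y : (0 <= u i j c x y)%E by rewrite mule_ge0// lee_fin ler0n.
have mu i j c : mf2 (u i j c).
  have h1 := mcell i j c; have h2 := mev i j; have h3 := mgam i j.
  by apply/mfMe; [apply/mfE/mf_chi/mf_and|].
pose T i j c := (\int[mu1]_x \int[mu2]_y u i j c x y)%E.
have T0 i j c : (0 <= T i j c)%E by apply: int_ge0 => x; exact: int_ge0.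
have stepA i j : (\int[mu1]_x \int[mu2]_y (gam i j x y * ((ev i j x y)%:R : R)%:E) <=
    \big[+%E/0]_(0 <= c <oo) T i j c)%E.
  have e2 x : (\int[mu2]_y \big[+%E/0]_(0 <= c <oo) u i j c x y =
      \big[+%E/0]_(0 <= c <oo) \int[mu2]_y u i j c x y)%E.
    by apply: integral_nneseries => // c; have h := mu i j c; meas.
  have -> : (\big[+%E/0]_(0 <= c <oo) T i j c =
      \int[mu1]_x \int[mu2]_y \big[+%E/0]_(0 <= c <oo) u i j c x y)%E.
    rewrite -integral_nneseries//; last 2 first.
    - by move=> c; have h := mu i j c; meas.
    - by move=> c x _; exact: int_ge0.
    by apply: eq_int => x; rewrite e2.
  have ev0 x y : (0 <= ((ev i j x y)%:R : R)%:E)%E by rewrite lee_fin ler0n.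
  apply: le_int => x; first by apply: int_ge0 => y; rewrite mule_ge0.
  apply: le_int => y; first by rewrite mule_ge0.
  (* The floors of the coordinates name the cell of [(x, y)], whose term already bounds the
     left-hand side. *)
  pose ab : 'rV[int]_n * 'rV[int]_m := (\row_i' Num.floor (co i' x / 2 ^ (k1 + i%:Z)),
    \row_j' Num.floor (co j' y / 2 ^ (k2 + j%:Z))).
  apply: le_trans (nneseries_ge_term (pickle ab) (fun c => u0 i j c x y)).
  by rewrite /u /cell pickleK_inv /= !same_cell_point /= muleC.
pose valid i j c := `[< if @pickle_inv ('rV[int]_n * 'rV[int]_m)%type c is Some ab then
  drect (0 : 'rV[R]_n) (0 : 'rV[R]_m) (Q i j ab) `<=` Om else False >].
pose q i j c := if @pickle_inv ('rV[int]_n * 'rV[int]_m)%type c is Some ab then Q i j ab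
  else (0, 0, 0, 0).
pose CQ q := CIJ mu1 mu2 muP lam1 lam2 K (0 : 'rV[R]_n) (0 : 'rV[R]_m) q.1.1.1 q.1.1.2 q.1.2 q.2.
(* A cell that meets the selected set lies in [Om], because selections are constant on cells; every
   other cell contributes 0. *)
have stepB i j c : (i < M1)%N -> (j < M2)%N ->
    (T i j c <= (cell_const^-1)%:E * (if valid i j c then CQ (q i j c) else 0))%E.
  move=> iM jM; have h0 : (forall x y, cell i j c x y && ev i j x y = false) -> T i j c = 0%E.
    move=> h; rewrite /T (eq_int _ (g := fun=> 0%E)) ?integral0// => x.
    by rewrite (eq_int _ (g := fun=> 0%E)) ?integral0// => y; rewrite /u h mul0e.
  case E1 : (pickle_inv c) => [ab|]; last first.
    rewrite h0; last by move=> x y; rewrite /cell E1.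
    by apply: mule_ge0; [rewrite lee_fin invr_ge0 ltW|case: ifP => // _; exact: CIJ0].
  have [vc|/negP nv] := boolP (valid i j c); last first.
    rewrite mule0 h0// => x y; apply/negbTE/negP => /andP[]; rewrite /cell E1 => /andP[hx hy] h.
    by apply: nv; apply/asboolP; rewrite E1; exact: cellOm h hx hy.
  rewrite -(@lee_pmul2l _ cell_const%:E)// muleA -EFinM mulfV ?gt_eqF// mul1e.
  rewrite /CQ /q E1 /=.
  have h1 : 4 * sc s1 i = 2 ^ (k1 + i%:Z) by rewrite -sc4 (scE _ _ _ hs1).
  have h2 : 4 * sc s2 j = 2 ^ (k2 + j%:Z) by rewrite -sc4 (scE _ _ _ hs2).
  apply: le_trans (CIJ_ge ab.1 ab.2 h1 h2); apply: lee_wpmul2l; first by rewrite lee_fin ltW.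
  apply: le_int => x; first exact: int_ge0.
  apply: le_int => y; first exact: u0.
  rewrite /u /cell E1; apply: lee_wpmul2r => //; rewrite lee_fin -natrM ler_nat.
  by case: (same _ _ x) => //; case: (same _ _ y) => //; case: (ev i j x y).
apply: (@le_trans _ _ (\sum_(i < M1) \sum_(j < M2) \big[+%E/0]_(0 <= c <oo) T i j c)%E).
  by apply: lee_sum => i _; apply: lee_sum => j _; exact: stepA.
under eq_bigr do rewrite -nneseries_sum//.
rewrite -nneseries_sum; last by move=> i c _; apply: sume_ge0.
apply: nneseries_le_ub => [c|C]; first by apply: sume_ge0 => i _; apply: sume_ge0.
pose Tb c i j : \bar R := if valid i j c then CQ (q i j c) else 0%E.
have Tb0 c i j : (0 <= Tb c i j)%E by rewrite /Tb; case: ifP => // _; exact: CIJ0.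
have ic0 : 0 <= cell_const^-1 by rewrite invr_ge0 ltW.
apply: (@le_trans _ _ (\sum_(p : 'I_C * ('I_M1 * 'I_M2)) (cell_const^-1)%:E * Tb p.1 p.2.1 p.2.2)%E).
  rewrite -(pair_bigA _ (fun (c : 'I_C) (ij : 'I_M1 * 'I_M2) => (cell_const^-1)%:E * Tb c ij.1 ij.2)%E)/=.
  apply: lee_sum => c _.
  rewrite -(pair_bigA _ (fun (i : 'I_M1) (j : 'I_M2) => (cell_const^-1)%:E * Tb c i j)%E)/=.
  by apply: lee_sum => i _; apply: lee_sum => j _; exact: stepB.
rewrite -ge0_sume_distrr; last by move=> p _; exact: Tb0.
(* [esum] is a supremum over finite sets; the one chosen consists of the rectangles coming from
   valid codes below [C]. *)
apply: lee_wpmul2l => //; apply: esum_ge.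
pose V := [pred p : 'I_C * ('I_M1 * 'I_M2) | valid p.2.1 p.2.2 p.1].
pose qq (p : 'I_C * ('I_M1 * 'I_M2)) := q p.2.1 p.2.2 p.1.
exists [set` [seq qq p | p <- enum V]].
  split; first exact: finite_seq.
  move=> _ /= /mapP[p + ->]; rewrite mem_enum inE => /asboolP; rewrite asboolE /qq /q.
  by case: pickle_inv.
(* A label records both scales and both indices, so different triples give different labels and no
   coefficient is counted twice. *)
have uq : uniq [seq qq p | p <- enum V].
  rewrite map_inj_in_uniq ?enum_uniq// => -[c [i j]] [c' [i' j']].
  rewrite !mem_enum !inE /= => /asboolP hv /asboolP hv'; rewrite !asboolE in hv hv'; rewrite /qq /q /=.
  move: hv hv'; have := @pickle_invK ('rV[int]_n * 'rV[int]_m)%type c.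
  have := @pickle_invK ('rV[int]_n * 'rV[int]_m)%type c'.
  case: pickle_inv => [ab'|//]; case: pickle_inv => [ab|//] /= h' h _ _.
  move=> [/addrI [hi] ea /addrI [hj] eb].
  have eab : ab = ab' by case: ab ab' ea eb {h h'} => [? ?] [? ?] /= -> ->.
  by congr (_, (_, _)); apply: val_inj => //=; rewrite -h -h' eab.
rewrite -fsbig_seq//= big_map big_enum/= [leLHS](bigID V)/= [X in (_ + X)%E]big1 ?adde0; last first.
  by move=> p; rewrite /Tb => /negPf ->.
by rewrite [leRHS](eq_bigl V)//; apply: lee_sum => p; rewrite /Tb /qq => ->.
Qed.

End CellBound.
End CarlesonOfAssumptions.

(** * Passage to the limit *)

Section Windows.
Context {R : realType}.

(* The octaves [2 ^ (1 - L) <= t < 2 ^ (2 + L)] exhaust the half line. *)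
Definition window (L : nat) (t : R) : R := \sum_(i < (L + L).+1) om (sc (2 ^- L) i) t.

Lemma window_near t : \forall L \near \oo, window L t = (0 < t)%R%:R / t.
Proof.
have l0 L : 0 < (2 : R) ^- L by rewrite invr_gt0 exprn_gt0.
have [t0|t0] := ltP 0 t; last first.
  by near=> L; rewrite /window mul0r big1// => i _; rewrite om_neg// sc_gt0.
have [k1 h1] := pow2_bound t; have [k2 h2] := pow2_bound (2 / t).
near=> L; rewrite /window sum_om//.
have p2 (i j : nat) : (i <= j)%N -> (2 : R) ^+ i <= 2 ^+ j by move=> ij; rewrite ler_weXn2l// ler1n.
have kL1 : (k1 <= L)%N by near: L; exact: nbhs_infty_ge.
have kL2 : (k2 <= L)%N by near: L; exact: nbhs_infty_ge.
rewrite (_ : (_ && _) = true)//; apply/andP; split.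
  rewrite ler_pdivrMr ?exprn_gt0// -ler_pdivrMl// mulrC.
  exact: le_trans (ltW h2) (p2 _ _ kL2).
rewrite /sc exprD -mulrA mulfV ?mulr1 ?expf_neq0//.
have := lt_le_trans h1 (p2 _ _ kL1); have : 0 <= (2 : R) ^+ L by rewrite exprn_ge0.
by lra.
Unshelve. all: by end_near.
Qed.

Lemma window_ge0 L t : 0 <= window L t.
Proof.
by apply: sumr_ge0 => i _; apply/om_ge0/sc_gt0; rewrite invr_gt0 exprn_gt0.
Qed.

Lemma mf_window {d} {P : measurableType d} L (f : P -> R) :
  measurable_fun setT f -> measurable_fun setT (fun p => window L (f p)).
Proof. by move=> mf; apply: mf_sum => i; apply: mf_om. Qed.

Lemma limn_einf_le (u : nat -> \bar R) (B : \bar R) :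
  (forall L, (u L <= B)%E) -> (limn_einf u <= B)%E.
Proof.
move=> uB; rewrite limn_einf_lim; apply: lime_le; first exact: is_cvg_einfs.
by near=> L; apply: le_trans (uB L); apply: ereal_inf_lbound; exists L => //=.
Unshelve. all: by end_near.
Qed.

End Windows.

(** The theorem quantifies over bare measures, whereas Tonelli needs sigma-finiteness, which the
    boxes supply. Destructuring [mu] makes the repacked measure convertible to the original one. *)
Lemma sigma_finite_pack {R : realType} {n} (mu : {measure set (Rn R n) -> \bar R}) :
  is_lebesgue mu -> exists mu' : {sigma_finite_measure set (Rn R n) -> \bar R},
    (mu' : {measure set (Rn R n) -> \bar R}) = mu.
Proof.
move=> lmu; have := lebesgue_sigma_finite lmu; move: lmu; case: mu => m c lmu h.
pose mm : {measure set (Rn R n) -> \bar R} := Measure.Pack c.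
pose X := Measure_isSigmaFinite.Build _ _ _ mm h.
pose mu' : {sigma_finite_measure set (Rn R n) -> \bar R} := HB.pack (Measure.sort mm) X.
by exists mu'.
Qed.

Section RealSquareFunction.
Context {R : realType} {n m : nat}.
Variables (mu1 : {sigma_finite_measure set (Rn R n) -> \bar R})
  (mu2 : {sigma_finite_measure set (Rn R m) -> \bar R})
  (muP : {measure set (Rnm R n m) -> \bar R}).
Hypotheses (lmu1 : is_lebesgue mu1) (lmu2 : is_lebesgue mu2) (lmuP : is_lebesgue2 muP).
Local Notation Z1 := (Rn R n).
Local Notation Z2 := (Rn R m).
Local Notation leb := (@lebesgue_measure R).
Local Notation nu1 := (prodm leb mu1).
Local Notation nu2 := (prodm leb mu2).

Definition truncate (f : Rnm R n m -> R) (L : nat) (z1 : Z1) (z2 : Z2) : R :=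
  f (z1, z2) * ((`|f (z1, z2)| <= L%:R) && ((ninf z1 <= L%:R) && (ninf z2 <= L%:R)))%:R.

Lemma truncate_le f L z1 z2 : `|truncate f L z1 z2| <= `|f (z1, z2)|.
Proof. by rewrite /truncate; case: (_ && _); rewrite ?mulr1// mulr0 normr0. Qed.

Lemma truncate_near f z1 z2 : \forall L \near \oo, truncate f L z1 z2 = f (z1, z2).
Proof.
near=> L; rewrite /truncate.
have h (x : R) : x <= (Num.bound `|x|)%:R.
  by apply/ltW/(le_lt_trans (ler_norm x))/archi_boundP.
have hL (x : R) : (Num.bound `|x| <= L)%N -> x <= L%:R.
  by move=> xL; apply: le_trans (h x) _; rewrite ler_nat.
rewrite !hL ?mulr1//; by near: L; exact: nbhs_infty_ge.
Unshelve. all: by end_near.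
Qed.

Lemma c1_ball {d} (mu : {sigma_finite_measure set (Rn R d) -> \bar R}) (L : nat) :
  is_lebesgue mu -> c1 mu (fun z => (ninf z <= L%:R)%R%:R).
Proof.
move=> lmu; have mb : measurable_fun setT (fun z : Rn R d => (ninf z <= L%:R)%R%:R : R) by meas.
split => //; first by exists 1 => z; rewrite ger0_norm// lern1 leq_b1.
apply: iblP => //; under eq_int do rewrite ger0_norm//.
apply: le_lt_trans (int_box lmu (c := const_mx (- L%:R)) (l := L%:R + L%:R + 1) _ _) (ltry _).
  by rewrite addr_ge0// addr_ge0.
move=> x /ninf_leP h i; have := h (ler0n _ _) i; rewrite !mxE ler_norml => /andP[h1 h2].
by apply/andP; split => //; lra.
Qed.

Lemma c2_truncate f L : measurable_fun setT f -> c2 mu1 mu2 (truncate f L).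
Proof.
move=> mf; split.
  have mf2' : mf2 (fun z1 z2 => f (z1, z2)) by apply: (mf1_comp mf); meas.
  rewrite /truncate /mf2; apply: mfM; first by apply: (mf1_comp mf); meas.
  apply: mf_chi; apply: mf_and; last by meas.
  by apply: mf_le; [apply: mf_norm; apply: (mf1_comp mf)|]; meas.
exists (fun z1 => L%:R * (ninf z1 <= L%:R)%R%:R), (fun z2 => (ninf z2 <= L%:R)%R%:R); split.
- exact/c1Z/c1_ball.
- exact: c1_ball.
move=> z1 z2; rewrite /truncate normrM [X in _ * X]ger0_norm//.
case: (lerP `|f (z1, z2)| L%:R) => /= h; last by rewrite mulr0; pos.
by rewrite -mulrA -natrM mulnb; apply: ler_wpM2r.
Qed.

Lemma Rint_prodm (F : Rnm R n m -> R) : \int[muP]_z F z = \int[prodm mu1 mu2]_z F z.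
Proof. by rewrite /Rintegral; congr fine; exact: (int_lebesgue2 lmu1 lmu2 lmuP). Qed.

Section VerticalSquareFunction.
Variables (a b N C : R) (k : R -> R -> Z1 -> Z1 -> Z2 -> Z2 -> R).
Hypotheses (a0 : 0 < a) (b0 : 0 < b) (C0 : 0 <= C) (kk : bi_kernel mu1 mu2 a b N k).
Hypothesis window_bound : forall L f, c2 mu1 mu2 f ->
  (\int[nu1]_u \int[nu2]_v
     (window L u.1 * window L v.1 * bi_op mu1 mu2 k f u.1 v.1 u.2 v.2 ^+ 2)%:E
   <= C%:E * nrm mu1 mu2 f)%E.
Variable f : Rnm R n m -> R.
Hypotheses (mf : measurable_fun setT f) (f2 : (\int[muP]_z (f z ^+ 2)%:E < +oo)%E).
Let mk : mf6 k. Proof. by case: kk. Qed.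

Definition lin_op t1 t2 y1 y2 := \int[muP]_z (k t1 t2 y1 z.1 y2 z.2 * f z).

(** At positive times the section of the kernel is bounded and integrable, hence in [L^2], and
    [|k f| <= k^2 + f^2]. *)
Lemma ibl_lin_op t1 t2 y1 y2 : 0 < t1 -> 0 < t2 ->
  ibl muP (fun z => k t1 t2 y1 z.1 y2 z.2 * f z).
Proof.
move=> t10 t20; have ck := c2_bi_kernel lmu1 lmu2 a0 b0 kk y1 y2 t10 t20.
have [M hM] := c2_bounded ck.
have d := dom2_prod (c2_dom2 (c2M (c2_mf ck) hM ck)).
have m1 : measurable_fun setT (fun z : Rnm R n m => k t1 t2 y1 z.1 y2 z.2) by meas.
have ik : ibl muP (fun z => k t1 t2 y1 z.1 y2 z.2 * k t1 t2 y1 z.1 y2 z.2).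
  apply: iblP; first exact: mfM.
  by rewrite (int_lebesgue2 lmu1 lmu2 lmuP); have /integrableP[_] := d.
have if2 : ibl muP (fun z => f z ^+ 2).
  apply: iblP; first exact: mfX.
  by under eq_int do rewrite ger0_norm ?sqr_ge0//.
apply: (ibl_dom _ _ (iblD ik if2)); first exact: mfM.
move=> z; rewrite normrM -expr2 -[X in _ <= X + _]real_normK ?num_real//.
rewrite -[X in _ <= _ + X]real_normK ?num_real//.
set x := `|k _ _ _ _ _ _|; set y := `|f z|.
have := sqr_ge0 (x - y); have := mulr_ge0 (normr_ge0 _ : 0 <= x) (normr_ge0 _ : 0 <= y).
by move=> h1 h2; nra.
Qed.

Lemma mf_lin_op : mf4 lin_op.
Proof.
rewrite /lin_op /mf4; under eq_fun do rewrite Rint_prodm.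
by apply: mf_Rint; apply: mfM; meas.
Qed.

Lemma cvg_truncate t1 t2 y1 y2 : 0 < t1 -> 0 < t2 ->
  bi_op mu1 mu2 k (truncate f L) t1 t2 y1 y2 @[L --> \oo] --> lin_op t1 t2 y1 y2.
Proof.
move=> t10 t20; have ik := ibl_lin_op y1 y2 t10 t20.
have ck := c2_bi_kernel lmu1 lmu2 a0 b0 kk y1 y2 t10 t20.
pose h L (z : Rnm R n m) := k t1 t2 y1 z.1 y2 z.2 * truncate f L z.1 z.2.
have mt L : mf2 (truncate f L) := c2_mf (c2_truncate L mf).
have hle L z : `|h L z| <= `|k t1 t2 y1 z.1 y2 z.2 * f z|.
  rewrite /h normrM [leRHS]normrM; apply: ler_wpM2l => //.
  by have := truncate_le f L z.1 z.2; rewrite -surjective_pairing.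
have mh L : measurable_fun setT (h L).
  by have ml := mt L; rewrite /h; meas.
have ih L : ibl muP (h L) := ibl_dom (mh L) (hle L) (ibl_norm ik).
have bE L : bi_op mu1 mu2 k (truncate f L) t1 t2 y1 y2 = fine (\int[muP]_z (h L z)%:E)%E.
  have [M hM] := c2_bounded (c2_truncate L mf).
  by rewrite /bi_op -(Rint_lebesgue2 lmu1 lmu2 lmuP (c2_dom2 (c2M (mt L) hM ck))).
under eq_fun do rewrite bE.
rewrite /lin_op; apply: fine_cvg; rewrite RintE//.
apply: (@dominated_cvg _ _ _ muP setT measurableT (fun L z => (h L z)%:E) _
  (fun z => (`|k t1 t2 y1 z.1 y2 z.2 * f z|)%:E)) => //.
- by move=> L; exact/mfE.
- move=> z _; apply: cvg_near_cst; have := truncate_near f z.1 z.2.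
  apply: filterS => L e; rewrite /h e; congr (_ * f _)%:E.
  by case: z {e}.
- exact: ibl_norm ik.
- by move=> L z _; rewrite lee_fin.
Qed.

(** One parameter [L] drives both the truncation of [f] and the window of times. The windowed bound
    is uniform in [L] and truncation does not increase the norm. *)
Lemma vertical_L2 :
  (\int[nu1]_u \int[nu2]_v
     (((0 < u.1)%R%:R / u.1) * ((0 < v.1)%R%:R / v.1) * lin_op u.1 v.1 u.2 v.2 ^+ 2)%:E
   <= C%:E * \int[muP]_z (f z ^+ 2)%:E)%E.
Proof.
have ml := mf_lin_op.
pose G (q : (R * Z1) * (R * Z2)) : \bar R := (((0 < q.1.1)%R%:R / q.1.1) *
  ((0 < q.2.1)%R%:R / q.2.1) * lin_op q.1.1 q.2.1 q.1.2 q.2.2 ^+ 2)%:E.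
pose GL L (q : (R * Z1) * (R * Z2)) : \bar R := (window L q.1.1 * window L q.2.1 *
  bi_op mu1 mu2 k (truncate f L) q.1.1 q.2.1 q.1.2 q.2.2 ^+ 2)%:E.
have iv (t : R) : 0 <= (0 < t)%R%:R / t.
  by have [t0|t0] := ltP 0 t; rewrite ?mul0r// mul1r invr_ge0 ltW.
have G0 q : (0 <= G q)%E.
  by rewrite lee_fin; apply: mulr_ge0; [exact: mulr_ge0|exact: sqr_ge0].
have mG : measurable_fun setT G by rewrite /G; meas.
have GL0 L q : (0 <= GL L q)%E.
  rewrite lee_fin; apply: mulr_ge0; last exact: sqr_ge0.
  by apply: mulr_ge0; exact: window_ge0.
have mGL L : measurable_fun setT (GL L).
  have mt := c2_mf (c2_truncate L mf).
  rewrite /GL; apply/mfE/mfM; first by apply: mfM; apply: mf_window; meas.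
  by apply: mfX; rewrite /bi_op; meas.
have limG q : GL L q @[L --> \oo] --> G q.
  case: q => -[t1 y1] [t2 y2]; rewrite /G /GL /=.
  have z1 := window_near t1; have z2 := window_near t2.
  (* At nonpositive times nothing is known of the operator, but the window is eventually 0 there. *)
  have [t10|t10] := ltP 0 t1; last first.
    apply: cvg_near_cst; apply: filterS z1 => L ->.
    by rewrite (le_gtF t10) !mul0r.
  have [t20|t20] := ltP 0 t2; last first.
    apply: cvg_near_cst; apply: filterS z2 => L ->.
    by rewrite (le_gtF t20) !(mul0r, mulr0).
  apply: cvg_EFin; first by apply: nearW.
  have cv := @cvg_truncate t1 t2 y1 y2 t10 t20.
  pose op L := bi_op mu1 mu2 k (truncate f L) t1 t2 y1 y2.
  have cv2 : t1^-1 * t2^-1 * (op L * op L) @[L --> \oo] -->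
      t1^-1 * t2^-1 * (lin_op t1 t2 y1 y2 * lin_op t1 t2 y1 y2).
    by apply: cvgM; [exact: cvg_cst|apply: cvgM].
  rewrite (_ : _ * _ ^+ 2 = t1^-1 * t2^-1 * (lin_op t1 t2 y1 y2 * lin_op t1 t2 y1 y2)); last first.
    by rewrite !mul1r expr2.
  refine (cvg_trans _ cv2); apply: near_eq_cvg.
  apply: filterS (filterI z1 z2) => L [e1 e2].
  by rewrite /comp /fine e1 e2 /op t10 t20 !mul1r expr2.
rewrite -(@int_prodm _ _ _ _ _ nu1 nu2 G mG G0).
apply: (@le_trans _ _ (\int[prodm nu1 nu2]_q limn_einf (GL^~ q))%E).
  apply: le_int => // q; by rewrite (cvg_limn_einf_sup (limG q)).1 lexx.
apply: le_trans (@fatou _ _ _ (prodm nu1 nu2) setT measurableT GL mGL (fun L q _ => GL0 L q)) _.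
apply: limn_einf_le => L; rewrite int_prodm//; last exact: mGL.
apply: le_trans (window_bound L (c2_truncate L mf)) _.
apply: lee_wpmul2l => //.
have mff : mf2 (fun z1 z2 => f (z1, z2)) by apply: (mf1_comp mf); meas.
have -> : (\int[muP]_z (f z ^+ 2)%:E = \int[mu1]_z1 \int[mu2]_z2 (f (z1, z2) ^+ 2)%:E)%E.
  rewrite -(int_lebesgue2_iter lmu1 lmu2 lmuP); last 2 first.
  - exact/mfE/mfX.
  - by move=> z1 z2; rewrite lee_fin sqr_ge0.
  by apply: eq_int => z; rewrite -surjective_pairing.
apply: le_int => z1; first by pos.
apply: le_int => z2; first by pos.
rewrite lee_fin -[leRHS]real_normK ?num_real//; apply: sqr_le_norm; exact: truncate_le.
Qed.

End VerticalSquareFunction.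
End RealSquareFunction.

(** * The square function with weights *)

Section WeightIntegral.
Context {R : realType} {n : nat}.
Variable mu : {sigma_finite_measure set (Rn R n) -> \bar R}.
Hypothesis lmu : is_lebesgue mu.

(** With [a = n (lam - 1)] the exponent [n + a] is [n lam]: the weight is a multiple of the decay
    factor, whose integral is already bounded. *)
Lemma wgt_pdecay lam t (u : 'rV[R]_n) : 0 < t ->
  wgt n lam t u = t ^+ n * pdecay n (n%:R * (lam - 1)) t u.
Proof.
move=> t0; have u0 := ninf_ge0 u; have tu : 0 < t + ninf u by rewrite ltr_wpDr.
rewrite /wgt /pdecay mulrA -powR_mulrn ?(ltW t0)// -powRD; last by rewrite (gt_eqF t0) implybT.
rewrite (_ : n%:R + n%:R * (lam - 1) = n%:R * lam); last by ring.
rewrite powRM ?(ltW t0) ?invr_ge0 ?(ltW tu)//; congr (_ * _).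
by rewrite -powR_inv1 ?(ltW tu)// -powRrM mulN1r powRN.
Qed.

Lemma int_wgt lam : (0 < n)%N -> 1 < lam -> exists2 C : R, 0 < C &
  forall t (y : Rn R n), 0 < t ->
    (\int[mu]_x (wgt n lam t ((x : 'rV[R]_n) - y))%:E <= (C * t ^+ n)%:E)%E.
Proof.
move=> n0 lam1; have a0 : 0 < n%:R * (lam - 1) by rewrite mulr_gt0 ?ltr0n// subr_gt0.
have [C C0 hC] := decay_int lmu a0; exists C => // t y t0.
rewrite (@eq_int _ _ _ mu _ (fun x => (t ^+ n)%:E * (pdecay n (n%:R * (lam - 1)) t (vsub y x))%:E)%E).
  rewrite intZ; [|by rewrite exprn_ge0// ltW|by meas|by pos].
  rewrite [C * _]mulrC EFinM; apply: lee_wpmul2l; first by rewrite lee_fin exprn_ge0// ltW.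
  exact: (int_pdecay lmu hC).
move=> x; rewrite -EFinM (wgt_pdecay lam _ t0); congr (_ * _)%:E.
exact: (pdecay_symm n (n%:R * (lam - 1)) t x y).
Qed.

End WeightIntegral.

Section WindowBound.
Context {R : realType} {n m : nat}.
Variables (mu1 : {sigma_finite_measure set (Rn R n) -> \bar R})
  (mu2 : {sigma_finite_measure set (Rn R m) -> \bar R})
  (muP : {measure set (Rnm R n m) -> \bar R}).
Hypotheses (lmu1 : is_lebesgue mu1) (lmu2 : is_lebesgue mu2) (lmuP : is_lebesgue2 muP).
Local Notation leb := (@lebesgue_measure R).
Local Notation nu1 := (prodm leb mu1).
Local Notation nu2 := (prodm leb mu2).

Lemma window_bound_of_assumptions (lam1 lam2 a b A1 A2 A3 : R) :
  0 <= lam1 -> 0 <= lam2 -> 0 < a -> 0 < b -> exists N C : R, 0 <= C /\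
  forall K : gkernel R n m, kernel_measurable K -> assumption1 a b A1 K ->
  assumption2 mu1 mu2 lam1 lam2 a b A2 K ->
  assumption3 mu1 mu2 muP lam1 lam2 A3 K -> forall e,
  bi_kernel mu1 mu2 a b N (real_kernel K e) /\ (forall L f, c2 mu1 mu2 f ->
  (\int[nu1]_u \int[nu2]_v
     (window L u.1 * window L v.1 *
      bi_op mu1 mu2 (real_kernel K e) f u.1 v.1 u.2 v.2 ^+ 2)%:E
   <= C%:E * nrm mu1 mu2 f)%E).
Proof.
move=> lam10 lam20 a0 b0; have [C C0 hC] := biparameter_square_function lmu1 lmu2 a0 b0.
pose q1 := (wgt_const n lam1)^-1; pose q2 := (wgt_const m lam2)^-1.
have q10 : 0 <= q1 by rewrite invr_ge0; exact/ltW/wgt_const_gt0.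
have q20 : 0 <= q2 by rewrite invr_ge0; exact/ltW/wgt_const_gt0.
(* [N] must be positive, dominate [A1], and satisfy [q A2^2 <= N^2] for both weight constants; since
   [q <= (1 + q)^2], the term [(1 + q) |A2|] achieves the last without a square root. *)
pose N := `|A1| + 1 + (1 + q1) * `|A2| + (1 + q2) * `|A2|.
have p0 : 0 <= `|A1| by []. have p1 : 0 <= `|A2| by [].
have p2 : 0 <= q1 * `|A2| by rewrite mulr_ge0.
have p3 : 0 <= q2 * `|A2| by rewrite mulr_ge0.
have N0 : 0 < N by rewrite /N; lra.
have N1 : A1 <= N by have := ler_norm A1; rewrite /N; lra.
have key q : 0 <= q -> (1 + q) * `|A2| <= N -> q * A2 ^+ 2 <= N ^+ 2.
  move=> q0 h; rewrite -real_normK ?num_real//.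
  have h2 : 0 <= (1 + q) * `|A2| by rewrite mulr_ge0// addr_ge0.
  apply: (@le_trans _ _ (((1 + q) * `|A2|) ^+ 2)); last by rewrite lerXn2r ?nnegrE// ltW.
  rewrite exprMn; apply: ler_wpM2r; first exact: sqr_ge0.
  by have := sqr_ge0 q; lra.
have N21 : q1 * A2 ^+ 2 <= N ^+ 2 by apply: key => //; rewrite /N; lra.
have N22 : q2 * A2 ^+ 2 <= N ^+ 2 by apply: key => //; rewrite /N; lra.
pose A := (@cell_const R n m lam1 lam2)^-1 * `|A3|.
have A0 : 0 <= A by rewrite mulr_ge0// invr_ge0; exact/ltW/cell_const_gt0.
exists N, (C * (N ^+ 2 + A)); split.
  by rewrite mulr_ge0 ?(ltW C0)// addr_ge0// sqr_ge0.
move=> K mK h1 h2 h3 e.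
have kk := real_bi_kernel lmu1 lmu2 lam10 lam20 a0 b0 mK h1 h2 N0 N1 N21 N22 e.
split => // L f cf.
have l0 : 0 < (2 : R) ^- L by rewrite invr_gt0 exprn_gt0.
(* The finest scale is a power of 2, so the cells of side [4 * l] are standard dyadic cubes, to
   which the Carleson condition applies. *)
have l4 : 4 * (2 : R) ^- L = 2 ^ (2%:Z - L%:Z).
  rewrite expfzDr ?pnatr_eq0// -exprnN -exprnP; congr (_ * _).
  by ring.
apply: hC => //.
exact: (carleson_of_assumption3 lmu1 lmu2 lmuP lam10 lam20 a0 b0 kk h3 l0 l0 l4 l4).
Qed.

End WindowBound.

Section ComplexSquareFunction.
Context {R : realType} {n m : nat}.
Variables (mu1 : {sigma_finite_measure set (Rn R n) -> \bar R})
  (mu2 : {sigma_finite_measure set (Rn R m) -> \bar R})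
  (muP : {measure set (Rnm R n m) -> \bar R}).
Hypotheses (lmu1 : is_lebesgue mu1) (lmu2 : is_lebesgue mu2) (lmuP : is_lebesgue2 muP).
Local Notation Z1 := (Rn R n).
Local Notation Z2 := (Rn R m).
Local Notation leb := (@lebesgue_measure R).
Local Notation nu1 := (prodm leb mu1).
Local Notation nu2 := (prodm leb mu2).
Variables (lam1 lam2 a b N C : R) (K : gkernel R n m).
Hypotheses (a0 : 0 < a) (b0 : 0 < b) (C0 : 0 <= C).
Hypothesis kk : forall e, bi_kernel mu1 mu2 a b N (real_kernel K e).
Hypothesis window_bound : forall e L f, c2 mu1 mu2 f ->
  (\int[nu1]_u \int[nu2]_v
     (window L u.1 * window L v.1 *
      bi_op mu1 mu2 (real_kernel K e) f u.1 v.1 u.2 v.2 ^+ 2)%:E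
   <= C%:E * nrm mu1 mu2 f)%E.
Variable f : Rnm R n m -> R[i].
Hypothesis hf : inL2 muP f.

Let mf e : measurable_fun setT (fun z => pr e (f z)).
Proof. by case: hf => h1 [h2 _]; case: e. Qed.

Let f2 e : (\int[muP]_z (pr e (f z) ^+ 2)%:E < +oo)%E.
Proof.
case: hf => _ [_ h]; apply: le_lt_trans h; apply: le_int => z.
  by rewrite lee_fin sqr_ge0.
rewrite lee_fin pr_sqr; case: e; first by rewrite lerDl sqr_ge0.
by rewrite lerDr sqr_ge0.
Qed.

Local Notation op e e' := (lin_op muP (real_kernel K e) (fun z => pr e' (f z))).

Let mop e e' : mf4 (op e e').
Proof. exact: (mf_lin_op lmu1 lmu2 lmuP (kk e) (mf e')). Qed.

Lemma theta_split t1 t2 y1 y2 : 0 < t1 -> 0 < t2 ->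
  cabs (theta muP K t1 t2 f (y1, y2)) ^+ 2 =
  (op true true t1 t2 y1 y2 - op false false t1 t2 y1 y2) ^+ 2 +
  (op true false t1 t2 y1 y2 + op false true t1 t2 y1 y2) ^+ 2.
Proof.
move=> t10 t20; rewrite pr_sqr /theta !pr_cint.
have ik e e' := ibl_lin_op lmu1 lmu2 lmuP a0 b0 (kk e) (mf e') (f2 e') y1 y2 t10 t20.
rewrite /lin_op -RintB// -RintD//; congr (_ ^+ 2 + _ ^+ 2); apply: eq_Rint => -[z1 z2] /=.
  rewrite !real_kernelE//=; move: (K _ _ _ _) (f _) => [x y] [x' y'] /=; ring.
rewrite !real_kernelE//=; move: (K _ _ _ _) (f _) => [x y] [x' y'] /=; ring.
Qed.

(** The factor makes [theta] irrelevant at nonpositive times, so that measurability follows from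
    that of the four real operators. *)
Definition density t1 t2 y1 y2 : R :=
  ((0 < t1) && (0 < t2))%:R * cabs (theta muP K t1 t2 f (y1, y2)) ^+ 2.

Lemma density_ge0 t1 t2 y1 y2 : 0 <= density t1 t2 y1 y2.
Proof. by apply: mulr_ge0 => //; exact: sqr_ge0. Qed.

Lemma mf_density : mf4 density.
Proof.
have h1 := mop true true; have h2 := mop false false.
have h3 := mop true false; have h4 := mop false true.
rewrite (_ : density = fun t1 t2 y1 y2 => ((0 < t1) && (0 < t2))%:R *
  ((op true true t1 t2 y1 y2 - op false false t1 t2 y1 y2) ^+ 2 +
   (op true false t1 t2 y1 y2 + op false true t1 t2 y1 y2) ^+ 2)).
  by meas.
apply/funext => t1; apply/funext => t2; apply/funext => y1; apply/funext => y2.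
rewrite /density; case: andP => [[t10 t20]|_]; last by rewrite !mul0r.
by rewrite theta_split.
Qed.

(** [(p - q)^2 + (r + s)^2 <= 2 (p^2 + q^2 + r^2 + s^2)] gives one factor 2. Each of the real and
    imaginary parts of [f] meets both parts of the kernel, which gives the other. *)
Lemma density_bound :
  (\int[nu1]_u \int[nu2]_v (density u.1 v.1 u.2 v.2 / (u.1 * v.1))%:E
   <= (4 * C)%:E * \int[muP]_z (cabs (f z) ^+ 2)%:E)%E.
Proof.
pose g e e' (u : R * Z1) (v : R * Z2) : R := ((0 < u.1)%R%:R / u.1) * ((0 < v.1)%R%:R / v.1) *
  op e e' u.1 v.1 u.2 v.2 ^+ 2.
have iv (t : R) : 0 <= (0 < t)%R%:R / t.
  by have [t0|t0] := ltP 0 t; rewrite ?mul0r// mul1r invr_ge0 ltW.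
have g0 e e' u v : 0 <= g e e' u v.
  by apply: mulr_ge0; [exact: mulr_ge0|exact: sqr_ge0].
have mg e e' : mf2 (g e e') by have h := mop e e'; rewrite /g; meas.
have hg e e' : (\int[nu1]_u \int[nu2]_v (g e e' u v)%:E <=
    C%:E * \int[muP]_z (pr e' (f z) ^+ 2)%:E)%E.
  exact: (vertical_L2 lmu1 lmu2 lmuP a0 b0 C0 (kk e) (window_bound e) (mf e') (f2 e')).
have fsq : (\int[muP]_z (cabs (f z) ^+ 2)%:E =
    \int[muP]_z (pr true (f z) ^+ 2)%:E + \int[muP]_z (pr false (f z) ^+ 2)%:E)%E.
  rewrite -intD; last 4 first.
  - exact/mfE/mfX.
  - exact/mfE/mfX.
  - by move=> z; rewrite lee_fin sqr_ge0.
  - by move=> z; rewrite lee_fin sqr_ge0.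
  by apply: eq_int => z; rewrite pr_sqr.
have addII (F G : R * Z1 -> R * Z2 -> R) : mf2 F -> mf2 G -> (forall u v, 0 <= F u v) ->
    (forall u v, 0 <= G u v) ->
    (\int[nu1]_u \int[nu2]_v (F u v + G u v)%:E =
     \int[nu1]_u \int[nu2]_v (F u v)%:E + \int[nu1]_u \int[nu2]_v (G u v)%:E)%E.
  move=> mF mG F0 G0; rewrite -intD; [|by meas|by meas| |]; last 2 first.
  - by move=> u; apply: int_ge0 => v; rewrite lee_fin.
  - by move=> u; apply: int_ge0 => v; rewrite lee_fin.
  apply: eq_int => u; rewrite -intD; [|by meas|by meas| |]; last 2 first.
  - by move=> v; rewrite lee_fin.
  - by move=> v; rewrite lee_fin.
  by apply: eq_int => v.
pose G u v := (g true true u v + g false false u v) + (g true false u v + g false true u v).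
have mG : mf2 G.
  have h1 := mg true true; have h2 := mg false false.
  by have h3 := mg true false; have h4 := mg false true; rewrite /G; meas.
have G0 u v : 0 <= G u v by rewrite /G !addr_ge0.
have mgD e1 e2 e3 e4 : mf2 (fun u v => g e1 e2 u v + g e3 e4 u v).
  by have h1 := mg e1 e2; have h2 := mg e3 e4; meas.
apply: (@le_trans _ _ (\int[nu1]_u \int[nu2]_v (G u v + G u v)%:E)%E).
  have d0 (u : R * Z1) (v : R * Z2) : 0 <= density u.1 v.1 u.2 v.2 / (u.1 * v.1).
    rewrite /density; case: andP => [[t1 t2]|_]; last by rewrite !mul0r.
    by rewrite mul1r; apply: mulr_ge0; [exact: sqr_ge0|rewrite invr_ge0 mulr_ge0 ?ltW].
  apply: le_int => u; first by apply: int_ge0 => v; rewrite lee_fin.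
  apply: le_int => v; first by rewrite lee_fin.
  rewrite lee_fin /density; case: andP => [[t1 t2]|_]; last by rewrite !mul0r addr_ge0.
  rewrite mul1r theta_split// /G /g t1 t2 !mul1r.
  move: (op true true _ _ _ _) (op false false _ _ _ _) => p q.
  move: (op true false _ _ _ _) (op false true _ _ _ _) => r s.
  have w : 0 <= u.1^-1 * v.1^-1 by rewrite mulr_ge0// invr_ge0 ltW.
  rewrite invfM mulrC -!mulrDr; apply: ler_wpM2l => //.
  by have := sqr_ge0 (p + q); have := sqr_ge0 (r - s); nra.
have fin e : exists r, (\int[muP]_z (pr e (f z) ^+ 2)%:E = r%:E)%E.
  exists (fine (\int[muP]_z (pr e (f z) ^+ 2)%:E)%E); rewrite fineK// ge0_fin_numE//.
  by apply: int_ge0 => z; rewrite lee_fin sqr_ge0.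
have [r hr] := fin true; have [s hs] := fin false.
pose Ga u v := g true true u v + g false false u v.
pose Gb u v := g true false u v + g false true u v.
have Ga0 u v : 0 <= Ga u v by exact: addr_ge0.
have Gb0 u v : 0 <= Gb u v by exact: addr_ge0.
have eG : (\int[nu1]_u \int[nu2]_v (G u v + G u v)%:E =
  \int[nu1]_u \int[nu2]_v (G u v)%:E + \int[nu1]_u \int[nu2]_v (G u v)%:E)%E by exact: addII.
have eG' : (\int[nu1]_u \int[nu2]_v (G u v)%:E =
  \int[nu1]_u \int[nu2]_v (Ga u v)%:E + \int[nu1]_u \int[nu2]_v (Gb u v)%:E)%E by exact: addII.
have ea : (\int[nu1]_u \int[nu2]_v (Ga u v)%:E = \int[nu1]_u \int[nu2]_v (g true true u v)%:E +
  \int[nu1]_u \int[nu2]_v (g false false u v)%:E)%E by exact: addII.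
have eb : (\int[nu1]_u \int[nu2]_v (Gb u v)%:E = \int[nu1]_u \int[nu2]_v (g true false u v)%:E +
  \int[nu1]_u \int[nu2]_v (g false true u v)%:E)%E by exact: addII.
have eGG := etrans eG' (congr2 adde ea eb).
rewrite [leLHS](etrans eG (congr2 adde eGG eGG)).
have := hg true true; have := hg false false; have := hg true false; have := hg false true.
rewrite fsq hr hs => h1 h2 h3 h4.
apply: le_trans (leeD (leeD (leeD h4 h3) (leeD h2 h1)) (leeD (leeD h4 h3) (leeD h2 h1))) _.
rewrite -[(r%:E + s%:E)%E]EFinD -!EFinM -!EFinD lee_fin.
by rewrite le_eqVlt; apply/orP; left; apply/eqP; ring.
Qed.

(** [density] vanishes off positive times, so the half-line integrals become integrals over the line
    and the integral in [x] can be moved innermost; each weight then turns one [t^(n+1)] into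
    [t]. *)
Lemma int_gstar2 : (0 < n)%N -> (0 < m)%N -> 1 < lam1 -> 1 < lam2 ->
  forall Cw1 Cw2, 0 < Cw1 -> 0 < Cw2 ->
  (forall t (y : Z1), 0 < t ->
    (\int[mu1]_x (wgt n lam1 t ((x : 'rV[R]_n) - y))%:E <= (Cw1 * t ^+ n)%:E)%E) ->
  (forall t (y : Z2), 0 < t ->
    (\int[mu2]_x (wgt m lam2 t ((x : 'rV[R]_m) - y))%:E <= (Cw2 * t ^+ m)%:E)%E) ->
  (\int[muP]_x gstar2 mu1 mu2 muP lam1 lam2 K f x <=
   (Cw1 * Cw2)%:E * \int[nu1]_u \int[nu2]_v (density u.1 v.1 u.2 v.2 / (u.1 * v.1))%:E)%E.
Proof.
move=> n0 m0 l1 l2 Cw1 Cw2 Cw10 Cw20 hw1 hw2.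
have md := mf_density.
pose H (x : Z1 * Z2) (v : R * Z2) (u : R * Z1) : R :=
  wgt m lam2 v.1 (vsub x.2 v.2) * wgt n lam1 u.1 (vsub x.1 u.2) *
  density u.1 v.1 u.2 v.2 / (u.1 ^+ n.+1 * v.1 ^+ m.+1).
have H0 x v u : 0 <= H x v u.
  rewrite /H /density; case: andP => [[t1 t2]|_]; last by rewrite mul0r mulr0 mul0r.
  apply: mulr_ge0; last by rewrite invr_ge0 mulr_ge0// exprn_ge0// ltW.
  by apply: mulr_ge0; [apply: mulr_ge0; exact: wgt_ge0|rewrite mul1r sqr_ge0].
have mH : mf3 H.
  rewrite /H /mf3; apply: mfM; last by meas.
  by apply: mfM; [apply: mfM; apply: mf_wgt|]; meas.
have gE x : (gstar2 mu1 mu2 muP lam1 lam2 K f x = \int[nu2]_v \int[nu1]_u (H x v u)%:E)%E.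
  rewrite int_prodm; last 2 first.
  - by meas.
  - by move=> v; apply: int_ge0 => u; rewrite lee_fin.
  rewrite /gstar2 integral_mkcond; apply: (@eq_int _ _ _ leb) => t2.
  rewrite patchE; case: ifPn => [|/negP]; rewrite inE /oitvy /= in_itv/= andbT => t20; last first.
    rewrite (eq_int _ (g := fun=> 0%E)) ?integral0// => y2.
    rewrite (eq_int _ (g := fun=> 0%E)) ?integral0// => u.
    by rewrite /H /density (negPf (introN idP t20)) andbF mul0r mulr0 mul0r.
  apply: eq_int => y2; rewrite int_prodm; last 2 first.
  - by apply/mfE; apply: (mf3_comp mH); meas.
  - by move=> u; rewrite lee_fin.
  rewrite integral_mkcond; apply: (@eq_int _ _ _ leb) => t1.
  rewrite patchE; case: ifPn => [|/negP]; rewrite inE /oitvy /= in_itv/= andbT => t10; last first.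
    rewrite (eq_int _ (g := fun=> 0%E)) ?integral0// => y1.
    by rewrite /H /density (negPf (introN idP t10)) mul0r mulr0 mul0r.
  by apply: eq_int => y1; rewrite /H /density /= t10 t20 mul1r.
have -> : (\int[muP]_x gstar2 mu1 mu2 muP lam1 lam2 K f x =
    \int[prodm mu1 mu2]_x \int[nu2]_v \int[nu1]_u (H x v u)%:E)%E.
  rewrite (int_lebesgue2 lmu1 lmu2 lmuP); apply: eq_int => x; exact: gE.
rewrite tonelli; last 2 first.
- by meas.
- by move=> x v; apply: int_ge0 => u; rewrite lee_fin.
have d0 (u : R * Z1) (v : R * Z2) : 0 <= density u.1 v.1 u.2 v.2 / (u.1 * v.1).
  rewrite /density; case: andP => [[t1 t2]|_]; last by rewrite !mul0r.
  by rewrite mul1r; apply: mulr_ge0; [exact: sqr_ge0|rewrite invr_ge0 mulr_ge0 ?ltW].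
have mdd : mf2 (fun (u : R * Z1) (v : R * Z2) => density u.1 v.1 u.2 v.2 / (u.1 * v.1)) by meas.
rewrite [X in (_ <= _ * X)%E]tonelli; last 2 first.
- exact/mfE.
- by move=> u v; rewrite lee_fin.
have c0 : 0 <= Cw1 * Cw2 by rewrite mulr_ge0 ?ltW.
rewrite -intZ//; last 2 first.
- by apply: mf_int; apply/mfE; apply: (mf2_comp mdd); meas.
- by move=> v; apply: int_ge0 => u; rewrite lee_fin.
apply: le_int => v.
  by apply: int_ge0 => x; apply: int_ge0 => u; rewrite lee_fin.
rewrite tonelli; last 2 first.
- by apply/mfE; apply: (mf3_comp mH); meas.
- by move=> x u; rewrite lee_fin.
rewrite -intZ//; last 2 first.
- by apply/mfE; apply: (mf2_comp mdd); meas.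
- by move=> u; rewrite lee_fin.
apply: le_int => u; first by apply: int_ge0 => x; rewrite lee_fin.
have [t1|t1] := ltP 0 u.1; last first.
  rewrite (eq_int _ (g := fun=> 0%E)) ?integral0 => [|x]; last first.
    by rewrite /H /density (le_gtF t1) mul0r mulr0 mul0r.
  by rewrite mule_ge0// lee_fin.
have [t2|t2] := ltP 0 v.1; last first.
  rewrite (eq_int _ (g := fun=> 0%E)) ?integral0 => [|x]; last first.
    by rewrite /H /density (le_gtF t2) andbF mul0r mulr0 mul0r.
  by rewrite mule_ge0// lee_fin.
pose q := density u.1 v.1 u.2 v.2 / (u.1 ^+ n.+1 * v.1 ^+ m.+1).
have q0 : 0 <= q.
  by apply: mulr_ge0; [exact: density_ge0|rewrite invr_ge0 mulr_ge0// exprn_ge0// ltW].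
have mw1 : measurable_fun setT (fun x : Z1 => wgt n lam1 u.1 (vsub x u.2)) by apply: mf_wgt; meas.
have mw2 : measurable_fun setT (fun x : Z2 => wgt m lam2 v.1 (vsub x v.2)) by apply: mf_wgt; meas.
rewrite int_prodm; last 2 first.
- by apply/mfE; apply: (mf3_comp mH); meas.
- by move=> x; rewrite lee_fin.
apply: (@le_trans _ _ (\int[mu1]_x1 ((q * (Cw2 * v.1 ^+ m))%:E *
    (wgt n lam1 u.1 (vsub x1 u.2))%:E))%E).
  apply: le_int => x1; first by apply: int_ge0 => x2; rewrite lee_fin.
  rewrite (@eq_int _ _ _ mu2 _ (fun x2 => (q * wgt n lam1 u.1 (vsub x1 u.2))%:E *
     (wgt m lam2 v.1 (vsub x2 v.2))%:E)%E); last first.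
    by move=> x2; rewrite -EFinM /H /q /=; congr (_%:E); ring.
  have qw : 0 <= q * wgt n lam1 u.1 (vsub x1 u.2) by apply: mulr_ge0 => //; exact: wgt_ge0.
  rewrite intZ//; [|exact/mfE|by move=> x2; rewrite lee_fin; exact: wgt_ge0].
  apply: le_trans (lee_wpmul2l _ (hw2 v.1 v.2 t2)) _; first by rewrite lee_fin.
  by rewrite -!EFinM lee_fin le_eqVlt; apply/orP; left; apply/eqP; ring.
have qc : 0 <= q * (Cw2 * v.1 ^+ m).
  by apply: mulr_ge0 => //; apply: mulr_ge0; [exact: ltW|rewrite exprn_ge0// ltW].
rewrite intZ//; [|exact/mfE|by move=> x1; rewrite lee_fin; exact: wgt_ge0].
apply: le_trans (lee_wpmul2l _ (hw1 u.1 u.2 t1)) _; first by rewrite lee_fin.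
rewrite -!EFinM lee_fin le_eqVlt; apply/orP; left; apply/eqP.
by rewrite /q !exprS; field; rewrite ?gt_eqF ?exprn_gt0.
Qed.

End ComplexSquareFunction.

Theorem theorem1p1 (R : realType) (n m : nat) (lam1 lam2 alpha beta : R) :
  (1 <= n)%N -> (1 <= m)%N ->
  2 < lam1 -> 2 < lam2 ->
  0 < alpha -> alpha <= n%:R * (lam1 - 2) / 2 ->
  0 < beta -> beta <= m%:R * (lam2 - 2) / 2 ->
  forall (mun : {measure set (Rn R n) -> \bar R})
         (mum : {measure set (Rn R m) -> \bar R})
         (muP : {measure set (Rnm R n m) -> \bar R}),
  is_lebesgue mun -> is_lebesgue mum -> is_lebesgue2 muP ->
  forall A1 A2 A3 : R,
  exists C : R,
  forall K : gkernel R n m,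
  kernel_measurable K ->
  assumption1 alpha beta A1 K ->
  assumption2 mun mum lam1 lam2 alpha beta A2 K ->
  assumption3 mun mum muP lam1 lam2 A3 K ->
  forall f : Rnm R n m -> R[i], inL2 muP f ->
  (L2norme muP (gstar mun mum muP lam1 lam2 K f) <= C%:E * L2normc muP f)%E.
Proof.
move=> n1 m1 l1 l2 a0 _ b0 _ mun mum muP lmun lmum lmuP A1 A2 A3.
have [mu1 e1] := sigma_finite_pack lmun; have [mu2 e2] := sigma_finite_pack lmum.
rewrite -{}e1 in lmun *; rewrite -{}e2 in lmum *.
have lam1_gt1 : 1 < lam1 by apply: lt_trans l1; rewrite ltr1n.
have lam2_gt1 : 1 < lam2 by apply: lt_trans l2; rewrite ltr1n.
have lam1_ge0 : 0 <= lam1 by apply/ltW/lt_trans/lam1_gt1.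
have lam2_ge0 : 0 <= lam2 by apply/ltW/lt_trans/lam2_gt1.
have [N [C [C0 hC]]] := window_bound_of_assumptions lmun lmum lmuP A1 A2 A3 lam1_ge0 lam2_ge0 a0 b0.
have [Cw1 Cw10 hw1] := int_wgt lmun n1 lam1_gt1.
have [Cw2 Cw20 hw2] := int_wgt lmum m1 lam2_gt1.
(* Bound for the squared norms: the two weight integrals and the factor [4 * C] of [density_bound].
   The constant of the theorem is its square root. *)
pose B := Cw1 * Cw2 * (4 * C).
have B0 : 0 <= B by rewrite mulr_ge0 ?mulr_ge0// ltW.
exists (Num.sqrt B) => K mK hA1 hA2 hA3 f hf.
have kk e := (hC K mK hA1 hA2 hA3 e).1; have hw e := (hC K mK hA1 hA2 hA3 e).2.
have g0 x : (0 <= gstar2 mu1 mu2 muP lam1 lam2 K f x)%E.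
  apply: integral_ge0 => t2; rewrite /oitvy /= in_itv/= andbT => t20.
  apply: integral_ge0 => y2 _; apply: integral_ge0 => t1; rewrite /oitvy /= in_itv/= andbT => t10.
  apply: integral_ge0 => y1 _; rewrite lee_fin; apply: mulr_ge0.
    by apply: mulr_ge0; [apply: mulr_ge0; exact: wgt_ge0|exact: sqr_ge0].
  by rewrite invr_ge0 mulr_ge0// exprn_ge0// ltW.
have -> : L2norme muP (gstar mu1 mu2 muP lam1 lam2 K f) =
    sqrte (\int[muP]_x gstar2 mu1 mu2 muP lam1 lam2 K f x)%E.
  rewrite /L2norme /gstar; congr sqrte; apply: eq_int => x.
  by rewrite gee0_abs ?sqrte_ge0// sqr_sqrte.
have f0 : (0 <= \int[muP]_x (cabs (f x) ^+ 2)%:E)%E by apply: int_ge0 => x; rewrite lee_fin sqr_ge0.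
rewrite /L2normc (_ : (Num.sqrt B)%:E = sqrte B%:E)// -sqrteM ?lee_fin// lee_sqrt ?mule_ge0 ?lee_fin//.
apply: le_trans (int_gstar2 lmun lmum lmuP a0 b0 kk hf n1 m1 lam1_gt1 lam2_gt1 Cw10 Cw20 hw1 hw2) _.
rewrite /B (EFinM (Cw1 * Cw2)) -muleA; apply: lee_wpmul2l; first by rewrite lee_fin mulr_ge0// ltW.
exact: (density_bound lmun lmum lmuP a0 b0 C0 kk hw hf).
Qed.
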